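(* Let $H$ be a double-incommensurate twisted trilayer graphene tight-binding Hamiltonian and $\widehat H=\{\widehat H_q\}_{q\in\mathbb R^2}$ its family of reciprocal Hamiltonians (setting and assumptions as given in the context). Then for every $f\in\mathcal O(\widehat H)$ (the limits defining the thermodynamic limit traces exist and) $$\underline{\operatorname{Tr}}\, f(\widehat H_0)=\mathcal T f(\widehat H)=\underline{\operatorname{Tr}}\, f(H).$$
   Context: Lattices. Let $a=1.42\sqrt3$, $A=\frac a2\begin{bmatrix}2&1\\0&\sqrt3\end{bmatrix}$, $B=2\pi A^{-T}$, and let $\mathfrak R_\theta$ be the counterclockwise rotation of $\mathbb R^2$ by $\theta$. For twist angles $\theta_1,\theta_2,\theta_3$ and $j\in\{1,2,3\}$ put $A_j=\mathfrak R_{\theta_j}A$, $B_j=\mathfrak R_{\theta_j}B$, $\mathcal R_j=A_j\mathbb Z^2$, $\mathcal R_j^*=B_j\mathbb Z^2$, $\Gamma_j^*=B_j[0,1)^2$ (area $|\Gamma_j^*|$), $c_j^*=\sqrt{|\Gamma_j^*|}$. Orbital indices: $\mathcal A_j=\{jA,jB\}$, $\mathcal A=\bigcup_j\mathcal A_j$, with shifts $\tau_{jA}=0$, $\tau_{jB}=\mathfrak R_{\theta_j}\frac a2(1,\tfrac{\sqrt3}{3})^T$. Double incommensurability (assumed). For both families $(\mathcal R_j)_{j=1}^3$ and $(\mathcal R_j^* )_{j=1}^3$: for every $I\subset\{1,2,3\}$ and lattice vectors $v_j$ in the $j$th lattice, $\sum_{j\in I}v_j=0$ iff $v_j=0$ for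 all $j\in I$. Real-space Hamiltonian. $\Omega_j=\mathcal R_j\times\mathcal A_j$, $\Omega=\bigsqcup_{j=1}^3\Omega_j$. Given intralayer hoppings $h_{j\beta}^{j\alpha}:\mathcal R_j\to\mathbb C$ and, for $j\ne k$, continuous interlayer hoppings $h_{k\beta}^{j\alpha}:\mathbb R^2\to\mathbb C$, $H$ acts on $\ell^2(\Omega)$ by $$(H\psi)_{(R,j\alpha)}=\sum_{(R',j\beta)\in\Omega_j}(h_{j\beta}^{j\alpha})_{R-R'}\psi_{(R',j\beta)}+\sum_{k\neq j}\sum_{(R',k\beta)\in\Omega_k}h_{k\beta}^{j\alpha}(R+\tau_{j\alpha}-R'-\tau_{k\beta})\psi_{(R',k\beta)}.$$ Fourier transform: $\widehat h(\xi)=\frac1{4\pi^2}\int_{\mathbb R^2}h(x)e^{-i\xi\cdot x}dx$. Assumptions: (decay) there are $\gamma_1,\gamma_2>0$ such that for all $j\neq k$ and all orbitals $\sup_x|h_{k\beta}^{j\alpha}(x)|e^{\gamma_1\|x\|_2}+\sup_\xi|\widehat h_{k\beta}^{j\alpha}(\xi)|e^{\gamma_2\|\xi\|_2}<\infty$, and $\sup_{R\in\mathcal R_j}|(h_{j\beta}^{j\alpha})_R|e^{\gamma_1\|R\|_2}<\infty$; (hermiticity) $(h_{j\beta}^{j\alpha})_R=\overline{(h_{j\alpha}^{j\beta})_{-R}}$ and $h_{k\beta}^{j\alpha}(x)=\overline{h_{j\alpha}^{k\beta}(-x)}$; (nearest-layer coupling) $h_{3\beta}^{1\alpha}=h_{1\beta}^{3\alpha}=0$.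 Reciprocal Hamiltonian. $\kappa_j^*=\{G=(G_1,G_2,G_3)\in\bigoplus_{t=1}^3\mathcal R_t^*:G_j=0\}$, $\Omega_j^*=\kappa_j^*\times\mathcal A_j$, $\Omega^*=\bigsqcup_j\Omega_j^*$. For $q\in\mathbb R^2$, $\widehat H_q$ is the operator on $\ell^2(\Omega^* )$ with entries, for $(G,j\alpha)\in\Omega_j^*$ and $(G',k\beta)\in\Omega_k^*$: if $j=k$, $[\widehat H_q]^{(G,j\alpha)}_{(G',j\beta)}=\delta_{G,G'}\,\widetilde h_{j\beta}^{j\alpha}(q+\sum_tG_t)$ with $\widetilde h_{j\beta}^{j\alpha}(q)=\sum_{R\in\mathcal R_j}e^{-iq\cdot(R+\tau_{j\alpha}-\tau_{j\beta})}(h_{j\beta}^{j\alpha})_R$; if $j\ne k$ and $l$ is the third layer, $[\widehat H_q]^{(G,j\alpha)}_{(G',k\beta)}=\delta_{G_l,G_l'}\,c_j^*c_k^*e^{i(G_j'\cdot\tau_{j\alpha}-G_k\cdot\tau_{k\beta})}\,\widehat h_{k\beta}^{j\alpha}(q+G_j'+G_k+G_l)$. Traces. $\sigma(\widehat H)$ denotes the closure of $\bigcup_{q}\sigma(\widehat H_q)$. $\mathcal O(\widehat H)$ is the set of complex-valued functions analytic in an open neighborhood of $\sigma(\widehat H)\cup\sigma(H)$. With $\Omega_r=\{(R,j\alpha)\in\Omega:\|R\|_2<r\}$ and $\Omega_r^*=\{(G,j\alpha)\in\Omega^*:\|\bigoplus_{k\neq j}G_k\|_2<r\}$, $$\underline{\operatorname{Tr}}f(H)=\lim_{r\to\infty}\frac1{|\Omega_r|}\sum_{(R,j\alpha)\in\Omega_r}[f(H)]^{(R,j\alpha)}_{(R,j\alpha)},\qquad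 \underline{\operatorname{Tr}}f(\widehat H_q)=\lim_{r\to\infty}\frac1{|\Omega_r^*|}\sum_{(G,j\alpha)\in\Omega_r^*}[f(\widehat H_q)]^{(G,j\alpha)}_{(G,j\alpha)}.$$ Finally $\mathcal Tf(\widehat H)=\nu^*\sum_{j\alpha\in\mathcal A}\int_{\Gamma_j^*}[f(\widehat H_q)]^{(0,j\alpha)}_{(0,j\alpha)}dq$ with $\nu^*=\big(\sum_{j=1}^3|\mathcal A_j||\Gamma_j^*|\big)^{-1}$. *)

(* Defs.v *)
From HB Require Import structures.
From mathcomp Require Import all_boot all_order all_algebra finmap.
From mathcomp Require Import all_classical all_reals all_analysis.
From mathcomp Require Import complex.

Set Implicit Arguments.
Unset Strict Implicit.
Unset Printing Implicit Defensive.

Import Order.TTheory GRing.Theory Num.Theory.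
Import numFieldNormedType.Exports.

Local Open Scope classical_set_scope.
Local Open Scope ring_scope.
Local Open Scope complex_scope.

Section ComplexAnalysis.
Variable R : realType.
Local Notation C := (R[i]).

Definition cabs (z : C) : R := ComplexField.Normc.normc z.

Definition cis (t : R) : C := cos t +i* sin t.

Definition cintegral d (T : measurableType d) (mu : {measure set T -> \bar R})
    (D : set T) (f : T -> C) : C :=
  Rintegral mu D (fun x => complex.Re (f x)) +i*
  Rintegral mu D (fun x => complex.Im (f x)).

(* Unordered sums over an arbitrary index type; meaningful for absolutely
   summable families, which are the only ones that occur. *)
Definition rsum (T : choiceType) (u : T -> R) : R :=
  fine (esum setT (EFin \o u)^\+ - esum setT (EFin \o u)^\-)%E.

Definition csum (T : choiceType) (u : T -> C) : C :=
  rsum (fun t => complex.Re (u t)) +i* rsum (fun t => complex.Im (u t)).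

Definition analytic_at (f : C -> C) (z0 : C) : Prop :=
  exists (r : R) (a : nat -> C), 0 < r /\ forall z : C, cabs (z - z0) < r ->
    series (fun n => a n * (z - z0) ^+ n : C^o) @ \oo --> (f z : C^o).

Definition segment_integral (g : C -> C) (z w : C) : C :=
  (w - z) * cintegral (@lebesgue_measure R) `[0, 1] (fun t => g (z + t%:C * (w - z))).

(* A rectangle is given by its lower-left and upper-right corners. *)
Definition rect_closed (p : C * C) : set C :=
  [set z | complex.Re p.1 <= complex.Re z <= complex.Re p.2 /\
           complex.Im p.1 <= complex.Im z <= complex.Im p.2].

Definition rect_open (p : C * C) : set C :=
  [set z | complex.Re p.1 < complex.Re z < complex.Re p.2 /\
           complex.Im p.1 < complex.Im z < complex.Im p.2].

(* Integral over the boundary, counterclockwise. *)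
Definition rect_integral (g : C -> C) (p : C * C) : C :=
  let se := complex.Re p.2 +i* complex.Im p.1 in
  let nw := complex.Re p.1 +i* complex.Im p.2 in
  segment_integral g p.1 se + segment_integral g se p.2 +
  segment_integral g p.2 nw + segment_integral g nw p.1.

End ComplexAnalysis.

Section Operators.
Variables (R : realType) (T : choiceType).
Local Notation C := (R[i]).

Definition l2 : set (T -> C) :=
  [set psi | (esum setT (fun t => (cabs (psi t) ^+ 2)%:E) < +oo)%E].

Definition l2norm (psi : T -> C) : R :=
  Num.sqrt (fine (esum setT (fun t => (cabs (psi t) ^+ 2)%:E))).

(* Operators on l2 are represented by maps on all functions, of which only the
   restriction to l2 matters. *)
Definition op := (T -> C) -> (T -> C).

Definition matrix_op (M : T -> T -> C) : op :=
  fun psi x => csum (fun y => M x y * psi y).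

Definition basis_vec (y : T) : T -> C := fun x => (x == y)%:R.

Definition entry (A : op) (x y : T) : C := A (basis_vec y) x.

Definition shifted (A : op) (z : C) : op := fun psi x => z * psi x - A psi x.

Definition is_resolvent (A : op) (z : C) (S : op) : Prop :=
  (exists K : R, forall psi, l2 psi ->
     l2 (S psi) /\ l2norm (S psi) <= K * l2norm psi) /\
  (forall psi, l2 psi ->
     shifted A z (S psi) = psi /\ S (shifted A z psi) = psi).

Definition spectrum (A : op) : set C := [set z | ~ exists S, is_resolvent A z S].

Definition resolvent (A : op) (z : C) : op :=
  if pselect (exists S, is_resolvent A z S) is left h then projT1 (cid h) else id.

(* Contours for the Riesz-Dunford integral.  For operators with real spectrum
   boundaries of finitely many pairwise disjoint closed rectangles suffice:
   a compact subset of the real line inside an open set U can always be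
   covered by the interiors of such rectangles contained in U. *)
Definition encloses_spectrum (f : C -> C) (A : op) (Q : seq (C * C)) : Prop :=
  [/\ forall p, p \in Q ->
        complex.Re p.1 < complex.Re p.2 /\ complex.Im p.1 < complex.Im p.2,
      trivIset [set i | (i < size Q)%N] (fun i => rect_closed (nth (0, 0) Q i)),
      forall p z, p \in Q -> rect_closed p z -> analytic_at f z &
      forall z, spectrum A z -> exists2 p, p \in Q & rect_open p z].

(* f(A) = (2 i pi)^-1 \oint f(z) (z - A)^-1 dz; by Cauchy's theorem the choice
   of the contour does not matter. *)
Definition holo_calc (f : C -> C) (A : op) : op := fun psi x =>
  (2 * pi%:C * (0 +i* 1))^-1 *
  \sum_(p <- xget [::] (encloses_spectrum f A))
     rect_integral (fun z => f z * resolvent A z psi x) p.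

Definition trace_avg (D : set T) (A : op) : C :=
  (\sum_(x \in D) entry A x x) / (#|` fset_set D |)%:R.

End Operators.

Section Geometry.
Variable R : realType.

Definition mx22 (a b c d : R) : 'M[R]_2 :=
  \matrix_(i, j) if i == 0 then (if j == 0 then a else b)
                 else (if j == 0 then c else d).

Definition vec2 (x : R * R) : 'cV[R]_2 := \col_i if i == 0 then x.1 else x.2.

Definition dot (u v : 'cV[R]_2) : R := \sum_i u i 0 * v i 0.

Definition enorm (u : 'cV[R]_2) : R := Num.sqrt (dot u u).

(* Lebesgue measure on the plane. *)
Definition leb2 : {measure set (measurableTypeR R * measurableTypeR R) -> \bar R} :=
  (@lebesgue_measure R \x @lebesgue_measure R)%E.

Definition plane_integral (D : set (R * R)) (f : 'cV[R]_2 -> R[i]) : R[i] :=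
  cintegral leb2 D (fun x => f (vec2 x)).

Definition fourier (h : 'cV[R]_2 -> R[i]) (xi : 'cV[R]_2) : R[i] :=
  ((4 * pi ^+ 2)^-1)%:C * plane_integral setT (fun x => h x * cis (- dot xi x)).

Definition lattice_const : R := (142 / 100) * Num.sqrt 3.

Definition rotation (t : R) : 'M[R]_2 := mx22 (cos t) (- sin t) (sin t) (cos t).

Definition baseA : 'M[R]_2 := (lattice_const / 2) *: mx22 2 1 0 (Num.sqrt 3).

Definition baseB : 'M[R]_2 := (2 * pi) *: (invmx baseA)^T.

End Geometry.

(* Layers 1, 2, 3 are the elements of 'I_3; the sublattice A is false and B is
   true.  Vectors of the lattices A_j Z^2 and B_j Z^2 are represented by their
   integer coordinates. *)
Notation orbital := ('I_3 * bool)%type.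
Notation coords := ('cV[int]_2).
Notation site := (orbital * coords)%type.
Notation dual_site :=
  {x : orbital * {ffun 'I_3 -> coords} | x.2 x.1.1 == 0}.

Section Trilayer.
Variables (R : realType) (theta : 'I_3 -> R).
Local Notation C := (R[i]).

Definition lattA (j : 'I_3) : 'M[R]_2 := rotation (theta j) *m baseA R.
Definition lattB (j : 'I_3) : 'M[R]_2 := rotation (theta j) *m baseB R.

Definition lvec (L : 'M[R]_2) (n : coords) : 'cV[R]_2 := L *m map_mx intr n.

Definition incommensurate (L : 'I_3 -> 'M[R]_2) : Prop :=
  forall (I : {set 'I_3}) (v : 'I_3 -> coords),
    \sum_(j in I) lvec (L j) (v j) = 0 <->
    forall j, j \in I -> lvec (L j) (v j) = 0.

Definition double_incommensurate : Prop :=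
  incommensurate lattA /\ incommensurate lattB.

Definition tau (o : orbital) : 'cV[R]_2 :=
  if o.2 then
    rotation (theta o.1) *m
      ((lattice_const R / 2) *: vec2 (1, Num.sqrt 3 / 3))
  else 0.

Definition dual_cell (j : 'I_3) : set (R * R) :=
  [set x | exists s t : R, [/\ 0 <= s < 1, 0 <= t < 1 &
                               vec2 x = lattB j *m vec2 (s, t)]].

Definition dual_area (j : 'I_3) : R := fine (leb2 R (dual_cell j)).

Definition cstar (j : 'I_3) : R := Num.sqrt (dual_area j).

(* intra j alpha beta n is the hopping h_{j beta}^{j alpha} at A_j n, and
   inter (j, alpha) (k, beta) is h_{k beta}^{j alpha}, used for j != k only. *)
Variable intra : 'I_3 -> bool -> bool -> coords -> C.
Variable inter : orbital -> orbital -> 'cV[R]_2 -> C.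

Definition inter_continuous : Prop :=
  forall o o' : orbital, o.1 != o'.1 ->
    continuous (inter o o' : 'cV[R]_2 -> C^o).

Definition exp_decay : Prop :=
  exists gamma1 gamma2 : R,
  [/\ 0 < gamma1, 0 < gamma2,
      forall o o' : orbital, o.1 != o'.1 ->
        has_ubound (range (fun x : 'cV[R]_2 =>
          cabs (inter o o' x) * expR (gamma1 * enorm x))) /\
        has_ubound (range (fun xi : 'cV[R]_2 =>
          cabs (fourier (inter o o') xi) * expR (gamma2 * enorm xi))) &
      forall j alpha beta,
        has_ubound (range (fun n : coords =>
          cabs (intra j alpha beta n) * expR (gamma1 * enorm (lvec (lattA j) n))))].

Definition hermitian_hopping : Prop :=
  (forall j alpha beta n,
     intra j alpha beta n = (intra j beta alpha (- n))^*) /\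
  (forall o o' : orbital, o.1 != o'.1 ->
     forall x, inter o o' x = (inter o' o (- x))^*).

Definition nearest_layer_coupling : Prop :=
  forall (alpha beta : bool) x,
    inter (ord0, alpha) (ord_max, beta) x = 0 /\
    inter (ord_max, alpha) (ord0, beta) x = 0.

Definition H_mat (p p' : site) : C :=
  let: (o, n) := p in let: (o', n') := p' in
  if o.1 == o'.1 then intra o.1 o.2 o'.2 (n - n')
  else inter o o' (lvec (lattA o.1) n + tau o - lvec (lattA o'.1) n' - tau o').

Definition H_op : op R site := matrix_op H_mat.

Definition intra_symbol (j : 'I_3) (alpha beta : bool) (q : 'cV[R]_2) : C :=
  csum (fun n : coords =>
    cis (- dot q (lvec (lattA j) n + tau (j, alpha) - tau (j, beta))) *
    intra j alpha beta n).

Definition dvec (G : {ffun 'I_3 -> coords}) (t : 'I_3) : 'cV[R]_2 :=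
  lvec (lattB t) (G t).

(* For j != k the index l below ranges over the third layer only. *)
Definition Hhat_mat (q : 'cV[R]_2) (p p' : dual_site) : C :=
  let: (o, G) := val p in let: (o', G') := val p' in
  let j := o.1 in let k := o'.1 in
  if j == k then
    (G == G')%:R * intra_symbol j o.2 o'.2 (q + \sum_t dvec G t)
  else
    [forall l, (l != j) && (l != k) ==> (G l == G' l)]%:R *
    (cstar j * cstar k)%:C * cis (dot (dvec G' j) (tau o) - dot (dvec G k) (tau o')) *
    fourier (inter o o')
      (q + dvec G' j + dvec G k + \sum_(l | (l != j) && (l != k)) dvec G l).

Definition Hhat_op (q : 'cV[R]_2) : op R dual_site := matrix_op (Hhat_mat q).

Definition spectrum_hat : set C :=
  closure ((\bigcup_q spectrum (Hhat_op q)) : set C^o).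

Definition O_hat (f : C -> C) : Prop :=
  exists U : set C^o, [/\ open U,
    spectrum_hat `|` spectrum H_op `<=` U & forall z, U z -> analytic_at f z].

Definition Omega_ball (r : R) : set site :=
  [set p | enorm (lvec (lattA p.1.1) p.2) < r].

Definition dual_Omega_ball (r : R) : set dual_site :=
  [set p | Num.sqrt (\sum_(k | k != (val p).1.1)
                       enorm (dvec (val p).2 k) ^+ 2) < r].

Definition trace_limit (T : choiceType) (ball : R -> set T) (A : op R T) (z : C) :=
  (fun r : R => trace_avg (ball r) A : C^o) @ +oo --> (z : C^o).

Fact origin_subproof (o : orbital) :
  (o, [ffun=> 0] : {ffun 'I_3 -> coords}).2 o.1 == 0.
Proof. by rewrite ffunE. Qed.

Definition origin (o : orbital) : dual_site :=
  exist _ (o, [ffun=> 0]) (origin_subproof o).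

Definition nustar : R :=
  (\sum_(j < 3) #|[set o : orbital | o.1 == j]%SET|%:R * dual_area j)^-1.

Definition cell_trace (f : C -> C) : C :=
  nustar%:C * \sum_(o : orbital)
    plane_integral (dual_cell o.1)
      (fun q => entry (holo_calc f (Hhat_op q)) (origin o) (origin o)).

End Trilayer.

(* Main.v *)
(* After Runge's theorem, applied once on a compact real set containing all the spectra, [f] may be
   replaced by a polynomial with an error that is uniform in [q], so that only powers [H^N] matter.
   By Poisson summation the plane waves [W_q] with entries [e^{i (q + sum G) . (R + tau)}] satisfy
   [H W_q = W_q Hhat_q], whence [H^N W_q = W_q Hhat_q^N].  Averaging this identity over [R], double
   incommensurability removes all the terms but the diagonal one and shows that the diagonal entry
   of [Hhat_q^N] at a site of layer [j] is [F (q + sum G)] for one absolutely convergent series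
   [F xi = sum_S m S * e^{i xi . A_j S}], where [m S] is the mean over [R] of the entries of [H^N]
   between [R] and [R + S].  The trace of [H^N], the mean of [F] over the cell of the dual lattice
   and, again by incommensurability, the mean of [F] over the points [sum G] are all given by the
   coefficients [m 0]. *)

Require Import Defs.
From HB Require Import structures.
From mathcomp Require Import all_boot all_order all_algebra finmap.
From mathcomp Require Import all_classical all_reals all_analysis measurable_realfun.
From mathcomp Require Import complex.
From mathcomp Require Import ring lra zify.
Set Implicit Arguments.
Unset Strict Implicit.
Unset Printing Implicit Defensive.

Import Order.TTheory GRing.Theory Num.Theory.
Import numFieldNormedType.Exports.

Local Open Scope classical_set_scope.
Local Open Scope ring_scope.
Local Open Scope complex_scope.

(** * Absolutely summable families *)

(** Plane waves are not square summable, so the intertwining is no identity of operators on [l2]: it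
    is handled entry by entry, and passes to powers because both matrices satisfy Schur bounds and
    the waves have entries of modulus at most one. The averages over [R] of the entries of [H^N]
    have no evident limit; the intertwining only supplies the limit of a whole series in [S], one
    for each dual site. The single coefficients are recovered by a second average, over sites whose
    momenta run through the dual lattice of another layer; the decay of the entries of [H^N],
    obtained from weighted column sums, dominates these series. The passage from [f] to polynomials
    rests on one estimate: the norm of [p(A)] is at most twice the supremum of the modulus of [p] on
    the spectrum. It is derived from the best constant in a quadratic inequality, without a spectral
    resolution. One finite set of contour nodes then serves both the scalar Cauchy formula and the
    entries of the resolvent, whichever contour [holo_calc] has picked. *)

#[global] Arguments cabs : simpl never.

Section Modulus.
Variable R : realType.
Local Notation C := (R[i]).
Implicit Types (z w : C) (r : R).

(** All estimates are made with this real-valued modulus rather than with the complex-valued norm of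
    the library, so that real order tactics apply. *)
Lemma cabsE z : cabs z = Num.sqrt (complex.Re z ^+ 2 + complex.Im z ^+ 2).
Proof. by case: z. Qed.

Lemma normcabs z : `|z| = (cabs z)%:C.
Proof. by rewrite normc_def cabsE. Qed.

Lemma cabs_ge0 z : 0 <= cabs z.
Proof. by rewrite cabsE sqrtr_ge0. Qed.

Lemma cabs0 : cabs (0 : C) = 0.
Proof. exact: ComplexField.Normc.normc0. Qed.

Lemma cabs1 : cabs (1 : C) = 1.
Proof. exact: ComplexField.Normc.normc1. Qed.

Lemma cabsM z w : cabs (z * w) = cabs z * cabs w.
Proof. exact: ComplexField.Normc.normcM. Qed.

Lemma cabsV z : cabs z^-1 = (cabs z)^-1.
Proof. exact: ComplexField.Normc.normcV. Qed.

Lemma cabsX z n : cabs (z ^+ n) = cabs z ^+ n.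
Proof.
by elim: n => [|n IH]; rewrite ?expr0 ?cabs1// !exprS cabsM IH.
Qed.

Lemma cabsN z : cabs (- z) = cabs z.
Proof. exact: normcN. Qed.

Lemma cabsB z w : cabs (z - w) = cabs (w - z).
Proof. by rewrite -cabsN opprB. Qed.

Lemma cabsD z w : cabs (z + w) <= cabs z + cabs w.
Proof. exact: le_normcD. Qed.

Lemma cabs_dist z x w : cabs (z - w) <= cabs (z - x) + cabs (x - w).
Proof. by rewrite -[z - w](subrKA x) cabsD. Qed.

Lemma cabs_lerB z w : cabs z - cabs w <= cabs (z - w).
Proof. by rewrite lerBlDr -{1}(subrK w z) cabsD. Qed.

Lemma cabs_eq0 z : (cabs z == 0) = (z == 0).
Proof.
apply/eqP/eqP => [|->]; last exact: cabs0.
exact: ComplexField.Normc.eq0_normc.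
Qed.

Lemma cabs_gt0 z : (0 < cabs z) = (z != 0).
Proof. by rewrite lt_neqAle cabs_ge0 andbT eq_sym cabs_eq0. Qed.

Lemma cabs_real r : cabs r%:C = `|r|.
Proof. by rewrite cabsE /= expr0n addr0 sqrtr_sqr. Qed.

Lemma cabs_nat n : cabs (n%:R : C) = n%:R.
Proof. by rewrite -(rmorph_nat (real_complex R)) cabs_real normr_nat. Qed.

Lemma cabs_conj z : cabs (conjc z) = cabs z.
Proof. by case: z => a b; rewrite !cabsE /= sqrrN. Qed.

Lemma cabs_sqr z : cabs z ^+ 2 = complex.Re z ^+ 2 + complex.Im z ^+ 2.
Proof. by rewrite cabsE sqr_sqrtr // addr_ge0 // sqr_ge0. Qed.

Lemma mul_conjc z : z * (conjc z) = (cabs z ^+ 2)%:C.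
Proof.
case: z => a b; rewrite cabs_sqr; apply/eqP; rewrite eq_complex /=.
by apply/andP; split; apply/eqP; ring.
Qed.

Lemma Re_le_cabs z : `|complex.Re z| <= cabs z.
Proof.
by rewrite cabsE -sqrtr_sqr ler_wsqrtr // lerDl sqr_ge0.
Qed.

Lemma Im_le_cabs z : `|complex.Im z| <= cabs z.
Proof.
by rewrite cabsE -sqrtr_sqr ler_wsqrtr // lerDr sqr_ge0.
Qed.

Lemma cReD z w : complex.Re (z + w) = complex.Re z + complex.Re w.
Proof. by case: z w => [? ?] []. Qed.

Lemma cImD z w : complex.Im (z + w) = complex.Im z + complex.Im w.
Proof. by case: z w => [? ?] []. Qed.

Lemma cReN z : complex.Re (- z) = - complex.Re z.
Proof. by case: z. Qed.

Lemma cImN z : complex.Im (- z) = - complex.Im z.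
Proof. by case: z. Qed.

Lemma cReM z w : complex.Re (z * w) =
  complex.Re z * complex.Re w - complex.Im z * complex.Im w.
Proof. by case: z w => [? ?] []. Qed.

Lemma cImM z w : complex.Im (z * w) =
  complex.Re z * complex.Im w + complex.Im z * complex.Re w.
Proof. by case: z w => [? ?] []. Qed.

Lemma Re_sum I (s : seq I) (P : pred I) (F : I -> C) :
  complex.Re (\sum_(i <- s | P i) F i) = \sum_(i <- s | P i) complex.Re (F i).
Proof. by elim/big_rec2: _ => // i x y _ <-; rewrite cReD. Qed.

Lemma Im_sum I (s : seq I) (P : pred I) (F : I -> C) :
  complex.Im (\sum_(i <- s | P i) F i) = \sum_(i <- s | P i) complex.Im (F i).
Proof. by elim/big_rec2: _ => // i x y _ <-; rewrite cImD. Qed.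

Lemma realCD r s : (r + s)%:C = r%:C + s%:C :> C.
Proof. exact: (rmorphD (real_complex R)). Qed.

Lemma realCB r s : (r - s)%:C = r%:C - s%:C :> C.
Proof. exact: (rmorphB (real_complex R)). Qed.

Lemma realCM r s : (r * s)%:C = r%:C * s%:C :> C.
Proof. exact: (rmorphM (real_complex R)). Qed.

Lemma realCV r : (r^-1)%:C = (r%:C)^-1 :> C.
Proof. exact: (fmorphV (real_complex R)). Qed.

Lemma realC_nat n : (n%:R)%:C = n%:R :> C.
Proof. exact: (rmorph_nat (real_complex R)). Qed.

Lemma realC_sum I (s : seq I) (P : pred I) (F : I -> R) :
  (\sum_(i <- s | P i) F i)%:C = \sum_(i <- s | P i) (F i)%:C :> C.
Proof. exact: (rmorph_sum (real_complex R)). Qed.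

Lemma conjcD z w : (conjc (z + w)) = (conjc z) + (conjc w).
Proof. exact: (rmorphD (@conjc R)). Qed.

Lemma conjcM z w : (conjc (z * w)) = (conjc z) * (conjc w).
Proof. exact: (rmorphM (@conjc R)). Qed.

Lemma cabs_le_ReIm z : cabs z <= `|complex.Re z| + `|complex.Im z|.
Proof.
rewrite -[leRHS]ger0_norm ?addr_ge0// -sqrtr_sqr cabsE ler_wsqrtr//.
by rewrite sqrrD !real_normK ?num_real// -addrA lerD2l lerDr mulrn_wge0// mulr_ge0.
Qed.

Lemma cabs_sum I (s : seq I) (P : pred I) (F : I -> C) :
  cabs (\sum_(i <- s | P i) F i) <= \sum_(i <- s | P i) cabs (F i).
Proof.
elim/big_rec2: _ => [|i x y _ IH]; first by rewrite cabs0.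
by apply: (le_trans (cabsD _ _)); rewrite lerD2l.
Qed.

Lemma cabs_cis (t : R) : cabs (cis t) = 1.
Proof. by rewrite cabsE /= cos2Dsin2 sqrtr1. Qed.

Lemma cisD (t u : R) : cis (t + u) = cis t * cis u.
Proof. by apply/eqP; rewrite eq_complex /= cosD sinD [X in _ && (X == _)]addrC !eqxx. Qed.

Lemma cis0 : cis 0 = 1 :> C.
Proof. by rewrite /cis cos0 sin0. Qed.

Lemma cisN (t : R) : cis (- t) = (conjc (cis t)).
Proof. by rewrite /cis cosN sinN. Qed.

(** A positive element of the partially ordered field of complex numbers is a positive real, so the
    tolerance in the definition of convergence can be taken real. *)
Lemma cvgCP T (F : set_system T) {FF : Filter F} (g : T -> C) (l : C) :
  (g : T -> C^o) @ F --> (l : C^o) <->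
  forall e : R, 0 < e -> \forall x \near F, cabs (g x - l) < e.
Proof.
split => [/cvgrPdist_lt H e e0|H].
  have := H (e%:C) ; rewrite ltcR => /(_ e0).
  by apply: filterS => x; rewrite normcabs ltcR cabsB.
apply/cvgrPdist_lt => e; rewrite ltcE /= => /andP[/eqP ime ree].
have := H _ ree; apply: filterS => x; rewrite normcabs cabsB.
by case: e ime ree => a b /= -> _ h; rewrite ltcR.
Qed.

End Modulus.

(** * Unordered sums as limits of finite partial sums *)

Section FamilySums.
Variables (R : realType).
Local Notation C := (R[i]).

(** For nonnegative families this is summability together with an explicit majorant of the sum, the
    form in which dominations are passed around. *)
Definition bsum (T : choiceType) (v : T -> R) (B : R) : Prop :=
  forall s : seq T, uniq s -> \sum_(x <- s) v x <= B.

Definition nsum (T : choiceType) (v : T -> R) : R :=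
  fine (esum setT (EFin \o v)).

Definition asummable (T : choiceType) (u : T -> C) : Prop :=
  exists B, bsum (fun x => cabs (u x)) B.

(** Convergence of the net of finite partial sums. Limits are proved in this form and carried over
    to [csum], defined by positive and negative parts, through [csum_sums] and uniqueness. *)
Definition sums_to (T : choiceType) (u : T -> C) (l : C) : Prop :=
  forall e : R, 0 < e -> exists s0 : seq T, uniq s0 /\
    forall s, uniq s -> {subset s0 <= s} -> cabs (\sum_(x <- s) u x - l) <= e.

Section Nonneg.
Variable T : choiceType.
Implicit Types (u v : T -> R).

Lemma bsum_esum v B : bsum v B -> (esum setT (EFin \o v) <= B%:E)%E.
Proof.
move=> vB; apply: ge_ereal_sup => _ [A [Afin _] <-].
have [s sA] := (finite_seqP A).1 Afin.
rewrite [A](_ : _ = [set` undup s]); last first.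
  by rewrite sA; apply/seteqP; split => x /=; rewrite mem_undup.
by rewrite -fsbig_seq ?undup_uniq//= sumEFin lee_fin vB// undup_uniq.
Qed.

Lemma sum_le_esum v (s : seq T) : uniq s ->
  ((\sum_(x <- s) v x)%:E <= esum setT (EFin \o v))%E.
Proof.
move=> us; apply: ereal_sup_ubound; exists [set` s]; first by split.
by rewrite -fsbig_seq //= sumEFin.
Qed.

Lemma nsumE v B : bsum v B -> esum setT (EFin \o v) = (nsum v)%:E.
Proof.
move=> vB; rewrite /nsum fineK// fin_numE; apply/andP; split.
  rewrite -ltNye; apply: lt_le_trans (sum_le_esum v (s := [::]) isT).
  by rewrite ltNye.
by rewrite -ltey; apply: le_lt_trans (bsum_esum vB) _; rewrite ltey.
Qed.

Lemma nsum_bsum v B : bsum v B -> bsum v (nsum v).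
Proof. by move=> vB s us; rewrite -lee_fin -(nsumE vB) sum_le_esum. Qed.

Lemma nsum_le v B : bsum v B -> nsum v <= B.
Proof. by move=> vB; rewrite -lee_fin -(nsumE vB) bsum_esum. Qed.

Lemma nsum_ge0 v B : bsum v B -> 0 <= nsum v.
Proof. by move=> vB; have := nsum_bsum vB (s := [::]) isT; rewrite big_nil. Qed.

Lemma nsum_approx v B e : bsum v B -> 0 < e ->
  exists s, uniq s /\ nsum v - e < \sum_(x <- s) v x.
Proof.
move=> vB e0; apply/not_existsP => H.
suff : nsum v <= nsum v - e by lra.
apply: nsum_le => s us; rewrite leNgt; apply/negP => h; exact: (H s).
Qed.

Lemma sum_subset v (s0 s : seq T) : (forall x, 0 <= v x) ->
  uniq s0 -> uniq s -> {subset s0 <= s} ->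
  \sum_(x <- s0) v x <= \sum_(x <- s) v x.
Proof.
move=> v0 u0 us sub.
have p : perm_eq s (s0 ++ [seq x <- s | x \notin s0]).
  apply: uniq_perm => //.
    rewrite cat_uniq u0 filter_uniq// andbT; apply/hasPn => x.
    by rewrite mem_filter => /andP[].
  move=> x; rewrite mem_cat mem_filter.
  by case: (boolP (x \in s0)) => //= /sub ->.
by rewrite (perm_big _ p)/= big_cat /= lerDl sumr_ge0.
Qed.

Lemma bsum_le u v B : (forall x, u x <= v x) -> bsum v B -> bsum u B.
Proof. by move=> uv vB s us; apply: le_trans (vB s us); exact: ler_sum. Qed.

End Nonneg.

Lemma sub_undup (T : choiceType) (s1 s2 : seq T) :
  [/\ uniq (undup (s1 ++ s2)), {subset s1 <= undup (s1 ++ s2)} &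
      {subset s2 <= undup (s1 ++ s2)}].
Proof.
by split; [exact: undup_uniq| |] => x xs; rewrite mem_undup mem_cat xs ?orbT.
Qed.

Section Csum.
Variable T : choiceType.
Implicit Types (u v : T -> C).

Lemma sums_to_uniq u l l' : sums_to u l -> sums_to u l' -> l = l'.
Proof.
move=> ul ul'; apply/eqP; rewrite -subr_eq0 -cabs_eq0 eq_le cabs_ge0 andbT.
apply/ler_addgt0Pl => e e0; rewrite addr0.
have e20 : 0 < e / 2 by rewrite divr_gt0.
have [s1 [_ h1]] := ul _ e20; have [s2 [_ h2]] := ul' _ e20.
have [us i1 i2] := sub_undup s1 s2.
apply: le_trans (cabs_dist _ (\sum_(x <- undup (s1 ++ s2)) u x) _) _.
by rewrite cabsB [leRHS]splitr lerD ?h1 ?h2.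
Qed.

Lemma sums_toD u v a l m : sums_to u l -> sums_to v m ->
  sums_to (fun x => a * u x + v x) (a * l + m).
Proof.
move=> ul vm e e0.
have a0 : 0 < cabs a + 1 by rewrite ltr_wpDl ?cabs_ge0.
have e1 : 0 < e / 2 / (cabs a + 1) by rewrite !divr_gt0.
have e20 : 0 < e / 2 by rewrite divr_gt0.
have [s1 [_ h1]] := ul _ e1; have [s2 [_ h2]] := vm _ e20.
have [us i1 i2] := sub_undup s1 s2.
exists (undup (s1 ++ s2)); split => // s uqs sub.
rewrite big_split /= -mulr_sumr opprD addrACA -mulrBr.
apply: le_trans (cabsD _ _) _.
rewrite [leRHS]splitr cabsM; apply: lerD; last first.
  by apply: h2 => // x /i2/sub.
have {}h1 : cabs (\sum_(x <- s) u x - l) <= e / 2 / (cabs a + 1).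
  by apply: h1 => // x /i1/sub.
rewrite -[leRHS](divfK (lt0r_neq0 a0)) mulrC ler_pM ?cabs_ge0//.
by rewrite lerDl.
Qed.

Lemma real_sums_pos (v : T -> R) B : (forall x, 0 <= v x) -> bsum v B ->
  sums_to (fun x => (v x)%:C) (nsum v)%:C.
Proof.
move=> v0 vB e e0; have [s0 [us0 h0]] := nsum_approx vB e0.
exists s0; split=> // s us sub.
rewrite -realC_sum -realCB cabs_real distrC ger0_norm.
  rewrite lerBlDr -lerBlDl; apply: le_trans (ltW h0) _.
  exact: sum_subset.
by rewrite subr_ge0; exact: (nsum_bsum vB).
Qed.

Lemma rsumE (v : T -> R) B : bsum (fun x => `|v x|) B ->
  rsum v = nsum (fun x => Num.max (v x) 0) - nsum (fun x => Num.max (- v x) 0).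
Proof.
move=> vB; rewrite /rsum.
have b1 : bsum (fun x => Num.max (v x) 0) B.
  by apply: bsum_le vB => x; rewrite ge_max ler_norm normr_ge0.
have b2 : bsum (fun x => Num.max (- v x) 0) B.
  by apply: bsum_le vB => x; rewrite ge_max normr_ge0 andbT -normrN ler_norm.
rewrite (_ : (EFin \o v)^\+%E = EFin \o (fun x => Num.max (v x) 0)); last first.
  by apply/funext => x; rewrite /= funeposE /= EFin_max.
rewrite (_ : (EFin \o v)^\-%E = EFin \o (fun x => Num.max (- v x) 0)); last first.
  by apply/funext => x; rewrite /= funenegE /= EFin_max.
by rewrite (nsumE b1) (nsumE b2).
Qed.

Lemma bsum_pos (v : T -> R) B : bsum (fun x => `|v x|) B ->
  bsum (fun x => Num.max (v x) 0) B /\ bsum (fun x => Num.max (- v x) 0) B.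
Proof.
move=> vB; split; apply: bsum_le vB => x; rewrite ge_max normr_ge0 andbT.
  by rewrite ler_norm.
by rewrite -normrN ler_norm.
Qed.

Lemma rsum_sums (v : T -> R) B : bsum (fun x => `|v x|) B ->
  sums_to (fun x => (v x)%:C) (rsum v)%:C.
Proof.
move=> vB; have [b1 b2] := bsum_pos vB.
have m0 (r : R) : 0 <= Num.max r 0 by rewrite le_max lexx orbT.
have h1 := real_sums_pos (fun x => m0 _) b1.
have h2 := real_sums_pos (fun x => m0 _) b2.
rewrite (rsumE vB) realCB addrC -mulN1r.
have := sums_toD (-1) h2 h1; congr (sums_to _ _); apply/funext => x.
rewrite mulN1r addrC -realCB; congr (_%:C).
rewrite /Num.max; case: ifP; case: ifP; lra.
Qed.

Lemma csum_sums u : asummable u -> sums_to u (csum u).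
Proof.
move=> [B uB].
have b1 : bsum (fun x => `|complex.Re (u x)|) B.
  by apply: bsum_le uB => x; exact: Re_le_cabs.
have b2 : bsum (fun x => `|complex.Im (u x)|) B.
  by apply: bsum_le uB => x; exact: Im_le_cabs.
have := sums_toD 'i%C (rsum_sums b2) (rsum_sums b1).
rewrite addrC (_ : _ + _ = csum u); last first.
  by rewrite [RHS]complexE.
by congr (sums_to _ _); apply/funext => x; rewrite addrC -complexE.
Qed.

Lemma sums_csum u l : asummable u -> sums_to u l -> csum u = l.
Proof. by move=> us; apply: sums_to_uniq; exact: csum_sums. Qed.

End Csum.
End FamilySums.

(** * Dominated convergence, reindexing and Fubini for unordered sums *)

Section CsumTheory.
Variables (R : realType).
Local Notation C := (R[i]).

Section OneIndex.
Variable T : choiceType.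
Implicit Types (u v w : T -> C) (g : T -> R).

Lemma asummable_le u g B : (forall x, cabs (u x) <= g x) -> bsum g B ->
  asummable u.
Proof. by move=> ug gB; exists B; apply: bsum_le gB. Qed.

Lemma asummableD u v a : asummable u -> asummable v ->
  asummable (fun x => a * u x + v x).
Proof.
move=> [B uB] [D vD]; exists (cabs a * B + D) => s us.
apply: (@le_trans _ _ (\sum_(x <- s) (cabs a * cabs (u x) + cabs (v x)))).
  by apply: ler_sum => x _; rewrite -cabsM cabsD.
by rewrite big_split /= -mulr_sumr lerD ?vD// ler_wpM2l ?cabs_ge0// uB.
Qed.

Lemma asummable0 : asummable (fun _ : T => 0 : C).
Proof. by exists 0 => s _; rewrite big1// => x _; rewrite cabs0. Qed.

Lemma asummableZ u a : asummable u -> asummable (fun x => a * u x).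
Proof.
move=> us; have := asummableD a us asummable0.
by congr asummable; apply/funext => x; rewrite addr0.
Qed.

Lemma eq_csum u v : u =1 v -> csum u = csum v.
Proof. by move=> /funext ->. Qed.

Lemma csum0 : csum (fun _ : T => 0 : C) = 0.
Proof.
apply: sums_csum asummable0 _ => e e0; exists [::]; split => // s _ _.
by rewrite big1// subrr cabs0 ltW.
Qed.

Lemma csumD u v a : asummable u -> asummable v ->
  csum (fun x => a * u x + v x) = a * csum u + csum v.
Proof.
move=> us vs; apply: sums_csum; first exact: asummableD.
by apply: sums_toD; exact: csum_sums.
Qed.

Lemma csumZ u a : asummable u -> csum (fun x => a * u x) = a * csum u.
Proof.
move=> us; have := csumD a us asummable0; rewrite csum0 addr0 => <-.
by apply: eq_csum => x; rewrite addr0.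
Qed.

Lemma asummable_conj u : asummable u -> asummable (fun x => (conjc (u x))).
Proof.
move=> [B uB]; exists B; apply: bsum_le uB => x /=; by rewrite cabs_conj.
Qed.

Lemma csum_conj u : asummable u -> csum (fun x => (conjc (u x))) = (conjc (csum u)).
Proof.
move=> us; apply: sums_csum; first exact: asummable_conj.
move=> e e0; have [s0 [us0 h]] := csum_sums us e0; exists s0; split => // s h1 h2.
by rewrite -rmorph_sum -rmorphB /= cabs_conj h.
Qed.

Lemma cabs_csum u B : bsum (fun x => cabs (u x)) B -> cabs (csum u) <= B.
Proof.
move=> uB; apply/ler_addgt0Pl => e e0.
have us : asummable u by exists B.
have [s0 [us0 h]] := csum_sums us e0.
have := h s0 us0 (fun x => id); rewrite cabsB => {}h.
rewrite -[csum u](subrK (\sum_(x <- s0) u x)).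
apply: le_trans (cabsD _ _) _; apply: lerD => //.
exact: le_trans (cabs_sum _ _ _) (uB _ us0).
Qed.

Lemma big_zero_out (V : nmodType) (u : T -> V) (s0 s : seq T) :
  uniq s0 -> uniq s -> {subset s0 <= s} ->
  (forall x, x \notin s0 -> u x = 0) -> \sum_(x <- s) u x = \sum_(x <- s0) u x.
Proof.
move=> u0 us sub h; rewrite (bigID (mem s0)) /= addrC big1 ?add0r; last first.
  by move=> x; exact: h.
rewrite -big_filter; apply: perm_big; apply: uniq_perm => //.
  by rewrite filter_uniq.
move=> x; rewrite mem_filter; case: (boolP (x \in s0)) => //= /sub ->//.
Qed.

Lemma csum_seq u (s0 : seq T) : uniq s0 -> (forall x, x \notin s0 -> u x = 0) ->
  asummable u /\ csum u = \sum_(x <- s0) u x.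
Proof.
move=> us0 h.
have as_ : asummable u.
  exists (\sum_(x <- s0) cabs (u x)) => s us.
  have [uu i1 i2] := sub_undup s0 s.
  have <- : \sum_(x <- undup (s0 ++ s)) cabs (u x) = \sum_(x <- s0) cabs (u x).
    by apply: big_zero_out => // x /h ->; rewrite cabs0.
  by apply: sum_subset => // x; exact: cabs_ge0.
split => //; apply: sums_csum => // e e0; exists s0; split => // s us sub.
by rewrite (big_zero_out us0 us sub h) subrr cabs0 ltW.
Qed.

Lemma csum1 u x0 : (forall x, x != x0 -> u x = 0) -> csum u = u x0.
Proof.
move=> h; have [|x|_ ->] := @csum_seq u [:: x0]; rewrite ?big_seq1//.
by rewrite inE => /h.
Qed.

Lemma nsum_csum g B : (forall x, 0 <= g x) -> bsum g B ->
  csum (fun x => (g x)%:C) = (nsum g)%:C.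
Proof.
move=> g0 gB; apply: sums_csum; last exact: real_sums_pos gB.
by apply: asummable_le gB => x; rewrite cabs_real ger0_norm.
Qed.

(** The set [s0] depends only on the majorant: it carries the mass of [g] up to [e], so cutting any
    dominated family off outside [s0] changes its sum by at most [e]. *)
Lemma csum_tail g B e : (forall x, 0 <= g x) -> bsum g B -> 0 < e ->
  exists s0, uniq s0 /\ forall u, (forall x, cabs (u x) <= g x) ->
   cabs (csum u - \sum_(x <- s0) u x) <= e.
Proof.
move=> g0 gB e0; have [s0 [us0 h0]] := nsum_approx gB e0; exists s0; split => //.
move=> u ug; have us : asummable u by exact: asummable_le gB.
pose v x := if x \in s0 then u x else 0.
have [|x /negbTE|vs vE] := @csum_seq v s0 => //; first by rewrite /v => ->.
have -> : csum u - \sum_(x <- s0) u x = csum (fun x => u x - v x).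
  rewrite (_ : (fun x => u x - v x) = (fun x => (-1) * v x + u x)); last first.
    by apply/funext => x; rewrite mulN1r addrC.
  rewrite csumD// vE mulN1r addrC; congr (- _ + _).
  by rewrite !big_seq; apply: eq_bigr => x; rewrite /v => ->.
apply: cabs_csum => s hs.
rewrite (bigID (mem s0)) /= big1 ?add0r; last first.
  by move=> x xs; rewrite /v xs subrr cabs0.
rewrite -big_filter.
apply: (@le_trans _ _ (\sum_(x <- [seq x <- s | x \notin s0]) g x)).
  rewrite !big_seq; apply: ler_sum => x.
  by rewrite mem_filter /v => /andP[/negbTE -> _]; rewrite subr0.
have : \sum_(x <- s0 ++ [seq x <- s | x \notin s0]) g x <= nsum g.
  apply: (nsum_bsum gB); rewrite cat_uniq us0 filter_uniq// andbT /=.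
  by apply/hasPn => x; rewrite mem_filter => /andP[].
by rewrite big_cat /=; lra.
Qed.

(** Dominated convergence along an arbitrary filter: [csum_tail] provides one finite set for all
    indices, and there termwise convergence suffices. *)
Lemma tannery I (F : set_system I) {FF : Filter F} (a : I -> T -> C) (b : T -> C)
    g B : (forall x, 0 <= g x) -> bsum g B ->
  (forall i x, cabs (a i x) <= g x) -> (forall x, cabs (b x) <= g x) ->
  (forall x e, 0 < e -> \forall i \near F, cabs (a i x - b x) < e) ->
  forall e, 0 < e -> \forall i \near F, cabs (csum (a i) - csum b) < e.
Proof.
move=> g0 gB ag bg ab e e0.
have e4 : 0 < e / 4 by rewrite divr_gt0.
have [s0 [us0 h]] := csum_tail g0 gB e4.
have : \forall i \near F, cabs (\sum_(x <- s0) a i x - \sum_(x <- s0) b x) <= e / 4.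
  have H : forall s : seq T, forall d, 0 < d ->
    \forall i \near F, cabs (\sum_(x <- s) a i x - \sum_(x <- s) b x) <= d.
    elim => [|y s IH] d d0.
      by apply: nearW => i; rewrite !big_nil subrr cabs0 ltW.
    have d2 : 0 < d / 2 by rewrite divr_gt0.
    have A := ab y _ d2; have A' := IH _ d2.
    apply: filterS2 A A' => i h1 h2.
    rewrite !big_cons opprD addrACA.
    by apply: le_trans (cabsD _ _) _; rewrite [leRHS]splitr lerD// ltW.
  exact: H.
apply: filterS => i hi.
have h1 := h _ (ag i); have h2 := h _ bg.
apply: le_lt_trans (cabs_dist _ (\sum_(x <- s0) a i x) _) _.
have := cabs_dist (\sum_(x <- s0) a i x) (\sum_(x <- s0) b x) (csum b).
rewrite [cabs (_ - csum b)]cabsB; rewrite [cabs (_ - csum b)]cabsB in h2 *.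
by move: h1 h2 hi; lra.
Qed.

End OneIndex.

Section Reindex.
Variables T T' : choiceType.

Lemma reindex_sums (h : T -> T') (u : T' -> C) : injective h ->
  (forall y, (forall x, y != h x) -> u y = 0) -> asummable (u \o h) ->
  asummable u /\ csum u = csum (u \o h).
Proof.
move=> hi h0 us.
(* The second clause ranges over all additive monoids so that one [r] serves the moduli, the values
   of [u], and a counting function with values in [nat] which shows that a new preimage is not yet
   in [r]. *)
have key : forall s : seq T', uniq s -> exists r : seq T,
    [/\ uniq r, (forall V : nmodType, forall w : T' -> V,
      (forall y, (forall x, y != h x) -> w y = 0) ->
      \sum_(y <- s) w y = \sum_(x <- r) w (h x)) &
      forall x, h x \in s -> x \in r].
  elim => [|y s IH] /=; first by exists [::]; split => // V w _; rewrite !big_nil.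
  move=> /andP[ys /IH[r [ur sr rr]]].
  have [[x yx]|/forallNP ny] := pselect (exists x, y = h x).
    exists (x :: r); split => /=.
    - rewrite ur andbT; apply/negP => xr.
      suff : (\sum_(z <- s) (z == y) : nat) = 0%N.
        have := sr _ (fun z => (z == y) : nat); rewrite /= => ->; last first.
          by move=> z /(_ x); rewrite -yx => /negbTE ->.
        by rewrite (bigD1_seq x) //= yx eqxx.
      rewrite big_seq big1// => z zs; apply/eqP; rewrite eqb0.
      by apply: contraNN ys => /eqP <-.
    - by move=> V w w0; rewrite !big_cons (sr _ _ w0) yx.
    - move=> x'; rewrite !inE yx => /orP[/eqP/hi ->|/rr ->]; first by rewrite eqxx.
      by rewrite orbT.
  exists r; split => //.
    move=> V w w0; rewrite big_cons (w0 y) ?add0r ?(sr _ _ w0)//.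
    by move=> x; apply/eqP.
  by move=> x; rewrite inE => /orP[/eqP/esym/ny//|/rr].
have as_ : asummable u.
  case: us => B uB; exists B => s /key[r [ur sr _]].
  rewrite sr; first exact: uB.
  by move=> y /h0 ->; rewrite cabs0.
split => //; apply: sums_csum => // e e0.
have [s0 [us0 hs0]] := csum_sums us e0.
exists [seq h x | x <- s0]; rewrite map_inj_uniq//; split => // s ss sub.
have [r [ur sr rr]] := key _ ss; rewrite (sr _ _ h0); apply: hs0 => // x xs.
by apply: rr; apply: sub; rewrite map_f.
Qed.

Lemma reindex_csum (h : T -> T') (u : T' -> C) : injective h ->
  (forall y, (forall x, y != h x) -> u y = 0) -> asummable (u \o h) ->
  csum u = csum (u \o h).
Proof. by move=> h1 h2 h3; have [] := reindex_sums h1 h2 h3. Qed.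

Lemma bsum_inj (h : T -> T') (g : T' -> R) B : injective h -> bsum g B ->
  bsum (g \o h) B.
Proof.
move=> hi gB s us; rewrite -(big_map h xpredT g); apply: gB.
by rewrite map_inj_uniq.
Qed.

End Reindex.

Lemma divn_mulrn_le (e : R) n : 0 < e -> e / n.+1%:R *+ n <= e.
Proof.
move=> e0; rewrite -mulr_natr -mulrA ger_pMr// mulrC ler_pdivrMr ?ltr0n//.
by rewrite mul1r ler_nat.
Qed.

Section Fubini.
Variables T1 T2 : choiceType.

Definition bsum2 (g : T1 -> T2 -> R) B := forall s1 s2, uniq s1 -> uniq s2 ->
  \sum_(x <- s1) \sum_(y <- s2) g x y <= B.

Definition asummable2 (u : T1 -> T2 -> C) :=
  exists B, bsum2 (fun x y => cabs (u x y)) B.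

Implicit Types (u : T1 -> T2 -> C).

(** Finitely many inner sums are approximated on one common finite set of columns, with the error
    [e] divided evenly among the rows; the rectangle bound then applies. *)
Lemma asummable2_l u B : bsum2 (fun x y => cabs (u x y)) B ->
  (forall x, asummable (u x)) /\ bsum (fun x => cabs (csum (u x))) B.
Proof.
move=> uB.
have ux x : asummable (u x).
  by exists B => s us; have := uB [:: x] s isT us; rewrite big_seq1.
split => // s us; apply/ler_addgt0Pl => e e0.
pose n := (size s).+1.
have n0 : 0 < n%:R :> R by rewrite ltr0n.
have en : 0 < e / n%:R by rewrite divr_gt0.
have [t [ut ht]] : exists t, uniq t /\ forall x, x \in s -> forall t', uniq t' ->
    {subset t <= t'} -> cabs (\sum_(y <- t') u x y - csum (u x)) <= e / n%:R.
  elim: (s) en => [|x s' IH] en; first by exists [::].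
  have [t [ut ht]] := IH en; have [t1 [ut1 ht1]] := csum_sums (ux x) en.
  have [uu i1 i2] := sub_undup t t1; exists (undup (t ++ t1)); split => //.
  move=> x'; rewrite inE => /orP[/eqP ->|xs] t' ut' sub'.
    by apply: ht1 => // z /i2/sub'.
  by apply: ht => // z /i1/sub'.
apply: (@le_trans _ _ (\sum_(x <- s) (e / n%:R + \sum_(y <- t) cabs (u x y)))).
  rewrite !big_seq; apply: ler_sum => x xs.
  rewrite -[csum _](subrK (\sum_(y <- t) u x y)).
  apply: le_trans (cabsD _ _) _; apply: lerD; last exact: cabs_sum.
  by rewrite cabsB; exact: ht.
rewrite big_split /=; apply: lerD; last exact: uB.
rewrite big_const_seq count_predT iter_addr_0.
exact: divn_mulrn_le.
Qed.

Lemma sum_pairs (V : nmodType) (u : T1 -> T2 -> V) (s1 : seq T1) (s2 : seq T2) :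
  \sum_(p <- [seq (x, y) | x <- s1, y <- s2]) u p.1 p.2 =
  \sum_(x <- s1) \sum_(y <- s2) u x y.
Proof. by rewrite big_allpairs. Qed.

(** A finite set of pairs lies in the product of its two projections. *)
Lemma asummable_pair u B : bsum2 (fun x y => cabs (u x y)) B ->
  bsum (fun p => cabs (u p.1 p.2)) B.
Proof.
move=> uB s us.
apply: le_trans (uB (undup (map fst s)) (undup (map snd s)) _ _);
  rewrite ?undup_uniq// -sum_pairs.
apply: (@sum_subset _ _ (fun p => cabs (u p.1 p.2))) => //.
- by move=> x; exact: cabs_ge0.
- by apply: allpairs_uniq => //; rewrite ?undup_uniq// => -[? ?] [].
- move=> [x y] xy; apply: allpairs_f; rewrite mem_undup; apply/mapP.
    by exists (x, y).
  by exists (x, y).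
Qed.

(** The iterated sum over finitely many rows is compared with the sum over a rectangle that contains
    the good set of pairs [s0] and has enough columns to make each inner sum exact up to [d / n]. *)
Lemma csum_pair u : asummable2 u ->
  csum (fun p => u p.1 p.2) = csum (fun x => csum (u x)).
Proof.
move=> [B uB]; have [ux uxB] := asummable2_l uB.
have up : asummable (fun p => u p.1 p.2) by exists B; exact: asummable_pair.
apply/esym; apply: sums_csum; first by exists B.
move=> e e0; have [s0 [us0 h0]] := csum_sums up e0.
exists (undup (map fst s0)); rewrite undup_uniq; split => // s us sub.
set l := csum (fun p => _).
apply/ler_addgt0Pl => d d0.
pose n := (size s).+1.
have n0 : 0 < n%:R :> R by rewrite ltr0n.
have en : 0 < d / n%:R by rewrite divr_gt0.
have [t [ut ht]] : exists t, uniq t /\ forall x, x \in s -> forall t', uniq t' ->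
    {subset t <= t'} -> cabs (\sum_(y <- t') u x y - csum (u x)) <= d / n%:R.
  elim: (s) en => [|x s' IH] en; first by exists [::].
  have [t [ut ht]] := IH en; have [t1 [ut1 ht1]] := csum_sums (ux x) en.
  have [uu i1 i2] := sub_undup t t1; exists (undup (t ++ t1)); split => //.
  move=> x'; rewrite inE => /orP[/eqP ->|xs] t' ut' sub'.
    by apply: ht1 => // z /i2/sub'.
  by apply: ht => // z /i1/sub'.
have [uu i1 i2] := sub_undup t (map snd s0); set t' := undup _ in uu i1 i2.
apply: le_trans (cabs_dist _ (\sum_(x <- s) \sum_(y <- t') u x y) _) _.
apply: lerD; last first.
  rewrite -sum_pairs; apply: h0.
    by apply: allpairs_uniq => // -[? ?] [].
  move=> [x y] xy; apply: allpairs_f.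
    by apply: sub; rewrite mem_undup; apply/mapP; exists (x, y).
  by apply: i2; apply/mapP; exists (x, y).
rewrite -sumrB; apply: le_trans (cabs_sum _ _ _) _.
apply: (@le_trans _ _ (\sum_(x <- s) (d / n%:R))).
  by rewrite !big_seq; apply: ler_sum => x xs; rewrite cabsB; exact: ht.
rewrite big_const_seq count_predT iter_addr_0.
exact: divn_mulrn_le.
Qed.

End Fubini.

Lemma csum_exchange (T1 T2 : choiceType) (u : T1 -> T2 -> C) : asummable2 u ->
  csum (fun x => csum (u x)) = csum (fun y => csum (fun x => u x y)).
Proof.
move=> us; case: (us) => B uB.
have us' : asummable2 (fun y x => u x y).
  by exists B => s1 s2 u1 u2; rewrite exchange_big /=; exact: uB.
rewrite -(csum_pair us) -(csum_pair us').
rewrite (@reindex_csum (T1 * T2)%type (T2 * T1)%type (fun p => (p.2, p.1))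
  (fun p => u p.2 p.1)) //.
- by move=> [? ?] [? ?] /= [-> ->].
- by move=> [y x] /(_ (x, y)); rewrite eqxx.
- by exists B; exact: asummable_pair.
Qed.

End CsumTheory.

(** * Bounded self-adjoint operators *)

Lemma exp_small (R : realType) (r k e : R) : 0 <= r < 1 -> 0 < e ->
  exists n, k * r ^+ n < e.
Proof.
move=> /andP[r0 r1] e0.
have h : (fun n => k * r ^+ n) @ \oo --> (0 : R).
  rewrite -[0](mulr0 k); apply: cvgM; [exact: cvg_cst|apply: cvg_expr].
  by rewrite ger0_norm.
move/cvgrPdist_lt : h => /(_ _ e0)[n _ hn]; exists n.
by have := hn n (leqnn n); rewrite /= sub0r normrN; apply: le_lt_trans; exact: ler_norm.
Qed.

Section Complete.
Variable R : realType.
Local Notation C := (R[i]).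

(* The limit is the supremum of the lower bounds [u n - b n]. *)
Lemma cauchy_real (u b : nat -> R) :
  (forall n k, `|u (n + k)%N - u n| <= b n) -> exists l, forall n, `|u n - l| <= b n.
Proof.
move=> h.
have key n m : u n - b n <= u m + b m.
  have := h n m; have := h m n; rewrite (addnC m n) !ler_norml => /andP[? ?] /andP[? ?].
  by lra.
pose S := [set u n - b n | n in setT].
have S0 : S !=set0 by exists (u 0%N - b 0%N); exists 0%N.
have SU m : ubound S (u m + b m) by move=> _ [n _ <-].
have hs : has_sup S by split => //; exists (u 0%N + b 0%N).
exists (sup S) => n.
have h1 : u n - b n <= sup S by apply: ub_le_sup => //; [case: hs | exists n].
have h2 : sup S <= u n + b n by apply: ge_sup => //; exact: SU.
by rewrite ler_norml; lra.
Qed.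

Lemma cauchy_complex (u : nat -> C) (b : nat -> R) :
  (forall n k, cabs (u (n + k)%N - u n) <= b n) ->
  exists l, forall n, cabs (u n - l) <= b n + b n.
Proof.
move=> h.
have [a ha] : exists l, forall n, `|complex.Re (u n) - l| <= b n.
  apply: cauchy_real => n k; rewrite -cReN -cReD; exact: le_trans (Re_le_cabs _) (h n k).
have [c hc] : exists l, forall n, `|complex.Im (u n) - l| <= b n.
  apply: cauchy_real => n k; rewrite -cImN -cImD; exact: le_trans (Im_le_cabs _) (h n k).
exists (a +i* c) => n; apply: le_trans (cabs_le_ReIm _) _.
by rewrite cReD cReN cImD cImN /= lerD.
Qed.

End Complete.

(** * The Hilbert space of square summable families *)

Section L2.
Variables (R : realType) (T : choiceType).
Local Notation C := (R[i]).
Implicit Types (phi psi chi : T -> C) (a b : C).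

Definition sqf psi (x : T) : R := cabs (psi x) ^+ 2.

Definition n2 psi : R := nsum (sqf psi).

(** The only vector space operation in use: it covers sums, differences ([a = -1]) and multiples
    (last argument zero), so that linearity and norm estimates are stated once. *)
Definition lc a phi psi : T -> C := fun x => a * phi x + psi x.

Lemma sqf_ge0 psi x : 0 <= sqf psi x.
Proof. exact: sqr_ge0. Qed.

Lemma l2P psi : l2 psi <-> exists B, bsum (sqf psi) B.
Proof.
split => [h|[B hB]]; last first.
  by rewrite /l2 /=; apply: le_lt_trans (bsum_esum hB) _; rewrite ltey.
exists (fine (esum setT (EFin \o sqf psi))) => s us; rewrite -lee_fin fineK.
  exact: sum_le_esum.
rewrite ge0_fin_numE//; apply: esum_ge0 => x _; rewrite lee_fin; exact: sqf_ge0.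
Qed.

Lemma n2_bsum psi : l2 psi -> bsum (sqf psi) (n2 psi).
Proof. by move=> /l2P[B hB]; exact: nsum_bsum hB. Qed.

Lemma n2_le psi B : bsum (sqf psi) B -> l2 psi /\ n2 psi <= B.
Proof. by move=> h; split; [apply/l2P; exists B | exact: nsum_le]. Qed.

Lemma n2_ge0 psi : l2 psi -> 0 <= n2 psi.
Proof. by move=> /l2P[B hB]; exact: nsum_ge0 hB. Qed.

Lemma l2normE psi : l2norm psi = Num.sqrt (n2 psi).
Proof. by []. Qed.

Lemma l2norm_ge0 psi : 0 <= l2norm psi.
Proof. exact: sqrtr_ge0. Qed.

Lemma l2norm_sqr psi : l2 psi -> l2norm psi ^+ 2 = n2 psi.
Proof. by move=> /n2_ge0 h; rewrite l2normE sqr_sqrtr. Qed.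

Lemma l2_entry psi x : l2 psi -> cabs (psi x) <= l2norm psi.
Proof.
move=> h; rewrite -(@ler_pXn2r _ 2)// ?nnegrE ?cabs_ge0 ?l2norm_ge0//.
rewrite l2norm_sqr//; have := n2_bsum h (s := [:: x]) isT.
by rewrite big_seq1.
Qed.

Lemma l2_lc a phi psi : l2 phi -> l2 psi -> l2 (lc a phi psi).
Proof.
move=> /l2P[B hB] /l2P[D hD]; apply/l2P.
exists (2 * cabs a ^+ 2 * B + 2 * D) => s us.
apply: (@le_trans _ _
  (\sum_(x <- s) (2 * cabs a ^+ 2 * sqf phi x + 2 * sqf psi x))).
  apply: ler_sum => x _; rewrite /sqf /lc.
  have := cabsD (a * phi x) (psi x); rewrite cabsM.
  move: (cabs_ge0 (a * phi x + psi x)); set u := cabs (_ + _).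
  set v := cabs a * cabs (phi x); set w := cabs (psi x) => u0 uvw.
  have -> : 2 * cabs a ^+ 2 * cabs (phi x) ^+ 2 = 2 * v ^+ 2 by rewrite /v; ring.
  have : u ^+ 2 <= (v + w) ^+ 2 by rewrite ler_pXn2r// nnegrE; lra.
  have := sqr_ge0 (v - w); lra.
rewrite big_split /= -!mulr_sumr; apply: lerD; apply: ler_wpM2l.
- by rewrite mulr_ge0 ?sqr_ge0.
- exact: hB.
- by [].
- exact: hD.
Qed.

Lemma l2_0 : l2 (fun _ : T => 0 : C).
Proof.
apply/l2P; exists 0 => s _; rewrite big1// => x _.
by rewrite /sqf cabs0 expr0n.
Qed.

Lemma l2_scale a psi : l2 psi -> l2 (fun x => a * psi x).
Proof.
move=> h; have := l2_lc a h l2_0; congr l2; apply/funext => x.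
by rewrite /lc addr0.
Qed.

Definition ip phi psi : C := csum (fun x => phi x * (conjc (psi x))).

Lemma ip_asummable phi psi : l2 phi -> l2 psi ->
  asummable (fun x => phi x * (conjc (psi x))).
Proof.
move=> /n2_bsum h1 /n2_bsum h2; exists (n2 phi + n2 psi) => s us.
apply: (@le_trans _ _ (\sum_(x <- s) (sqf phi x + sqf psi x))).
  apply: ler_sum => x _; rewrite cabsM cabs_conj /sqf.
  by have := sqr_ge0 (cabs (phi x) - cabs (psi x)); have := sqr_ge0 (cabs (phi x) + cabs (psi x)); lra.
by rewrite big_split /=; apply: lerD; [exact: h1|exact: h2].
Qed.

Lemma ip_lcl a phi psi chi : l2 phi -> l2 psi -> l2 chi ->
  ip (lc a phi psi) chi = a * ip phi chi + ip psi chi.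
Proof.
move=> h1 h2 h3; rewrite /ip -csumD; try exact: ip_asummable.
by apply: eq_csum => x; rewrite /lc; ring.
Qed.

Lemma ipC phi psi : l2 phi -> l2 psi -> ip psi phi = (conjc (ip phi psi)).
Proof.
move=> h1 h2; rewrite /ip -csum_conj; last exact: ip_asummable.
by apply: eq_csum => x; rewrite rmorphM /= conjcK mulrC.
Qed.

Lemma ip_n2 psi : l2 psi -> ip psi psi = (n2 psi)%:C.
Proof.
move=> /n2_bsum h; rewrite -(nsum_csum (sqf_ge0 psi) h).
by apply: eq_csum => x; rewrite mul_conjc.
Qed.

Lemma ip_lcr a phi psi chi : l2 phi -> l2 psi -> l2 chi ->
  ip chi (lc a phi psi) = (conjc a) * ip chi phi + ip chi psi.
Proof.
move=> h1 h2 h3; rewrite ipC ?ip_lcl//; last exact: l2_lc.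
by rewrite conjcD conjcM -!ipC.
Qed.

Lemma n2_lc a phi psi : l2 phi -> l2 psi ->
  n2 (lc a phi psi) =
  cabs a ^+ 2 * n2 phi + 2 * complex.Re (a * ip phi psi) + n2 psi.
Proof.
move=> h1 h2; have h := l2_lc a h1 h2.
have := ip_n2 h; rewrite ip_lcl// !ip_lcr// !ip_n2// (ipC h1 h2).
set p := ip phi psi; rewrite -[n2 (lc _ _ _)]/(complex.Re (n2 (lc a phi psi))%:C) => <-.
rewrite cabs_sqr; case: p => p q; case: (a) => u v /=; ring.
Qed.

(** With [p] the inner product, the squared norm of [psi - t * conjc p * phi] is nonnegative for
    every real [t]; [t = (n2 phi)^-1] gives the inequality. If [n2 phi = 0] the expression is affine
    in [t], and a large [t] makes it negative unless [p = 0]. *)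
Lemma ip_CS phi psi : l2 phi -> l2 psi -> cabs (ip phi psi) ^+ 2 <= n2 phi * n2 psi.
Proof.
move=> h1 h2; set p := ip phi psi.
have key t : 0 <= t ^+ 2 * cabs p ^+ 2 * n2 phi - 2 * t * cabs p ^+ 2 + n2 psi.
  have := n2_ge0 (l2_lc ((- t)%:C * (conjc p)) h1 h2).
  rewrite n2_lc // -/p cabsM cabs_conj cabs_real exprMn real_normK ?num_real//.
  rewrite sqrrN -mulrA [(conjc p) * p]mulrC mul_conjc -realCM /=; lra.
have := n2_ge0 h1; rewrite le_eqVlt => /orP[/eqP n0|n0].
  rewrite -n0 mul0r; rewrite leNgt; apply/negP => p0.
  have := key ((n2 psi + 1) / cabs p ^+ 2); rewrite -n0 mulr0 add0r.
  rewrite -!mulrA mulVf ?lt0r_neq0// mulr1; have := n2_ge0 h2; lra.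
have := key (n2 phi)^-1.
have -> : (n2 phi)^-1 ^+ 2 * cabs p ^+ 2 * n2 phi - 2 * (n2 phi)^-1 * cabs p ^+ 2 =
   - (cabs p ^+ 2 / n2 phi) by field; rewrite lt0r_neq0.
by rewrite addrC subr_ge0 ler_pdivrMr// mulrC.
Qed.

Lemma l2norm_lc a phi psi : l2 phi -> l2 psi ->
  l2norm (lc a phi psi) <= cabs a * l2norm phi + l2norm psi.
Proof.
move=> h1 h2; have h := l2_lc a h1 h2.
have p0 := l2norm_ge0 phi; have q0 := l2norm_ge0 psi; have a0 := cabs_ge0 a.
have s0 : 0 <= cabs a * l2norm phi + l2norm psi by rewrite addr_ge0// mulr_ge0.
rewrite -(@ler_pXn2r _ 2)// ?nnegrE ?l2norm_ge0// l2norm_sqr// n2_lc//.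
rewrite -!l2norm_sqr//.
have : complex.Re (a * ip phi psi) <= cabs a * (l2norm phi * l2norm psi).
  apply: le_trans (ler_norm _) _; apply: le_trans (Re_le_cabs _) _.
  rewrite cabsM ler_wpM2l//.
  rewrite -(@ler_pXn2r _ 2)// ?nnegrE ?cabs_ge0 ?mulr_ge0//.
  by rewrite exprMn !l2norm_sqr// ip_CS.
move=> hr; nra.
Qed.

Lemma l2norm0 : l2norm (fun _ : T => 0 : C) = 0.
Proof.
have [_ h] : l2 (fun _ : T => 0 : C) /\ n2 (fun _ : T => 0 : C) <= 0.
  by apply: n2_le => s _; rewrite big1// => x _; rewrite /sqf cabs0 expr0n.
by rewrite l2normE; apply/eqP; rewrite sqrtr_eq0.
Qed.

Lemma l2norm_scale a psi : l2 psi -> l2norm (fun x => a * psi x) = cabs a * l2norm psi.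
Proof.
move=> h.
have le b phi : l2 phi -> l2norm (fun x => b * phi x) <= cabs b * l2norm phi.
  move=> hp; have := l2norm_lc b hp l2_0; rewrite l2norm0 addr0.
  by congr (l2norm _ <= _); apply/funext => x; rewrite /lc addr0.
have [->|a0] := eqVneq a 0.
  rewrite cabs0 mul0r -l2norm0; congr l2norm; apply/funext => x.
  by rewrite mul0r.
apply/le_anti; rewrite le//=.
have := le a^-1 _ (l2_scale a h).
rewrite (_ : (fun x => _) = psi); last by apply/funext => x; rewrite mulKf.
rewrite cabsV -ler_pdivlMl ?invr_gt0 ?cabs_gt0// invrK//.
Qed.

Lemma l2norm_eq0 psi : l2 psi -> l2norm psi <= 0 -> psi = fun=> 0.
Proof.
move=> h n0; apply/funext => x; apply/eqP; rewrite -cabs_eq0.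
by rewrite eq_le cabs_ge0 andbT (le_trans (l2_entry x h)).
Qed.

Lemma l2_basis (y : T) : l2 (basis_vec R y) /\ l2norm (basis_vec R y) <= 1.
Proof.
have h : bsum (sqf (basis_vec R y)) 1.
  move=> s us; rewrite /sqf /basis_vec.
  have e x : cabs ((x == y)%:R : C) ^+ 2 = (x == y)%:R.
    by case: eqP; rewrite ?cabs1 ?cabs0 ?expr1n ?expr0n.
  rewrite (eq_bigr _ (fun x _ => e x)).
  have [ys|ys] := boolP (y \in s).
    rewrite (bigD1_seq y) //= eqxx big1 ?addr0// => x /negbTE ->//.
  rewrite big_seq big1 ?ler01// => x xs; case: eqP => // xy.
  by rewrite -xy xs in ys.
have [h1 h2] := n2_le h; split => //; rewrite l2normE -[leRHS]sqrtr1.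
by rewrite ler_wsqrtr.
Qed.

(** Entrywise limits exist because an entry is bounded by the norm. The estimate in norm is a Fatou
    argument: on a finite set of entries the limit is replaced by a far member [phi N] at
    arbitrarily small cost. *)
Lemma l2_complete (phi : nat -> T -> C) (c r : R) : 0 <= c -> 0 <= r < 1 ->
  (forall n, l2 (phi n)) ->
  (forall n, l2norm (lc (-1) (phi n) (phi n.+1)) <= c * r ^+ n) ->
  exists psi, l2 psi /\ forall n, l2norm (lc (-1) (phi n) psi) <= 2 * (c / (1 - r)) * r ^+ n.
Proof.
move=> c0 /andP[r0 r1] h hd; set c' := c / (1 - r).
have r1' : 0 < 1 - r by lra.
have c'0 : 0 <= c' by rewrite divr_ge0// ltW.
have dist n k : l2norm (lc (-1) (phi n) (phi (n + k)%N)) <= c' * r ^+ n.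
  suff : l2norm (lc (-1) (phi n) (phi (n + k)%N)) <= c' * (1 - r ^+ k) * r ^+ n.
    by move=> /le_trans; apply; rewrite ler_wpM2r ?exprn_ge0// ler_piMr// gerBl exprn_ge0.
  elim: k => [|k IH].
    rewrite addn0 expr0 subrr mulr0 mul0r -l2norm0 le_eqVlt; apply/orP; left.
    by apply/eqP; congr l2norm; apply/funext => x; rewrite /lc; ring.
  have -> : lc (-1) (phi n) (phi (n + k.+1)%N) =
    lc 1 (lc (-1) (phi n) (phi (n + k)%N)) (lc (-1) (phi (n + k)%N) (phi (n + k.+1)%N)).
    by apply/funext => x; rewrite /lc; ring.
  apply: le_trans (l2norm_lc _ _ _) _; try exact: l2_lc.
  rewrite cabs1 mul1r; have := hd (n + k)%N; rewrite -addnS exprD => hk.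
  apply: le_trans (lerD IH hk) _.
  have -> : c = c' * (1 - r) by rewrite /c' divfK// lt0r_neq0.
  by rewrite le_eqVlt exprS; apply/orP; left; apply/eqP; ring.
have [psi hpsi] : exists psi : T -> C, forall x n,
    cabs (phi n x - psi x) <= c' * r ^+ n + c' * r ^+ n.
  suff /boolp.choice[psi] : forall x, exists l, forall n,
      cabs (phi n x - l) <= c' * r ^+ n + c' * r ^+ n by exists psi.
  move=> x; apply: cauchy_complex => n k.
  have := l2_entry x (l2_lc (-1) (h n) (h (n + k)%N)); rewrite /lc mulN1r addrC.
  by move=> /le_trans; apply; exact: dist.
have main n : bsum (sqf (lc (-1) (phi n) psi)) ((2 * c' * r ^+ n) ^+ 2).
  move=> s us; apply/ler_addgt0Pl => e e0.
  (* Each entry of the limit differs from that of [phi N] by at most [2 * c' * r ^+ m]; squaring,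
     doubling and summing over [s] gives the constant 8. *)
  have [m hm] : exists m, (8 * (size s)%:R * c' ^+ 2) * (r ^+ 2) ^+ m < e.
    by apply: exp_small => //; rewrite exprn_ge0//= expr_lt1.
  have [N [nN mN]] : exists N, (n <= N /\ m <= N)%N by exists (n + m)%N; lia.
  have hN : \sum_(x <- s) sqf (lc (-1) (phi n) (phi N)) x <= (c' * r ^+ n) ^+ 2.
    apply: le_trans (n2_bsum (l2_lc _ (h n) (h N)) us) _.
    rewrite -l2norm_sqr; last exact: l2_lc.
    have cr0 : 0 <= c' * r ^+ n by apply: mulr_ge0 => //; exact: exprn_ge0.
    rewrite ler_pXn2r// ?nnegrE ?l2norm_ge0//.
    by have := dist n (N - n)%N; rewrite subnKC.
  apply: (@le_trans _ _ (\sum_(x <- s)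
    (2 * sqf (lc (-1) (phi n) (phi N)) x + 8 * c' ^+ 2 * (r ^+ 2) ^+ m))).
    apply: ler_sum => x _; rewrite /sqf /lc !mulN1r !(addrC (- _)).
    have := cabs_dist (psi x) (phi N x) (phi n x); have := hpsi x N.
    rewrite [cabs (phi N x - psi x)]cabsB.
    have : r ^+ N <= r ^+ m by apply: ler_wiXn2l => //; exact: ltW.
    have := exprn_ge0 N r0; have := exprn_ge0 m r0.
    rewrite exprAC; set rm := r ^+ m; set rN := r ^+ N.
    have := cabs_ge0 (psi x - phi n x); have := cabs_ge0 (psi x - phi N x).
    have := cabs_ge0 (phi N x - phi n x).
    set u := cabs (psi x - phi n x); set v := cabs (psi x - phi N x).
    set w := cabs (phi N x - phi n x) => w0 v0 u0 rm0 rN0 rNm vl ul.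
    have h1 : u ^+ 2 <= (v + w) ^+ 2 by rewrite ler_pXn2r// nnegrE; lra.
    have h2 : v ^+ 2 <= (2 * c' * rm) ^+ 2.
      have := ler_wpM2l c'0 rNm; have := mulr_ge0 c'0 rm0 => ? ?.
      have ? : 0 <= 2 * c' * rm by lra.
      by rewrite ler_pXn2r ?nnegrE//; lra.
    have := sqr_ge0 (v - w); lra.
  rewrite big_split /= -mulr_sumr big_const_seq count_predT iter_addr_0 -mulr_natr.
  have := exprn_ge0 n r0; set rn := r ^+ n in hN * => rn0.
  have : 0 <= (c' * rn) ^+ 2 by exact: sqr_ge0.
  lra.
exists psi; split.
  have := l2_lc 1 (h 0%N) (n2_le (main 0%N)).1; congr l2; apply/funext => x.
  by rewrite /lc; ring.
move=> n; have [l n2l] := n2_le (main n).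
have cr0 : 0 <= 2 * c' * r ^+ n.
  by apply: mulr_ge0; [exact: mulr_ge0|exact: exprn_ge0].
by rewrite -(@ler_pXn2r _ 2)// ?nnegrE ?l2norm_ge0// l2norm_sqr.
Qed.

End L2.

(** * Neumann series, resolvents and the spectrum of symmetric operators *)

Section Operators.
Variables (R : realType) (T : choiceType).
Local Notation C := (R[i]).
Local Notation op := (op R T).
Implicit Types (phi psi chi : T -> C) (a b z : C) (A B : op) (K : R).

(** Restricted to square summable arguments, where the sums defining a matrix operator converge. *)
Definition oplin A := forall a phi psi, l2 phi -> l2 psi ->
  A (lc a phi psi) = lc a (A phi) (A psi).

Definition opbnd A K := forall psi, l2 psi ->
  l2 (A psi) /\ l2norm (A psi) <= K * l2norm psi.

Definition opsym A := forall phi psi, l2 phi -> l2 psi ->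
  ip (A phi) psi = ip phi (A psi).

Definition sa_op A K := [/\ 0 <= K, oplin A, opbnd A K & opsym A].

Lemma lc_scale a psi : (fun x => a * psi x) = lc a psi (fun=> 0).
Proof. by apply/funext => x; rewrite /lc addr0. Qed.

Lemma oplin0 A : oplin A -> A (fun=> 0) = fun=> 0.
Proof.
move=> lA; have h0 := @l2_0 R T.
have := lA (-1) _ _ h0 h0; rewrite (_ : lc (-1) _ _ = fun=> 0); last first.
  by apply/funext => x; rewrite /lc mulr0 addr0.
by move=> ->; apply/funext => x; rewrite /lc mulN1r addNr.
Qed.

(** Iteration of [phi = A phi + psi] from zero: successive differences are the iterates of [A] on
    [psi], hence geometrically small. The limit equation is checked entrywise. *)
Lemma neumann A (r : R) psi : oplin A -> opbnd A r -> 0 <= r < 1 -> l2 psi ->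
  exists2 phi, l2 phi & phi = lc 1 (A phi) psi.
Proof.
move=> lA bA r01 hpsi; have /andP[r0 r1] := r01.
pose u n : T -> C := iter n (fun f => lc 1 (A f) psi) (fun=> 0).
have lu n : l2 (u n).
  elim: n => [|n IH] /=; first exact: l2_0.
  by apply: l2_lc => //; case: (bA _ IH).
have us n : u n.+1 = lc 1 (A (u n)) psi by [].
have du n : l2norm (lc (-1) (u n) (u n.+1)) <= l2norm psi * r ^+ n.
  elim: n => [|n IH].
    rewrite expr0 mulr1 /= oplin0// le_eqVlt; apply/orP; left; apply/eqP.
    by congr l2norm; apply/funext => x; rewrite /lc; ring.
  rewrite (_ : lc _ _ _ = A (lc (-1) (u n) (u n.+1))); last first.
    by rewrite lA// !us; apply/funext => x; rewrite /lc; ring.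
  apply: le_trans (bA _ (l2_lc _ (lu _) (lu _))).2 _.
  by rewrite exprS mulrCA ler_wpM2l.
have [phi [lphi hphi]] := l2_complete (l2norm_ge0 psi) r01 lu du.
exists phi => //; apply/funext => x; apply/eqP; rewrite -subr_eq0 -cabs_eq0.
rewrite eq_le cabs_ge0 andbT; apply/ler_addgt0Pl => e e0; rewrite addr0.
set k := 2 * _ in hphi.
have [n hn] := exp_small (2 * k) r01 e0; apply/ltW; apply: le_lt_trans hn.
have h1 := hphi n.+1; have h2 := hphi n.
have h3 := l2_entry x (l2_lc (-1) (lu n.+1) lphi).
have [l4 h4] := bA _ (l2_lc (-1) (lu n) lphi).
have h5 := l2_entry x l4.
have -> : phi x - lc 1 (A phi) psi x =
    lc (-1) (u n.+1) phi x - A (lc (-1) (u n) phi) x.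
  by rewrite lA// us /lc; ring.
apply: le_trans (cabsD _ _) _; rewrite cabsN.
have k0 : 0 <= k by rewrite mulr_ge0// divr_ge0 ?l2norm_ge0// subr_ge0 ltW.
have rn0 := exprn_ge0 n r0.
have : r * l2norm (lc (-1) (u n) phi) <= k * r ^+ n.
  apply: (@le_trans _ _ (r * (k * r ^+ n))); first by rewrite ler_wpM2l.
  by rewrite ler_piMl ?(ltW r1)//; exact: mulr_ge0.
have : k * r ^+ n.+1 <= k * r ^+ n.
  by rewrite ler_wpM2l// exprS ler_piMl// ltW.
lra.
Qed.

Lemma shifted_lc A z psi : shifted A z psi = lc (-1) (A psi) (fun x => z * psi x).
Proof. by apply/funext => x; rewrite /shifted /lc; ring. Qed.

Lemma shifted_l2 A K z psi : opbnd A K -> l2 psi -> l2 (shifted A z psi).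
Proof.
move=> bA h; rewrite shifted_lc; apply: l2_lc; first by case: (bA _ h).
exact: l2_scale.
Qed.

Lemma shifted_lin A z : oplin A -> oplin (shifted A z).
Proof.
move=> lA a phi psi h1 h2; apply/funext => x; rewrite /shifted lA// /lc; ring.
Qed.

(** The lower bound gives injectivity, so a choice of preimages is automatically a bounded two-sided
    inverse. Closedness, boundedness and reality of the spectrum are all proved by verifying these
    two conditions. *)
Lemma resolvent_exists A z K k : oplin A -> opbnd A K ->
  (forall psi, l2 psi -> l2norm psi <= k * l2norm (shifted A z psi)) ->
  (forall psi, l2 psi -> exists2 phi, l2 phi & shifted A z phi = psi) ->
  exists2 S, is_resolvent A z S & forall psi, l2 psi -> l2norm (S psi) <= k * l2norm psi.
Proof.
move=> lA bA low surj.
have [S hS] : exists S : (T -> C) -> (T -> C),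
    forall psi, l2 psi -> l2 (S psi) /\ shifted A z (S psi) = psi.
  suff /boolp.choice[S] : forall psi, exists phi, l2 psi ->
     l2 phi /\ shifted A z phi = psi by exists S.
  move=> psi; have [h|h] := pselect (l2 psi); last by exists psi.
  by have [phi h1 h2] := surj _ h; exists phi.
have nS psi : l2 psi -> l2norm (S psi) <= k * l2norm psi.
  by move=> h; have [h1 h2] := hS _ h; have := low _ h1; rewrite h2.
exists S => //; split; first by exists k => psi h; split; [case: (hS _ h)|exact: nS].
move=> psi h; split; first by case: (hS _ h).
have ls := shifted_l2 z bA h; have [l1 e1] := hS _ ls.
have l0 := l2_lc (-1) h l1.
have /(l2norm_eq0 l0) E : l2norm (lc (-1) psi (S (shifted A z psi))) <= 0.
  have := low _ l0; rewrite (shifted_lin z lA)// e1.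
  have -> : lc (-1) (shifted A z psi) (shifted A z psi) = fun=> 0.
    by apply/funext => x; rewrite /lc mulN1r addNr.
  by rewrite l2norm0 mulr0.
apply/funext => x; have := congr1 (fun f => f x) E; rewrite /lc mulN1r /= => /eqP.
by rewrite addrC subr_eq0 => /eqP.
Qed.

Lemma not_spectrum A z : ~ spectrum A z -> exists S, is_resolvent A z S.
Proof. by move=> /contrapT. Qed.

Lemma spectrumN A z S : is_resolvent A z S -> ~ spectrum A z.
Proof. by move=> h; apply; exists S. Qed.

Lemma resolvent_bnd A z S : is_resolvent A z S -> exists2 k, 0 < k &
  forall psi, l2 psi -> l2 (S psi) /\ l2norm (S psi) <= k * l2norm psi.
Proof.
move=> [[K hK] _]; exists (`|K| + 1); first by rewrite ltr_wpDl.
move=> psi h; have [h1 h2] := hK _ h; split => //.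
apply: le_trans h2 _; rewrite ler_wpM2r ?l2norm_ge0//.
by rewrite (le_trans (ler_norm _))// lerDl.
Qed.

Lemma resolvent_low A z S K : opbnd A K -> is_resolvent A z S -> exists2 c, 0 < c &
  forall psi, l2 psi -> c * l2norm psi <= l2norm (shifted A z psi).
Proof.
move=> bA hS; have [k k0 hk] := resolvent_bnd hS; exists k^-1; first by rewrite invr_gt0.
move=> psi h; rewrite ler_pdivrMl//.
have [_] := hk _ (shifted_l2 z bA h).
by rewrite (hS.2 _ h).2.
Qed.

Lemma resolvent_lin A z S K : oplin A -> opbnd A K -> is_resolvent A z S -> oplin S.
Proof.
move=> lA bA hS a phi psi h1 h2; have [k k0 hk] := resolvent_bnd hS.
have l1 := (hk _ h1).1; have l2' := (hk _ h2).1.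
rewrite -[RHS](hS.2 _ (l2_lc a l1 l2')).2 (shifted_lin z lA)//.
by rewrite (hS.2 _ h1).1 (hS.2 _ h2).1.
Qed.

(** With [S] the inverse at [z0], the equation at [z] reads [phi = (z0 - z) * S phi + S psi], a
    Neumann problem. The bound [k] is left free because symmetric operators supply a sharper one
    than the definition of the resolvent does. *)
Lemma resolvent_step A z0 S K k z : oplin A -> opbnd A K -> is_resolvent A z0 S ->
  0 <= k -> (forall psi, l2 psi -> l2norm (S psi) <= k * l2norm psi) ->
  cabs (z - z0) * k < 1 ->
  forall psi, l2 psi -> exists2 phi, l2 phi & shifted A z phi = psi.
Proof.
move=> lA bA hS k0 hk zk psi h; have [K' K'0 bS] := resolvent_bnd hS.
have lS := resolvent_lin lA bA hS.
pose B : op := fun f x => (z0 - z) * S f x.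
have lB : oplin B.
  by move=> a f g hf hg; apply/funext => x; rewrite /B lS// /lc; ring.
have bB : opbnd B (cabs (z - z0) * k).
  move=> f hf; split; first by apply: l2_scale; case: (bS _ hf).
  rewrite l2norm_scale; last by case: (bS _ hf).
  by rewrite cabsB -mulrA ler_wpM2l ?cabs_ge0// hk.
have lSpsi := (bS _ h).1.
have zk' : 0 <= cabs (z - z0) * k < 1 by rewrite zk mulr_ge0 ?cabs_ge0.
have [phi lphi E] := neumann lB bB zk' lSpsi.
exists phi => //.
have -> : phi = S (lc (z0 - z) phi psi) by rewrite lS// {1}E /lc /B; apply/funext => x; rewrite mul1r.
have -> : shifted A z (S (lc (z0 - z) phi psi)) =
  lc (z - z0) (S (lc (z0 - z) phi psi)) (shifted A z0 (S (lc (z0 - z) phi psi))).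
  by apply/funext => x; rewrite /shifted /lc; ring.
rewrite (hS.2 _ (l2_lc _ lphi h)).1 lS//.
apply/funext => x; rewrite /lc.
have := congr1 (fun f => f x) E; rewrite /lc /B mul1r => ->; ring.
Qed.

Lemma spectrum_open A K z0 : oplin A -> opbnd A K -> ~ spectrum A z0 ->
  exists2 d, 0 < d & forall z, cabs (z - z0) < d -> ~ spectrum A z.
Proof.
move=> lA bA /not_spectrum[S hS]; have [k k0 hk] := resolvent_bnd hS.
exists k^-1 => [|z zz0]; first by rewrite invr_gt0.
have zk : cabs (z - z0) * k < 1 by rewrite -ltr_pdivlMr// mul1r.
have [||S' hS' _] := @resolvent_exists A z K (k / (1 - cabs (z - z0) * k)) lA bA.
- move=> psi h; rewrite mulrAC ler_pdivlMr ?subr_gt0//.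
  have := (hk _ (shifted_l2 z0 bA h)).2; rewrite (hS.2 _ h).2.
  have -> : shifted A z0 psi = lc (z0 - z) psi (shifted A z psi).
    by apply/funext => x; rewrite /shifted /lc; ring.
  have := l2norm_lc (z0 - z) h (shifted_l2 z bA h); rewrite cabsB.
  set u := l2norm _; set v := l2norm psi; set w := l2norm (shifted _ _ _).
  set c := cabs _ => h1 h2.
  have := ler_wpM2l (ltW k0) h1; lra.
- by apply: (resolvent_step lA bA hS (ltW k0)) => // psi /hk[].
- exact: spectrumN hS'.
Qed.

Lemma spectrum_bounded A K z : oplin A -> opbnd A K -> 0 <= K -> spectrum A z ->
  cabs z <= K.
Proof.
move=> lA bA K0 hz; rewrite leNgt; apply/negP => Kz.
have z0 : 0 < cabs z by exact: le_lt_trans Kz.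
have zn0 : z != 0 by rewrite -cabs_gt0.
have [||S hS _] := @resolvent_exists A z K (cabs z - K)^-1 lA bA.
- move=> psi h; rewrite ler_pdivlMl ?subr_gt0//.
  have := l2norm_lc 1 (shifted_l2 z bA h) (bA _ h).1.
  rewrite (_ : lc _ _ _ = fun x => z * psi x); last first.
    by apply/funext => x; rewrite /lc /shifted; ring.
  rewrite l2norm_scale// cabs1; have := (bA _ h).2; lra.
- move=> psi h; pose B : op := fun f x => z^-1 * A f x.
  have lB : oplin B.
    by move=> a f g hf hg; apply/funext => x; rewrite /B lA// /lc; ring.
  have bB : opbnd B (K / cabs z).
    move=> f hf; split; first by apply: l2_scale; case: (bA _ hf).
    rewrite l2norm_scale; last by case: (bA _ hf).
    rewrite cabsV mulrAC [leRHS]mulrC ler_wpM2l ?invr_ge0 ?(ltW z0)//.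
    by case: (bA _ hf).
  have [|phi lphi E] := neumann lB bB _ (l2_scale z^-1 h).
    by rewrite divr_ge0 ?(ltW z0)//= ltr_pdivrMr// mul1r.
  exists phi => //; apply/funext => x; rewrite /shifted {1}E /lc /B.
  by field.
- exact: spectrumN hS hz.
Qed.

(** For [z = u + i v] the vector [(z - A) psi] is [i v psi] plus [(u - A) psi]; the mixed term
    vanishes since the inner product of [psi] with [(u - A) psi] is real, leaving a sum of
    squares. *)
Lemma sa_low A K z psi : sa_op A K -> l2 psi ->
  `|complex.Im z| * l2norm psi <= l2norm (shifted A z psi).
Proof.
move=> [K0 lA bA sA] h; case: z => u v /=.
have lAp := (bA _ h).1.
set chi := shifted A u%:C psi.
have lchi : l2 chi := shifted_l2 _ bA h.
have -> : shifted A (u +i* v) psi = lc (0 +i* v) psi chi.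
  apply/funext => x; rewrite /shifted /lc /chi /shifted.
  have -> : u +i* v = (0 +i* v) + u%:C.
    by apply/eqP; rewrite eq_complex /= add0r addr0 !eqxx.
  by ring.
have realip : complex.Im (ip psi chi) = 0.
  have E : ip psi chi = u%:C * (n2 psi)%:C + - ip psi (A psi).
    rewrite /chi shifted_lc ip_lcr//; last exact: l2_scale.
    rewrite lc_scale ip_lcr//; last exact: l2_0.
    rewrite ip_n2// [ip psi (fun=> 0)](_ : _ = 0); last first.
      rewrite -[RHS](@csum0 R T); apply: eq_csum => x.
      by rewrite conjc0 mulr0.
    rewrite [conjc (-1)](_ : _ = -1); last exact: (rmorphN1 (@conjc R)).
    by rewrite [conjc u%:C](_ : _ = u%:C) ?conjc_real//; ring.
  rewrite E -realCM cImD cImN; move: (ipC h lAp); rewrite (sA _ _ h h).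
  by set w := ip psi (A psi); case: w => p q [] /=; lra.
rewrite -(@ler_pXn2r _ 2)// ?nnegrE ?l2norm_ge0 ?mulr_ge0 ?l2norm_ge0//.
rewrite exprMn !l2norm_sqr//; last exact: l2_lc.
rewrite n2_lc// cabs_sqr; move: realip; case: (ip psi chi) => p q /= ->.
rewrite mul0r mulr0 subrr mulr0 addr0.
rewrite expr0n add0r real_normK ?num_real// lerDl.
exact: n2_ge0.
Qed.

(** The lower bound is [sa_low]; surjectivity is reached in one Neumann step from [x + i Y], which
    lies beyond the norm bound. With [|Y| = |y| + K + 1] on the same side of the axis, the inverse
    there has norm at most [1 / |Y|], while the step has length [K + 1 < |Y|]. *)
Lemma sa_spectrum_real A K z : sa_op A K -> spectrum A z -> complex.Im z = 0.
Proof.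
move=> hA; have [K0 lA bA sA] := hA => hz; apply/eqP/negP => /negP y0.
case: z y0 hz => x y /= y0 hz.
pose Y := y * (1 + (K + 1) / `|y|).
have ny : 0 < `|y| by rewrite normr_gt0.
have Yp : 0 < 1 + (K + 1) / `|y| by rewrite addr_gt0// divr_gt0// ltr_wpDl.
have nY : `|Y| = `|y| + K + 1.
  rewrite /Y normrM (gtr0_norm Yp) mulrDr mulr1 mulrCA divff ?lt0r_neq0//.
  by rewrite mulr1 addrA.
have Y0 : 0 < `|Y| by rewrite nY -addrA addr_gt0// ltr_wpDl.
have nYy : `|y - Y| = K + 1.
  have -> : y - Y = - (y * ((K + 1) / `|y|)) by rewrite /Y; ring.
  rewrite normrN normrM [X in _ * X]ger0_norm; last by rewrite divr_ge0// addr_ge0.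
  by rewrite mulrCA divff ?mulr1// lt0r_neq0.
have ns : ~ spectrum A (x +i* Y).
  move=> /(spectrum_bounded lA bA K0); rewrite leNgt => /negP; apply.
  by apply: lt_le_trans (Im_le_cabs _); rewrite /= nY; lra.
have [S0 hS0] := not_spectrum ns.
have lowY psi : l2 psi -> l2norm psi <= `|Y|^-1 * l2norm (shifted A (x +i* Y) psi).
  by move=> h; rewrite ler_pdivlMl//; exact: (sa_low (x +i* Y) hA h).
have S0n psi : l2 psi -> l2norm (S0 psi) <= `|Y|^-1 * l2norm psi.
  move=> h; have [k k0 hk] := resolvent_bnd hS0.
  by have := lowY _ (hk _ h).1; rewrite (hS0.2 _ h).1.
have [||S hS _] := @resolvent_exists A (x +i* y) K `|y|^-1 lA bA.
- by move=> psi h; rewrite ler_pdivlMl//; exact: (sa_low (x +i* y) hA h).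
- apply: (resolvent_step lA bA hS0 _ S0n); first by rewrite invr_ge0.
  have -> : x +i* y - (x +i* Y) = 0 +i* (y - Y).
    by apply/eqP; rewrite eq_complex /= subrr !eqxx.
  rewrite ltr_pdivrMr// mul1r cabsE /= expr0n add0r sqrtr_sqr nYy nY; lra.
- exact: spectrumN hS hz.
Qed.

End Operators.

(** * Polynomials of an operator and their norm in terms of the spectrum *)

Section PolyCalculus.
Variables (R : realType) (T : choiceType).
Local Notation C := (R[i]).
Local Notation op := (op R T).
Implicit Types (phi psi chi : T -> C) (a b z : C) (A B : op) (K : R).

(** The vector [p(A) psi], written through iterates so that no algebra of operators has to be set
    up. *)
Definition act A (p : {poly C}) psi : T -> C :=
  fun x => \sum_(i < size p) p`_i * iter i A psi x.

Lemma act_widen A (p : {poly C}) psi n x : (size p <= n)%N ->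
  act A p psi x = \sum_(i < n) p`_i * iter i A psi x.
Proof.
move=> pn; rewrite /act -!(big_mkord xpredT (fun i => p`_i * iter i A psi x)).
rewrite [in RHS](big_cat_nat (n := size p))//= [X in _ + X]big_nat_cond.
rewrite [X in _ + X]big1 ?addr0// => i /andP[/andP[h _] _].
by rewrite nth_default// mul0r.
Qed.

Lemma act_lcp A a p q psi : act A (a *: p + q) psi = lc a (act A p psi) (act A q psi).
Proof.
apply/funext => x; pose n := maxn (size (a *: p + q)) (maxn (size p) (size q)).
rewrite (@act_widen _ _ _ n) ?leq_maxl// /lc.
rewrite (@act_widen _ p _ n); last by rewrite !leq_max leqnn orbT.
rewrite (@act_widen _ q _ n); last by rewrite !leq_max leqnn !orbT.
rewrite mulr_sumr -big_split /=; apply: eq_bigr => i _.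
by rewrite coefD coefZ; ring.
Qed.

Lemma act0 A psi : act A 0 psi = fun=> 0.
Proof. by apply/funext => x; rewrite /act size_poly0 big_ord0. Qed.

Lemma actC A c psi : act A c%:P psi = fun x => c * psi x.
Proof.
apply/funext => x; rewrite (@act_widen _ _ _ 1) ?size_polyC ?leq_b1//.
by rewrite big_ord1 coefC.
Qed.

Lemma act1 A psi : act A 1 psi = psi.
Proof. by rewrite -polyC1 actC; apply/funext => x; rewrite mul1r. Qed.

Lemma actMX A p psi : act A (p * 'X) psi = act A p (A psi).
Proof.
apply/funext => x; rewrite (@act_widen _ (p * 'X) _ (size p).+1).
  rewrite big_ord_recl coefMX mul0r add0r; apply: eq_bigr => i _.
  by rewrite coefMX /= -iterSr.
by rewrite (leq_trans (size_polyMleq _ _))// size_polyX addn2.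
Qed.

Lemma act_cons A p c psi :
  act A (p * 'X + c%:P) psi = lc c psi (act A p (A psi)).
Proof.
rewrite -[p * 'X]scale1r act_lcp actMX actC; apply/funext => x.
by rewrite /lc; ring.
Qed.

Section Bounded.
Variables (A : op) (K : R).
Hypotheses (lA : oplin A) (bA : opbnd A K).

Lemma act_l2 p psi : l2 psi -> l2 (act A p psi).
Proof.
elim/poly_ind: p psi => [|p c IH] psi h; first by rewrite act0; exact: l2_0.
by rewrite act_cons; apply: l2_lc => //; apply: IH; case: (bA h).
Qed.

Lemma act_lin p : oplin (act A p).
Proof.
elim/poly_ind: p => [|p c IH] a phi psi h1 h2.
  by rewrite !act0; apply/funext => x; rewrite /lc mulr0 addr0.
have [h3 _] := bA h1; have [h4 _] := bA h2.
by rewrite !act_cons lA// IH//; apply/funext => x; rewrite /lc; ring.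
Qed.

Lemma act_comm p psi : l2 psi -> A (act A p psi) = act A p (A psi).
Proof.
elim/poly_ind: p psi => [|p c IH] psi h; first by rewrite !act0 oplin0.
have [h3 _] := bA h.
by rewrite !act_cons lA ?IH//; exact: act_l2.
Qed.

Lemma act_mul p q psi : l2 psi -> act A (p * q) psi = act A p (act A q psi).
Proof.
elim/poly_ind: p q => [|p c IH] q h; first by rewrite mul0r !act0.
have -> : (p * 'X + c%:P) * q = c *: q + p * (q * 'X).
  by rewrite mulrDl mul_polyC addrC -mulrA ['X * q]mulrC.
by rewrite act_lcp IH// actMX act_cons act_comm.
Qed.

End Bounded.

Definition rpoly (p : {poly R}) : {poly C} := map_poly (real_complex R) p.

Lemma rpoly_cons p c : rpoly (p * 'X + c%:P) = rpoly p * 'X + (c%:C)%:P.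
Proof. by rewrite /rpoly rmorphD rmorphM /= map_polyX map_polyC. Qed.

Lemma rpoly_horner p (t : R) : (rpoly p).[t%:C] = (p.[t])%:C.
Proof. exact: horner_map. Qed.

Lemma act_sym A K p : sa_op A K -> opsym (act A (rpoly p)).
Proof.
move=> [K0 lA bA sA]; elim/poly_ind: p => [|p c IH] phi psi h1 h2.
  rewrite /rpoly rmorph0 !act0 /ip; apply: eq_csum => x.
  by rewrite mul0r conjc0 mulr0.
have [h3 _] := bA _ h1; have [h4 _] := bA _ h2.
rewrite rpoly_cons !act_cons ip_lcl ?ip_lcr//; try exact: (act_l2 bA).
rewrite (_ : conjc c%:C = c%:C); last exact: conjc_real.
rewrite IH// sA//; last exact: (act_l2 bA).
by rewrite (act_comm lA bA).
Qed.

(* The optimal constant [M] of [||B psi||^2 <= M ||psi||^2] lies in the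
   approximate point spectrum of [B^2]. *)
Lemma sa_optimal B K (x0 : T) : oplin B -> opbnd B K -> opsym B ->
  exists M, [/\ 0 <= M, forall psi, l2 psi -> n2 (B psi) <= M * n2 psi &
    forall c, 0 < c -> ~ forall psi, l2 psi ->
      c * n2 psi <= n2 (lc (- M%:C) psi (B (B psi)))].
Proof.
move=> lB bB sB.
pose S := [set k : R | 0 <= k /\ forall psi, l2 psi -> n2 (B psi) <= k * n2 psi].
have S0 : S (K ^+ 2).
  split => [|psi h]; first exact: sqr_ge0.
  have [h1 h2] := bB _ h; rewrite -!l2norm_sqr// -exprMn.
  have h0 : 0 <= K * l2norm psi by apply: le_trans h2; exact: l2norm_ge0.
  by rewrite ler_pXn2r// nnegrE l2norm_ge0.
have lbS : lbound S 0 by move=> k [].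
have hS : has_inf S by split; [exists (K ^+ 2)|exists 0].
have M0 : 0 <= inf S by apply: lb_le_inf => //; exists (K ^+ 2).
have MS psi : l2 psi -> n2 (B psi) <= inf S * n2 psi.
  move=> h; have := n2_ge0 h; rewrite le_eqVlt => /orP[/eqP n0|n0].
    have := S0.2 _ h; by rewrite -n0 !mulr0.
  rewrite -ler_pdivrMr//; apply: lb_le_inf; first by exists (K ^+ 2).
  by move=> k [k0 hk]; rewrite ler_pdivrMr//; exact: hk.
exists (inf S); split => // c c0 hc; set M := inf S in M0 MS hc.
(* Expansion of the square, with [n2 (B (B psi)) <= M * n2 (B psi)]. For [M > 0] it makes
   [M - c / M] an admissible constant below the infimum. *)
have key psi : l2 psi -> c * n2 psi <= M * (M * n2 psi - n2 (B psi)).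
  move=> h; have [h1 _] := bB _ h; have [h2 _] := bB _ h1.
  apply: le_trans (hc _ h) _; rewrite n2_lc// cabsN cabs_real (ger0_norm M0).
  rewrite -sB// ip_n2// mulNr -realCM cReN /=.
  have := MS _ h1; lra.
move: M0; rewrite le_eqVlt => /orP[/eqP M0|M0].
  have [h _] := l2_basis R x0; have := key _ h; rewrite -M0 mul0r.
  suff n1 : 1 <= n2 (basis_vec R x0) by nra.
  have := n2_bsum h (s := [:: x0]) isT.
  by rewrite big_seq1 /sqf /basis_vec eqxx cabs1 expr1n.
have key2 psi : l2 psi -> n2 (B psi) <= (M - c / M) * n2 psi.
  move=> h; have := key _ h; rewrite -ler_pdivrMl// => h'.
  have -> : (M - c / M) * n2 psi = M * n2 psi - M^-1 * (c * n2 psi) by ring.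
  by lra.
have cM : 0 < c / M by rewrite divr_gt0.
have [k0|k0] := leP 0 (M - c / M).
  have : M <= M - c / M by apply: ge_inf => //; exists 0.
  lra.
have : M <= 0.
  apply: ge_inf; first by exists 0.
  split => // psi h; have := key2 _ h; have := n2_ge0 h; have := n2_ge0 (bB _ h).1.
  by nra.
lra.
Qed.

Lemma act_roots_low A K (s : seq C) : oplin A -> opbnd A K ->
  (forall z, z \in s -> ~ spectrum A z) -> exists2 c, 0 < c &
  forall psi, l2 psi -> c * l2norm psi <= l2norm (act A (\prod_(z <- s) ('X - z%:P)) psi).
Proof.
move=> lA bA; elim: s => [|z s IH] hs.
  by exists 1 => // psi h; rewrite big_nil act1 mul1r.
have [c c0 hc] : exists2 c, 0 < c & forall psi, l2 psi ->
    c * l2norm psi <= l2norm (act A (\prod_(z <- s) ('X - z%:P)) psi).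
  by apply: IH => w ws; apply: hs; rewrite inE ws orbT.
have [S hS] := not_spectrum (hs z (mem_head _ _)).
have [d d0 hd] := resolvent_low bA hS.
exists (d * c); first exact: mulr_gt0.
move=> psi h; rewrite big_cons (act_mul lA bA)//.
set chi := act A _ psi; have lchi : l2 chi by exact: (act_l2 bA).
have -> : act A ('X - z%:P) chi = fun x => -1 * shifted A z chi x.
  rewrite -[in LHS](mul1r 'X) -polyCN act_cons act1.
  by apply/funext => x; rewrite /lc /shifted; ring.
rewrite l2norm_scale; last exact: (shifted_l2 _ bA).
rewrite cabsN cabs1 mul1r; apply: le_trans (hd _ lchi).
by rewrite -mulrA ler_wpM2l ?(ltW d0)//; exact: hc.
Qed.

(** Over the complex numbers [q] splits into linear factors, each bounded below because its root is
    outside the spectrum. *)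
Lemma act_low A K (q : {poly C}) : oplin A -> opbnd A K -> q != 0 ->
  (forall z, root q z -> ~ spectrum A z) -> exists2 c, 0 < c &
  forall psi, l2 psi -> c * l2norm psi <= l2norm (act A q psi).
Proof.
move=> lA bA q0 hq; have [s qE] := closed_field_poly_normal q.
have [c c0 hc] : exists2 c, 0 < c & forall psi, l2 psi ->
    c * l2norm psi <= l2norm (act A (\prod_(z <- s) ('X - z%:P)) psi).
  apply: (act_roots_low lA bA) => z zs; apply: hq; rewrite qE rootZ ?lead_coef_eq0//.
  by rewrite root_prod_XsubC.
have a0 : 0 < cabs (lead_coef q) by rewrite cabs_gt0 lead_coef_eq0.
exists (cabs (lead_coef q) * c); first exact: mulr_gt0.
move=> psi h; rewrite [in leRHS]qE -[_ *: _]addr0 act_lcp act0.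
rewrite -lc_scale l2norm_scale; last exact: (act_l2 bA).
by rewrite -mulrA ler_wpM2l ?(ltW a0)//; exact: hc.
Qed.

(** Were all roots of [p ^+ 2 - M%:P] outside the spectrum, [p(A)^2 - M] would be bounded below,
    against the optimality of [M]. So the best constant is the value of [p ^+ 2] at a spectral
    point, which does the work of the spectral theorem in the norm bounds. *)
Lemma sa_opt_root A K (x0 : T) (p : {poly R}) : sa_op A K ->
  exists M, [/\ 0 <= M,
    forall psi, l2 psi -> n2 (act A (rpoly p) psi) <= M * n2 psi &
    p ^+ 2 - M%:P != 0 -> exists t, spectrum A t%:C /\ p.[t] ^+ 2 = M].
Proof.
move=> hA; have [K0 lA bA sA] := hA.
have lB := act_lin lA bA (rpoly p); have sB := act_sym p hA.
have [K' K'0 bB] : exists2 K', 0 <= K' & opbnd (act A (rpoly p)) K'.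
  elim/poly_ind: (p) => [|r c [K' K'0 IH]].
    exists 0 => // psi h; rewrite /rpoly rmorph0 act0 l2norm0 mul0r; split => //; exact: l2_0.
  exists (`|c| + K' * K) => [|psi h]; first by rewrite addr_ge0// mulr_ge0.
  split; first exact: (act_l2 bA).
  have [h1 h2] := bA _ h; have [h3 h4] := IH _ h1.
  rewrite rpoly_cons act_cons; apply: le_trans (l2norm_lc _ h h3) _.
  rewrite cabs_real mulrDl lerD2l; apply: le_trans h4 _; rewrite -mulrA.
  exact: ler_wpM2l.
have [M [M0 hM hc]] := sa_optimal x0 lB bB sB.
exists M; split => // q0; apply/not_existsP => H.
have q0' : rpoly (p ^+ 2 - M%:P) != 0 by rewrite map_poly_eq0.
have [|c c0 low] := act_low lA bA q0'.
  move=> z rz hz; have := sa_spectrum_real hA hz; case: z rz hz => t y /= rz hz y0.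
  rewrite {}y0 in rz hz; apply: (H t); split => //.
  move: rz; rewrite rootE rpoly_horner !hornerE => /eqP/(congr1 (@complex.Re R)) /=.
  by move/eqP; rewrite subr_eq0 => /eqP.
apply: (hc (c ^+ 2)); first exact: exprn_gt0.
move=> psi h; have := low _ h.
have -> : act A (rpoly (p ^+ 2 - M%:P)) psi =
   lc (- M%:C) psi (act A (rpoly p) (act A (rpoly p) psi)).
  rewrite -(act_mul lA bA)// -rmorphM /= -expr2 /rpoly rmorphB /= map_polyC /=.
  rewrite addrC -polyCN -[X in X + _]alg_polyC act_lcp.
  by rewrite act1.
set chi := lc _ _ _ => hl.
have lchi : l2 chi by apply: l2_lc => //; apply: (act_l2 bA); exact: (act_l2 bA).
rewrite -!l2norm_sqr// -exprMn ler_pXn2r// nnegrE ?l2norm_ge0//.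
by rewrite mulr_ge0 ?l2norm_ge0 ?ltW.
Qed.

Lemma sa_spectrum_nonempty A K (x0 : T) : sa_op A K -> exists t : R, spectrum A t%:C.
Proof.
move=> hA; have [M [_ _]] := sa_opt_root x0 'X hA; case => [|t [ht _]]; last by exists t.
by rewrite -size_poly_eq0 size_XnsubC.
Qed.

Lemma sa_rpoly_bound A K (x0 : T) (p : {poly R}) e : sa_op A K -> 0 <= e ->
  (forall t : R, spectrum A t%:C -> `|p.[t]| <= e) ->
  forall psi, l2 psi -> l2norm (act A (rpoly p) psi) <= e * l2norm psi.
Proof.
move=> hA e0 he psi h; have [M [M0 hM ht]] := sa_opt_root x0 p hA.
have Me : M <= e ^+ 2.
  have [q0|/ht[t [st <-]]] := eqVneq (p ^+ 2 - M%:P) 0; last first.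
    by rewrite -[X in X <= _]real_normK ?num_real// ler_pXn2r ?nnegrE// he.
  have [t st] := sa_spectrum_nonempty x0 hA.
  have := congr1 (fun r => r.[t]) q0; rewrite !hornerE => /eqP.
  rewrite subr_eq0 => /eqP <-.
  by rewrite -[X in X <= _]real_normK ?num_real// ler_pXn2r ?nnegrE// he.
have lp : l2 (act A (rpoly p) psi) by case: hA => _ _ bA _; exact: (act_l2 bA).
rewrite -(@ler_pXn2r _ 2)// ?nnegrE ?l2norm_ge0 ?mulr_ge0 ?l2norm_ge0//.
rewrite exprMn !l2norm_sqr//; apply: le_trans (hM _ h) _.
by rewrite ler_wpM2r// n2_ge0.
Qed.

(** The factor 2 comes from treating the real and imaginary parts of the coefficients separately; at
    real points both are bounded by the modulus of the value. *)
Lemma sa_poly_bound A K (x0 : T) (p : {poly C}) e : sa_op A K -> 0 <= e ->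
  (forall t : R, spectrum A t%:C -> cabs p.[t%:C] <= e) ->
  forall psi, l2 psi -> l2norm (act A p psi) <= 2 * e * l2norm psi.
Proof.
move=> hA e0 he psi h.
pose p1 := map_poly (@complex.Re R) p; pose p2 := map_poly (@complex.Im R) p.
have pE : p = 'i%C *: rpoly p2 + rpoly p1.
  apply/polyP => i; rewrite coefD coefZ !coef_map_id0//.
  by rewrite addrC; exact: complexE.
have pt t : p.[t%:C] = 'i%C * (p2.[t])%:C + (p1.[t])%:C.
  by rewrite [in LHS]pE hornerD hornerZ !rpoly_horner.
have b1 t : spectrum A t%:C -> `|p1.[t]| <= e.
  move=> /he; rewrite pt; apply: le_trans; apply: le_trans (Re_le_cabs _).
  by rewrite cReD cReM /= mul0r mulr0 subrr add0r.
have b2 t : spectrum A t%:C -> `|p2.[t]| <= e.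
  move=> /he; rewrite pt; apply: le_trans; apply: le_trans (Im_le_cabs _).
  by rewrite cImD cImM /= mul0r mul1r add0r addr0.
have h1 := sa_rpoly_bound x0 hA e0 b1 h; have h2 := sa_rpoly_bound x0 hA e0 b2 h.
have [_ _ bA _] := hA.
rewrite pE act_lcp; apply: le_trans (l2norm_lc _ _ _) _; try exact: (act_l2 bA).
rewrite (_ : cabs 'i%C = 1) ?mul1r; last by rewrite cabsE /= expr0n expr1n add0r sqrtr1.
lra.
Qed.

(* Since [p(A) (z - A) - 1 = s(A)] with [s] small on the spectrum, [p(A)] is
   close to the resolvent. *)
Lemma resolvent_poly A K (x0 : T) z : sa_op A K -> ~ spectrum A z ->
  exists k, 0 < k /\ forall (p : {poly C}) e, 0 <= e ->
    (forall t : R, spectrum A t%:C -> cabs (p.[t%:C] - (z - t%:C)^-1) <= e) ->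
    forall x, cabs (resolvent A z (basis_vec R x) x - act A p (basis_vec R x) x) <= k * e.
Proof.
move=> hA nz; have [K0 lA bA sA] := hA.
have hS : is_resolvent A z (resolvent A z).
  rewrite /resolvent; case: pselect => [h|h]; first by case: (cid h).
  by have := not_spectrum nz.
have [c c0 hc] := resolvent_bnd hS.
have L0 : 0 <= cabs z + K by rewrite addr_ge0 ?cabs_ge0.
exists (2 * (cabs z + K) * c + 1); split.
  by rewrite ltr_wpDl// !mulr_ge0// ltW.
move=> p e e0 hp x; have [hb nb] := l2_basis R x.
set b := basis_vec R x in hb nb *; have [lS nS] := hc _ hb.
pose s := p * (z%:P - 'X) - 1.
have sb (t : R) : spectrum A t%:C -> cabs s.[t%:C] <= e * (cabs z + K).
  move=> st; have tz : z - t%:C != 0.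
    by rewrite subr_eq0; apply/eqP => zt; apply: nz; rewrite zt.
  have -> : s.[t%:C] = (p.[t%:C] - (z - t%:C)^-1) * (z - t%:C).
    by rewrite /s !hornerE; field.
  rewrite cabsM ler_pM ?cabs_ge0 ?hp//.
  apply: le_trans (cabsD _ _) _; rewrite cabsN lerD2l.
  exact: (spectrum_bounded lA bA K0 st).
have := sa_poly_bound x0 hA (mulr_ge0 e0 L0) sb lS.
have -> : act A s (resolvent A z b) = lc (-1) (resolvent A z b) (act A p b).
  have sE : s = (-1) *: 1%:P + p * (z%:P - 'X).
    by rewrite /s addrC scaleN1r.
  rewrite sE act_lcp actC (act_mul lA bA)//; apply/funext => y.
  rewrite /lc mul1r; congr (_ + act A p _ y).
  rewrite -[RHS](hS.2 _ hb).1.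
  rewrite addrC -[- 'X]mul1r mulrN -mulNr -polyCN act_cons actC.
  by apply/funext => w; rewrite /lc /shifted; ring.
set D := lc _ _ _ => hD.
have lD : l2 D by apply: l2_lc => //; exact: (act_l2 bA).
have := l2_entry x lD; rewrite {1}/D /lc mulN1r addrC cabsB.
move=> /le_trans; apply; apply: le_trans hD _.
have nS' : l2norm (resolvent A z b) <= c by apply: le_trans nS _; rewrite ler_piMr// ltW.
have : (2 * (e * (cabs z + K))) * l2norm (resolvent A z b) <= (2 * (e * (cabs z + K))) * c.
  by rewrite ler_wpM2l// !mulr_ge0.
lra.
Qed.

End PolyCalculus.

(** * Matrices satisfying the Schur test, and their powers *)

Section SchurMatrices.
Variables (R : realType) (T : choiceType).
Local Notation C := (R[i]).
Implicit Types (phi psi chi : T -> C) (M N : T -> T -> C) (K : R).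

Definition schur M K := [/\ 0 <= K,
  forall x, bsum (fun y => cabs (M x y)) K &
  forall y, bsum (fun x => cabs (M x y)) K].

Definition hermitian_mat M := forall x y, M y x = conjc (M x y).

Lemma row_asummable (u v : T -> C) K B : bsum (fun y => cabs (u y)) K ->
  0 <= B -> (forall y, cabs (v y) <= B) ->
  bsum (fun y => cabs (u y * v y)) (K * B).
Proof.
move=> uK B0 vB s us; apply: (@le_trans _ _ (\sum_(y <- s) cabs (u y) * B)).
  by apply: ler_sum => y _; rewrite cabsM ler_wpM2l ?cabs_ge0.
by rewrite -mulr_suml ler_wpM2r// uK.
Qed.

(** Induction on the sequence: besides [A * D - B ^+ 2], the gap grows by [a y] times the quadratic
    [A * b y ^+ 2 - 2 * B * b y + D], which the induction hypothesis makes nonnegative. *)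
Lemma weighted_CS (s : seq T) (a b : T -> R) : (forall x, 0 <= a x) ->
  (\sum_(x <- s) a x * b x) ^+ 2 <=
  (\sum_(x <- s) a x) * (\sum_(x <- s) a x * b x ^+ 2).
Proof.
move=> a0; elim: s => [|y s IH]; first by rewrite !big_nil expr0n mulr0.
rewrite !big_cons; set A := \sum_(x <- s) a x in IH *.
set B := \sum_(x <- s) a x * b x in IH *.
set D := \sum_(x <- s) a x * b x ^+ 2 in IH *.
have A0 : 0 <= A by apply: sumr_ge0 => x _.
have D0 : 0 <= D by apply: sumr_ge0 => x _; rewrite mulr_ge0 ?sqr_ge0.
have key : 0 <= A * b y ^+ 2 - 2 * B * b y + D.
  move: A0; rewrite le_eqVlt => /orP[/eqP A0|A0].
    move: IH; rewrite -A0 mul0r => B2.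
    have : B = 0 by apply/eqP; rewrite -sqrf_eq0 eq_le B2 sqr_ge0.
    by move=> ->; rewrite mulr0 !mul0r subrr add0r.
  rewrite -(pmulr_rge0 _ A0); have := sqr_ge0 (A * b y - B); lra.
have := mulr_ge0 (a0 y) key; have := a0 y; nra.
Qed.

Lemma bsum_nsum (T1 T2 : choiceType) (g : T1 -> T2 -> R) B :
  (forall x y, 0 <= g x y) -> bsum2 g B ->
  (forall x, bsum (g x) B) /\ bsum (fun x => nsum (g x)) B.
Proof.
move=> g0 gB.
have gx x : bsum (g x) B.
  by move=> s us; have := gB [:: x] s isT us; rewrite big_seq1.
split => // s us.
have h2 : bsum2 (fun x y => cabs ((g x y)%:C : C)) B.
  move=> s1 s2 u1 u2; apply: le_trans (gB _ _ u1 u2).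
  by apply: ler_sum => x _; apply: ler_sum => y _; rewrite cabs_real ger0_norm.
have [_ h] := asummable2_l h2.
apply: le_trans (h s us); apply: ler_sum => x _.
by rewrite (nsum_csum (g0 x) (gx x)) cabs_real ler_norm.
Qed.

Section OneMatrix.
Variables (M : T -> T -> C) (K : R).
Hypothesis (MK : schur M K).

Lemma schur_asummable x psi B : 0 <= B -> (forall y, cabs (psi y) <= B) ->
  asummable (fun y => M x y * psi y).
Proof.
by move=> B0 hB; exists (K * B); case: MK => _ r _; exact: row_asummable.
Qed.

Lemma schur_l2_asummable x psi : l2 psi -> asummable (fun y => M x y * psi y).
Proof.
move=> h; apply: (schur_asummable x (l2norm_ge0 psi)) => y; exact: l2_entry.
Qed.

Lemma matrix_lin : oplin (matrix_op M).
Proof.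
move=> a phi psi h1 h2; apply/funext => x; rewrite /matrix_op /lc.
rewrite -csumD; try exact: schur_l2_asummable.
by apply: eq_csum => y; ring.
Qed.

(** The Schur test: Cauchy-Schwarz with weights [cabs (M x y)] bounds the square of an entry of the
    image by [K] times a weighted square sum, and summation over the rows uses the column bound. *)
Lemma matrix_bnd : opbnd (matrix_op M) K.
Proof.
move=> psi h; have [K0 row col] := MK.
pose g x y := cabs (M x y) * sqf psi y.
have g0 x y : 0 <= g x y by rewrite mulr_ge0 ?cabs_ge0 ?sqf_ge0.
have g2 : bsum2 g (K * n2 psi).
  move=> s1 s2 u1 u2; rewrite exchange_big /=.
  apply: (@le_trans _ _ (\sum_(y <- s2) K * sqf psi y)).
    apply: ler_sum => y _; rewrite -mulr_suml ler_wpM2r ?sqf_ge0//; exact: col.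
  by rewrite -mulr_sumr ler_wpM2l// n2_bsum.
have [gx gs] := bsum_nsum g0 g2.
have key : bsum (sqf (matrix_op M psi)) (K * (K * n2 psi)).
  move=> s us; apply: (@le_trans _ _ (\sum_(x <- s) K * nsum (g x))).
    apply: ler_sum => x _; rewrite /sqf /matrix_op.
    have q0 : 0 <= nsum (g x) := nsum_ge0 (gx x).
    rewrite -[leRHS]sqr_sqrtr ?mulr_ge0// ler_pXn2r ?nnegrE ?cabs_ge0 ?sqrtr_ge0//.
    apply: cabs_csum => s2 u2; rewrite -(@ler_pXn2r _ 2)// ?nnegrE ?sqrtr_ge0//.
      rewrite sqr_sqrtr ?mulr_ge0//.
      under eq_bigr do rewrite cabsM.
      apply: le_trans (weighted_CS _ _ _) _; first by move=> y; exact: cabs_ge0.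
      apply: ler_pM.
      - by apply: sumr_ge0 => y _; exact: cabs_ge0.
      - by apply: sumr_ge0 => y _; exact: g0.
      - exact: row.
      - exact: (nsum_bsum (gx x)).
    by apply: sumr_ge0 => y _; exact: cabs_ge0.
  by rewrite -mulr_sumr ler_wpM2l// gs.
have [l nl] := n2_le key; split => //.
rewrite -(@ler_pXn2r _ 2)// ?nnegrE ?l2norm_ge0 ?mulr_ge0 ?l2norm_ge0//.
by rewrite exprMn !l2norm_sqr// expr2 -mulrA.
Qed.

(** The product of two moduli is at most the sum of their squares, so the column and row bounds give
    the double summability required to exchange the sums. *)
Lemma matrix_sym : hermitian_mat M -> opsym (matrix_op M).
Proof.
move=> hM phi psi h1 h2; have [K0 row col] := MK.
pose u x y := M x y * phi y * conjc (psi x).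
have u2 : asummable2 u.
  exists (K * n2 phi + K * n2 psi) => s1 s2 us1 us2.
  apply: (@le_trans _ _ (\sum_(x <- s1) \sum_(y <- s2)
      (cabs (M x y) * sqf phi y + cabs (M x y) * sqf psi x))).
    apply: ler_sum => x _; apply: ler_sum => y _.
    rewrite /u /sqf !cabsM cabs_conj -mulrDr -mulrA ler_wpM2l ?cabs_ge0//.
    have := sqr_ge0 (cabs (phi y) - cabs (psi x)).
    have := mulr_ge0 (cabs_ge0 (phi y)) (cabs_ge0 (psi x)); lra.
  under eq_bigr do rewrite big_split /=.
  rewrite big_split /=; apply: lerD.
    rewrite exchange_big /=.
    apply: (@le_trans _ _ (\sum_(y <- s2) K * sqf phi y)).
      by apply: ler_sum => y _; rewrite -mulr_suml ler_wpM2r ?sqf_ge0//; exact: col.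
    by rewrite -mulr_sumr ler_wpM2l// n2_bsum.
  apply: (@le_trans _ _ (\sum_(x <- s1) K * sqf psi x)).
    by apply: ler_sum => x _; rewrite -mulr_suml ler_wpM2r ?sqf_ge0//; exact: row.
  by rewrite -mulr_sumr ler_wpM2l// n2_bsum.
rewrite /ip /matrix_op.
transitivity (csum (fun x => csum (u x))).
  apply: eq_csum => x; rewrite mulrC -csumZ; last exact: schur_l2_asummable.
  by apply: eq_csum => y; rewrite /u mulrC.
rewrite csum_exchange//; apply: eq_csum => y.
rewrite -csum_conj; last exact: schur_l2_asummable.
rewrite -csumZ; last by apply: asummable_conj; exact: schur_l2_asummable.
by apply: eq_csum => x; rewrite /u conjcM -hM; ring.
Qed.

Lemma matrix_sa : hermitian_mat M -> sa_op (matrix_op M) K.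
Proof.
move=> hM; have [K0 _ _] := MK.
by split => //; [exact: matrix_lin|exact: matrix_bnd|exact: matrix_sym].
Qed.

End OneMatrix.

(** The entry of the [n]-th power of [M], read off from iterates on a basis vector so as to agree
    with [act] by definition. *)
Definition mpow M n x y : C := iter n (matrix_op M) (basis_vec R y) x.

#[global] Arguments mpow : simpl never.

Lemma mpowS M n x y : mpow M n.+1 x y = csum (fun z => M x z * mpow M n z y).
Proof. by []. Qed.

Lemma mpow0 M x y : mpow M 0 x y = (x == y)%:R.
Proof. by []. Qed.

Lemma act_mpow M (p : {poly C}) x y :
  act (matrix_op M) p (basis_vec R y) x = \sum_(i < size p) p`_i * mpow M i x y.
Proof. by []. Qed.

(** A submultiplicative weight passes to products of matrices. With an exponential of the distance
    as weight this yields decay of the entries of powers away from the diagonal. *)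
Lemma mpow_col_weight M K (w : T -> T -> R) :
  0 <= K -> (forall x y, 0 <= w x y) -> (forall x, w x x <= 1) ->
  (forall x y z, w x z <= w x y * w y z) ->
  (forall y, bsum (fun x => cabs (M x y) * w x y) K) ->
  (forall x y, 1 <= w x y) ->
  forall n y, bsum (fun x => cabs (mpow M n x y) * w x y) (K ^+ n).
Proof.
move=> K0 w0 w1 wt col wge n; elim: n => [|n IH] y s us.
  rewrite expr0; have [ys|ys] := boolP (y \in s).
    rewrite (bigD1_seq y)//= mpow0 eqxx cabs1 mul1r big1 ?addr0//.
    by move=> x /negbTE xy; rewrite mpow0 xy cabs0 mul0r.
  rewrite big_seq big1 ?ler01// => x xs; rewrite mpow0.
  case: eqP => [xy|_]; last by rewrite cabs0 mul0r.
  by rewrite -xy xs in ys.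
pose g x z := cabs (M x z) * w x z * (cabs (mpow M n z y) * w z y).
have g0 x z : 0 <= g x z by rewrite !mulr_ge0 ?cabs_ge0.
have g2 : bsum2 g (K * K ^+ n).
  move=> s1 s2 us1 us2; rewrite exchange_big /=.
  apply: (@le_trans _ _ (\sum_(z <- s2) K * (cabs (mpow M n z y) * w z y))).
    apply: ler_sum => z _; rewrite -mulr_suml ler_wpM2r ?mulr_ge0 ?cabs_ge0//.
    exact: col.
  by rewrite -mulr_sumr ler_wpM2l// IH.
have [gx gs] := bsum_nsum g0 g2.
rewrite exprS; apply: le_trans (gs s us); apply: ler_sum => x _.
have wxy : 0 < w x y by apply: lt_le_trans (wge x y).
rewrite -ler_pdivlMr// mpowS; apply: cabs_csum => s2 us2.
rewrite ler_pdivlMr// mulr_suml; apply: le_trans (nsum_bsum (gx x) us2).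
apply: ler_sum => z _; rewrite cabsM /g.
have -> : cabs (M x z) * w x z * (cabs (mpow M n z y) * w z y) =
   cabs (M x z) * cabs (mpow M n z y) * (w x z * w z y) by ring.
by rewrite ler_wpM2l ?mulr_ge0 ?cabs_ge0.
Qed.

Lemma mpow_col M K : schur M K -> forall n y, bsum (fun x => cabs (mpow M n x y)) (K ^+ n).
Proof.
move=> [K0 row col] n y.
have := @mpow_col_weight M K (fun _ _ => 1) K0 _ _ _ _ _ n y.
move=> h s us; under eq_bigr do rewrite -[cabs _]mulr1; apply: h => //.
  by move=> *; rewrite mulr1.
by move=> z t ut; under eq_bigr do rewrite mulr1; exact: col.
Qed.

End SchurMatrices.

(** * Cauchy's formula and Runge's theorem *)

(** Compactness in terms of near coverings, applied to the filter of small positive radii; it serves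
    for uniform continuity and for Lebesgue numbers of covers alike. *)
Lemma lebesgue_number (R : realType) (K : set R) (P : R -> R -> Prop) :
  compact K ->
  (forall x, K x -> exists2 d : R, 0 < d &
     forall x' e, `|x' - x| < d -> 0 < e < d -> P e x') ->
  exists2 e, 0 < e & forall x, K x -> P e x.
Proof.
move=> /compact_near_coveringP cK h.
have : \forall e \near (0 : R)^'+, K `<=` P e.
  apply: cK => x Kx; have [d d0 hd] := h _ Kx.
  exists (ball x d, [set e | 0 < e < d]) => /=.
    split; first exact: nbhsx_ballx.
    have : \forall e \near (0 : R)^'+, e < d by exact: nbhs_right_lt.
    have : \forall e \near (0 : R)^'+, 0 < e by exact: nbhs_right_gt.
    by apply: filterS2 => e /= -> ->.
  by move=> [x' e] /= [bx e0]; apply: hd => //; rewrite distrC.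
have : \forall e \near (0 : R)^'+, 0 < e by exact: nbhs_right_gt.
move=> h1 h2; have [e [e0 he]] := @filter_ex _ _ (at_right_proper_filter (0 : R)) _ (filterI h1 h2).
by exists e.
Qed.

(** * Integration over the unit interval by Riemann sums *)

Section UnitInterval.
Variable R : realType.
Local Notation C := (R[i]).
Local Notation mu := (@lebesgue_measure R).

Definition ccont_at (g : R -> C) (t : R) : Prop :=
  forall e, 0 < e -> exists2 d, 0 < d &
    forall s, `|s - t| < d -> cabs (g s - g t) < e.

Definition ccont (g : R -> C) : Prop := forall t, 0 <= t <= 1 -> ccont_at g t.

Definition crint (g : R -> C) : C := cintegral mu `[0, 1] g.

(** Linearity, bounds, halving and reversal of [crint] are derived from these left Riemann sums. *)
Definition rsum_unit (N : nat) (g : R -> C) : C :=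
  (N%:R)^-1 * \sum_(i < N) g (i%:R / N%:R).

Lemma ccont_unif g : ccont g -> forall e, 0 < e -> exists2 d, 0 < d &
  forall s t, 0 <= t <= 1 -> `|s - t| <= d -> cabs (g s - g t) <= e.
Proof.
move=> hg e e0.
have [|d d0 hd] := @lebesgue_number R `[0, 1]
    (fun d t => forall s, `|s - t| <= d -> cabs (g s - g t) <= e) (@segment_compact _ _ _).
  move=> x; rewrite /= in_itv /= => x01.
  have [|d d0 hd] := hg _ x01 (e / 2); first by rewrite divr_gt0.
  exists (d / 2) => [|x' u xx' /andP[u0 ud] s sx]; first by rewrite divr_gt0.
  have h1 : cabs (g s - g x) < e / 2.
    apply: hd; rewrite -(subrKA x' s) (le_lt_trans (ler_normD _ _))//.
    by rewrite (splitr d) ltrD// (le_lt_trans sx).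
  have h2 : cabs (g x' - g x) < e / 2 by apply: hd; rewrite (lt_trans xx')// ltr_pdivrMr// ltr_pMr// ltr1n.
  apply: le_trans (cabs_dist _ (g x) _) _; rewrite [cabs (g x - _)]cabsB; lra.
exists d => // s t t01; apply: hd; by rewrite /= in_itv.
Qed.

Lemma ccont_within (g : R -> C) (h : C -> R) :
  (forall z w, `|h z - h w| <= cabs (z - w)) -> ccont g ->
  {within `[(0:R), 1], continuous (h \o g)}.
Proof.
move=> hh hg; apply: continuous_in_subspaceT => x.
rewrite inE /= in_itv /= => /hg cg.
apply/cvgrPdist_lt => e e0; have [d d0 hd] := cg _ e0.
exists d => // s /=; rewrite distrC => /hd; apply: le_lt_trans.
by rewrite distrC; exact: hh.
Qed.

Lemma Re_lip (z w : C) : `|complex.Re z - complex.Re w| <= cabs (z - w).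
Proof. by rewrite -cReN -cReD; exact: Re_le_cabs. Qed.

Lemma Im_lip (z w : C) : `|complex.Im z - complex.Im w| <= cabs (z - w).
Proof. by rewrite -cImN -cImD; exact: Im_le_cabs. Qed.

Lemma riemann_real (f : R -> R) N e : (0 < N)%N ->
  {within `[(0:R), 1], continuous f} ->
  (forall s t, 0 <= s <= 1 -> 0 <= t <= 1 -> `|s - t| <= N%:R^-1 -> `|f s - f t| <= e) ->
  `|Rintegral mu `[0, 1] f - N%:R^-1 * \sum_(i < N) f (i%:R / N%:R)| <= e.
Proof.
move=> N0 cf hf.
have n0 : 0 < N%:R :> R by rewrite ltr0n.
have int01 : mu.-integrable `[(0:R), 1] (EFin \o f).
  by apply: continuous_compact_integrable => //; exact: segment_compact.
have intuv u v : 0 <= u -> v <= 1 -> mu.-integrable `[u, v] (EFin \o f).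
  move=> u0 v1; apply: integrableS int01 => //.
  by move=> x /=; rewrite !in_itv /= => /andP[h1 h2]; rewrite (le_trans u0)// (le_trans h2).
have bound u v c : 0 <= u -> u <= v -> v <= 1 -> (forall x, u <= x <= v -> `|f x - c| <= e) ->
    `|Rintegral mu `[u, v] f - c * (v - u)| <= e * (v - u).
  move=> u0 uv v1 hc.
  have muuv : fine (mu `[u, v]) = v - u.
    rewrite lebesgue_measure_itv /= lte_fin; case: ltP => [//|vu].
    have E : u = v by lra.
    by rewrite E /= subrr.
  have intc k : mu.-integrable `[u, v] (EFin \o (fun=> k)).
    apply: continuous_compact_integrable; first exact: segment_compact.
    by apply: continuous_subspaceT => x; exact: cvg_cst.
  have mk k : Rintegral mu `[u, v] (fun=> k) = k * (v - u) by rewrite Rintegral_cst// muuv.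
  have h1 : Rintegral mu `[u, v] f <= Rintegral mu `[u, v] (fun=> c + e).
    apply: le_Rintegral => //; first exact: intuv.
    by move=> x; rewrite /= in_itv /= => /hc; rewrite ler_norml; lra.
  have h2 : Rintegral mu `[u, v] (fun=> c - e) <= Rintegral mu `[u, v] f.
    apply: le_Rintegral => //; first exact: intuv.
    by move=> x; rewrite /= in_itv /= => /hc; rewrite ler_norml; lra.
  move: h1 h2; rewrite !mk ler_norml; lra.
have split_ u v : 0 <= u -> u <= v -> v <= 1 ->
    Rintegral mu `[0, v] f = Rintegral mu `[0, u] f + Rintegral mu `[u, v] f.
  move=> u0 uv v1; apply/eqP; rewrite addrC -subr_eq; apply/eqP.
  rewrite Rintegral_itvB ?bnd_simp//; last exact: intuv.
  rewrite Rintegral_itv_obnd_cbnd//.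
  apply: integrableS (intuv _ _ u0 v1) => //.
  by move=> x /=; rewrite !in_itv /= => /andP[/ltW -> ->].
have key k : (k <= N)%N -> `|Rintegral mu `[0, k%:R / N%:R] f -
    N%:R^-1 * \sum_(i < k) f (i%:R / N%:R)| <= e * (k%:R / N%:R).
  elim: k => [|k IH] kN.
    by rewrite big_ord0 mul0r !mulr0 set_itv1 Rintegral_set1 subr0 normr0.
  have kn1 : k.+1%:R / N%:R <= 1 :> R by rewrite ler_pdivrMr// mul1r ler_nat.
  have k0 : 0 <= k%:R / N%:R :> R by rewrite divr_ge0.
  have kE : k.+1%:R / N%:R = k%:R / N%:R + N%:R^-1 :> R by rewrite -natr1 mulrDl mul1r.
  have ni : 0 < N%:R^-1 :> R by rewrite invr_gt0.
  rewrite (split_ (k%:R / N%:R)) ?kE ?lerDl ?(ltW ni)// -?kE//.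
  rewrite big_ord_recr /= mulrDr.
  have B : `|Rintegral mu `[k%:R / N%:R, k.+1%:R / N%:R] f -
       f (k%:R / N%:R) * (k.+1%:R / N%:R - k%:R / N%:R)| <=
      e * (k.+1%:R / N%:R - k%:R / N%:R).
    apply: bound => //; first by rewrite kE lerDl ltW.
    move=> x /andP[kx xk]; apply: hf.
    - by rewrite (le_trans k0 kx) (le_trans xk).
    - by rewrite k0 (le_trans kx)// (le_trans xk).
    - rewrite ger0_norm ?subr_ge0// lerBlDl -kE//.
  have := IH (ltnW kN); move: B; rewrite kE.
  set a := k%:R / N%:R; rewrite [a + _ - a]addrAC subrr add0r => B IHk.
  rewrite mulrDr opprD addrACA (le_trans (ler_normD _ _))//.
  by rewrite [N%:R^-1 * f _]mulrC lerD.
have := key N (leqnn N).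
by rewrite divff ?lt0r_neq0// mulr1.
Qed.

Lemma crint_riemann g N e : (0 < N)%N -> ccont g ->
  (forall s t, 0 <= s <= 1 -> 0 <= t <= 1 -> `|s - t| <= N%:R^-1 -> cabs (g s - g t) <= e) ->
  cabs (crint g - rsum_unit N g) <= 2 * e.
Proof.
move=> N0 cg hg; apply: le_trans (cabs_le_ReIm _) _.
have E : rsum_unit N g = (N%:R^-1 * \sum_(i < N) complex.Re (g (i%:R / N%:R))) +i*
   (N%:R^-1 * \sum_(i < N) complex.Im (g (i%:R / N%:R))).
  rewrite /rsum_unit -realC_nat -realCV.
  rewrite -Re_sum -Im_sum; case: (\sum_(i < N) g _) => a b.
  by apply/eqP; rewrite eq_complex /= !mul0r subr0 addr0 !eqxx.
rewrite E cReD cReN cImD cImN /= mulr2n mulrDl mul1r; apply: lerD.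
  apply: riemann_real => //; first by apply: ccont_within cg; exact: Re_lip.
  by move=> s t h1 h2 h3; apply: le_trans (Re_lip _ _) _; exact: hg.
apply: riemann_real => //; first by apply: ccont_within cg; exact: Im_lip.
by move=> s t h1 h2 h3; apply: le_trans (Im_lip _ _) _; exact: hg.
Qed.

Lemma small_inv (d : R) : 0 < d -> exists2 N0, (0 < N0)%N &
  forall N, (N0 <= N)%N -> N%:R^-1 <= d.
Proof.
move=> d0; exists (Num.truncn d^-1).+1 => // N hN.
have : d^-1 < N%:R.
  have : d^-1 < (Num.truncn d^-1).+1%:R by rewrite truncnS_gt// invr_ge0 ltW.
  by move=> /lt_le_trans; apply; rewrite ler_nat.
move=> h; rewrite -[leRHS]invrK lef_pV2 ?posrE ?invr_gt0// ?ltW//.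
by apply: lt_trans h; rewrite invr_gt0.
Qed.

Lemma crint_lim g e : ccont g -> 0 < e -> exists2 N0, (0 < N0)%N &
  forall N, (N0 <= N)%N -> cabs (crint g - rsum_unit N g) <= e.
Proof.
move=> cg e0; have [|d d0 hd] := ccont_unif cg (e := e / 2); first by rewrite divr_gt0.
have [N0 N00 hN0] := small_inv d0; exists N0 => // N hN.
have -> : e = 2 * (e / 2) by rewrite mulrC divfK.
apply: crint_riemann => //; first exact: leq_trans hN.
by move=> s t _ t01 st; apply: hd => //; apply: le_trans st _; exact: hN0.
Qed.

Lemma ccont_lc a g h : ccont g -> ccont h -> ccont (fun t => a * g t + h t).
Proof.
move=> cg ch t t01 e e0; have a0 : 0 < cabs a + 1 by rewrite ltr_wpDl ?cabs_ge0.
have [|d1 d10 h1] := cg _ t01 (e / 2 / (cabs a + 1)); first by rewrite !divr_gt0.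
have [|d2 d20 h2] := ch _ t01 (e / 2); first by rewrite divr_gt0.
exists (Num.min d1 d2); first by rewrite lt_min d10.
move=> s; rewrite lt_min => /andP[/h1 k1 /h2 k2].
have -> : a * g s + h s - (a * g t + h t) = a * (g s - g t) + (h s - h t) by ring.
apply: le_lt_trans (cabsD _ _) _; rewrite cabsM (splitr e).
rewrite ler_ltD// -[leRHS](divfK (lt0r_neq0 a0)) mulrC ler_pM ?cabs_ge0// ?ltW//.
by rewrite ltrDl.
Qed.

Lemma ccont_cst c : ccont (fun=> c).
Proof. by move=> t _ e e0; exists 1 => // s _; rewrite subrr cabs0. Qed.

Lemma rsum_lc a g h N :
  rsum_unit N (fun t => a * g t + h t) = a * rsum_unit N g + rsum_unit N h.
Proof. by rewrite /rsum_unit big_split /= -mulr_sumr; ring. Qed.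

Lemma cabs_le_eps (z : C) : (forall e, 0 < e -> cabs z <= e) -> z = 0.
Proof.
move=> h; apply/eqP; rewrite -cabs_eq0 eq_le cabs_ge0 andbT.
by apply/ler_addgt0Pl => e e0; rewrite addr0; exact: h.
Qed.

Lemma crint_lc a g h : ccont g -> ccont h ->
  crint (fun t => a * g t + h t) = a * crint g + crint h.
Proof.
move=> cg ch; apply/eqP; rewrite -subr_eq0; apply/eqP; apply: cabs_le_eps => e e0.
have a0 : 0 < cabs a + 1 by rewrite ltr_wpDl ?cabs_ge0.
have e3 : 0 < e / 3 by rewrite divr_gt0.
have [|N1 N10 h1] := crint_lim cg (e := e / 3 / (cabs a + 1)); first by rewrite !divr_gt0.
have [N2 N20 h2] := crint_lim ch e3.
have [N3 N30 h3] := crint_lim (ccont_lc a cg ch) e3.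
have [N NE] : exists N, N = (N1 + N2 + N3)%N by eexists.
have {}h1 := h1 N ltac:(lia); have {}h2 := h2 N ltac:(lia).
have {}h3 := h3 N ltac:(lia).
rewrite rsum_lc in h3; move: h1 h2 h3.
set x := crint (fun t => a * g t + h t); set y := crint g; set z := crint h.
set u := rsum_unit N g; set v := rsum_unit N h => h1 h2 h3.
have -> : x - (a * y + z) = (x - (a * u + v)) + (- a * (y - u) + (- (z - v))) by ring.
apply: le_trans (cabsD _ _) _.
have : cabs (- a * (y - u) + - (z - v)) <= e / 3 + e / 3.
  apply: le_trans (cabsD _ _) _; rewrite !cabsN lerD// cabsM cabsN.
  rewrite -[leRHS](divfK (lt0r_neq0 a0)) mulrC ler_pM ?cabs_ge0// lerDl//.
lra.
Qed.

Lemma rsum_bound g M N : (0 < N)%N -> (forall t, 0 <= t <= 1 -> cabs (g t) <= M) ->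
  cabs (rsum_unit N g) <= M.
Proof.
move=> N0 hM; have n0 : 0 < N%:R :> R by rewrite ltr0n.
rewrite /rsum_unit cabsM cabsV cabs_nat ler_pdivrMl//.
apply: le_trans (cabs_sum _ _ _) _.
apply: (@le_trans _ _ (\sum_(i < N) M)); last by rewrite sumr_const card_ord mulr_natl.
apply: ler_sum => i _; apply: hM; rewrite divr_ge0//= ler_pdivrMr// mul1r ler_nat.
exact: ltnW.
Qed.

Lemma crint_bound g M : ccont g -> (forall t, 0 <= t <= 1 -> cabs (g t) <= M) ->
  cabs (crint g) <= M.
Proof.
move=> cg hM; apply/ler_addgt0Pl => e e0.
have [N N0 h] := crint_lim cg e0; have {}h := h N (leqnn N).
rewrite -[crint g](subrK (rsum_unit N g)); apply: le_trans (cabsD _ _) _.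
by rewrite lerD// rsum_bound.
Qed.

Lemma crint_cst c : crint (fun=> c) = c.
Proof.
apply/eqP; rewrite -subr_eq0; apply/eqP; apply: cabs_le_eps => e e0.
have [N N0 h] := crint_lim (ccont_cst c) e0; have := h N (leqnn N).
congr (cabs (_ - _) <= _); rewrite /rsum_unit sumr_const card_ord -(mulr_natl c) mulrA mulVf ?mul1r//.
by rewrite pnatr_eq0 -lt0n.
Qed.

Lemma eq_crint g h : (forall t, 0 <= t <= 1 -> g t = h t) -> crint g = crint h.
Proof.
move=> gh; rewrite /crint /cintegral; congr (_ +i* _); apply: eq_Rintegral => x;
  by rewrite inE /= in_itv /= => /gh ->.
Qed.

Lemma ccont_affine g (a b : R) : 0 <= a -> 0 <= a + b -> a <= 1 -> a + b <= 1 ->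
  ccont g -> ccont (fun t => g (a + b * t)).
Proof.
move=> a0 ab0 a1 ab1 cg t /andP[t0 t1] e e0.
have t01 : 0 <= a + b * t <= 1.
  by apply/andP; split; nra.
have [d d0 hd] := cg _ t01 _ e0.
have b0 : 0 < `|b| + 1 by rewrite ltr_wpDl.
exists (d / (`|b| + 1)) => [|s st]; first exact: divr_gt0.
apply: hd; rewrite opprD addrACA subrr add0r -mulrBr normrM.
move: st; rewrite ltr_pdivlMr//; apply: le_lt_trans.
by rewrite mulrC ler_wpM2l// lerDl.
Qed.

Lemma crint_half g : ccont g ->
  crint g = (crint (fun t => g (0 + 2^-1 * t)) + crint (fun t => g (2^-1 + 2^-1 * t))) / 2.
Proof.
move=> cg; set g1 := fun t => g (0 + _); set g2 := fun t => g (2^-1 + _).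
have c1 : ccont g1 by apply: ccont_affine => //; lra.
have c2 : ccont g2 by apply: ccont_affine => //; lra.
apply/eqP; rewrite -subr_eq0; apply/eqP; apply: cabs_le_eps => e e0.
have e3 : 0 < e / 2 by rewrite divr_gt0.
have [N1 N10 h1] := crint_lim c1 e3; have [N2 N20 h2] := crint_lim c2 e3.
have [N3 N30 h3] := crint_lim cg e3.
have [N NE] : exists N, N = (N1 + N2 + N3)%N by eexists.
have {}h1 := h1 N ltac:(lia); have {}h2 := h2 N ltac:(lia).
have {}h3 := h3 (N + N)%N ltac:(lia).
have N0 : N%:R != 0 :> R by rewrite pnatr_eq0; lia.
have N0' : N%:R != 0 :> C by rewrite pnatr_eq0; lia.
have E : rsum_unit (N + N) g = (rsum_unit N g1 + rsum_unit N g2) / 2.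
  rewrite /rsum_unit big_split_ord /=.
  have -> : \sum_(i < N) g ((i%:R : R) / (N + N)%:R) = \sum_(i < N) g1 (i%:R / N%:R).
    apply: eq_bigr => i _; rewrite /g1 natrD; congr g; field.
    by rewrite N0 -natrD pnatr_eq0; lia.
  have -> : \sum_(i < N) g (((N + i)%:R : R) / (N + N)%:R) = \sum_(i < N) g2 (i%:R / N%:R).
    apply: eq_bigr => i _; rewrite /g2 !natrD; congr g; field.
    by rewrite N0 -natrD pnatr_eq0; lia.
  by rewrite natrD; field; rewrite N0' -natrD pnatr_eq0; lia.
rewrite E in h3; move: h1 h2 h3.
set x := crint g; set y := crint g1; set z := crint g2.
set u := rsum_unit N g1; set v := rsum_unit N g2 => h1 h2 h3.
have -> : x - (y + z) / 2 = (x - (u + v) / 2) - ((y - u) / 2 + (z - v) / 2) by ring.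
apply: le_trans (cabsD _ _) _; rewrite cabsN.
have : cabs ((y - u) / 2 + (z - v) / 2) <= e / 2.
  apply: le_trans (cabsD _ _) _; rewrite !cabsM cabsV cabs_nat; lra.
lra.
Qed.

Lemma crint_rev g : ccont g -> crint g = crint (fun t => g (1 + (-1) * t)).
Proof.
move=> cg; set g1 := fun t => g (1 + _).
have c1 : ccont g1 by apply: ccont_affine => //; lra.
apply/eqP; rewrite -subr_eq0; apply/eqP; apply: cabs_le_eps => e e0.
have e3 : 0 < e / 3 by rewrite divr_gt0.
have [d d0 hd] := ccont_unif cg e3.
have [N0 N00 hN0] := small_inv d0.
have [N1 N10 h1] := crint_lim cg e3; have [N2 N20 h2] := crint_lim c1 e3.
have [N NE] : exists N, N = (N0 + N1 + N2)%N by eexists.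
have {}h1 := h1 N ltac:(lia); have {}h2 := h2 N ltac:(lia).
have {}hN0 := hN0 N ltac:(lia).
have Np : (0 < N)%N by lia.
have n0 : 0 < N%:R :> R by rewrite ltr0n.
have : cabs (rsum_unit N g - rsum_unit N g1) <= e / 3.
  (* Reversing the order of the nodes turns [i / N] into [(N - i - 1) / N], which misses the
     reflected node [1 - i / N] by one mesh width. *)
  rewrite /rsum_unit -mulrBr (reindex_inj rev_ord_inj) /= -sumrB.
  rewrite cabsM cabsV cabs_nat ler_pdivrMl//; apply: le_trans (cabs_sum _ _ _) _.
  apply: (@le_trans _ _ (\sum_(i < N) (e / 3))); last by rewrite sumr_const card_ord mulr_natl.
  apply: ler_sum => i _; rewrite /g1; apply: hd.
    have h : (i%:R : R) / N%:R <= 1 by rewrite ler_pdivrMr// mul1r ler_nat ltnW.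
    have h' : 0 <= (i%:R : R) / N%:R by rewrite divr_ge0.
    by apply/andP; split; lra.
  have -> : ((N - i.+1)%:R : R) / N%:R - (1 + -1 * (i%:R / N%:R)) = - N%:R^-1.
    by rewrite natrB// -natr1; field; rewrite lt0r_neq0.
  by rewrite normrN ger0_norm// invr_ge0 ltW.
move: h1 h2; set x := crint g; set y := crint g1; set u := rsum_unit N g; set v := rsum_unit N g1.
move=> h1 h2 h3; have -> : x - y = (x - u) + ((u - v) + (- (y - v))) by ring.
apply: le_trans (cabsD _ _) _; have := cabsD (u - v) (- (y - v)); rewrite cabsN; lra.
Qed.

End UnitInterval.

(** * Integrals along segments and Goursat's theorem on rectangles *)

Section Segments.
Variable R : realType.
Local Notation C := (R[i]).
Implicit Types (g h : C -> C) (z w : C) (a b c d : R).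

Definition contC g z := forall e, 0 < e -> exists2 dl, 0 < dl &
  forall w, cabs (w - z) < dl -> cabs (g w - g z) < e.

Definition segpath z w (t : R) : C := z + t%:C * (w - z).

Definition scont g z w := ccont (fun t => g (segpath z w t)).

Definition seg g z w : C := segment_integral g z w.

Lemma segE g z w : seg g z w = (w - z) * crint (fun t => g (segpath z w t)).
Proof. by []. Qed.

Lemma segpath_cont g z w : (forall t, 0 <= t <= 1 -> contC g (segpath z w t)) ->
  scont g z w.
Proof.
move=> cg t /cg h e e0; have [dl dl0 hd] := h _ e0.
have p : 0 < cabs (w - z) + 1 by rewrite ltr_wpDl ?cabs_ge0.
exists (dl / (cabs (w - z) + 1)) => [|s st]; first exact: divr_gt0.
apply: hd; rewrite /segpath opprD addrACA subrr add0r -mulrBl -realCB cabsM cabs_real.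
move: st; rewrite ltr_pdivlMr//; apply: le_lt_trans.
by rewrite ler_wpM2l// lerDl.
Qed.

Lemma segpath_rev z w t : segpath w z t = segpath z w (1 + (-1) * t).
Proof. by rewrite /segpath mulN1r realCB (_ : 1%:C = 1)//; ring. Qed.

Lemma seg_rev g z w : scont g z w -> seg g w z = - seg g z w.
Proof.
move=> cg; rewrite !segE (crint_rev cg) -mulNr opprB; congr (_ * _).
by apply: eq_crint => t _; rewrite segpath_rev.
Qed.

Lemma seg_split g z w m : m = (z + w) / 2 -> scont g z w ->
  seg g z w = seg g z m + seg g m w.
Proof.
move=> -> cg; rewrite !segE (crint_half cg).
have E t : segpath z w (0 + 2^-1 * t) = segpath z ((z + w) / 2) t.
  by rewrite /segpath add0r realCM realCV realC_nat; field.
have E' t : segpath z w (2^-1 + 2^-1 * t) = segpath ((z + w) / 2) w t.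
  by rewrite /segpath realCD realCM realCV realC_nat; field.
rewrite (eq_crint (fun t _ => congr1 g (E t))) (eq_crint (fun t _ => congr1 g (E' t))).
by field.
Qed.

Lemma seg_lc (k : C) g h z w : scont g z w -> scont h z w ->
  seg (fun u => k * g u + h u) z w = k * seg g z w + seg h z w.
Proof. by move=> cg ch; rewrite !segE crint_lc//; ring. Qed.

Lemma seg_bound g z w M : scont g z w ->
  (forall t, 0 <= t <= 1 -> cabs (g (segpath z w t)) <= M) ->
  cabs (seg g z w) <= cabs (w - z) * M.
Proof.
by move=> cg hM; rewrite segE cabsM ler_wpM2l ?cabs_ge0// crint_bound.
Qed.

Lemma eq_seg g h z w : (forall t, 0 <= t <= 1 -> g (segpath z w t) = h (segpath z w t)) ->
  seg g z w = seg h z w.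
Proof. by move=> gh; rewrite !segE; congr (_ * _); exact: eq_crint. Qed.

Lemma ccont_line (A B : C) : ccont (fun t => B * t%:C + A).
Proof.
have h : ccont (fun t => t%:C : C).
  move=> t _ e e0; exists e => // s; by rewrite -realCB cabs_real.
exact: ccont_lc h (ccont_cst A).
Qed.

Lemma realC_rev t : (1 + (-1) * t)%:C = 1 - t%:C :> C.
Proof. by rewrite mulN1r realCB. Qed.

(** Adding the reversed integrand gives a constant, and the integral is half of it. *)
Lemma crint_affine (A B : C) : crint (fun t => B * t%:C + A) = A + B / 2.
Proof.
have c1 := ccont_line A B.
have h := crint_rev c1.
have E : crint (fun t => 1 * (B * t%:C + A) + (B * (1 + -1 * t)%:C + A)) = A + A + B.
  rewrite -[RHS](crint_cst (A + A + B)); apply: eq_crint => t _.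
  by rewrite realC_rev; ring.
rewrite crint_lc// -?h in E; last first.
  apply: (_ : ccont (fun t => B * (1 + -1 * t)%:C + A)).
  have -> : (fun t => B * (1 + -1 * t)%:C + A) = (fun t : R => (- B) * t%:C + (B + A)).
    by apply/funext => t; rewrite realC_rev; ring.
  exact: ccont_line.
rewrite mul1r in E; set x := crint _ in E *.
have -> : x = (x + x) / 2 by field.
by rewrite E; field.
Qed.

Lemma seg_affine (A B : C) z w :
  seg (fun u => B * u + A) z w = (A * w + B * w ^+ 2 / 2) - (A * z + B * z ^+ 2 / 2).
Proof.
rewrite segE (_ : (fun t => _) = (fun t : R => (B * (w - z)) * t%:C + (B * z + A))).
  by rewrite crint_affine; field.
by apply/funext => t; rewrite /segpath; ring.
Qed.

Definition inrect a b c d z :=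
  a <= complex.Re z <= c /\ b <= complex.Im z <= d.

Definition RI g a b c d : C := rect_integral g (a +i* b, c +i* d).

Lemma RIE g a b c d : RI g a b c d =
  seg g (a +i* b) (c +i* b) + seg g (c +i* b) (c +i* d) +
  seg g (c +i* d) (a +i* d) + seg g (a +i* d) (a +i* b).
Proof. by []. Qed.

Lemma segpath_inrect a b c d z w t : inrect a b c d z -> inrect a b c d w ->
  0 <= t <= 1 -> inrect a b c d (segpath z w t).
Proof.
case: z => x y; case: w => x' y'; rewrite /inrect /segpath /=.
move=> [/andP[? ?] /andP[? ?]] [/andP[? ?] /andP[? ?]] /andP[t0 t1].
rewrite !mul0r subr0 addr0; split; apply/andP; split; nra.
Qed.

Lemma scont_rect g a b c d z w : (forall u, inrect a b c d u -> contC g u) ->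
  inrect a b c d z -> inrect a b c d w -> scont g z w.
Proof.
by move=> cg hz hw; apply: segpath_cont => t t01; apply: cg; exact: segpath_inrect.
Qed.

Lemma mid_complex a b c d : (a +i* b + (c +i* d)) / 2 = ((a + c) / 2) +i* ((b + d) / 2) :> C.
Proof.
rewrite -(realC_nat _ 2) -realCV; apply/eqP; rewrite eq_complex /=.
by apply/andP; split; apply/eqP; ring.
Qed.

(** Each of the four inner half sides is traversed twice, in opposite directions. *)
Lemma RI_quad g a b c d : a <= c -> b <= d -> (forall u, inrect a b c d u -> contC g u) ->
  let x := (a + c) / 2 in let y := (b + d) / 2 in
  RI g a b c d = RI g a b x y + RI g x b c y + RI g x y c d + RI g a y x d.
Proof.
move=> ac bd cg x y.
have xa : a <= x <= c by rewrite /x; lra.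
have yb : b <= y <= d by rewrite /y; lra.
have ir u v : a <= u <= c -> b <= v <= d -> inrect a b c d (u +i* v) by [].
have sc := scont_rect cg.
have aa : a <= a <= c by lra.
have cc : a <= c <= c by lra.
have bb : b <= b <= d by lra.
have dd : b <= d <= d by lra.
rewrite !RIE.
rewrite (@seg_split g (a +i* b) (c +i* b) (x +i* b)); last 2 first.
- by rewrite mid_complex; congr (_ +i* _); lra.
- by apply: sc; apply: ir.
rewrite (@seg_split g (c +i* b) (c +i* d) (c +i* y)); last 2 first.
- by rewrite mid_complex; congr (_ +i* _); lra.
- by apply: sc; apply: ir.
rewrite (@seg_split g (c +i* d) (a +i* d) (x +i* d)); last 2 first.
- by rewrite mid_complex; congr (_ +i* _); rewrite /x; lra.
- by apply: sc; apply: ir.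
rewrite (@seg_split g (a +i* d) (a +i* b) (a +i* y)); last 2 first.
- by rewrite mid_complex; congr (_ +i* _); rewrite /y; lra.
- by apply: sc; apply: ir.
rewrite (@seg_rev g (x +i* b) (x +i* y)); last by apply: sc; apply: ir.
rewrite (@seg_rev g (x +i* y) (c +i* y)); last by apply: sc; apply: ir.
rewrite (@seg_rev g (x +i* y) (x +i* d)); last by apply: sc; apply: ir.
rewrite (@seg_rev g (a +i* y) (x +i* y)); last by apply: sc; apply: ir.
clear; move: x y (seg g) => x y S; ring.
Qed.

(** An affine function has a quadratic primitive, so its contributions telescope around the
    rectangle and only the remainder, at most [M] on the perimeter, is left. *)
Lemma RI_affine_bound g a b c d (A B : C) M : a <= c -> b <= d ->
  (forall u, inrect a b c d u -> contC g u) ->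
  (forall u, inrect a b c d u -> cabs (g u - (B * u + A)) <= M) ->
  cabs (RI g a b c d) <= 2 * ((c - a) + (d - b)) * M.
Proof.
move=> ac bd cg hM.
have aff u : contC (fun u => B * u + A) u.
  move=> e e0; have B0 : 0 < cabs B + 1 by rewrite ltr_wpDl ?cabs_ge0.
  exists (e / (cabs B + 1)) => [|w]; first exact: divr_gt0.
  rewrite ltr_pdivlMr//; apply: le_lt_trans.
  have -> : B * w + A - (B * u + A) = (w - u) * B by ring.
  by rewrite cabsM ler_wpM2l ?cabs_ge0// lerDl.
pose r u := -1 * (B * u + A) + g u.
have cr u : inrect a b c d u -> contC r u.
  move=> /cg hg e e0; have e2 : 0 < e / 2 by rewrite divr_gt0.
  have [d1 d10 h1] := hg _ e2; have [d2 d20 h2] := aff u _ e2.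
  exists (Num.min d1 d2); first by rewrite lt_min d10.
  move=> w; rewrite lt_min => /andP[/h1 k1 /h2 k2].
  have -> : r w - r u = (g w - g u) - (B * w + A - (B * u + A)) by rewrite /r; ring.
  by apply: le_lt_trans (cabsD _ _) _; rewrite cabsN (splitr e) ltrD.
have sE z w : inrect a b c d z -> inrect a b c d w ->
    seg g z w = seg r z w + ((A * w + B * w ^+ 2 / 2) - (A * z + B * z ^+ 2 / 2)).
  move=> hz hw; rewrite -seg_affine /r (@seg_lc (-1) (fun u => B * u + A) g); last 2 first.
  - by apply: segpath_cont => t _; exact: aff.
  - exact: scont_rect cg hz hw.
  by ring.
have rM z w : inrect a b c d z -> inrect a b c d w -> cabs (seg r z w) <= cabs (w - z) * M.
  move=> hz hw; apply: seg_bound; first exact: scont_rect cr hz hw.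
  move=> t t01; have := hM _ (segpath_inrect hz hw t01).
  by rewrite /r mulN1r addrC.
have aa : a <= a <= c by lra.
have cc : a <= c <= c by lra.
have bb : b <= b <= d by lra.
have dd : b <= d <= d by lra.
have ir u v : a <= u <= c -> b <= v <= d -> inrect a b c d (u +i* v) by [].
rewrite RIE !sE; try exact: ir.
have := rM (a +i* b) (c +i* b) (ir _ _ aa bb) (ir _ _ cc bb).
have := rM (c +i* b) (c +i* d) (ir _ _ cc bb) (ir _ _ cc dd).
have := rM (c +i* d) (a +i* d) (ir _ _ cc dd) (ir _ _ aa dd).
have := rM (a +i* d) (a +i* b) (ir _ _ aa dd) (ir _ _ aa bb).
have n1 : cabs (c +i* b - (a +i* b)) = c - a.
  by rewrite cabsE /= subrr expr0n addr0 sqrtr_sqr ger0_norm// subr_ge0.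
have n2 : cabs (c +i* d - (c +i* b)) = d - b.
  by rewrite cabsE /= subrr expr0n add0r sqrtr_sqr ger0_norm// subr_ge0.
have n3 : cabs (a +i* d - (c +i* d)) = c - a.
  by rewrite cabsB cabsE /= subrr expr0n addr0 sqrtr_sqr ger0_norm// subr_ge0.
have n4 : cabs (a +i* b - (a +i* d)) = d - b.
  by rewrite cabsB cabsE /= subrr expr0n add0r sqrtr_sqr ger0_norm// subr_ge0.
rewrite n1 n2 n3 n4.
set s1 := seg r _ _; set s2 := seg r _ _; set s3 := seg r _ _; set s4 := seg r _ _.
move=> h4 h3 h2 h1.
set X := (X in cabs X); have -> : X = (s1 + s2) + (s3 + s4) by rewrite /X; ring.
apply: le_trans (cabsD _ _) _; have := cabsD s1 s2; have := cabsD s3 s4.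
by clearbody s1 s2 s3 s4; move: h1 h2 h3 h4; clear; lra.
Qed.

Definition diffC g z := exists b : C, forall e, 0 < e -> exists2 dl, 0 < dl &
  forall w, cabs (w - z) < dl -> cabs (g w - g z - b * (w - z)) <= e * cabs (w - z).

Lemma diffC_cont g z : diffC g z -> contC g z.
Proof.
move=> [b hb] e e0; have [d1 d10 h1] := hb 1 ltr01.
have b0 : 0 < cabs b + 1 by rewrite ltr_wpDl ?cabs_ge0.
exists (Num.min d1 (e / (cabs b + 1))); first by rewrite lt_min d10 divr_gt0.
move=> w; rewrite lt_min => /andP[/h1 k1]; rewrite ltr_pdivlMr//; apply: le_lt_trans.
rewrite -[g w - g z](subrK (b * (w - z))); apply: le_trans (cabsD _ _) _.
move: k1; rewrite cabsM; lra.
Qed.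

(* Bisection: a quarter of the rectangle carries at least a quarter of the
   integral; compare with the affine approximation at the limit point. *)
Lemma goursat g a b c d : a <= c -> b <= d ->
  (forall u, inrect a b c d u -> diffC g u) -> RI g a b c d = 0.
Proof.
move=> ac bd dg.
have cg u : inrect a b c d u -> contC g u by move=> /dg; exact: diffC_cont.
pose quad := (R * R * (R * R))%type.
pose inside (q : quad) := [/\ a <= q.1.1, q.1.1 <= q.2.1, q.2.1 <= c &
   [/\ b <= q.1.2, q.1.2 <= q.2.2 & q.2.2 <= d]].
pose I (q : quad) := cabs (RI g q.1.1 q.1.2 q.2.1 q.2.2).
pose half (q r : quad) := [/\ q.1.1 <= r.1.1, r.2.1 <= q.2.1, q.1.2 <= r.1.2, r.2.2 <= q.2.2 &
  [/\ r.2.1 - r.1.1 = (q.2.1 - q.1.1) / 2, r.2.2 - r.1.2 = (q.2.2 - q.1.2) / 2 & I q <= 4 * I r]].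
have : forall q, exists r, inside q -> half q r.
  move=> [[a' b'] [c' d']]; have [[/= h1 h2 h3 [h4 h5 h6]]|] := pselect (inside (a', b', (c', d'))); last first.
    by move=> h; exists (a, b, (c, d)).
  pose x := (a' + c') / 2; pose y := (b' + d') / 2.
  have E : RI g a' b' c' d' = RI g a' b' x y + RI g x b' c' y + RI g x y c' d' + RI g a' y x d'.
    apply: RI_quad => // u [/andP[? ?] /andP[? ?]]; apply: cg; split; apply/andP; split; lra.
  have [x1 x2 x3 x4] : [/\ a' <= x, x <= c', x - a' = (c' - a') / 2 & c' - x = (c' - a') / 2].
    by clear -h2; rewrite /x; split; lra.
  have [y1 y2 y3 y4] : [/\ b' <= y, y <= d', y - b' = (d' - b') / 2 & d' - y = (d' - b') / 2].
    by clear -h5; rewrite /y; split; lra.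
  have [k1|k1] := leP (I (a', b', (c', d'))) (4 * I (a', b', (x, y))).
    by exists (a', b', (x, y)) => _.
  have [k2|k2] := leP (I (a', b', (c', d'))) (4 * I (x, b', (c', y))).
    by exists (x, b', (c', y)) => _.
  have [k3|k3] := leP (I (a', b', (c', d'))) (4 * I (x, y, (c', d'))).
    by exists (x, y, (c', d')) => _.
  have [k4|k4] := leP (I (a', b', (c', d'))) (4 * I (a', y, (x, d'))).
    by exists (a', y, (x, d')) => _.
  exfalso; move: k1 k2 k3 k4; rewrite /I /= E.
  set s1 := RI g a' b' x y; set s2 := RI g x b' c' y.
  set s3 := RI g x y c' d'; set s4 := RI g a' y x d'.
  clear; move: s1 s2 s3 s4 => s1 s2 s3 s4.
  have := cabsD (s1 + s2 + s3) s4; have := cabsD (s1 + s2) s3; have := cabsD s1 s2.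
  lra.
move=> /boolp.choice[nx hnx].
pose q n := iter n nx (a, b, (c, d)).
have qi n : inside (q n).
  elim: n => [|n IH] /=; first by rewrite /inside /=; split.
  have [h1 h2 h3 h4 [h5 h6 _]] := hnx _ IH; case: IH => i1 i2 i3 [i4 i5 i6].
  by clear -h1 h2 h3 h4 h5 h6 i1 i2 i3 i4 i5 i6 ac bd; split; [lra|lra|lra|split; lra].
have qs n : half (q n) (q n.+1) := hnx _ (qi n).
have size_ n : (q n).2.1 - (q n).1.1 = (c - a) * (2^-1) ^+ n /\
               (q n).2.2 - (q n).1.2 = (d - b) * (2^-1) ^+ n.
  elim: n => [|n [h1 h2]]; first by rewrite expr0 !mulr1.
  by have [_ _ _ _ [-> -> _]] := qs n; rewrite h1 h2 exprS; split; ring.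
have mono n k : [/\ (q n).1.1 <= (q (n + k)%N).1.1, (q (n + k)%N).2.1 <= (q n).2.1,
    (q n).1.2 <= (q (n + k)%N).1.2 & (q (n + k)%N).2.2 <= (q n).2.2].
  elim: k => [|k [h1 h2 h3 h4]]; first by rewrite addn0.
  by rewrite addnS; have [k1 k2 k3 k4 _] := qs (n + k)%N; split; lra.
have [x hx] : exists l, forall n, `|(q n).1.1 - l| <= (c - a) * (2^-1) ^+ n.
  apply: cauchy_real => n k; have [h1 h2 _ _] := mono n k; have [_ i2 _ _] := qi (n + k)%N.
  have [h _] := size_ n; rewrite ger0_norm ?subr_ge0// -h; lra.
have [y hy] : exists l, forall n, `|(q n).1.2 - l| <= (d - b) * (2^-1) ^+ n.
  apply: cauchy_real => n k; have [_ _ h1 h2] := mono n k; have [_ _ _ [_ i2 _]] := qi (n + k)%N.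
  have [_ h] := size_ n; rewrite ger0_norm ?subr_ge0// -h; lra.
have h01 : 0 <= (2^-1 : R) < 1 by lra.
have limle (k u v : R) (m : nat -> R) : (forall n, u <= v + k * (2^-1) ^+ n) -> u <= v.
  move=> h; apply/ler_addgt0Pl => e e0; have [n hn] := exp_small k h01 e0.
  by have := h n; lra.
have zin : inrect a b c d (x +i* y).
  split => /=; apply/andP; split.
  - apply: (limle (c - a) _ _ (fun=> 0)) => n; have := hx n; have [i1 _ _ _] := qi n.
    by rewrite ler_norml; lra.
  - apply: (limle (c - a) _ _ (fun=> 0)) => n; have := hx n; have [_ i1 i2 _] := qi n.
    by rewrite ler_norml; lra.
  - apply: (limle (d - b) _ _ (fun=> 0)) => n; have := hy n; have [_ _ _ [i1 _ _]] := qi n.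
    by rewrite ler_norml; lra.
  - apply: (limle (d - b) _ _ (fun=> 0)) => n; have := hy n; have [_ _ _ [_ i1 i2]] := qi n.
    by rewrite ler_norml; lra.
have [be hbe] := dg _ zin; set z0 := x +i* y in zin hbe.
apply: cabs_le_eps => e e0.
pose L := (c - a) + (d - b).
have L0 : 0 <= L by rewrite /L; lra.
(* The rectangle at stage [n] has half perimeter [L / 2^n] and lies within [2 * L / 2^n] of [z0], so
   its integral is at most [4 * L ^+ 2 * eta / 4^n]; the factor [4 ^+ n] lost in the bisection
   cancels. *)
have eta0 : 0 < e / (4 * L ^+ 2 + 1).
  by rewrite divr_gt0// ltr_wpDl// mulr_ge0// sqr_ge0.
set eta := e / _ in eta0; have [dl dl0 hdl] := hbe _ eta0.
have [n hn] := exp_small (2 * L) h01 dl0.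
have Iq m : I (q 0%N) <= 4 ^+ m * I (q m).
  elim: m => [|m IH]; first by rewrite expr0 mul1r.
  have [_ _ _ _ [_ _ h]] := qs m; apply: le_trans IH _.
  by rewrite exprSr -mulrA ler_wpM2l// exprn_ge0.
have r0 : 0 <= (2^-1 : R) ^+ n by rewrite exprn_ge0.
have [s1 s2] := size_ n; have [i1 i2 i3 [i4 i5 i6]] := qi n.
have near u : inrect (q n).1.1 (q n).1.2 (q n).2.1 (q n).2.2 u ->
    cabs (u - z0) <= 2 * L * 2^-1 ^+ n.
  case: u => u v [/= /andP[u1 u2] /andP[v1 v2]].
  apply: le_trans (cabs_le_ReIm _) _ => /=.
  have := hx n; have := hy n; rewrite !ler_norml => /andP[k1 k2] /andP[k3 k4].
  have -> : 2 * L * 2^-1 ^+ n = 2 * ((c - a) * 2^-1 ^+ n) + 2 * ((d - b) * 2^-1 ^+ n).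
    by rewrite /L; ring.
  clear -k1 k2 k3 k4 u1 u2 v1 v2 s1 s2.
  by apply: lerD; rewrite ler_norml; apply/andP; split; lra.
have B : I (q n) <= 2 * (L * 2^-1 ^+ n) * (eta * (2 * L * 2^-1 ^+ n)).
  have -> : L * 2^-1 ^+ n = ((q n).2.1 - (q n).1.1) + ((q n).2.2 - (q n).1.2).
    by rewrite s1 s2 /L; ring.
  apply: (@RI_affine_bound g _ _ _ _ (g z0 - be * z0) be) => // u hu.
    apply: cg; case: hu => /andP[k1 k2] /andP[k3 k4].
    by clear -k1 k2 k3 k4 i1 i2 i3 i4 i5 i6; split; apply/andP; split; lra.
  have -> : g u - (be * u + (g z0 - be * z0)) = g u - g z0 - be * (u - z0) by ring.
  apply: le_trans (hdl u _) _; first by apply: le_lt_trans hn; exact: near.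
  by rewrite ler_wpM2l ?(ltW eta0)//; exact: near.
have p4 : 4 ^+ n * (2^-1 ^+ n * 2^-1 ^+ n) = 1 :> R.
  by rewrite -!exprMn (_ : 4 * (2^-1 * 2^-1) = 1 :> R) ?expr1n//; field.
have : I (q 0%N) <= 4 * L ^+ 2 * eta.
  apply: le_trans (Iq n) _.
  apply: le_trans (ler_wpM2l (exprn_ge0 n (ler0n _ 4)) B) _.
  rewrite le_eqVlt; apply/orP; left; apply/eqP.
  transitivity (4 * L ^+ 2 * eta * (4 ^+ n * (2^-1 ^+ n * 2^-1 ^+ n))); first by ring.
  by rewrite p4 mulr1.
rewrite /I /= => /le_trans; apply.
rewrite /eta mulrA ler_pdivrMr; last by rewrite ltr_wpDl// mulr_ge0// sqr_ge0.
by have := sqr_ge0 L; nra.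
Qed.

End Segments.

(** * The integral of the inverse around the origin *)

Section WindingNumber.
Variable R : realType.
Local Notation C := (R[i]).
Local Notation mu := (@lebesgue_measure R).

Lemma ftc01 (f F : R -> R) : (forall x : R, is_derive x 1 F (f x)) ->
  {within `[(0:R), 1], continuous f} -> Rintegral mu `[0, 1] f = F 1 - F 0.
Proof.
move=> dF cf.
have cF x : {for x, continuous F}.
  by apply: differentiable_continuous; apply/derivable1_diffP; case: (dF x).
rewrite /Rintegral (@continuous_FTC2 _ f F 0 1 ltr01 cf) //.
  split => [x _|  |]; first by case: (dF x).
    by apply: cvg_at_right_filter; exact: cF.
  by apply: cvg_at_left_filter; exact: cF.
by move=> x _; rewrite derive1E; case: (dF x).
Qed.

Lemma is_derive_line (p q x : R) : is_derive x 1 (fun t : R => p + t * q) q.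
Proof.
have h : is_derive x 1 ((fun=> p) + (fun t : R => t * q)) (0 + q).
  apply: is_deriveD.
  have -> : (fun t : R => t * q) = q *: id by apply/funext => t /=; rewrite mulrC.
  have : is_derive x 1 (q *: id) (q *: (1 : R)) by apply: is_deriveZ.
  by rewrite /GRing.scale /= mulr1.
by rewrite add0r in h.
Qed.

Lemma is_derive_atan_line (s p q x : R) : 0 < s ->
  is_derive x 1 (fun t : R => atan (p / s + t * (q / s)))
    (q * s / (s ^+ 2 + (p + x * q) ^+ 2)).
Proof.
move=> s0; have h1 := is_derive_line (p / s) (q / s) x.
have h2 := is_derive1_atan (p / s + x * (q / s)).
have h := @is_derive1_comp R (@atan R) (fun t => p / s + t * (q / s)) x _ _ h2 h1.
apply: (is_derive_eq h).
have s1 : s != 0 by rewrite lt0r_neq0.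
have n0 : s ^+ 2 + (p + x * q) ^+ 2 != 0.
  by rewrite lt0r_neq0// ltr_pwDl ?exprn_gt0// sqr_ge0.
have n1 : 1 + (p / s + x * (q / s)) ^+ 2 != 0.
  by rewrite lt0r_neq0// ltr_pwDl ?ltr01// sqr_ge0.
by field; rewrite s1 n0.
Qed.

Lemma is_derive_ln_line (s p q x : R) : 0 < s ->
  is_derive x 1 (fun t : R => ln (s ^+ 2 + (p + t * q) ^+ 2) / 2)
    (q * (p + x * q) / (s ^+ 2 + (p + x * q) ^+ 2)).
Proof.
move=> s0.
have n0 y : 0 < s ^+ 2 + (p + y * q) ^+ 2.
  by rewrite ltr_pwDl ?exprn_gt0// sqr_ge0.
have h1 := is_derive_line p q x.
have h2 : is_derive x 1 (fun t : R => s ^+ 2 + (p + t * q) ^+ 2) (2 * (p + x * q) * q).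
  have h := @is_deriveD _ _ _ (fun=> s ^+ 2) _ x 1 _ _ (is_derive_cst _ _ _) (is_deriveX 2 h1).
  by apply: (is_derive_eq h); rewrite /GRing.scale /= expr1; ring.
have h3 := is_derive1_ln (n0 x).
have h4 := @is_derive1_comp R (@ln R) (fun t => s ^+ 2 + (p + t * q) ^+ 2) x _ _ h3 h2.
have := is_deriveZ (2^-1 : R) h4.
set v := (X in is_derive _ _ _ X).
have -> : 2^-1 \*: (@ln R \o (fun t => s ^+ 2 + (p + t * q) ^+ 2)) =
  (fun t : R => ln (s ^+ 2 + (p + t * q) ^+ 2) / 2).
  by apply/funext => t; exact: mulrC.
move=> h; apply: (is_derive_eq h); rewrite /v /GRing.scale /=.
by field; rewrite lt0r_neq0.
Qed.

Lemma atan_gt0 (x : R) : 0 < x -> 0 < atan x.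
Proof.
move=> x0; rewrite ltNge; apply/negP => a0.
have h1 := atan_gtNpi2 x; have h2 := atan_ltpi2 x.
have c0 : 0 < cos (atan x) by apply: cos_gt0_pihalf; rewrite h1 h2.
have s0 : 0 <= sin (- atan x).
  have pi0 := pi_gt0 R.
  by apply: sin_ge0_pi; apply/andP; split; lra.
have := atanK x; rewrite /tan => E.
have : 0 < sin (atan x) by rewrite -E in x0; move: x0; rewrite pmulr_lgt0// invr_gt0.
by rewrite sinN in s0; lra.
Qed.

Lemma atan_inv (x : R) : 0 < x -> atan x^-1 = pi / 2 - atan x.
Proof.
move=> x0; have a0 := atan_gt0 x0.
have h1 := atan_gtNpi2 x; have h2 := atan_ltpi2 x.
have <- : tan (pi / 2 - atan x) = x^-1.
  rewrite -[in RHS](atanK x) /tan sinB cosB sin_pihalf cos_pihalf.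
  by rewrite !mul1r !mul0r subr0 add0r invf_div.
have pi0 := pi_gt0 R.
by apply: tanK; rewrite in_itv /=; apply/andP; split; lra.
Qed.

Lemma atan_div_add (x y : R) : 0 < x -> 0 < y -> atan (x / y) + atan (y / x) = pi / 2.
Proof. by move=> x0 y0; rewrite -[y / x]invf_div atan_inv ?divr_gt0//; ring. Qed.

Definition linv (z : C) : C := z^-1.

Lemma contC_inv (t z : C) : z != t -> contC (fun w => (w - t)^-1) z.
Proof.
move=> zt e e0; set p := cabs (z - t).
have p0 : 0 < p by rewrite cabs_gt0 subr_eq0.
exists (Num.min (p / 2) (e * p ^+ 2 / 2)).
  by rewrite lt_min !divr_gt0// mulr_gt0// exprn_gt0.
move=> w; rewrite lt_min => /andP[w1 w2].
have wt : p / 2 < cabs (w - t).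
  have := cabs_lerB (z - t) (z - w); rewrite -/p cabsB in w1 *.
  have -> : z - t - (z - w) = w - t by ring.
  by move: w1; rewrite cabsB; lra.
have wt0 : w - t != 0 by rewrite -cabs_gt0; apply: lt_trans wt; rewrite divr_gt0.
have zt0 : z - t != 0 by rewrite subr_eq0.
have -> : (w - t)^-1 - (z - t)^-1 = (z - w) / ((w - t) * (z - t)) by field; rewrite zt0 wt0.
rewrite cabsM cabsV cabsM -/p ltr_pdivrMr; last by rewrite mulr_gt0// cabs_gt0.
rewrite cabsB; apply: lt_le_trans w2 _.
have -> : e * p ^+ 2 / 2 = e * (p / 2 * p) by field.
by rewrite ler_wpM2l ?(ltW e0)// ler_wpM2r ?(ltW p0)// ltW.
Qed.

Lemma linv_cont z : z != 0 -> contC linv z.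
Proof.
by move=> z0 e /(contC_inv z0)[d d0 hd]; exists d => // w; have := hd w; rewrite /linv !subr0.
Qed.

(** On a vertical line to the right of the origin the real and imaginary parts have explicit
    primitives: the logarithm of the modulus and the angle [atan (y / s)]. *)
Lemma seg_side (s p q : R) : 0 < s ->
  seg linv (s +i* p) (s +i* q) =
  (ln (s ^+ 2 + q ^+ 2) / 2 - ln (s ^+ 2 + p ^+ 2) / 2) +i* (atan (q / s) - atan (p / s)).
Proof.
move=> s0; pose r := q - p.
have pr : p + r = q by rewrite /r addrC subrK.
have n0 x : 0 < s ^+ 2 + (p + x * r) ^+ 2.
  by rewrite ltr_pwDl ?exprn_gt0// sqr_ge0.
pose g (t : R) : C := (r * (p + t * r) / (s ^+ 2 + (p + t * r) ^+ 2)) +i*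
   (r * s / (s ^+ 2 + (p + t * r) ^+ 2)).
have E t : (0 +i* r) * linv (segpath (s +i* p) (s +i* q) t) = g t.
  rewrite /segpath /linv -/(r).
  have -> : s +i* p + t%:C * (s +i* q - (s +i* p)) = s +i* (p + t * r).
    by apply/eqP; rewrite eq_complex /= subrr !mulr0 !mul0r subr0 !addr0 !eqxx.
  by apply/eqP; rewrite eq_complex /= /g /=; apply/andP; split; apply/eqP; field; rewrite lt0r_neq0.
have cg0 : scont linv (s +i* p) (s +i* q).
  apply: segpath_cont => t _; apply: linv_cont; rewrite eq_complex /= negb_and; apply/orP; left.
  by rewrite subrr !mul0r mulr0 subr0 addr0 lt0r_neq0.
have gE : g = fun t => (0 +i* r) * linv (segpath (s +i* p) (s +i* q) t) + 0.
  by apply/funext => t; rewrite addr0 E.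
have cg : ccont g by rewrite gE; apply: ccont_lc => //; exact: ccont_cst.
have -> : seg linv (s +i* p) (s +i* q) = crint g.
  rewrite gE crint_lc//; last exact: ccont_cst.
  by rewrite crint_cst addr0 segE; congr (_ * _); apply/eqP; rewrite eq_complex /= subrr !eqxx.
rewrite /crint /cintegral; congr (_ +i* _).
  have cRe := ccont_within (h := @complex.Re R) (@Re_lip R) cg.
  rewrite (ftc01 (fun x => is_derive_ln_line p r x s0) cRe).
  by rewrite mul1r mul0r addr0 pr.
have cIm := ccont_within (h := @complex.Im R) (@Im_lip R) cg.
rewrite (ftc01 (fun x => is_derive_atan_line p r x s0) cIm).
by rewrite mul1r mul0r addr0 -mulrDl pr.
Qed.

Lemma scont_linv z w : (forall t, segpath z w t != 0) -> scont linv z w.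
Proof. by move=> h; apply: segpath_cont => t _; exact: linv_cont. Qed.

Lemma seg_linv_scale (k z w : C) : k != 0 -> scont linv z w ->
  seg linv (k * z) (k * w) = seg linv z w.
Proof.
move=> k0 cs; rewrite !segE.
have E t : linv (segpath (k * z) (k * w) t) = k^-1 * linv (segpath z w t) + 0.
  rewrite /segpath /linv.
  have -> : k * z + t%:C * (k * w - k * z) = k * (z + t%:C * (w - z)) by ring.
  by rewrite invfM addr0.
rewrite (eq_crint (fun t _ => E t)) crint_lc//; last exact: ccont_cst.
by rewrite crint_cst addr0 -mulrBr mulrA [k * _]mulrC mulfK.
Qed.

(** Multiplication by [i], [-i] and [-1] moves the other three sides to the right of the origin
    without changing the integral. The logarithms cancel, and the two arctangents at each corner add
    up to a right angle, four in all. *)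
Lemma RI_inv (a b c d : R) : a < 0 -> 0 < c -> b < 0 -> 0 < d ->
  RI linv a b c d = (2 * pi)%:C * 'i%C.
Proof.
move=> a0 c0 b0 d0; rewrite RIE.
have i0 : 'i%C != 0 :> C by rewrite eq_complex /= oner_eq0 andbF.
have sh x y z : y != 0 -> scont linv (x +i* y) (z +i* y).
  move=> y0; apply: scont_linv => t; rewrite eq_complex /= negb_and; apply/orP; right.
  by rewrite subrr mulr0 mul0r !addr0.
have sv x y z : x != 0 -> scont linv (x +i* y) (x +i* z).
  move=> y0; apply: scont_linv => t; rewrite eq_complex /= negb_and; apply/orP; left.
  by rewrite subrr mulr0 mul0r subr0 !addr0.
rewrite -(@seg_linv_scale 'i%C (a +i* b) (c +i* b))//; last by apply: sh; rewrite ltr0_neq0.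
rewrite -(@seg_linv_scale (- 'i%C) (c +i* d) (a +i* d)) ?oppr_eq0//; last first.
  by apply: sh; rewrite gt_eqF.
rewrite -(@seg_linv_scale (-1) (a +i* d) (a +i* b)) ?oppr_eq0 ?oner_eq0//; last first.
  by apply: sv; rewrite ltr0_neq0.
have e1 x y : 'i%C * (x +i* y) = (- y) +i* x :> C.
  by apply/eqP; rewrite eq_complex /=; apply/andP; split; apply/eqP; ring.
have e2 x y : - 'i%C * (x +i* y) = y +i* (- x) :> C.
  by apply/eqP; rewrite eq_complex /=; apply/andP; split; apply/eqP; ring.
have e3 x y : -1 * (x +i* y) = (- x) +i* (- y) :> C.
  by rewrite mulN1r.
rewrite !e1 !e2 !e3 !seg_side ?oppr_gt0//.
have b1 : 0 < - b by lra.
have a1 : 0 < - a by lra.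
have h1 := atan_div_add c0 b1; have h2 := atan_div_add d0 c0.
have h3 := atan_div_add d0 a1; have h4 := atan_div_add a1 b1.
have k1 : atan (a / - b) = - atan (- a / - b) by rewrite -atanN mulNr opprK.
have k2 : atan (b / c) = - atan (- b / c) by rewrite -atanN mulNr opprK.
have k3 : atan (- c / d) = - atan (c / d) by rewrite -atanN mulNr.
have k4 : atan (- d / - a) = - atan (d / - a) by rewrite -atanN mulNr.
apply/eqP; rewrite eq_complex /= k1 k2 k3 k4 !sqrrN; apply/andP; split; apply/eqP.
  rewrite mulr0 mul0r subr0 [a ^+ 2 + d ^+ 2]addrC [b ^+ 2 + c ^+ 2]addrC.
  by rewrite [d ^+ 2 + c ^+ 2]addrC [b ^+ 2 + a ^+ 2]addrC; ring.
by rewrite mulr1 mul0r addr0; lra.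
Qed.

End WindingNumber.

(** * Cauchy's formula on a rectangle *)

Section CauchyFormula.
Variable R : realType.
Local Notation C := (R[i]).
Implicit Types (f g : C -> C) (z w t : C).

(** The second order is kept because the difference quotient of [f] has to be differentiable at its
    own centre. The cubic remainder comes from bounds on the coefficients at half the given
    radius. *)
Lemma analytic_expand f z : analytic_at f z ->
  exists a0 a1 a2 : C, exists K d : R, [/\ 0 < d, 0 <= K & forall u, cabs u < d ->
    cabs (f (z + u) - (a0 + a1 * u + a2 * u ^+ 2)) <= K * cabs u ^+ 3].
Proof.
move=> [r [a [r0 ha]]].
pose rho := r / 2; have rho0 : 0 < rho by rewrite divr_gt0.
have key u : cabs u < r -> forall e, 0 < e -> exists N, forall n, (N <= n)%N ->
    cabs (\sum_(k < n) a k * u ^+ k - f (z + u)) < e.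
  move=> ur e e0.
  have := ha (z + u); rewrite (_ : z + u - z = u); last by rewrite addrC addKr.
  move=> /(_ ur)/cvgCP/(_ e e0)[N _ hN]; exists N => n Nn.
  by have := hN n Nn; rewrite /series /= big_mkord.
have rr : cabs (rho%:C : C) < r.
  by rewrite cabs_real gtr0_norm// /rho ltr_pdivrMr// ltr_pMr// ltr1n.
have [N hN] := key _ rr 1 ltr01.
(* The terms of index at least [N] are differences of partial sums within 1 of the limit, hence at
   most 2; the earlier ones are covered by their sum. *)
pose M := 2 + \sum_(k < N) cabs (a k) * rho ^+ k.
have M0 : 0 <= M.
  by rewrite addr_ge0// sumr_ge0// => i _; rewrite mulr_ge0 ?cabs_ge0 ?exprn_ge0// ltW.
have aM k : cabs (a k) * rho ^+ k <= M.
  have [kN|Nk] := ltnP k N.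
    rewrite /M (bigD1 (Ordinal kN)) //= addrCA lerDl addr_ge0// sumr_ge0// => i _.
    by rewrite mulr_ge0 ?cabs_ge0 ?exprn_ge0// ltW.
  have h1 := hN k Nk; have h2 := hN k.+1 (leqW Nk).
  rewrite big_ord_recr /= in h2.
  have -> : cabs (a k) * rho ^+ k = cabs (a k * (rho%:C : C) ^+ k).
    by rewrite cabsM cabsX cabs_real gtr0_norm.
  move: h1 h2; set S := \sum_(i < k) _; set x := a k * _; set y := f _ => h1 h2.
  have -> : x = (S + x - y) - (S - y) by ring.
  apply: le_trans (cabsD _ _) _; rewrite cabsN /M.
  apply: le_trans (lerD (ltW h2) (ltW h1)) _.
  rewrite -[1 + 1]/(2%:R) lerDl sumr_ge0// => i _.
  by rewrite mulr_ge0 ?cabs_ge0 ?exprn_ge0// ltW.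
exists (a 0%N), (a 1%N), (a 2%N), (2 * M / rho ^+ 3), (rho / 2).
split; first by rewrite divr_gt0.
  by rewrite divr_ge0 ?mulr_ge0 ?exprn_ge0// ltW.
move=> u hu; pose q := cabs u / rho.
have q0 : 0 <= q by rewrite divr_ge0 ?cabs_ge0// ltW.
have q2 : q <= 2^-1 by rewrite ler_pdivrMr// mulrC ltW.
have -> : 2 * M / rho ^+ 3 * cabs u ^+ 3 = 2 * M * q ^+ 3.
  by rewrite /q; field; rewrite lt0r_neq0.
apply/ler_addgt0Pl => e e0.
have ur : cabs u < r.
  by apply: lt_trans hu _; rewrite /rho; lra.
have [N' hN'] := key u ur e e0.
pose n := N'; have hn := hN' (3 + n)%N (leq_addl _ _).
have E : \sum_(k < 3 + n) a k * u ^+ k =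
    (a 0%N + a 1%N * u + a 2%N * u ^+ 2) + \sum_(k < n) a (3 + k)%N * u ^+ (3 + k).
  rewrite big_split_ord /=; congr (_ + _).
  by rewrite !big_ord_recl big_ord0 /= !expr0 !addr0 mulr1 addrA expr1.
have B : cabs (\sum_(k < n) a (3 + k)%N * u ^+ (3 + k)) <= 2 * M * q ^+ 3.
  apply: le_trans (cabs_sum _ _ _) _.
  apply: (@le_trans _ _ (\sum_(k < n) M * q ^+ 3 * q ^+ k)).
    apply: ler_sum => k _; rewrite cabsM cabsX -mulrA -exprD.
    have -> : cabs u = q * rho by rewrite divfK// lt0r_neq0.
    by rewrite exprMn mulrCA [leRHS]mulrC ler_wpM2l ?exprn_ge0.
  rewrite -mulr_sumr.
  have S2 : \sum_(k < n) q ^+ k <= 2.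
    have := subrX1 q n; have := exprn_ge0 n q0.
    have : 0 <= \sum_(k < n) q ^+ k by apply: sumr_ge0 => k _; exact: exprn_ge0.
    by move=> s0 p0 h; nra.
  have := mulr_ge0 M0 (exprn_ge0 3 q0); nra.
move: hn; rewrite E; set A := a 0%N + _ + _ in E *; set S := \sum_(k < n) _ in E B *.
move=> hn; have -> : f (z + u) - A = - (A + S - f (z + u)) + S by ring.
by apply: le_trans (cabsD _ _) _; rewrite cabsN lerD// ltW.
Qed.

Lemma analytic_diff f z : analytic_at f z -> diffC f z.
Proof.
move=> /analytic_expand[a0 [a1 [a2 [K [d [d0 K0 h]]]]]].
have fz : f z = a0.
  have := h 0; rewrite cabs0 !expr0n /= !mulr0 !addr0 => /(_ d0) h0.
  by apply/eqP; rewrite -subr_eq0 -cabs_eq0 eq_le h0 cabs_ge0.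
exists a1 => e e0; pose k := cabs a2 + K + 1.
have k0 : 0 < k by rewrite ltr_wpDl// addr_ge0 ?cabs_ge0.
exists (Num.min d (Num.min 1 (e / k))); first by rewrite !lt_min d0 ltr01 divr_gt0.
move=> w; rewrite !lt_min => /andP[wd /andP[w1 we]].
pose u := w - z; have wE : w = z + u by rewrite /u addrC subrK.
have := h u; rewrite -wE -/u => /(_ wd) hu.
have -> : f w - f z - a1 * u = (f w - (a0 + a1 * u + a2 * u ^+ 2)) + a2 * u ^+ 2.
  by rewrite fz; ring.
apply: le_trans (cabsD _ _) _; rewrite cabsM cabsX.
have u0 := cabs_ge0 u; have a20 := cabs_ge0 a2.
move: we; rewrite ltr_pdivlMr// -/u => we.
have : cabs u * (cabs u * k) <= cabs u * e by rewrite ler_wpM2l// ltW.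
have : K * cabs u ^+ 3 <= K * cabs u ^+ 2.
  by rewrite ler_wpM2l// [leLHS]exprS ler_piMl ?exprn_ge0// ltW.
rewrite /k; nra.
Qed.

Lemma diff_quot f (k t z : C) : z != t -> diffC f z -> diffC (fun w => (f w - k) / (w - t)) z.
Proof.
move=> zt [b hb]; pose p := z - t; pose F := f z - k.
have p0 : p != 0 by rewrite subr_eq0.
have cp : 0 < cabs p by rewrite cabs_gt0.
(* The derivative given by the quotient rule, with [p = z - t] and [F = f z - k]. *)
exists ((b * p - F) / p ^+ 2) => e e0.
have e1 : 0 < e * cabs p / 4 by rewrite divr_gt0// mulr_gt0.
have [d1 d10 h1] := hb _ e1.
have L0 : 0 < cabs (F - b * p) + 1 by rewrite ltr_wpDl ?cabs_ge0.
exists (Num.min d1 (Num.min (cabs p / 2) (e * cabs p ^+ 3 / 4 / (cabs (F - b * p) + 1)))).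
  by rewrite !lt_min d10 !divr_gt0// mulr_gt0// exprn_gt0.
move=> w; rewrite !lt_min => /andP[wd /andP[w2 w3]].
pose de := w - z; have := h1 _ wd; rewrite -/de; set E := f w - f z - b * de => hE.
rewrite -/de in w2 w3.
have pd : cabs p / 2 <= cabs (p + de).
  by have := cabs_lerB p (- de); rewrite opprK cabsN; lra.
have pd0 : 0 < cabs (p + de) by apply: lt_le_trans pd; rewrite divr_gt0.
have pdn : p + de != 0 by rewrite -cabs_gt0.
have wt : w - t = p + de by rewrite /p /de; ring.
have fw : f w - k = F + b * de + E by rewrite /E /F; ring.
have -> : (f w - k) / (w - t) - (f z - k) / (z - t) - (b * p - F) / p ^+ 2 * de =
  E / (p + de) + de ^+ 2 * (F - b * p) / (p ^+ 2 * (p + de)).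
  by rewrite fw wt -/F -/p; field; rewrite p0 pdn.
apply: le_trans (cabsD _ _) _.
have X1 : cabs (E / (p + de)) = cabs E * (cabs (p + de))^-1 by rewrite cabsM cabsV.
have X2 : cabs (de ^+ 2 * (F - b * p) / (p ^+ 2 * (p + de))) =
    cabs de ^+ 2 * cabs (F - b * p) * (cabs p ^+ 2 * cabs (p + de))^-1.
  rewrite (cabsM (de ^+ 2 * (F - b * p))) cabsV (cabsM (de ^+ 2) (F - b * p)).
  by rewrite (cabsM (p ^+ 2) (p + de)) !cabsX.
rewrite X1 X2; have i1 : (cabs (p + de))^-1 <= 2 / cabs p.
  by rewrite -[leRHS]invf_div lef_pV2// posrE divr_gt0.
have B1 : cabs E * (cabs (p + de))^-1 <= e / 2 * cabs de.
  apply: (@le_trans _ _ (e * cabs p / 4 * cabs de * (2 / cabs p))).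
    by rewrite ler_pM ?cabs_ge0 ?invr_ge0 ?cabs_ge0.
  by rewrite le_eqVlt; apply/orP; left; apply/eqP; field; rewrite lt0r_neq0.
have B2 : cabs de ^+ 2 * cabs (F - b * p) * (cabs p ^+ 2 * cabs (p + de))^-1 <= e / 2 * cabs de.
  rewrite invfM.
  apply: (@le_trans _ _ (cabs de ^+ 2 * cabs (F - b * p) * ((cabs p ^+ 2)^-1 * (2 / cabs p)))).
    by rewrite ler_wpM2l ?mulr_ge0 ?exprn_ge0 ?cabs_ge0// ler_wpM2l ?invr_ge0 ?exprn_ge0 ?cabs_ge0.
  have -> : cabs de ^+ 2 * cabs (F - b * p) * ((cabs p ^+ 2)^-1 * (2 / cabs p)) =
     2 * (cabs de * cabs (F - b * p)) / cabs p ^+ 3 * cabs de.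
    by field; rewrite lt0r_neq0.
  rewrite ler_wpM2r ?cabs_ge0// ler_pdivrMr ?exprn_gt0//.
  move: w3; rewrite ltr_pdivlMr// => w3; have := cabs_ge0 de.
  lra.
lra.
Qed.

(** The value [a1] removes the singularity at [t], and the derivative there is the second Taylor
    coefficient. *)
Lemma diff_quot_at f t : analytic_at f t ->
  exists a1, diffC (fun w => if w == t then a1 else (f w - f t) / (w - t)) t.
Proof.
move=> /analytic_expand[a0 [a1 [a2 [K [d [d0 K0 h]]]]]].
have ft : f t = a0.
  have := h 0; rewrite cabs0 !expr0n /= !mulr0 !addr0 => /(_ d0) h0.
  by apply/eqP; rewrite -subr_eq0 -cabs_eq0 eq_le h0 cabs_ge0.
exists a1, a2 => e e0; have k0 : 0 < K + 1 by rewrite ltr_wpDl.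
exists (Num.min d (e / (K + 1))); first by rewrite lt_min d0 divr_gt0.
move=> w; rewrite lt_min => /andP[wd we]; rewrite eqxx; case: eqP => [->|/eqP wt].
  by rewrite !subrr mulr0 subrr cabs0 mulr0.
pose u := w - t; have wE : w = t + u by rewrite /u addrC subrK.
have u0 : u != 0 by rewrite subr_eq0.
have := h u; rewrite -wE -/u => /(_ wd) hu.
have -> : (f w - f t) / u - a1 - a2 * u = (f w - (a0 + a1 * u + a2 * u ^+ 2)) / u.
  by rewrite ft; field.
have cu : 0 < cabs u by rewrite cabs_gt0.
rewrite cabsM cabsV ler_pdivrMr//; apply: le_trans hu _.
move: we; rewrite ltr_pdivlMr// -/u => we.
have := mulr_ge0 (ltW cu) (ltW cu); nra.
Qed.

Lemma diffC_near g h z d : 0 < d -> (forall w, cabs (w - z) < d -> g w = h w) ->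
  diffC g z -> diffC h z.
Proof.
move=> d0 gh [b hb]; exists b => e e0; have [d1 d10 h1] := hb _ e0.
exists (Num.min d d1); first by rewrite lt_min d0.
move=> w; rewrite lt_min => /andP[/gh <- /h1]; rewrite -(gh z)// subrr cabs0//.
Qed.

Lemma contC_mul g h z : contC g z -> contC h z -> contC (fun w => g w * h w) z.
Proof.
move=> cg ch e e0.
have g0 : 0 < cabs (g z) + 1 by rewrite ltr_wpDl ?cabs_ge0.
have h0 : 0 < cabs (h z) + 1 by rewrite ltr_wpDl ?cabs_ge0.
have [d1 d10 h1] := cg _ (divr_gt0 (divr_gt0 e0 (ltr0n _ 2)) h0).
have [d2 d20 h2] := ch _ (divr_gt0 (divr_gt0 e0 (ltr0n _ 2)) g0).
have [d3 d30 h3] := cg _ ltr01.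
exists (Num.min d1 (Num.min d2 d3)); first by rewrite !lt_min d10 d20.
move=> w; rewrite !lt_min => /andP[/h1 k1 /andP[/h2 k2 /h3 k3]].
have -> : g w * h w - g z * h z = (g w - g z) * h z + g w * (h w - h z) by ring.
apply: le_lt_trans (cabsD _ _) _; rewrite !cabsM (splitr e).
have gw : cabs (g w) <= cabs (g z) + 1.
  by have := cabs_lerB (g w) (g z); lra.
apply: ltr_leD.
  rewrite ltr_pdivlMr// in k1; apply: le_lt_trans k1.
  by rewrite ler_wpM2l ?cabs_ge0// lerDl.
rewrite -[leRHS](divfK (lt0r_neq0 g0)) mulrC ler_pM ?cabs_ge0// ltW//.
Qed.

Lemma RI_shift g a b c d (t : C) : RI (fun w => g (w - t)) a b c d =
  RI g (a - complex.Re t) (b - complex.Im t) (c - complex.Re t) (d - complex.Im t).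
Proof.
have E z w : seg (fun w => g (w - t)) z w = seg g (z - t) (w - t).
  rewrite !segE; have -> : w - t - (z - t) = w - z by ring.
  congr (_ * _); apply: eq_crint => s _; congr g; rewrite /segpath; ring.
by rewrite !RIE !E; case: t E => x y _ /=.
Qed.

Lemma side_pts a b c d z w s : a < c -> b < d -> 0 <= s <= 1 ->
  (z, w) \in [:: (a +i* b, c +i* b); (c +i* b, c +i* d); (c +i* d, a +i* d); (a +i* d, a +i* b)] ->
  inrect a b c d (segpath z w s) /\
  ~ (a < complex.Re (segpath z w s) < c /\ b < complex.Im (segpath z w s) < d) :> Prop.
Proof.
move=> ac bd s01; rewrite !inE => H; split.
  by apply: segpath_inrect => //; case/or4P: H => /eqP[? ?]; subst z w; rewrite /inrect /=;
    split; apply/andP; split; lra.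
case/or4P: H => /eqP[? ?]; subst z w; rewrite /segpath /= !subrr !mul0r ?mulr0 ?subr0 ?add0r ?addr0 => -[];
  by rewrite ?ltxx ?andbF.
Qed.

Definition sides (p : C * C) : seq (C * C) :=
  let se := complex.Re p.2 +i* complex.Im p.1 in
  let nw := complex.Re p.1 +i* complex.Im p.2 in
  [:: (p.1, se); (se, p.2); (p.2, nw); (nw, p.1)].

Lemma rect_integralE g p : rect_integral g p = \sum_(s <- sides p) seg g s.1 s.2.
Proof. by rewrite !big_cons big_nil addr0 /= !addrA. Qed.

Definition good_rect (p : C * C) :=
  complex.Re p.1 < complex.Re p.2 /\ complex.Im p.1 < complex.Im p.2.

Definition on_segs (L : seq (C * C)) (u : C) :=
  exists zw s, [/\ zw \in L, 0 <= s <= 1 & u = segpath zw.1 zw.2 s].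

Lemma sides_pts p u : good_rect p -> on_segs (sides p) u ->
  rect_closed p u /\ ~ rect_open p u.
Proof.
case: p => [[a b] [c d]] [/= ac bd] [[z w] [s [h s01 ->]]].
by have [h1 h2] := side_pts ac bd s01 h; split.
Qed.

Lemma rect_open_closed (p : C * C) z : rect_open p z -> rect_closed p z.
Proof. by move=> [/andP[/ltW h1 /ltW h2] /andP[/ltW h3 /ltW h4]]; split; apply/andP. Qed.

Lemma cauchy_out f p t : good_rect p -> ~ rect_closed p t ->
  (forall z, rect_closed p z -> analytic_at f z) ->
  rect_integral (fun z => f z / (z - t)) p = 0.
Proof.
case: p => [[a b] [c d]] [/= /ltW ac /ltW bd] nt af.
apply: (@goursat R (fun z => f z / (z - t)) a b c d ac bd) => u hu.
have ut : u != t by apply/eqP => E; apply: nt; rewrite -E.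
have := diff_quot 0 ut (analytic_diff (af _ hu)).
by congr diffC; apply/funext => w; rewrite subr0.
Qed.

(** On the sides [f z / (z - t)] is [f t / (z - t)] plus the difference quotient with its
    singularity removed; the latter integrates to zero by [goursat], and the former is computed in
    [RI_inv]. *)
Lemma cauchy_in f p t : good_rect p -> rect_open p t ->
  (forall z, rect_closed p z -> analytic_at f z) ->
  rect_integral (fun z => f z / (z - t)) p = (2 * pi)%:C * 'i%C * f t.
Proof.
move=> gp ot af; have [a1 ha1] := diff_quot_at (af _ (rect_open_closed ot)).
set g := (fun w => if w == t then a1 else _) in ha1.
have dg u : rect_closed p u -> diffC g u.
  move=> hu; have [->//|ut] := eqVneq u t.
  have := diff_quot (f t) ut (analytic_diff (af _ hu)).
  apply: (@diffC_near _ _ _ (cabs (u - t))); first by rewrite cabs_gt0 subr_eq0.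
  move=> w wu; rewrite /g; case: eqP => [wt|//].
  by move: wu; rewrite wt cabsB ltxx.
have G : rect_integral g p = 0.
  by case: (p) gp dg => [[a b] [c d]] [/= /ltW ac /ltW bd] dg; exact: goursat.
have bt z w s : (z, w) \in sides p -> 0 <= s <= 1 ->
    rect_closed p (segpath z w s) /\ segpath z w s != t.
  move=> zw s01; have [] := @sides_pts p (segpath z w s) gp.
    by exists (z, w), s.
  by move=> h1 h2; split => //; apply/eqP => E; apply: h2; rewrite E.
have E : rect_integral (fun z => f z / (z - t)) p =
    f t * rect_integral (fun z => linv (z - t)) p + rect_integral g p.
  rewrite !rect_integralE mulr_sumr -big_split /= !big_seq; apply: eq_bigr => -[z w] zw /=.
  rewrite -seg_lc; last 2 first.
  - apply: segpath_cont => s s01; have [_ h] := bt z w s zw s01.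
    exact: contC_inv.
  - apply: segpath_cont => s s01; have [h _] := bt z w s zw s01.
    exact: diffC_cont (dg _ h).
  apply: eq_seg => s s01; have [_ h] := bt z w s zw s01.
  by rewrite /g (negbTE h) /linv; field; rewrite subr_eq0.
rewrite E G addr0 mulrC; congr (_ * _).
case: (p) gp ot => [[a b] [c d]] [/= ac bd] [/= /andP[t1 t2] /andP[t3 t4]].
rewrite -[LHS]/(RI (fun z => linv (z - t)) a b c d) RI_shift RI_inv//; lra.
Qed.

End CauchyFormula.

(** * Contours around a compact set of reals *)

Section Contours.
Variable R : realType.
Local Notation C := (R[i]).
Implicit Types (f : C -> C) (z w : C) (Q : seq (C * C)) (K : set R).

Lemma bounded_real K : compact K -> exists2 M, 0 < M & forall t, K t -> `|t| <= M.
Proof.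
move=> cK; have := @compact_bounded R R^o K cK.
move=> /pinfty_ex_gt0[M M0 hM]; exists M => // t Kt; exact: hM.
Qed.

Lemma real_compact K M : closed K -> (forall t, K t -> `|t| <= M) -> compact K.
Proof.
move=> clK hM; apply: (@subclosed_compact _ _ `[(- M), M]) => //.
  exact: segment_compact.
by move=> t /hM; rewrite /= in_itv /= ler_norml.
Qed.

Definition encloses K Q := [/\ forall p, p \in Q -> good_rect p,
  trivIset [set i | (i < size Q)%N] (fun i => rect_closed (nth (0, 0) Q i)) &
  forall t, K t -> exists2 p, p \in Q & rect_open p t%:C].

(* The rectangles sit over the maximal runs of mesh cells that meet [K]. *)
Lemma encloses_exists K (P : C -> Prop) : compact K ->
  (forall t, K t -> exists2 d : R, 0 < d & forall z, cabs (z - t%:C) < d -> P z) ->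
  exists Q, encloses K Q /\ forall p z, p \in Q -> rect_closed p z -> P z.
Proof.
move=> cK hP; have [M M0 hM] := bounded_real cK.
have [|de de0 hde] := @lebesgue_number R K
    (fun d t => forall z, cabs (z - t%:C) < d -> P z) cK.
  move=> x /hP[d d0 hd]; exists (d / 2) => [|x' e xx' /andP[e0 e2] z zx'].
    by rewrite divr_gt0.
  apply: hd; apply: le_lt_trans (cabs_dist _ x'%:C _) _.
  by rewrite -realCB cabs_real; lra.
(* A point of a rectangle built on a marked cell lies within [2 * mu + mu / 2 < de] of a point of
   [K]. *)
pose mu := de / 4; have mu0 : 0 < mu by rewrite divr_gt0.
pose x (i : nat) := - M + i%:R * mu.
have xS i : x i.+1 = x i + mu by rewrite /x -natr1; ring.
have xle i j : (i <= j)%N -> x i <= x j.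
  by move=> ij; rewrite lerD2l ler_wpM2r ?(ltW mu0)// ler_nat.
pose N := (Num.truncn (2 * M / mu)).+1.
have xN : M < x N.
  have : 2 * M / mu < N%:R by rewrite truncnS_gt// divr_ge0 ?mulr_ge0// ltW.
  by rewrite ltr_pdivrMr// /x; lra.
pose mk i := `[< exists2 t, K t & x i <= t <= x i.+1 >] && (i < N)%N.
have mkN : ~~ mk N by rewrite /mk ltnn andbF.
have cell t : K t -> exists2 i, mk i & x i <= t <= x i.+1.
  move=> Kt; have := hM _ Kt; rewrite ler_norml => /andP[t1 t2].
  have r0 : 0 <= (t + M) / mu by rewrite divr_ge0 ?(ltW mu0)//; lra.
  pose i := Num.truncn ((t + M) / mu).
  have i1 : x i <= t.
    have : i%:R <= (t + M) / mu by rewrite truncn_le.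
    by rewrite ler_pdivlMr// /x; lra.
  have i2 : t < x i.+1.
    have : (t + M) / mu < i.+1%:R by rewrite truncnS_gt.
    by rewrite ltr_pdivrMr// /x; lra.
  exists i; last by rewrite i1 ltW.
  rewrite /mk; apply/andP; split; first by apply/asboolP; exists t => //; rewrite i1 ltW.
  rewrite ltnNge; apply/negP => Ni; have := xle _ _ Ni; lra.
(* [mk] marks the cells that meet [K]; [st i] says that a run of marked cells starts at [i], and
   [e i] below is the first unmarked index after it. *)
pose st i := mk i && ((i == 0%N) || ~~ mk i.-1).
have exe i : mk i -> exists j, (i <= j)%N && ~~ mk j.
  by move=> /andP[_ iN]; exists N; rewrite ltnW.
pose e i := if pselect (exists j, (i <= j)%N && ~~ mk j) is left h then ex_minn h else N.
have eP i : mk i -> [/\ (i < e i)%N, ~~ mk (e i) & forall j, (i <= j < e i)%N -> mk j].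
  move=> mi; rewrite /e; case: pselect => [h|[]]; last exact: exe.
  case: ex_minnP => m /andP[im mm] hm; split => //.
    by rewrite ltn_neqAle im andbT; apply: contraNneq mm => <-.
  move=> j /andP[ij jm]; apply: contraTT jm => mj; rewrite -leqNgt.
  by apply: hm; rewrite ij.
(* Two runs are separated by a full cell of width [mu], so enlarging each by [mu / 3] at both ends
   keeps the rectangles disjoint and puts [K] in their interiors. *)
pose rc i : C * C := ((x i - mu / 3) +i* (- (mu / 2)), (x (e i) + mu / 3) +i* (mu / 2)).
pose S := [seq i <- iota 0 N | st i].
have uS : uniq S by rewrite filter_uniq// iota_uniq.
have stS i : i \in S -> st i by rewrite mem_filter => /andP[].
have sep i j z : st i -> st j -> (i < j)%N -> rect_closed (rc i) z -> rect_closed (rc j) z -> False.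
  move=> /andP[mi _] /andP[mj /orP[/eqP-> //|mj1]] ij.
  have [ie _ he] := eP _ mi.
  have ej : ((e i).+1 <= j)%N.
    case: j ij mj mj1 => // j ij mj mj1; rewrite ltnS leqNgt; apply/negP => je.
    by move/negP: mj1; apply; apply: he; rewrite -ltnS ij.
  have := xle _ _ ej; rewrite xS => h.
  move=> [/= /andP[_ h1] _] [/= /andP[h2 _] _]; lra.
exists [seq rc i | i <- S]; split; [split|].
- move=> p /mapP[i /stS/andP[mi _] ->]; have [ie _ _] := eP _ mi.
  have := xle _ _ (ltnW ie); rewrite /good_rect /=; split; lra.
- move=> i j /=; rewrite size_map => iS jS [z [/= zi zj]].
  rewrite (nth_map 0%N) // in zi; rewrite (nth_map 0%N) // in zj.
  have [ij|ij|//] := ltngtP (nth 0%N S i) (nth 0%N S j).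
  - by exfalso; apply: (sep _ _ z _ _ ij) => //; apply: stS; exact: mem_nth.
  - by exfalso; apply: (sep _ _ z _ _ ij) => //; apply: stS; exact: mem_nth.
  - by move=> /eqP; rewrite nth_uniq// => /eqP.
- move=> t Kt; have [i mi /andP[t1 t2]] := cell _ Kt.
  have [s [ss si hs]] : exists s, [/\ st s, (s <= i)%N & forall j, (s <= j <= i)%N -> mk j].
    elim: i mi {t1 t2} => [|i IH] mi.
      exists 0%N; split => //; first by rewrite /st mi eqxx.
      by move=> j; rewrite leqn0 => /andP[_ /eqP->].
    have [/IH[s [ss si hs]]|mi'] := boolP (mk i).
      exists s; split => //; first exact: leqW.
      move=> j /andP[sj]; rewrite leq_eqVlt => /orP[/eqP->//|]; rewrite ltnS => ji.
      by apply: hs; rewrite sj.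
    exists i.+1; split => //; first by rewrite /st mi /= mi'.
    by move=> j /andP[h1 h2]; have -> : j = i.+1 by apply/eqP; rewrite eqn_leq h1 h2.
  exists (rc s).
    apply: map_f; rewrite mem_filter ss mem_iota /=.
    by case/andP: ss => /andP[_ ->].
  have ms : mk s by case/andP: ss.
  have [_ me _] := eP _ ms.
  have ie : (i.+1 <= e s)%N.
    rewrite ltnNge; apply/negP => ei; move/negP: me; apply; apply: hs.
    by rewrite ei andbT; have [h _ _] := eP _ ms; exact: ltnW.
  have := xle _ _ si; have := xle _ _ ie => h1 h2.
  by split => /=; apply/andP; split; lra.
move=> p z /mapP[s /stS ss ->] [/= /andP[z1 z2] /andP[y1 y2]].
have ms : mk s by case/andP: ss.
have [se me he] := eP _ ms.
have near i : mk i -> x i - mu / 3 <= complex.Re z <= x i.+1 + mu / 3 -> P z.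
  move=> /andP[/asboolP[t Kt /andP[t1 t2]] _] /andP[r1 r2].
  apply: (hde _ Kt); apply: le_lt_trans (cabs_le_ReIm _) _.
  rewrite cReD cImD cReN cImN /= subr0.
  have -> : de = mu * 4 by rewrite /mu divfK.
  have n1 : `|complex.Re z - t| <= 2 * mu by rewrite ler_norml; rewrite xS in r2 t2; apply/andP; split; lra.
  have n2 : `|complex.Im z| <= mu / 2 by rewrite ler_norml; apply/andP.
  lra.
have key k : (s + k < e s)%N -> x s - mu / 3 <= complex.Re z <= x (s + k).+1 + mu / 3 -> P z.
  elim: k => [|k IH] ke.
    by rewrite addn0; apply: near.
  move=> /andP[r1 r2]; have [h|h] := leP (complex.Re z) (x (s + k).+1 + mu / 3).
    by apply: IH; [apply: ltn_trans ke; rewrite addnS|rewrite r1].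
  apply: (near (s + k.+1)%N); first by apply: he; rewrite ke leq_addr.
  by rewrite r2 andbT addnS; lra.
have [k ke] : exists k, e s = (s + k).+1.
  by exists (e s - s.+1)%N; rewrite -addSn subnKC.
by apply: (key k); rewrite -ke ?leqnn// z1.
Qed.

Definition contour Q : seq (C * C) := flatten [seq sides p | p <- Q].

Lemma contour_pts Q u : on_segs (contour Q) u -> exists2 p, p \in Q & on_segs (sides p) u.
Proof.
move=> [zw [s [/flattenP[/= l /mapP[p pQ ->] zp] s01 E]]].
by exists p => //; exists zw, s.
Qed.

Lemma contour_sum f Q : \sum_(p <- Q) rect_integral f p =
  \sum_(s <- contour Q) seg f s.1 s.2.
Proof.
rewrite /contour big_flatten /= big_map; apply: eq_bigr => p _.
exact: rect_integralE.
Qed.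

Lemma encloses_disj K Q p q z : encloses K Q -> p \in Q -> q \in Q ->
  rect_closed p z -> rect_closed q z -> p = q.
Proof.
move=> [_ tQ _] pQ qQ pz qz.
rewrite -(nth_index (0, 0) pQ) -(nth_index (0, 0) qQ); congr nth.
apply: tQ => /=; rewrite ?index_mem//.
by exists z; rewrite !nth_index.
Qed.

(** The contour stays out of the open rectangle around a given point of [K]: its own sides avoid its
    interior and the other rectangles are disjoint from it. Compactness makes the distance
    uniform. *)
Lemma encloses_dist K Q : compact K -> encloses K Q ->
  exists2 d, 0 < d & forall t u, K t -> on_segs (contour Q) u -> d <= cabs (u - t%:C).
Proof.
move=> cK eQ; have [gQ tQ hQ] := eQ.
have [|d d0 hd] := @lebesgue_number R K
    (fun d t => forall u, on_segs (contour Q) u -> d <= cabs (u - t%:C)) cK; last first.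
  by exists d => // t u Kt ou; exact: hd.
move=> t Kt; have [p pQ [/= /andP[t1 t2] /andP[t3 t4]]] := hQ _ Kt.
pose d := Num.min (Num.min (t - complex.Re p.1) (complex.Re p.2 - t))
                  (Num.min (0 - complex.Im p.1) (complex.Im p.2 - 0)).
have d0 : 0 < d by rewrite !lt_min !subr_gt0 t1 t2 t3.
exists (d / 2) => [|x' e xx' /andP[e0 e2] u ou]; first by rewrite divr_gt0.
rewrite leNgt; apply/negP => ue.
have ut : cabs (u - t%:C) < d.
  by apply: le_lt_trans (cabs_dist _ x'%:C _) _; rewrite -realCB cabs_real; lra.
have pu : rect_open p u.
  have := Re_lip u t%:C; have := Im_lip u t%:C; rewrite /= subr0.
  rewrite !lt_min in ut; case/andP: ut => /andP[d1 d2] /andP[d3 d4].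
  rewrite !ler_norml => /andP[k1 k2] /andP[k3 k4].
  by split; apply/andP; split; lra.
have [q qQ uq] := contour_pts ou.
have [h1 h2] := sides_pts (gQ _ qQ) uq; apply: h2.
by rewrite -(encloses_disj eQ pQ qQ (rect_open_closed pu) h1).
Qed.

(** Exactly one of the disjoint rectangles contains [t], and the others contribute nothing. *)
Lemma cauchy_contour f K Q t : encloses K Q -> K t ->
  (forall p z, p \in Q -> rect_closed p z -> analytic_at f z) ->
  \sum_(p <- Q) rect_integral (fun z => f z / (z - t%:C)) p = (2 * pi)%:C * 'i%C * f t%:C.
Proof.
move=> eQ Kt af; have [gQ tQ hQ] := eQ; have [p pQ pt] := hQ _ Kt.
have uQ : uniq Q.
  apply/(uniqP (0, 0)) => i j iQ jQ E; apply: tQ => //=.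
  have hi : nth (0, 0) Q i \in Q by exact: mem_nth.
  have [/ltW h1 /ltW h2] := gQ _ hi.
  by exists (nth (0, 0) Q i).1; rewrite /= -E; split; split; rewrite ?lexx ?h1 ?h2.
rewrite (bigD1_seq p)//= (cauchy_in (gQ _ pQ) pt); last by move=> z; exact: af.
rewrite big_seq_cond big1 ?addr0// => q /andP[qQ qp].
apply: cauchy_out; [exact: gQ| |by move=> z; exact: af].
move=> qt; move/eqP: qp; apply.
by rewrite (encloses_disj eQ qQ pQ qt (rect_open_closed pt)).
Qed.

(* The Riemann sum is uniform over the equi-Lipschitz functions [phi]. *)
Lemma contour_riemann f (L : seq (C * C)) (c e : R) : 0 <= c -> 0 < e ->
  (forall u, on_segs L u -> contC f u) ->
  exists W : seq (C * C), (forall k, k \in W -> on_segs L k.2) /\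
   forall phi : C -> C, (forall u, on_segs L u -> contC phi u) ->
    (forall u, on_segs L u -> cabs (phi u) <= c) ->
    (forall u v, on_segs L u -> on_segs L v -> cabs (phi u - phi v) <= c * cabs (u - v)) ->
    cabs (\sum_(s <- L) seg (fun z => f z * phi z) s.1 s.2 - \sum_(k <- W) k.1 * phi k.2) <= e.
Proof.
move=> c0; elim: L e => [|[z w] L IH] e e0 cf.
  by exists [::]; split => // phi _ _ _; rewrite !big_nil subrr cabs0 ltW.
have e2 : 0 < e / 2 by rewrite divr_gt0.
have onL u : on_segs L u -> on_segs ((z, w) :: L) u.
  by move=> [zw [s [h1 h2 h3]]]; exists zw, s; split => //; rewrite inE h1 orbT.
have [W [hW hphi]] := IH _ e2 (fun u h => cf u (onL u h)).
have onz s : 0 <= s <= 1 -> on_segs ((z, w) :: L) (segpath z w s).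
  by move=> s01; exists (z, w), s; split => //; rewrite inE eqxx.
have cg : scont f z w by apply: segpath_cont => s /onz; exact: cf.
pose ell := cabs (w - z); have ell0 : 0 <= ell by exact: cabs_ge0.
have [d1 d10 h1] := ccont_unif cg ltr01.
have [N1 N10 hN1] := small_inv d10.
have [M M0 hM] : exists2 M, 0 <= M & forall s, 0 <= s <= 1 -> cabs (f (segpath z w s)) <= M.
  exists (\sum_(i < N1.+1) cabs (f (segpath z w (i%:R / N1%:R))) + 1).
    by rewrite addr_ge0// sumr_ge0// => i _; exact: cabs_ge0.
  move=> s s01; pose i := Num.truncn (s * N1%:R).
  have N1p : 0 < N1%:R :> R by rewrite ltr0n.
  case/andP: (s01) => s0 s1.
  have r0 : 0 <= s * N1%:R by rewrite mulr_ge0// ltW.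
  have i1 : i%:R <= s * N1%:R by rewrite truncn_le.
  have i2 : s * N1%:R < i.+1%:R by rewrite truncnS_gt.
  have iN : (i < N1.+1)%N.
    rewrite ltnS -(ler_nat R); apply: le_trans i1 _; by rewrite ler_piMl// ltW.
  have t01 : 0 <= (i%:R : R) / N1%:R <= 1.
    rewrite divr_ge0//= ler_pdivrMr// mul1r ler_nat -ltnS//.
  have := h1 s _ t01; move=> hs.
  have {}hs : cabs (f (segpath z w s) - f (segpath z w (i%:R / N1%:R))) <= 1.
    apply: hs; apply: le_trans (hN1 N1 (leqnn _)).
    have -> : s - i%:R / N1%:R = (s * N1%:R - i%:R) / N1%:R by field; rewrite lt0r_neq0.
    rewrite normrM ger0_norm ?subr_ge0// gtr0_norm ?invr_gt0// ler_piMl ?invr_ge0 ?ltW//.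
    by rewrite -natr1 in i2; lra.
  rewrite (bigD1 (Ordinal iN)) //= -[f (segpath z w s)](subrK (f (segpath z w (i%:R / N1%:R)))).
  apply: le_trans (cabsD _ _) _.
  rewrite addrAC [leRHS]addrC -[leLHS]add0r lerD ?sumr_ge0//.
    by move=> j _; exact: cabs_ge0.
  lra.
(* For a fine mesh [f * phi] varies by at most [eta] between points one mesh width apart; the
   Riemann sum then errs by at most [2 * eta * ell], which is below half of [e]. *)
pose eta := e / 4 / (ell + 1).
have ell1 : 0 < ell + 1 by rewrite ltr_wpDl.
have eta0 : 0 < eta by rewrite !divr_gt0.
have c1 : 0 < c + 1 by rewrite ltr_wpDl.
have [d2 d20 h2] := ccont_unif cg (divr_gt0 (divr_gt0 eta0 (ltr0n _ 2)) c1).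
have k0 : 0 < M * c * ell + 1 by rewrite ltr_wpDl// !mulr_ge0.
have [N2 N20 hN2] := small_inv d20.
have [N3 N30 hN3] := small_inv (divr_gt0 (divr_gt0 eta0 (ltr0n _ 2)) k0).
have [N [Np N2N N3N]] : exists N, [/\ (0 < N)%N, (N2 <= N)%N & (N3 <= N)%N].
  by exists (N2 + N3)%N; rewrite addn_gt0 N20 leq_addr leq_addl.
pose node (i : 'I_N) := segpath z w (i%:R / N%:R).
have n01 (i : 'I_N) : 0 <= (i%:R : R) / N%:R <= 1.
  by rewrite divr_ge0//= ler_pdivrMr ?ltr0n// mul1r ler_nat ltnW.
exists ([seq ((w - z) * (N%:R)^-1 * f (node i), node i) | i <- enum 'I_N] ++ W); split.
  move=> k; rewrite mem_cat => /orP[/mapP[i _ ->] /=|/hW/onL//].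
  exact: onz.
move=> phi cphi phic philip.
rewrite big_cons big_cat /= opprD addrACA; apply: le_trans (cabsD _ _) _.
rewrite (splitr e); apply: lerD; last first.
  by apply: hphi => [u /onL|u /onL|u v /onL hu /onL hv]; [exact: cphi|exact: phic|exact: philip].
have spd s t : cabs (segpath z w s - segpath z w t) = `|s - t| * ell.
  by rewrite /segpath opprD addrACA subrr add0r -mulrBl -realCB cabsM cabs_real.
have lip s t : 0 <= s <= 1 -> 0 <= t <= 1 -> `|s - t| <= N%:R^-1 ->
    cabs (f (segpath z w s) * phi (segpath z w s) - f (segpath z w t) * phi (segpath z w t)) <= eta.
  move=> s01 t01 st.
  set fs := f _; set ps := phi _; set ft := f _; set pt := phi _.
  have -> : fs * ps - ft * pt = (fs - ft) * ps + ft * (ps - pt) by ring.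
  apply: le_trans (cabsD _ _) _; rewrite !cabsM (splitr eta); apply: lerD.
    have a1 : cabs (fs - ft) <= eta / 2 / (c + 1).
      by apply: h2 => //; apply: le_trans st (hN2 _ N2N).
    have a2 : cabs ps <= c + 1 by apply: le_trans (phic _ (onz _ s01)) _; rewrite lerDl.
    rewrite -[leRHS](divfK (lt0r_neq0 c1)) ler_pM ?cabs_ge0//.
  have a1 : cabs ft <= M by exact: hM.
  have a2 : cabs (ps - pt) <= c * (eta / 2 / (M * c * ell + 1) * ell).
    apply: le_trans (philip _ _ (onz _ s01) (onz _ t01)) _; rewrite spd.
    by rewrite ler_wpM2l// ler_wpM2r// (le_trans st)// hN3.
  apply: (@le_trans _ _ (M * (c * (eta / 2 / (M * c * ell + 1) * ell)))).
    by rewrite ler_pM ?cabs_ge0.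
  have -> : M * (c * (eta / 2 / (M * c * ell + 1) * ell)) =
    (eta / 2 / (M * c * ell + 1)) * (M * c * ell) by ring.
  rewrite -[leRHS](divfK (lt0r_neq0 k0)) ler_wpM2l ?lerDl//.
  by rewrite !divr_ge0// ltW.
have cgp : scont (fun u => f u * phi u) z w.
  apply: segpath_cont => s s01; apply: contC_mul; first exact: cf (onz _ s01).
  exact: cphi (onz _ s01).
have E : seg (fun u => f u * phi u) z w -
   \sum_(j <- [seq ((w - z) / N%:R * f (node i), node i) | i <- enum 'I_N]) j.1 * phi j.2 =
   (w - z) * (crint (fun s => f (segpath z w s) * phi (segpath z w s)) -
      rsum_unit N (fun s => f (segpath z w s) * phi (segpath z w s))).
  rewrite segE mulrBr; congr (_ - _); rewrite big_map big_enum /= /rsum_unit mulrA mulr_sumr.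
  by apply: eq_bigr => i _; rewrite /node; ring.
rewrite E cabsM; apply: (@le_trans _ _ (ell * (2 * eta))).
  by rewrite ler_wpM2l//; exact: crint_riemann.
have -> : ell * (2 * eta) = e / 2 / (ell + 1) * ell by rewrite /eta; field; rewrite lt0r_neq0.
rewrite -[leRHS](divfK (lt0r_neq0 ell1)) ler_wpM2l ?lerDl//.
by rewrite !divr_ge0// ltW.
Qed.

End Contours.

(** * Runge's theorem on the real line *)

Section Runge.
Variable R : realType.
Local Notation C := (R[i]).
Implicit Types (f g : C -> C) (K : set R).

Definition polyapprox K (g : R -> C) := forall e : R, 0 < e ->
  exists p : {poly C}, forall t, K t -> cabs (p.[t%:C] - g t) <= e.

(** Partial sums of the geometric series for [1 / (z - t)] about [c]; they converge uniformly
    because a disc about [c] contains [K] and leaves [z] outside. *)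
Lemma geom_poly K (c z : C) (rho y : R) : 0 <= rho < 1 -> 0 < y ->
  (forall t, K t -> cabs (t%:C - c) <= rho * cabs (z - c)) ->
  (forall t, K t -> y <= cabs (z - t%:C)) -> z != c ->
  polyapprox K (fun t => (z - t%:C)^-1).
Proof.
move=> rho01 y0 hrho hy zc e e0.
have zc0 : z - c != 0 by rewrite subr_eq0.
have [n hn] := exp_small y^-1 rho01 e0.
exists (\sum_(k < n) (z - c) ^- k.+1 *: ('X - c%:P) ^+ k) => t Kt.
have zt : z - t%:C != 0.
  by rewrite -cabs_gt0; apply: lt_le_trans y0 _; exact: hy.
pose q := (t%:C - c) / (z - c).
have -> : (\sum_(k < n) (z - c) ^- k.+1 *: ('X - c%:P) ^+ k).[t%:C] =
   (z - c)^-1 * \sum_(k < n) q ^+ k.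
  rewrite horner_sum mulr_sumr; apply: eq_bigr => k _.
  by rewrite !hornerE /q expr_div_n exprS invfM; ring.
have q1 : q - 1 = - (z - t%:C) / (z - c) by rewrite /q; field.
have q10 : q - 1 != 0 by rewrite q1 mulf_eq0 negb_or oppr_eq0 zt invr_eq0.
have -> : \sum_(k < n) q ^+ k = (q ^+ n - 1) / (q - 1).
  by rewrite subrX1 mulrC mulKf.
have -> : (z - c)^-1 * ((q ^+ n - 1) / (q - 1)) - (z - t%:C)^-1 = - (q ^+ n / (z - t%:C)).
  by rewrite q1; field; rewrite zc0 zt.
rewrite cabsN cabsM cabsV cabsX; apply: le_trans (ltW hn); rewrite mulrC.
apply: ler_pM; rewrite ?invr_ge0 ?exprn_ge0 ?cabs_ge0//.
  by rewrite lef_pV2 ?posrE ?hy// cabs_gt0.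
rewrite lerXn2r ?nnegrE ?cabs_ge0//; first by case/andP: rho01.
by rewrite /q cabsM cabsV ler_pdivrMr ?hrho// cabs_gt0.
Qed.

(** The centre [c] is put across the real axis from the pole, so far away that the disc about [c]
    through the pole contains [K]. By Pythagoras this asks for [B ^+ 2 + L ^+ 2 < (n + L) ^+ 2],
    which holds for [L = B ^+ 2 / n]. *)
Lemma inv_approx_nonreal K (x y M : R) : y != 0 -> (forall t, K t -> `|t| <= M) ->
  polyapprox K (fun t => ((x +i* y) - t%:C)^-1).
Proof.
move=> y0 hM; pose B := `|M| + `|x| + 1; pose n := `|y|.
have n0 : 0 < n by rewrite normr_gt0.
have B1 : 1 <= B by rewrite lerDr addr_ge0.
have B0 : 0 < B by exact: lt_le_trans B1.
pose L := B ^+ 2 / n.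
have L0 : 0 < L by rewrite divr_gt0// exprn_gt0.
pose c : C := x +i* (- (Num.sg y * L)).
have zc : (x +i* y) - c = 0 +i* (Num.sg y * (n + L)).
  apply/eqP; rewrite eq_complex /= subrr eqxx /= opprK mulrDr /n.
  by rewrite -numEsg.
have czc : cabs ((x +i* y) - c) = n + L.
  rewrite zc cabsE /= expr0n add0r sqrtr_sqr normrM normr_sg y0 mul1r gtr0_norm//.
  exact: addr_gt0.
have nL : 0 < n + L by exact: addr_gt0.
pose rho := Num.sqrt (B ^+ 2 + L ^+ 2) / (n + L).
have lt1 : B ^+ 2 + L ^+ 2 < (n + L) ^+ 2.
  have -> : (n + L) ^+ 2 = n ^+ 2 + 2 * (n * L) + L ^+ 2 by ring.
  have -> : n * L = B ^+ 2 by rewrite /L mulrCA divff ?mulr1// lt0r_neq0.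
  have := exprn_gt0 2 n0; have := exprn_gt0 2 B0; lra.
apply: (@geom_poly K c (x +i* y) rho n).
- rewrite divr_ge0 ?sqrtr_ge0 ?ltW//= ltr_pdivrMr// mul1r.
  rewrite -(@ltr_pXn2r _ 2)// ?nnegrE ?sqrtr_ge0 ?(ltW nL)//.
  by rewrite sqr_sqrtr// addr_ge0// sqr_ge0.
- exact: n0.
- move=> t Kt; rewrite czc divfK ?lt0r_neq0// cabsE ler_wsqrtr//=.
  rewrite opprK add0r exprMn sqr_sg y0 mul1r lerD2r.
  rewrite -real_normK ?num_real// ler_pXn2r ?nnegrE ?(ltW B0)//.
  apply: le_trans (ler_normB _ _) _; have := hM _ Kt; have := ler_norm M; rewrite /B; lra.
- by move=> t _; apply: le_trans (Im_le_cabs _); rewrite /= subr0.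
- by rewrite -subr_eq0 -cabs_gt0 czc.
Qed.

(** A real pole at distance [d] from [K] is moved off the axis by [eta], which changes the function
    by at most [eta / d ^+ 2], half of the tolerance. *)
Lemma inv_approx K (z : C) (M d : R) : 0 < d -> (forall t, K t -> `|t| <= M) ->
  (forall t, K t -> d <= cabs (z - t%:C)) ->
  polyapprox K (fun t => (z - t%:C)^-1).
Proof.
move=> d0 hM hd; case: z hd => x y hd.
have [y0|] := eqVneq y 0; last by move=> y0; exact: inv_approx_nonreal hM.
rewrite {}y0 in hd * => e e0.
pose eta := e * d ^+ 2 / 2.
have eta0 : 0 < eta by rewrite divr_gt0// mulr_gt0// exprn_gt0.
have e2 : 0 < e / 2 by rewrite divr_gt0.
have etan0 : eta != 0 by rewrite lt0r_neq0.
have [p hp] := @inv_approx_nonreal K x eta M etan0 hM _ e2.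
exists p => t Kt; apply: le_trans (cabs_dist _ (x +i* eta - t%:C)^-1 _) _.
rewrite (splitr e); apply: lerD; first exact: hp.
have dt := hd _ Kt.
have dt' : d <= cabs (x +i* eta - t%:C).
  apply: le_trans dt _; rewrite !cabsE ler_wsqrtr//= subrr expr0n addr0 lerDl.
  exact: sqr_ge0.
have n1 : x +i* 0 - t%:C != 0 by rewrite -cabs_gt0; exact: lt_le_trans dt.
have n2 : x +i* eta - t%:C != 0 by rewrite -cabs_gt0; exact: lt_le_trans dt'.
have -> : (x +i* eta - t%:C)^-1 - (x +i* 0 - t%:C)^-1 =
  ((x +i* 0) - (x +i* eta)) / ((x +i* eta - t%:C) * (x +i* 0 - t%:C)).
  by field; rewrite n1 n2.
rewrite cabsM cabsV cabsM ler_pdivrMr ?mulr_gt0 ?cabs_gt0//.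
have -> : cabs (x +i* 0 - (x +i* eta)) = eta.
  by rewrite cabsE /= subrr sub0r sqrrN expr0n add0r sqrtr_sqr gtr0_norm.
have E : eta = e / 2 * (d * d) by rewrite /eta; field.
by rewrite [leLHS]E ler_wpM2l ?(ltW e2)// ler_pM// ltW.
Qed.

Lemma polyapprox_sum K (W : seq (C * C)) (M d : R) : 0 < d ->
  (forall t, K t -> `|t| <= M) ->
  (forall k t, k \in W -> K t -> d <= cabs (k.2 - t%:C)) ->
  polyapprox K (fun t => \sum_(k <- W) k.1 * (k.2 - t%:C)^-1).
Proof.
move=> d0 hM; elim: W => [|[w u] W IH] hd e e0.
  by exists 0 => t _; rewrite big_nil horner0 subrr cabs0 ltW.
have w0 : 0 < cabs w + 1 by rewrite ltr_wpDl ?cabs_ge0.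
have hd' k t : k \in W -> K t -> d <= cabs (k.2 - t%:C).
  by move=> kW; apply: hd; rewrite inE kW orbT.
have [p hp] := IH hd' _ (divr_gt0 e0 (ltr0n _ 2)).
have [||q hq] := @inv_approx K u M d d0 hM _ (e / 2 / (cabs w + 1)).
- by move=> t; apply: (hd (w, u)); rewrite mem_head.
- by rewrite !divr_gt0.
exists (w *: q + p) => t Kt; rewrite big_cons hornerD hornerZ /=.
rewrite opprD addrACA -mulrBr; apply: le_trans (cabsD _ _) _.
rewrite (splitr e) cabsM; apply: lerD; last exact: hp.
rewrite -[leRHS](divfK (lt0r_neq0 w0)) mulrC ler_pM ?cabs_ge0 ?hq// lerDl//.
Qed.

Lemma inv_lip (t : R) (u v : C) (d : R) : 0 < d -> d <= cabs (u - t%:C) -> d <= cabs (v - t%:C) ->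
  cabs ((u - t%:C)^-1 - (v - t%:C)^-1) <= d ^- 2 * cabs (u - v).
Proof.
move=> d0 hu hv.
have n1 : u - t%:C != 0 by rewrite -cabs_gt0; exact: lt_le_trans hu.
have n2 : v - t%:C != 0 by rewrite -cabs_gt0; exact: lt_le_trans hv.
have -> : (u - t%:C)^-1 - (v - t%:C)^-1 = (v - u) / ((u - t%:C) * (v - t%:C)).
  by field; rewrite n1 n2.
rewrite cabsM cabsV cabsM cabsB mulrC ler_wpM2r ?cabs_ge0//.
rewrite lef_pV2 ?posrE ?exprn_gt0// ?mulr_gt0 ?cabs_gt0//.
by rewrite expr2 ler_pM// ltW.
Qed.

Lemma inv_bound (z : C) (d : R) : 0 < d -> d <= cabs z -> cabs z^-1 <= d^-1.
Proof. by move=> d0 h; rewrite cabsV lef_pV2 ?posrE//; exact: lt_le_trans h. Qed.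

Definition cauchy_cst : C := (2 * pi%:C * (0 +i* 1))^-1.

Lemma cauchy_cstE : cauchy_cst * ((2 * pi)%:C * 'i%C) = 1.
Proof.
rewrite /cauchy_cst realCM realC_nat mulVf// !mulf_neq0 ?pnatr_eq0//.
  by rewrite -cabs_gt0 cabs_real normr_gt0 lt0r_neq0// pi_gt0.
by rewrite eq_complex /= oner_eq0 andbF.
Qed.

Lemma contour_contC f K Q : encloses K Q ->
  (forall p z, p \in Q -> rect_closed p z -> analytic_at f z) ->
  forall u, on_segs (contour Q) u -> contC f u.
Proof.
move=> [gQ _ _] af u /contour_pts[p pQ up].
by apply: diffC_cont; apply: analytic_diff; apply: (af p) => //; case: (sides_pts (gQ _ pQ) up).
Qed.

(* Nodes and weights working simultaneously for the Cauchy formula at all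
   points of [K] and for the contour integral of any other such function. *)
Lemma contour_nodes f K Q (d c e : R) : encloses K Q ->
  (forall p z, p \in Q -> rect_closed p z -> analytic_at f z) ->
  0 < d -> (forall t u, K t -> on_segs (contour Q) u -> d <= cabs (u - t%:C)) ->
  0 <= c -> 0 < e ->
  exists W : seq (C * C), [/\ (forall k, k \in W -> on_segs (contour Q) k.2),
    forall t, K t -> cabs (f t%:C - \sum_(k <- W) k.1 * (k.2 - t%:C)^-1) <= e &
    forall phi : C -> C, (forall u, on_segs (contour Q) u -> contC phi u) ->
      (forall u, on_segs (contour Q) u -> cabs (phi u) <= c) ->
      (forall u v, on_segs (contour Q) u -> on_segs (contour Q) v ->
         cabs (phi u - phi v) <= c * cabs (u - v)) ->
      cabs (cauchy_cst * (\sum_(p <- Q) rect_integral (fun z => f z * phi z) p) -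
        \sum_(k <- W) k.1 * phi k.2) <= e].
Proof.
move=> eQ af d0 hd c0 e0.
have k0 : 0 < cabs cauchy_cst + 1 by rewrite ltr_wpDl ?cabs_ge0.
pose c' := c + d^-1 + d ^- 2.
have i1 : 0 <= d^-1 by rewrite invr_ge0 ltW.
have i2 : 0 <= d ^- 2 by rewrite invr_ge0 exprn_ge0 ?ltW.
have c'0 : 0 <= c' by rewrite /c' !addr_ge0.
have [W [hW hphi]] := contour_riemann c'0 (divr_gt0 e0 k0) (contour_contC eQ af).
have main phi : (forall u, on_segs (contour Q) u -> contC phi u) ->
      (forall u, on_segs (contour Q) u -> cabs (phi u) <= c') ->
      (forall u v, on_segs (contour Q) u -> on_segs (contour Q) v ->
         cabs (phi u - phi v) <= c' * cabs (u - v)) ->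
    cabs (cauchy_cst * (\sum_(p <- Q) rect_integral (fun z => f z * phi z) p) -
        \sum_(k <- [seq (cauchy_cst * k.1, k.2) | k <- W]) k.1 * phi k.2) <= e.
  move=> h1 h2 h3; rewrite big_map /=; under [X in _ - X]eq_bigr do rewrite -mulrA.
  rewrite -mulr_sumr -mulrBr cabsM contour_sum.
  rewrite -[leRHS](divfK (lt0r_neq0 k0)) mulrC ler_pM ?cabs_ge0 ?lerDl//.
  exact: hphi.
exists [seq (cauchy_cst * k.1, k.2) | k <- W]; split.
- by move=> k /mapP[k' /hW h ->].
- move=> t Kt; have := main (fun u => (u - t%:C)^-1).
  rewrite (cauchy_contour eQ Kt af) mulrA cauchy_cstE mul1r; apply.
  + move=> u ou; apply: contC_inv; rewrite -subr_eq0 -cabs_gt0.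
    by apply: lt_le_trans d0 _; exact: hd.
  + move=> u ou; apply: le_trans (inv_bound d0 (hd _ _ Kt ou)) _; rewrite /c'; lra.
  + move=> u v ou ov; apply: le_trans (inv_lip d0 (hd _ _ Kt ou) (hd _ _ Kt ov)) _.
    by rewrite ler_wpM2r ?cabs_ge0// /c'; lra.
move=> phi h1 h2 h3; apply: main => //.
  by move=> u /h2 /le_trans; apply; rewrite /c'; lra.
move=> u v ou ov; apply: le_trans (h3 _ _ ou ov) _.
by rewrite ler_wpM2r ?cabs_ge0// /c'; lra.
Qed.

(** Cauchy's formula discretised by [contour_nodes] leaves a finite combination of simple fractions,
    each of them approximated by polynomials. *)
Lemma runge f K : compact K ->
  (forall t, K t -> exists2 d : R, 0 < d & forall z, cabs (z - t%:C) < d -> analytic_at f z) ->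
  polyapprox K (fun t => f t%:C).
Proof.
move=> cK hf e e0; have [M M0 hM] := bounded_real cK.
have [Q [eQ af]] := encloses_exists cK hf.
have [d d0 hd] := encloses_dist cK eQ.
have [|W [hW hcau _]] := contour_nodes eQ af d0 hd (lexx 0) (e := e / 2).
  by rewrite divr_gt0.
have [||p hp] := @polyapprox_sum K W M d d0 hM _ (e / 2).
- by move=> k t kW Kt; apply: hd => //; exact: hW.
- by rewrite divr_gt0.
exists p => t Kt; apply: le_trans (cabs_dist _ (\sum_(k <- W) k.1 * (k.2 - t%:C)^-1) _) _.
by rewrite (splitr e) lerD ?hp// cabsB hcau.
Qed.

End Runge.

(** * Comparison of the holomorphic and the polynomial calculus *)

Section FunctionalCalculus.
Variables (R : realType) (T : choiceType).
Local Notation C := (R[i]).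
Variables (A : op R T) (K : R) (x0 : T).
Hypothesis hA : sa_op A K.

Definition rspec : set R := [set t | spectrum A t%:C].

Lemma rspecP z : spectrum A z -> z = (complex.Re z)%:C /\ rspec (complex.Re z).
Proof.
move=> hz; have z0 := sa_spectrum_real hA hz.
have E : z = (complex.Re z)%:C by case: z z0 {hz} => a b /= ->.
by split => //; rewrite /rspec /= -E.
Qed.

Lemma rspec_compact : compact rspec.
Proof.
have [K0 lA bA _] := hA.
apply: (@real_compact _ _ K); last first.
  by move=> t /(spectrum_bounded lA bA K0); rewrite cabs_real.
rewrite -[rspec]setCK; apply: open_closedC; rewrite openE => t nt.
have [d d0 hd] := spectrum_open lA bA nt.
exists d => //= s; rewrite /ball_ /= distrC => ts.
by apply: hd; rewrite -realCB cabs_real.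
Qed.

Let rho z : C := resolvent A z (basis_vec R x0) x0.

Lemma rspec_inv_approx z (d : R) : 0 < d -> (forall t, rspec t -> d <= cabs (z - t%:C)) ->
  polyapprox rspec (fun t => (z - t%:C)^-1) /\ ~ spectrum A z.
Proof.
move=> d0 hd; have [M M0 hM] := bounded_real rspec_compact.
split; first exact: inv_approx d0 hM hd.
move=> /rspecP[zE /hd]; rewrite -zE subrr cabs0 => h.
by have := lt_le_trans d0 h; rewrite ltxx.
Qed.

Lemma act_entry p e : 0 <= e -> (forall t, rspec t -> cabs p.[t%:C] <= e) ->
  cabs (act A p (basis_vec R x0) x0) <= 2 * e.
Proof.
move=> e0 hp; have [hb nb] := l2_basis R x0; have [_ _ bA _] := hA.
apply: le_trans (l2_entry x0 (act_l2 bA p hb)) _.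
apply: le_trans (sa_poly_bound x0 hA e0 hp hb) _.
by rewrite ler_piMr// mulr_ge0.
Qed.

Lemma act_sub p q : act A (p - q) (basis_vec R x0) x0 =
  act A p (basis_vec R x0) x0 - act A q (basis_vec R x0) x0.
Proof. by rewrite addrC -scaleN1r act_lcp /lc mulN1r addrC. Qed.

(** One polynomial approximates both [1 / (z - t)] on the spectrum and the diagonal entry of the
    resolvent; scalar estimates are thereby transferred to entries. *)
Lemma resolvent_entry_approx z d e : 0 < d -> 0 < e ->
  (forall t, rspec t -> d <= cabs (z - t%:C)) -> exists p,
  (forall t, rspec t -> cabs (p.[t%:C] - (z - t%:C)^-1) <= e) /\
  cabs (rho z - act A p (basis_vec R x0) x0) <= e.
Proof.
move=> d0 e0 hd; have [pa nz] := rspec_inv_approx d0 hd.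
have [k [k0 hk]] := resolvent_poly x0 hA nz.
have m0 : 0 < Num.min e (e / k) by rewrite lt_min e0 divr_gt0.
have [p hp] := pa _ m0; exists p; split.
  by move=> t /hp /le_trans; apply; rewrite ge_min lexx.
apply: le_trans (hk _ _ (ltW m0) hp x0) _.
by rewrite -ler_pdivlMl// mulrC ge_min lexx orbT.
Qed.

Lemma resolvent_entry_bound z d : 0 < d -> (forall t, rspec t -> d <= cabs (z - t%:C)) ->
  cabs (rho z) <= 2 / d.
Proof.
move=> d0 hd; apply/ler_addgt0Pl => e e0.
have e3 : 0 < e / 3 by rewrite divr_gt0.
have [p [h1 h2]] := resolvent_entry_approx d0 e3 hd.
have : cabs (act A p (basis_vec R x0) x0) <= 2 * (d^-1 + e / 3).
  apply: act_entry; first by rewrite addr_ge0 ?invr_ge0 ?ltW.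
  move=> t st; rewrite -[p.[_]](subrK (z - t%:C)^-1).
  apply: le_trans (cabsD _ _) _; rewrite addrC lerD ?h1//.
  exact: inv_bound (hd _ st).
have := cabsD (rho z - act A p (basis_vec R x0) x0) (act A p (basis_vec R x0) x0).
rewrite subrK; lra.
Qed.

Lemma resolvent_entry_lip u v d : 0 < d ->
  (forall t, rspec t -> d <= cabs (u - t%:C)) ->
  (forall t, rspec t -> d <= cabs (v - t%:C)) ->
  cabs (rho u - rho v) <= 2 * d ^- 2 * cabs (u - v).
Proof.
move=> d0 hu hv; apply/ler_addgt0Pl => e e0.
have e6 : 0 < e / 6 by rewrite divr_gt0.
have [p [p1 p2]] := resolvent_entry_approx d0 e6 hu.
have [q [q1 q2]] := resolvent_entry_approx d0 e6 hv.
have i2 : 0 <= d ^- 2 by rewrite invr_ge0 exprn_ge0 ?ltW.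
have : cabs (act A (p - q) (basis_vec R x0) x0) <= 2 * (d ^- 2 * cabs (u - v) + (e / 6 + e / 6)).
  apply: act_entry.
    by apply: addr_ge0; [rewrite mulr_ge0 ?cabs_ge0|lra].
  move=> t st; rewrite hornerD hornerN.
  have -> : p.[t%:C] - q.[t%:C] = ((u - t%:C)^-1 - (v - t%:C)^-1) +
     ((p.[t%:C] - (u - t%:C)^-1) - (q.[t%:C] - (v - t%:C)^-1)) by ring.
  apply: le_trans (cabsD _ _) _; apply: lerD; first by apply: inv_lip; [|exact: hu|exact: hv].
  by apply: le_trans (cabsD _ _) _; rewrite cabsN lerD ?p1 ?q1.
rewrite act_sub; set a := act A p _ _; set b := act A q _ _ => hab.
have -> : rho u - rho v = (rho u - a) + ((a - b) - (rho v - b)) by ring.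
apply: le_trans (cabsD _ _) _; have := cabsD (a - b) (- (rho v - b)); rewrite cabsN.
by move: p2 q2 hab; rewrite -/a -/b; lra.
Qed.

(** A single set of nodes discretises the contour integral of the resolvent entry and the scalar
    Cauchy formula. Replacing the resolvents at the nodes by polynomials gives [P] with the entry of
    [P(A)] close to that of [f(A)], and [P] close to [f], hence to [p], on the spectrum. *)
Lemma holo_calc_poly f (p : {poly C}) e : 0 <= e ->
  (forall t, rspec t -> exists2 d : R, 0 < d & forall z, cabs (z - t%:C) < d -> analytic_at f z) ->
  (forall t, rspec t -> cabs (f t%:C - p.[t%:C]) <= e) ->
  cabs (entry (holo_calc f A) x0 x0 - act A p (basis_vec R x0) x0) <= 2 * e.
Proof.
move=> e0 hf hp; have cK := rspec_compact.
rewrite /entry /holo_calc; set Q := xget _ _.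
have [eQ af] : encloses rspec Q /\ (forall q z, q \in Q -> rect_closed q z -> analytic_at f z).
  have [Q0 [[g0 t0 c0] a0]] := encloses_exists cK hf.
  (* [xget] falls back to the empty list of rectangles unless an admissible contour exists;
     [encloses_exists] supplies one. *)
  have : encloses_spectrum f A Q.
    apply: (@xgetPex _ [::] (encloses_spectrum f A)); exists Q0; split => //.
    by move=> z /rspecP[-> /c0].
  move=> [h1 h2 h3 h4]; split; last exact: h3.
  by split => // t /h4.
have [d d0 hd] := encloses_dist cK eQ.
(* Bound and Lipschitz constant of the resolvent entry at distance [d / 2] from the spectrum; the
   halved distance leaves room for a full neighbourhood of each contour point. *)
pose c := 2 / (d / 2) + 2 * (d / 2) ^- 2.
have d20 : 0 < d / 2 by rewrite divr_gt0.
have i2 : 0 <= (d / 2) ^- 2 by rewrite invr_ge0 exprn_ge0 ?(ltW d20).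
have c0 : 0 <= c.
  by apply: addr_ge0; [apply: divr_ge0 => //; exact: ltW|exact: mulr_ge0].
apply/ler_addgt0Pl => e' e'0.
have e3 : 0 < e' / 8 by rewrite divr_gt0.
have [W [hW hcau hphi]] := contour_nodes eQ af d0 hd c0 e3.
have hd2 u t : on_segs (contour Q) u -> rspec t -> d / 2 <= cabs (u - t%:C).
  by move=> ou st; have := hd _ _ st ou; lra.
have near u v t : on_segs (contour Q) u -> cabs (v - u) < d / 2 -> rspec t -> d / 2 <= cabs (v - t%:C).
  move=> ou uv st; have := hd _ _ st ou; have := cabs_dist u v t%:C; rewrite [cabs (u - v)]cabsB; lra.
have lip u v : on_segs (contour Q) u -> cabs (v - u) < d / 2 ->
    cabs (rho v - rho u) <= c * cabs (v - u).
  move=> ou uv.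
  apply: le_trans (resolvent_entry_lip d20 (fun t => near _ _ t ou uv) (fun t => hd2 _ t ou)) _.
  by rewrite ler_wpM2r ?cabs_ge0// /c lerDr divr_ge0// ltW.
have H : cabs (cauchy_cst R * (\sum_(q <- Q) rect_integral (fun z => f z * rho z) q) -
        \sum_(k <- W) k.1 * rho k.2) <= e' / 8.
  apply: hphi.
  - move=> u ou eps eps0.
    have c1 : 0 < c + 1 by rewrite ltr_wpDl.
    exists (Num.min (d / 2) (eps / (c + 1))); first by rewrite lt_min d20 divr_gt0.
    move=> w; rewrite lt_min => /andP[/(lip _ _ ou) h]; rewrite ltr_pdivlMr//.
    by apply: le_lt_trans; apply: le_trans h _; rewrite mulrC ler_wpM2l ?cabs_ge0// lerDl.
  - move=> u ou; apply: le_trans (resolvent_entry_bound d20 (fun t => hd2 _ t ou)) _.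
    by rewrite /c lerDl mulr_ge0.
  - move=> u v ou ov.
    apply: le_trans (resolvent_entry_lip d20 (fun t => hd2 _ t ou) (fun t => hd2 _ t ov)) _.
    by rewrite ler_wpM2r ?cabs_ge0// /c lerDr divr_ge0// ltW.
have [P [P1 P2]] : exists P : {poly C},
    (forall t, rspec t -> cabs (P.[t%:C] - \sum_(k <- W) k.1 * (k.2 - t%:C)^-1) <= e' / 8) /\
    cabs (\sum_(k <- W) k.1 * rho k.2 - act A P (basis_vec R x0) x0) <= e' / 8.
  elim: (W) hW (e' / 8) e3 => [|[k u] W' IH] hW' eps eps0.
    exists 0; split=> [t _|]; rewrite big_nil ?horner0 ?act0 subrr cabs0; exact: ltW.
  have k0 : 0 < cabs k + 1 by rewrite ltr_wpDl ?cabs_ge0.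
  have [||P [P1 P2]] := IH _ (eps / 2); rewrite ?divr_gt0//.
    by move=> k' k'W; apply: hW'; rewrite inE k'W orbT.
  have ou : on_segs (contour Q) u by apply: (hW' (k, u)); rewrite mem_head.
  have [|q [q1 q2]] := resolvent_entry_approx d20 _ (fun t => hd2 _ t ou) (e := eps / 2 / (cabs k + 1)).
    by rewrite !divr_gt0.
  exists (k *: q + P); split => [t st|].
    rewrite big_cons hornerD hornerZ /= opprD addrACA -mulrBr.
    apply: le_trans (cabsD _ _) _; rewrite cabsM (splitr eps); apply: lerD; last exact: P1.
    by rewrite -[leRHS](divfK (lt0r_neq0 k0)) mulrC ler_pM ?cabs_ge0 ?q1// lerDl.
  rewrite big_cons act_lcp /lc /= opprD addrACA -mulrBr.
  apply: le_trans (cabsD _ _) _; rewrite cabsM (splitr eps); apply: lerD; last exact: P2.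
  by rewrite -[leRHS](divfK (lt0r_neq0 k0)) mulrC ler_pM ?cabs_ge0// lerDl.
have PP : cabs (act A (P - p) (basis_vec R x0) x0) <= 2 * (e' / 8 + e' / 8 + e).
  apply: act_entry; first by lra.
  move=> t st; rewrite hornerD hornerN.
  set s := \sum_(k <- W) k.1 * (k.2 - t%:C)^-1.
  have -> : P.[t%:C] - p.[t%:C] = (P.[t%:C] - s) - (f t%:C - s) + (f t%:C - p.[t%:C]) by ring.
  apply: le_trans (cabsD _ _) _; apply: lerD; last exact: hp.
  by apply: le_trans (cabsD _ _) _; rewrite cabsN lerD ?P1 ?hcau.
rewrite act_sub in PP.
rewrite -/(cauchy_cst R); move: H P2 PP; rewrite -/(rho).
set X := _ * _; set S := \sum_(k <- W) _; set a := act A P _ _; set b := act A p _ _.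
move=> H P2 PP; have -> : X - b = (X - S) + ((S - a) + (a - b)) by ring.
apply: le_trans (cabsD _ _) _; have := cabsD (S - a) (a - b); lra.
Qed.

End FunctionalCalculus.

(** * Lattice sums and averages of characters *)

Section PlaneVectors.
Variable R : realType.
Implicit Types (v w : 'cV[R]_2) (L : 'M[R]_2) (n : coords).

(** The sum norm, whose exponentials factor over the coordinates; it is at most twice [enorm]. *)
Definition n1 v : R := `|v 0 0| + `|v 1 0|.

Definition ivec n : 'cV[R]_2 := map_mx intr n.

Lemma mul2E L v i : (L *m v) i 0 = L i 0 * v 0 0 + L i 1 * v 1 0.
Proof. by rewrite mxE big_ord_recl big_ord1; congr (_ + L _ _ * v _ _); apply/val_inj. Qed.

Lemma dotE v w : dot v w = v 0 0 * w 0 0 + v 1 0 * w 1 0.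
Proof. by rewrite /dot big_ord_recl big_ord1; congr (_ + v _ _ * w _ _); apply/val_inj. Qed.

Lemma cV2P v w : v 0 0 = w 0 0 -> v 1 0 = w 1 0 -> v = w.
Proof.
move=> h0 h1; apply/colP => i; case: (unliftP ord0 i) => [j ->|-> //].
by rewrite (ord1 j) (_ : lift ord0 0 = 1)//; apply/val_inj.
Qed.

Lemma n1_ge0 v : 0 <= n1 v.
Proof. by rewrite addr_ge0. Qed.

Lemma n1D v w : n1 (v + w) <= n1 v + n1 w.
Proof.
rewrite /n1 !mxE; have := ler_normD (v 0 0) (w 0 0); have := ler_normD (v 1 0) (w 1 0); lra.
Qed.

Lemma n1N v : n1 (- v) = n1 v.
Proof. by rewrite /n1 !mxE !normrN. Qed.

Lemma n10 : n1 0 = 0.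
Proof. by rewrite /n1 !mxE normr0 addr0. Qed.

Lemma enormE v : enorm v = Num.sqrt (v 0 0 ^+ 2 + v 1 0 ^+ 2).
Proof. by rewrite /enorm dotE -!expr2. Qed.

Lemma enorm_ge0 v : 0 <= enorm v.
Proof. exact: sqrtr_ge0. Qed.

Lemma enorm_le_n1 v : enorm v <= n1 v.
Proof.
rewrite enormE -[leRHS]ger0_norm ?n1_ge0// -sqrtr_sqr ler_wsqrtr//.
rewrite /n1 sqrrD !real_normK ?num_real//.
have : 0 <= `|v 0 0| * `|v 1 0| by rewrite mulr_ge0.
lra.
Qed.

Lemma n1_le_enorm v : n1 v <= 2 * enorm v.
Proof.
have h0 : `|v 0 0| <= enorm v by rewrite enormE -sqrtr_sqr ler_wsqrtr// lerDl sqr_ge0.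
have h1 : `|v 1 0| <= enorm v by rewrite enormE -sqrtr_sqr ler_wsqrtr// lerDr sqr_ge0.
rewrite /n1; lra.
Qed.

Lemma n1_upper L : exists2 c, 0 < c & forall v, n1 (L *m v) <= c * n1 v.
Proof.
exists (`|L 0 0| + `|L 0 1| + `|L 1 0| + `|L 1 1| + 1).
  by rewrite ltr_wpDl// !addr_ge0.
move=> v; rewrite /n1 !mul2E.
have := ler_normD (L 0 0 * v 0 0) (L 0 1 * v 1 0).
have := ler_normD (L 1 0 * v 0 0) (L 1 1 * v 1 0).
rewrite !normrM; have := normr_ge0 (v 0 0); have := normr_ge0 (v 1 0).
have := normr_ge0 (L 0 0); have := normr_ge0 (L 0 1).
have := normr_ge0 (L 1 0); have := normr_ge0 (L 1 1).
set a := `|L 0 0|; set b := `|L 0 1|; set c := `|L 1 0|; set d := `|L 1 1|.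
set x := `|v 0 0|; set y := `|v 1 0| => d0 c0 b0 a0 y0 x0.
have := mulr_ge0 a0 y0; have := mulr_ge0 b0 x0; have := mulr_ge0 c0 y0; have := mulr_ge0 d0 x0.
lra.
Qed.

Lemma n1_lower L : L \in unitmx -> exists2 c, 0 < c & forall v, c * n1 v <= n1 (L *m v).
Proof.
move=> uL; have [c c0 hc] := n1_upper (invmx L); exists c^-1; first by rewrite invr_gt0.
by move=> v; rewrite ler_pdivrMl//; have := hc (L *m v); rewrite mulKmx.
Qed.

Lemma lvecE L n : lvec L n = L *m ivec n.
Proof. by []. Qed.

Lemma ivecD n m : ivec (n + m) = ivec n + ivec m.
Proof. by apply/matrixP => i j; rewrite !mxE rmorphD. Qed.

Lemma lvecD L n m : lvec L (n + m) = lvec L n + lvec L m.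
Proof. by rewrite !lvecE ivecD mulmxDr. Qed.

Lemma lvecN L n : lvec L (- n) = - lvec L n.
Proof. by rewrite !lvecE -mulmxN; congr (_ *m _); apply/matrixP => i j; rewrite !mxE rmorphN. Qed.

Lemma lvecB L n m : lvec L (n - m) = lvec L n - lvec L m.
Proof. by rewrite lvecD lvecN. Qed.

Lemma lvec0 L : lvec L 0 = 0.
Proof. by rewrite -[0](subrr (0 : coords)) lvecB subrr. Qed.

Lemma ivec_inj : injective ivec.
Proof.
move=> n m /matrixP E; apply/matrixP => i j; have := E i j; rewrite !mxE.
by apply: intr_inj.
Qed.

Lemma lvec_inj L : L \in unitmx -> injective (lvec L).
Proof.
move=> uL n m; rewrite !lvecE => /(congr1 (mulmx (invmx L))).
by rewrite !mulKmx// => /ivec_inj.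
Qed.

Lemma dotDl u v w : dot (u + v) w = dot u w + dot v w :> R.
Proof. by rewrite !dotE !mxE; ring. Qed.

Lemma dotDr u v w : dot u (v + w) = dot u v + dot u w :> R.
Proof. by rewrite !dotE !mxE; ring. Qed.

Lemma dotNl v w : dot (- v) w = - dot v w :> R.
Proof. by rewrite !dotE !mxE; ring. Qed.

Lemma dotNr v w : dot v (- w) = - dot v w :> R.
Proof. by rewrite !dotE !mxE; ring. Qed.

Lemma dotC v w : dot v w = dot w v.
Proof. by rewrite !dotE; ring. Qed.

Lemma dot_mul L v w : dot v (L *m w) = dot (L^T *m v) w.
Proof. by rewrite !dotE !mul2E !mxE; ring. Qed.

Definition cpair (a b : int) : coords := \col_i (if i == 0 then a else b).

Lemma cpair0 a b : cpair a b 0 0 = a. Proof. by rewrite mxE. Qed.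

Lemma cpair1 a b : cpair a b 1 0 = b. Proof. by rewrite mxE. Qed.

Lemma cpair_eta n : cpair (n 0 0) (n 1 0) = n.
Proof.
apply/colP => i; rewrite mxE; case: (unliftP ord0 i) => [j ->|-> //].
by rewrite (ord1 j) (_ : lift ord0 0 = 1)//; apply/val_inj.
Qed.

End PlaneVectors.

(** * Exponential sums over lattices *)

Section LatticeSums.
Variable R : realType.
Implicit Types (v w : 'cV[R]_2) (L : 'M[R]_2).

Lemma geom_bound (r : R) n : 0 <= r < 1 -> \sum_(k < n) r ^+ k <= (1 - r)^-1.
Proof.
move=> /andP[r0 r1]; rewrite -[leRHS]mul1r ler_pdivlMr ?subr_gt0//.
have := subrX1 r n; have := exprn_ge0 n r0; lra.
Qed.

Lemma nat_geom (r : R) : 0 <= r < 1 -> bsum (fun k : nat => r ^+ k) (1 - r)^-1.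
Proof.
move=> r01 s us; apply: le_trans (geom_bound (\max_(i <- s) i).+1 r01).
rewrite -(big_mkord xpredT (fun k => r ^+ k)) /index_iota subn0.
apply: sum_subset => //; first by move=> x; apply: exprn_ge0; case/andP: r01.
  exact: iota_uniq.
by move=> x xs; rewrite mem_iota /= ltnS; apply: leq_bigmax_seq.
Qed.

Lemma int_geom (r : R) : 0 <= r < 1 ->
  bsum (fun k : int => r ^+ `|k|%N) ((1 - r)^-1 + (1 - r)^-1).
Proof.
move=> r01 s us; rewrite (bigID (fun k => 0 <= k)) /=.
have abs_le (P : pred int) : {in P &, injective absz} ->
    \sum_(k <- s | P k) r ^+ `|k|%N <= (1 - r)^-1.
  move=> hP; rewrite -big_filter -(big_map absz xpredT (fun k => r ^+ k)).
  apply: (nat_geom r01); rewrite map_inj_in_uniq ?filter_uniq//.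
  by move=> x y; rewrite !mem_filter => /andP[xP _] /andP[yP _]; apply: hP.
apply: lerD; apply: abs_le => x y; rewrite /in_mem /=.
  by move=> x0 y0 E; rewrite -(gez0_abs x0) -(gez0_abs y0) E.
rewrite -!ltNge => /ltW x0 /ltW y0 E.
by rewrite -[x]opprK -[y]opprK -(lez0_abs x0) -(lez0_abs y0) E.
Qed.

(** Uniform in the shift [x]: replacing [x] by its integral part costs a factor [expR c] and merely
    translates the integers. *)
Lemma int_exp_sum (c : R) : 0 < c -> exists2 B, 0 <= B &
  forall x : R, bsum (fun k : int => expR (- c * `|x + k%:~R|)) B.
Proof.
move=> c0; set r := expR (- c).
have r01 : 0 <= r < 1 by rewrite expR_ge0 /= expR_lt1 oppr_lt0.
exists (expR c * ((1 - r)^-1 + (1 - r)^-1)).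
  rewrite mulr_ge0 ?expR_ge0// addr_ge0// invr_ge0 subr_ge0; case/andP: r01 => _ /ltW//.
move=> x s us.
apply: (@le_trans _ _ (\sum_(k <- s) expR c * r ^+ absz (k + Num.floor x))).
  apply: ler_sum => k _; rewrite -expRM_natl -expRD ler_expR.
  rewrite natr_absz intr_norm rmorphD /= mulrN.
  have /andP[f1 f2] := floor_itv x.
  have : `|k%:~R + (Num.floor x)%:~R : R| <= `|x + k%:~R| + 1.
    have -> : k%:~R + (Num.floor x)%:~R = (x + k%:~R) + ((Num.floor x)%:~R - x) by ring.
    apply: le_trans (ler_normD _ _) _; rewrite lerD2l ler_norml.
    by rewrite rmorphD /= in f2; apply/andP; split; lra.
  by move=> h; have := ler_wpM2l (ltW c0) h; lra.
rewrite -mulr_sumr ler_wpM2l ?expR_ge0//.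
rewrite -(big_map (fun k => k + Num.floor x) xpredT (fun k => r ^+ `|k|%N)).
by apply: int_geom => //; rewrite map_inj_uniq//; exact: addIr.
Qed.

Lemma lat_sum1 (c : R) : 0 < c -> exists2 B, 0 <= B &
  forall w, bsum (fun g : coords => expR (- c * n1 (w + ivec R g))) B.
Proof.
move=> c0; have [B B0 hB] := int_exp_sum c0; exists (B * B); first exact: mulr_ge0.
move=> w s us.
pose s1 := undup [seq g 0 0 | g : coords <- s]; pose s2 := undup [seq g 1 0 | g : coords <- s].
have pe a b : 0 <= expR (- c * n1 (w + ivec R (cpair a b))) by exact: expR_ge0.
apply: (@le_trans _ _ (\sum_(g <- [seq cpair a b | a <- s1, b <- s2])
   expR (- c * n1 (w + ivec R g)))).
  apply: sum_subset => //.
    apply: allpairs_uniq; rewrite ?undup_uniq//.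
    move=> [a b] [a' b'] _ _ /= E.
    have := congr1 (fun g : coords => g 0 0) E; have := congr1 (fun g : coords => g 1 0) E.
    by rewrite !cpair0 !cpair1 => -> ->.
  move=> g gs; rewrite -(cpair_eta g); apply: allpairs_f; rewrite mem_undup.
    exact: map_f.
  exact: (map_f (fun g : coords => g 1 0)).
rewrite big_allpairs_dep.
apply: (@le_trans _ _ (\sum_(a <- s1) \sum_(b <- s2)
    expR (- c * `|w 0 0 + a%:~R|) * expR (- c * `|w 1 0 + b%:~R|))).
  apply: ler_sum => a _; apply: ler_sum => b _.
  by rewrite -expRD /n1 !mxE /= -mulrDr.
under eq_bigr do rewrite -mulr_sumr.
rewrite -mulr_suml ler_pM ?hB ?undup_uniq ?sumr_ge0// => *; exact: expR_ge0.
Qed.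

Lemma lat_sum L (c : R) : L \in unitmx -> 0 < c -> exists2 B, 0 <= B &
  forall w, bsum (fun g : coords => expR (- c * n1 (w + lvec L g))) B.
Proof.
move=> uL c0; have [d d0 hd] := n1_lower uL.
have [B B0 hB] := lat_sum1 (mulr_gt0 c0 d0); exists B => // w.
apply: bsum_le (hB (invmx L *m w)) => g; rewrite ler_expR !mulNr lerN2 -mulrA.
rewrite ler_wpM2l ?(ltW c0)//; apply: le_trans (hd _) _.
by rewrite mulmxDr mulKVmx.
Qed.

End LatticeSums.

(** * Geometric sums and the lattice points of a ball *)

Section CharacterAverages.
Variable R : realType.
Local Notation C := (R[i]).

(** An index set without gaps gives one geometric progression, whose sum is a difference of two
    unimodular numbers divided by [1 - w]. *)
Lemma interval_sum (w : C) (P : nat -> bool) N : w != 1 -> cabs w = 1 ->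
  (forall i j k, (i <= j <= k)%N -> P i -> P k -> P j) ->
  cabs (\sum_(k < N | P k) w ^+ k) <= 2 / cabs (1 - w).
Proof.
move=> w1 nw cP.
have w10 : 1 - w != 0 by rewrite subr_eq0 eq_sym.
(* Three states while the indices are scanned: the set has not begun, it has been running since [i],
   or it has ended. *)
have inv M : let S := \sum_(k < M | P k) w ^+ k in
    [\/ (S = 0 /\ forall k, (k < M)%N -> ~~ P k),
        (exists i, S = (w ^+ i - w ^+ M) / (1 - w) /\ (forall k, (i <= k < M)%N -> P k) /\ (i < M)%N) |
        (exists i j, S = (w ^+ i - w ^+ j) / (1 - w) /\ forall k, (M <= k)%N -> ~~ P k)].
  elim: M => [|M IH] /=; first by constructor 1; rewrite big_ord0.
  rewrite big_mkcond big_ord_recr /= -big_mkcond /=.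
  case: IH => [[-> h]|[i [-> [h iM]]]|[i [j [-> h]]]].
  - case: ifPn => PM; last first.
      constructor 1; rewrite addr0; split => // k; rewrite ltnS leq_eqVlt => /orP[/eqP->//|]; exact: h.
    constructor 2; exists M; split; last by split => // k /andP[h1 h2]; have -> : k = M by lia.
    by rewrite add0r exprS; field.
  - case: ifPn => PM.
      constructor 2; exists i; split; first by rewrite exprS; field.
      split; last exact: leqW.
      by move=> k /andP[ik]; rewrite ltnS leq_eqVlt => /orP[/eqP->//|kM]; apply: h; rewrite ik.
    constructor 3; exists i, M; split; first by rewrite addr0.
    move=> k Mk; apply: contraNN PM => Pk; apply: (cP i M k); rewrite ?(ltnW iM) ?(ltnW Mk)//.
    by apply: h; rewrite leqnn.
  - rewrite (negbTE (h M (leqnn M))); constructor 3; exists i, j.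
    by rewrite addr0; split => // k /ltnW; exact: h.
have d0 : 0 < cabs (1 - w) by rewrite cabs_gt0.
have b i j : cabs ((w ^+ i - w ^+ j) / (1 - w)) <= 2 / cabs (1 - w).
  rewrite cabsM cabsV ler_wpM2r ?invr_ge0 ?(ltW d0)//.
  by apply: le_trans (cabsD _ _) _; rewrite cabsN !cabsX nw !expr1n.
case: (inv N) => [[-> _]|[i [-> _]]|[i [j [-> _]]]] //.
by rewrite cabs0 divr_ge0 ?(ltW d0).
Qed.

Definition zbox (M : nat) : seq int := [seq (k%:Z - M%:Z) | k <- iota 0 (M + M).+1].

#[global] Arguments zbox : simpl never.

Lemma zbox_uniq M : uniq (zbox M).
Proof. by rewrite map_inj_uniq ?iota_uniq// => x y /addIr/eqP; rewrite eqz_nat => /eqP. Qed.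

Lemma size_zbox M : size (zbox M) = (M + M).+1.
Proof. by rewrite size_map size_iota. Qed.

Lemma mem_zbox M (k : int) : (`|k| <= M%:Z)%R -> k \in zbox M.
Proof.
move=> kM; apply/mapP; exists (absz (k + M%:Z)).
  by rewrite mem_iota /= add0n; lia.
by lia.
Qed.

Lemma zbox_le M (k : int) : k \in zbox M -> (`|k| <= M%:Z)%R.
Proof. by move=> /mapP[j]; rewrite mem_iota /= add0n => jM ->; lia. Qed.

Lemma zbox_sum (w : C) (P : int -> bool) M : w != 1 -> cabs w = 1 ->
  (forall i j k : int, i <= j <= k -> P i -> P k -> P j) ->
  cabs (\sum_(k <- zbox M | P k) w ^ k) <= 2 / cabs (1 - w).
Proof.
move=> w1 nw cP; have w0 : w != 0 by rewrite -cabs_gt0 nw ltr01.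
rewrite /zbox big_map.
have -> : iota 0 (M + M).+1 = index_iota 0 (M + M).+1 by rewrite /index_iota subn0.
rewrite big_mkord.
have -> : \sum_(i < (M + M).+1 | P (i%:Z - M%:Z)) w ^ (i%:Z - M%:Z) =
    w ^ (- M%:Z) * \sum_(i < (M + M).+1 | P (i%:Z - M%:Z)) w ^+ i.
  by rewrite mulr_sumr; apply: eq_bigr => i _; rewrite expfzDr// mulrC.
rewrite cabsM.
have -> : cabs (w ^ (- M%:Z)) = 1 by rewrite -invr_expz cabsV cabsX nw expr1n invr1.
rewrite mul1r; apply: (@interval_sum w (fun i => P (i%:Z - M%:Z))) => // i j k ijk.
by apply: cP; lia.
Qed.

Lemma cis_int (t : R) (k : int) : cis (t * k%:~R) = (cis t) ^ k.
Proof.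
have pos n : cis (t * n%:R) = (cis t) ^+ n.
  by elim: n => [|n IH]; rewrite ?mulr0 ?cis0// -natr1 mulrDr mulr1 cisD IH exprSr.
case: k => n; first exact: pos.
rewrite NegzE rmorphN mulrN /= cisN pos -invr_expz.
have n0 : (cis t) ^+ n.+1 != 0 by rewrite -cabs_gt0 cabsX cabs_cis expr1n ltr01.
apply: (mulfI n0); rewrite mul_conjc cabsX cabs_cis !expr1n mulfV//.
Qed.

Section Balls.
Variable L : 'M[R]_2.
Hypothesis uL : L \in unitmx.

Let cl : R := projT1 (cid2 (n1_lower uL)).

Let cl0 : 0 < cl.
Proof. by rewrite /cl; case: (cid2 _). Qed.

Let clP v : cl * n1 v <= n1 (L *m v).
Proof. by rewrite /cl; case: (cid2 _). Qed.

Definition ball_radius (r : R) : nat := (Num.truncn (2 * r / cl)).+1.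

Definition inball (r : R) (n : coords) := enorm (lvec L n) < r.

Definition ball2 (r : R) : seq coords :=
  [seq n <- [seq cpair a b | a <- zbox (ball_radius r), b <- zbox (ball_radius r)] | inball r n].

Lemma ball2_uniq r : uniq (ball2 r).
Proof.
apply: filter_uniq; apply: allpairs_uniq; rewrite ?zbox_uniq//.
move=> [a b] [a' b'] _ _ /= E.
have := congr1 (fun g : coords => g 0 0) E; have := congr1 (fun g : coords => g 1 0) E.
by rewrite !cpair0 !cpair1 => -> ->.
Qed.

Lemma inball_coord r n : inball r n -> n1 (ivec R n) < (ball_radius r)%:R.
Proof.
move=> nr; have : 2 * r / cl < (ball_radius r)%:R by exact: truncnS_gt.
apply: le_lt_trans; rewrite ler_pdivlMr// mulrC; apply: le_trans (clP _) _.
apply: le_trans (n1_le_enorm _) _; rewrite ler_wpM2l//; exact: ltW.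
Qed.

Lemma mem_ball2 r n : (n \in ball2 r) = inball r n.
Proof.
rewrite mem_filter; case: (boolP (inball r n)) => // nr; rewrite andTb.
have h := inball_coord nr; rewrite -(cpair_eta n).
have lt1 (k : int) : `|k%:~R : R| < (ball_radius r)%:R -> (`|k| <= (ball_radius r)%:Z)%R.
  by rewrite -intr_norm -[_%:R]/((ball_radius r)%:Z%:~R) ltr_int => /ltW.
apply: allpairs_f; apply: mem_zbox; apply: lt1; apply: le_lt_trans h; rewrite /n1 !mxE.
  by rewrite lerDl.
by rewrite lerDr.
Qed.

Lemma sum_box r (F : coords -> C) : \sum_(n <- ball2 r) F n =
  \sum_(a <- zbox (ball_radius r)) \sum_(b <- zbox (ball_radius r) | inball r (cpair a b)) F (cpair a b).
Proof.
rewrite /ball2 big_filter big_mkcond big_allpairs_dep.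
by apply: eq_bigr => a _; rewrite [RHS]big_mkcond.
Qed.

Lemma sum_box' r (F : coords -> C) : \sum_(n <- ball2 r) F n =
  \sum_(b <- zbox (ball_radius r)) \sum_(a <- zbox (ball_radius r) | inball r (cpair a b)) F (cpair a b).
Proof.
rewrite sum_box; under eq_bigr do rewrite big_mkcond.
by rewrite exchange_big /=; apply: eq_bigr => a _; rewrite [RHS]big_mkcond.
Qed.

(** Convexity of balls makes their intersection with a coordinate line an interval of integers, as
    [interval_sum] requires. *)
Lemma inball_convex r (n m : coords) (t : R) k :
  0 <= t <= 1 -> ivec R k = t *: ivec R n + (1 - t) *: ivec R m ->
  inball r n -> inball r m -> inball r k.
Proof.
move=> /andP[t0 t1] kE; rewrite /inball !lvecE kE mulmxDr -!scalemxAr.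
move: (L *m ivec R n) (L *m ivec R m) => u v ur vr.
have r0 : 0 < r by apply: le_lt_trans ur; exact: enorm_ge0.
have e2 w : enorm w < r -> w 0 0 ^+ 2 + w 1 0 ^+ 2 < r ^+ 2.
  rewrite enormE => h; rewrite -[ltLHS]sqr_sqrtr ?addr_ge0 ?sqr_ge0//.
  by rewrite ltr_pXn2r// nnegrE ?sqrtr_ge0// ltW.
have hu := e2 _ ur; have hv := e2 _ vr.
rewrite enormE -[r]gtr0_norm// -sqrtr_sqr ltr_sqrt ?exprn_gt0// !mxE.
set a := u 0 0 in hu *; set b := u 1 0 in hu *; set c := v 0 0 in hv *; set d := v 1 0 in hv *.
have -> : (t * a + (1 - t) * c) ^+ 2 + (t * b + (1 - t) * d) ^+ 2 =
  t * (a ^+ 2 + b ^+ 2) + (1 - t) * (c ^+ 2 + d ^+ 2) - t * (1 - t) * ((a - c) ^+ 2 + (b - d) ^+ 2) by ring.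
have h0 : 0 <= t * (1 - t) * ((a - c) ^+ 2 + (b - d) ^+ 2).
  by rewrite mulr_ge0 ?addr_ge0 ?sqr_ge0// mulr_ge0// subr_ge0.
have [t0'|t0'] := ltP 0 t.
  have := ltr_pM2l t0' (a ^+ 2 + b ^+ 2) (r ^+ 2); rewrite hu => h1.
  have h2 : (1 - t) * (c ^+ 2 + d ^+ 2) <= (1 - t) * r ^+ 2.
    by rewrite ler_wpM2l ?subr_ge0// ltW.
  have h3 : t * (a ^+ 2 + b ^+ 2) < t * r ^+ 2 by rewrite h1.
  by clear -h3 h2 h0; lra.
have -> : t = 0 by apply/eqP; rewrite eq_le t0' t0.
by clear -hv; lra.
Qed.

End Balls.
End CharacterAverages.

(** * Limits of averages *)

Section Averages.
Variable R : realType.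
Local Notation C := (R[i]).

Definition tends (F : R -> C) (l : C) : Prop :=
  forall e : R, 0 < e -> \forall r \near +oo, cabs (F r - l) < e.

Definition avg (T : Type) (bs : R -> seq T) (u : T -> C) (r : R) : C :=
  (\sum_(x <- bs r) u x) / (size (bs r))%:R.

Lemma cabs_avg (T : Type) (bs : R -> seq T) (u : T -> C) B r : 0 <= B ->
  (forall x, cabs (u x) <= B) -> cabs (avg bs u r) <= B.
Proof.
move=> B0 hu; rewrite /avg cabsM cabsV cabs_nat.
have [->|s0] := eqVneq (size (bs r)) 0%N; first by rewrite invr0 mulr0.
rewrite ler_pdivrMr ?ltr0n ?lt0n//; apply: le_trans (cabs_sum _ _ _) _.
apply: (@le_trans _ _ (\sum_(x <- bs r) B)); first exact: ler_sum.
by rewrite big_const_seq count_predT iter_addr_0 mulr_natr.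
Qed.

Lemma avg_lc (T : Type) (bs : R -> seq T) (u v : T -> C) a r :
  avg bs (fun x => a * u x + v x) r = a * avg bs u r + avg bs v r.
Proof. by rewrite /avg big_split /= -mulr_sumr mulrDl mulrA. Qed.

Lemma csum_sumr (S : choiceType) (T : Type) (s : seq T) (u : T -> S -> C) :
  (forall x, asummable (u x)) ->
  asummable (fun k => \sum_(x <- s) u x k) /\
  csum (fun k => \sum_(x <- s) u x k) = \sum_(x <- s) csum (u x).
Proof.
move=> hu; elim: s => [|x s [IH1 IH2]].
  rewrite big_nil; split; last by rewrite -[RHS](csum0 R S); apply: eq_csum => k; rewrite big_nil.
  by rewrite (_ : (fun _ => _) = fun _ => 0) //; [exact: asummable0|apply/funext => k; rewrite big_nil].
have E : (fun k => \sum_(y <- x :: s) u y k) = fun k => 1 * u x k + \sum_(y <- s) u y k.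
  by apply/funext => k; rewrite big_cons mul1r.
by rewrite E big_cons -IH2 csumD// mul1r; split => //; exact: asummableD.
Qed.

(** A dominated series of bounded functions may be averaged term by term, by [tannery]. *)
Lemma avg_csum (S : choiceType) (T : Type) (bs : R -> seq T) (chi : S -> T -> C)
    (m z : S -> C) (g : S -> R) B : (forall k, 0 <= g k) ->
  bsum g B -> (forall k, cabs (m k) <= g k) ->
  (forall k x, cabs (chi k x) <= 1) -> (forall k, cabs (z k) <= 1) ->
  (forall k, tends (avg bs (chi k)) (z k)) ->
  tends (avg bs (fun x => csum (fun k => m k * chi k x))) (csum (fun k => m k * z k)).
Proof.
move=> g0 gB mg c1 z1 h e e0.
have bnd (w : S -> C) : (forall k, cabs (w k) <= 1) -> forall k, cabs (m k * w k) <= g k.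
  by move=> w1 k; rewrite cabsM; apply: le_trans (mg k); rewrite ler_piMr ?cabs_ge0.
have sm x : asummable (fun k => m k * chi k x) by apply: (asummable_le _ gB); exact: bnd.
have E r : avg bs (fun x => csum (fun k => m k * chi k x)) r =
    csum (fun k => m k * avg bs (chi k) r).
  have [h1 h2] := csum_sumr (bs r) sm.
  rewrite /avg -h2 mulrC -csumZ//; apply: eq_csum => k.
  by rewrite mulrC -mulr_sumr mulrA.
rewrite (_ : avg _ _ = fun r => csum (fun k => m k * avg bs (chi k) r)); last exact/funext.
apply: (tannery g0 gB) => //.
- by move=> r k; apply: (bnd (fun k => avg bs (chi k) r)) => j; exact: cabs_avg.
- exact: bnd.
- move=> k e' e'0; have mk : 0 < cabs (m k) + 1 by rewrite ltr_wpDl ?cabs_ge0.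
  have := h k _ (divr_gt0 e'0 mk); apply: filterS => r hr.
  rewrite -mulrBr cabsM; apply: (@le_lt_trans _ _ ((cabs (m k) + 1) * cabs (avg bs (chi k) r - z k))).
    by rewrite ler_wpM2r ?cabs_ge0// lerDl.
  by rewrite mulrC -ltr_pdivlMr.
Qed.

Lemma tends_ge (F : R -> C) l : (forall e, 0 < e -> exists r0, forall r, r0 <= r -> cabs (F r - l) <= e) ->
  tends F l.
Proof.
move=> h e e0; have [|r0 hr] := h (e / 2); first by rewrite divr_gt0.
have : \forall r \near +oo, r0 <= r by exact: nbhs_pinfty_ge (num_real r0).
by apply: filterS => r /hr /le_lt_trans; apply; rewrite ltr_pdivrMr// ltr_pMr// ltr1n.
Qed.

Lemma tends_const (c : C) : tends (fun=> c) c.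
Proof. by move=> e e0; apply: nearW => r; rewrite subrr cabs0. Qed.

Lemma tends_uniq (F : R -> C) l l' : tends F l -> tends F l' -> l = l'.
Proof.
move=> h h'; apply/eqP; rewrite -subr_eq0 -cabs_eq0; apply/eqP; apply: le_anti.
rewrite cabs_ge0 andbT; apply/ler_addgt0Pl => e e0; rewrite addr0.
have e2 : 0 < e / 2 by rewrite divr_gt0.
have [r [h1 h2]] := @filter_ex _ _ _ _ (filterI (h _ e2) (h' _ e2)).
apply: le_trans (cabs_dist _ (F r) _) _; rewrite cabsB; lra.
Qed.

Lemma tends_lc (F G : R -> C) a l m : tends F l -> tends G m ->
  tends (fun r => a * F r + G r) (a * l + m).
Proof.
move=> hF hG e e0; have a0 : 0 < cabs a + 1 by rewrite ltr_wpDl ?cabs_ge0.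
have e2 : 0 < e / 2 by rewrite divr_gt0.
apply: filterS (filterI (hF _ (divr_gt0 e2 a0)) (hG _ e2)) => r [h1 h2].
have -> : a * F r + G r - (a * l + m) = a * (F r - l) + (G r - m) by ring.
apply: le_lt_trans (cabsD _ _) _; rewrite cabsM.
have : cabs a * cabs (F r - l) <= e / 2.
  apply: (@le_trans _ _ ((cabs a + 1) * cabs (F r - l))).
    by rewrite ler_wpM2r ?cabs_ge0// lerDl.
  by rewrite mulrC -ler_pdivlMr// ltW.
move: h2; lra.
Qed.

Lemma tends_avg1 (T : Type) (bs : R -> seq T) :
  (exists r0, forall r, r0 <= r -> (0 < size (bs r))%N) -> tends (avg bs (fun=> 1)) 1.
Proof.
move=> [r0 h]; apply: tends_ge => e e0; exists r0 => r /h s0.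
rewrite /avg big_const_seq count_predT iter_addr_0 divff ?subrr ?cabs0 ?(ltW e0)//.
by rewrite pnatr_eq0 -lt0n.
Qed.

End Averages.

(** * Averages of nontrivial characters *)

Section CharacterAverages.
Variable R : realType.
Local Notation C := (R[i]).
Implicit Types (L : 'M[R]_2) (w : 'cV[R]_2).

Definition achar w (n : coords) : C := cis (dot w (ivec R n)).

Definition trivial_char w : Prop := cis (w 0 0) = 1 /\ cis (w 1 0) = 1.

Lemma cabs_achar w n : cabs (achar w n) = 1.
Proof. exact: cabs_cis. Qed.

Lemma acharE w a b : achar w (cpair a b) = cis (w 0 0) ^ a * cis (w 1 0) ^ b.
Proof. by rewrite /achar dotE !mxE /= cisD !cis_int. Qed.

Lemma inball_interval L (uL : L \in unitmx) r (f : int -> coords) :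
  (forall a b c : int, a < c -> a <= b <= c ->
    ivec R (f b) = ((c - b)%:~R / (c - a)%:~R) *: ivec R (f a) +
      (1 - (c - b)%:~R / (c - a)%:~R) *: ivec R (f c)) ->
  forall a b c : int, a <= b <= c -> inball L r (f a) -> inball L r (f c) -> inball L r (f b).
Proof.
move=> hf a b c /andP[ab bc] ha hc.
have := le_trans ab bc; rewrite le_eqVlt => /orP[/eqP ac|ac].
  by have -> : b = a by lia.
have ca : 0 < (c - a)%:~R :> R by rewrite ltr0z; lia.
apply: (inball_convex _ (hf a b c ac _) ha hc); last by rewrite ab.
apply/andP; split; last by rewrite ler_pdivrMr// mul1r ler_int; lia.
by rewrite divr_ge0 ?(ltW ca)// ler0z; lia.
Qed.

Lemma ball_radius_upper L (uL : L \in unitmx) : exists2 c : R, 0 < c &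
  forall r, 0 <= r -> ((ball_radius uL r + ball_radius uL r).+1)%:R <= c * (r + 1).
Proof.
set c := projT1 (cid2 (n1_lower uL)).
have c0 : 0 < c by rewrite /c; case: (cid2 _).
exists (4 / c + 3); first by rewrite addr_gt0 ?divr_gt0.
move=> r r0; have : (Num.truncn (2 * r / c))%:R <= 2 * r / c.
  by rewrite truncn_le// !mulr_ge0 ?invr_ge0// ltW.
rewrite /ball_radius -/c; move: (Num.truncn _) => M.
have -> : (M.+1 + M.+1).+1%:R = 2 * M%:R + 3 :> R.
  have -> : ((M.+1 + M.+1).+1 = 2 * M + 3)%N by lia.
  by rewrite natrD natrM.
have : 0 < c^-1 by rewrite invr_gt0.
have : 0 <= r / c by rewrite divr_ge0// ltW.
lra.
Qed.

(** The ball is cut into lines along a coordinate in which the character is nontrivial: each line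
    contributes a bounded amount and there are of order [r] lines, against order [r ^+ 2] points. *)
Lemma char_sum_bound L (uL : L \in unitmx) w : ~ trivial_char w ->
  exists2 K, 0 <= K & forall r : R, 0 <= r -> cabs (\sum_(n <- ball2 uL r) achar w n) <= K * (r + 1).
Proof.
move=> nt; have [c c0 rad] := ball_radius_upper uL.
have aux (om : C) : om != 1 -> 0 <= c * (2 / cabs (1 - om)).
  by move=> _; rewrite mulr_ge0 ?divr_ge0 ?cabs_ge0// ltW.
have step (F : int -> C) d r : 0 <= r -> 0 <= d -> (forall a, cabs (F a) <= d) ->
    cabs (\sum_(a <- zbox (ball_radius uL r)) F a) <= c * d * (r + 1).
  move=> r0 d0 hF; apply: le_trans (cabs_sum _ _ _) _.
  apply: (@le_trans _ _ (\sum_(a <- zbox (ball_radius uL r)) d)); first exact: ler_sum.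
  rewrite big_const_seq count_predT iter_addr_0 size_zbox -mulr_natr.
  have -> : c * d * (r + 1) = d * (c * (r + 1)) by ring.
  by rewrite ler_wpM2l ?rad.
have [w1|w1] := eqVneq (cis (w 1 0)) (1 : C); last first.
  exists (c * (2 / cabs (1 - cis (w 1 0)))); first exact: aux.
  move=> r r0; rewrite sum_box; apply: step => //; first by rewrite divr_ge0 ?cabs_ge0.
  move=> a; under eq_bigr do rewrite acharE.
  rewrite -mulr_sumr cabsM.
  have -> : cabs (cis (w 0 0) ^ a) = 1 by rewrite -cis_int cabs_cis.
  rewrite mul1r; apply: zbox_sum; rewrite ?cabs_cis//.
  apply: inball_interval => // i j k ik _.
  have ki : (k - i)%:~R != 0 :> R by rewrite intr_eq0; lia.
  by apply: cV2P; rewrite !mxE /= ?rmorphB /= in ki *; field.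
have w0 : cis (w 0 0) != 1 :> C by apply/eqP => w0; apply: nt.
exists (c * (2 / cabs (1 - cis (w 0 0)))); first exact: aux.
move=> r r0; rewrite sum_box'; apply: step => //; first by rewrite divr_ge0 ?cabs_ge0.
move=> b; under eq_bigr do rewrite acharE mulrC.
rewrite -mulr_sumr cabsM.
have -> : cabs (cis (w 1 0) ^ b) = 1 by rewrite -cis_int cabs_cis.
rewrite mul1r; apply: (@zbox_sum R (cis (w 0 0)) (fun a => inball L r (cpair a b))); rewrite ?cabs_cis//.
apply: (@inball_interval L uL r (fun a => cpair a b)) => // i j k ik _.
have ki : (k - i)%:~R != 0 :> R by rewrite intr_eq0; lia.
by apply: cV2P; rewrite !mxE /= ?rmorphB /= in ki *; field.
Qed.

Lemma cpairs_uniq (s1 s2 : seq int) : uniq s1 -> uniq s2 ->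
  uniq [seq cpair a b | a <- s1, b <- s2].
Proof.
move=> u1 u2; apply: allpairs_uniq => //; move=> [a b] [a' b'] _ _ /= E.
have := congr1 (fun g : coords => g 0 0) E; have := congr1 (fun g : coords => g 1 0) E.
by rewrite !cpair0 !cpair1 => -> ->.
Qed.

Lemma ball2_size_lower L (uL : L \in unitmx) : exists2 c : R, 0 < c &
  forall r, 0 < r -> c * r ^+ 2 <= (size (ball2 uL r))%:R.
Proof.
have [C C0 hC] := n1_upper L; exists ((4 * C)^-1 ^+ 2); first by rewrite exprn_gt0 ?invr_gt0 ?mulr_gt0.
move=> r r0; set m := Num.truncn (r / (4 * C)).
have q0 : 0 <= r / (4 * C) by rewrite divr_ge0 ?mulr_ge0 ?ltW.
have m1 : m%:R <= r / (4 * C) by rewrite truncn_le.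
have m2 : r / (4 * C) < m.+1%:R by exact: truncnS_gt.
have sub : {subset [seq cpair a b | a <- zbox m, b <- zbox m] <= ball2 uL r}.
  move=> n /allpairsP[[a b] /= [am bm ->]]; rewrite mem_ball2.
  have le (k : int) : k \in zbox m -> `|k%:~R : R| <= m%:R.
    by move=> /zbox_le km; rewrite -intr_norm -[m%:R]/(m%:Z%:~R) ler_int.
  rewrite /inball; apply: le_lt_trans (enorm_le_n1 _) _; apply: le_lt_trans (hC _) _.
  have : n1 (ivec R (cpair a b)) <= 2 * (r / (4 * C)).
    by rewrite /n1 !mxE /=; have := le _ am; have := le _ bm; lra.
  move=> /(ler_wpM2l (ltW C0)) /le_lt_trans; apply.
  have -> : C * (2 * (r / (4 * C))) = r / 2 by field; rewrite gt_eqF.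
  lra.
have := uniq_leq_size (cpairs_uniq (zbox_uniq m) (zbox_uniq m)) sub.
rewrite size_allpairs size_zbox => h.
apply: (@le_trans _ _ ((m + m).+1 * (m + m).+1)%:R); last by rewrite ler_nat.
rewrite -exprMn mulrC natrM -expr2 ler_pXn2r ?nnegrE ?ler0n//.
by apply: ltW; apply: lt_le_trans m2 _; rewrite ler_nat; lia.
Qed.

Lemma ball2_size_upper L (uL : L \in unitmx) : exists2 c : R, 0 < c &
  forall r, 0 <= r -> (size (ball2 uL r))%:R <= c * (r + 1) ^+ 2.
Proof.
have [c c0 rad] := ball_radius_upper uL; exists (c ^+ 2); first by rewrite exprn_gt0.
move=> r r0; apply: (@le_trans _ _ (((ball_radius uL r + ball_radius uL r).+1)%:R ^+ 2)).
  rewrite expr2 -natrM ler_nat -size_zbox -(size_allpairs cpair).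
  by rewrite /ball2 size_filter count_size.
by rewrite -exprMn ler_pXn2r ?nnegrE ?ler0n ?mulr_ge0 ?addr_ge0 ?(ltW c0)// rad.
Qed.

Lemma ball2_size_gt0 L (uL : L \in unitmx) : exists r0 : R, forall r, r0 <= r -> (0 < size (ball2 uL r))%N.
Proof.
have [c c0 hc] := ball2_size_lower uL; exists 1 => r r1.
have r0 : 0 < r by lra.
by rewrite -(ltr0n R); apply: lt_le_trans (hc _ r0); rewrite mulr_gt0 ?exprn_gt0.
Qed.

Lemma achar_avg L (uL : L \in unitmx) w : ~ trivial_char w -> tends (avg (ball2 uL) (achar w)) 0.
Proof.
move=> nt; have [K K0 hK] := char_sum_bound uL nt; have [c c0 hc] := ball2_size_lower uL.
apply: tends_ge => e e0; exists (Num.max 1 (2 * K / (c * e))) => r; rewrite ge_max => /andP[r1 r2].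
have r0 : 0 < r by lra.
have s0 : 0 < (size (ball2 uL r))%:R :> R.
  by apply: lt_le_trans (hc _ r0); rewrite mulr_gt0 ?exprn_gt0.
rewrite subr0 /avg cabsM cabsV cabs_nat ler_pdivrMr//.
apply: le_trans (hK _ (ltW r0)) _.
apply: (@le_trans _ _ (e * (c * r ^+ 2))); last by rewrite ler_wpM2l ?hc ?(ltW e0).
move: r2; rewrite ler_pdivrMr ?mulr_gt0// => r2.
have h1 : K * (r + 1) <= K * (2 * r) by rewrite ler_wpM2l//; lra.
have h2 : 2 * K * r <= r * (c * e) * r by rewrite ler_wpM2r// ltW.
rewrite expr2; lra.
Qed.

Section FourBalls.
Variables (L L' : 'M[R]_2).
Hypotheses (uL : L \in unitmx) (uL' : L' \in unitmx).

Definition inball4 (r : R) (p : coords * coords) :=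
  Num.sqrt (enorm (lvec L p.1) ^+ 2 + enorm (lvec L' p.2) ^+ 2) < r.

Definition ball4 (r : R) : seq (coords * coords) :=
  [seq p <- [seq (g, h) | g <- ball2 uL r, h <- ball2 uL' r] | inball4 r p].

Lemma ball4_uniq r : uniq (ball4 r).
Proof. by apply: filter_uniq; apply: allpairs_uniq; rewrite ?ball2_uniq// => -[? ?] [? ?]. Qed.

Lemma mem_ball4 r p : (p \in ball4 r) = inball4 r p.
Proof.
rewrite mem_filter; case: (boolP (inball4 r p)) => //; case: p => g h hp; rewrite andTb.
apply: allpairs_f; rewrite mem_ball2 /inball; apply: le_lt_trans hp; rewrite /=.
  by rewrite -[leLHS]ger0_norm ?enorm_ge0// -sqrtr_sqr ler_wsqrtr// lerDl sqr_ge0.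
by rewrite -[leLHS]ger0_norm ?enorm_ge0// -sqrtr_sqr ler_wsqrtr// lerDr sqr_ge0.
Qed.

Lemma sqrt_lt (x r : R) : 0 <= x -> 0 < r -> (Num.sqrt x < r) = (x < r ^+ 2).
Proof. by move=> x0 r0; rewrite -{1}[r]gtr0_norm// -sqrtr_sqr ltr_sqrt// exprn_gt0. Qed.

(** Fixing one of the two lattice points cuts the four-dimensional ball in a plane ball, whose
    radius is given by Pythagoras. *)
Lemma slice_sum w r h : 0 < r -> h \in ball2 uL' r -> exists2 rho, 0 <= rho <= r &
  \sum_(g <- ball2 uL r | inball4 r (g, h)) achar w g = \sum_(g <- ball2 uL rho) achar w g.
Proof.
move=> r0; rewrite mem_ball2 /inball => hr.
set y := enorm _ in hr; have y0 : 0 <= y by exact: enorm_ge0.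
have yr : 0 < r ^+ 2 - y ^+ 2 by rewrite subr_gt0 ltr_pXn2r// nnegrE ltW.
exists (Num.sqrt (r ^+ 2 - y ^+ 2)).
  rewrite sqrtr_ge0 -[leRHS]gtr0_norm// -sqrtr_sqr ler_wsqrtr// lerBlDr lerDl sqr_ge0//.
rewrite -big_filter; apply: perm_big; apply: uniq_perm; [exact/filter_uniq/ball2_uniq|exact: ball2_uniq|].
move=> g; rewrite mem_filter !mem_ball2 /inball /inball4 /= -/y.
set x := enorm _; have x0 : 0 <= x by exact: enorm_ge0.
rewrite sqrt_lt// ?addr_ge0 ?sqr_ge0//.
rewrite -[x in RHS]ger0_norm// -sqrtr_sqr ltr_sqrt// -ltrBrDr.
apply/andP/idP => [[]//|hx]; split => //.
rewrite -[r]gtr0_norm// -sqrtr_sqr -[x]ger0_norm// -sqrtr_sqr ltr_sqrt ?exprn_gt0//.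
by apply: lt_le_trans hx _; rewrite lerBlDr lerDl sqr_ge0.
Qed.

Lemma ball4_size_lower : exists2 c : R, 0 < c & forall r, 0 < r -> c * r ^+ 4 <= (size (ball4 r))%:R.
Proof.
have [c c0 hc] := ball2_size_lower uL; have [d d0 hd] := ball2_size_lower uL'.
exists (c * d / 16); first by rewrite !mulr_gt0.
move=> r r0; have r2 : 0 < r / 2 by rewrite divr_gt0.
have sub : {subset [seq (g, h) | g <- ball2 uL (r / 2), h <- ball2 uL' (r / 2)] <= ball4 r}.
  move=> _ /allpairsP[[g h] /= [hg hh ->]]; move: hg hh; rewrite !mem_ball2 mem_ball4 /inball /inball4 /=.
  set x := enorm _; set y := enorm _; have x0 : 0 <= x by exact: enorm_ge0.
  have y0 : 0 <= y by exact: enorm_ge0.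
  move=> hx hy; rewrite sqrt_lt ?addr_ge0 ?sqr_ge0//.
  have : x ^+ 2 < (r / 2) ^+ 2 by rewrite ltr_pXn2r// nnegrE ltW.
  have : y ^+ 2 < (r / 2) ^+ 2 by rewrite ltr_pXn2r// nnegrE ltW.
  have := sqr_ge0 r; rewrite expr_div_n; lra.
have u : uniq [seq (g, h) | g <- ball2 uL (r / 2), h <- ball2 uL' (r / 2)].
  by apply: allpairs_uniq; rewrite ?ball2_uniq// => -[? ?] [? ?].
have := uniq_leq_size u sub; rewrite size_allpairs -(ler_nat R) => h; apply: le_trans h.
rewrite natrM; apply: (@le_trans _ _ ((c * (r / 2) ^+ 2) * (d * (r / 2) ^+ 2))).
  by rewrite le_eqVlt; apply/orP; left; apply/eqP; field.
by apply: ler_pM; rewrite ?hc ?hd// mulr_ge0 ?sqr_ge0 ?ltW.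
Qed.

Lemma ball4_size_gt0 : exists r0 : R, forall r, r0 <= r -> (0 < size (ball4 r))%N.
Proof.
have [c c0 hc] := ball4_size_lower; exists 1 => r r1.
have r0 : 0 < r by lra.
by rewrite -(ltr0n R); apply: lt_le_trans (hc _ r0); rewrite mulr_gt0 ?exprn_gt0.
Qed.

(** There are of order [r ^+ 2] slices, each contributing at most order [r], against order [r ^+ 4]
    points. *)
Lemma ball4_avg_l w w' : ~ trivial_char w ->
  tends (avg ball4 (fun p => achar w p.1 * achar w' p.2)) 0.
Proof.
move=> nt; have [K K0 hK] := char_sum_bound uL nt; have [c c0 hc] := ball4_size_lower.
have [D D0 hD] := ball2_size_upper uL'.
apply: tends_ge => e e0; exists (Num.max 1 (8 * K * D / (c * e))) => r.
rewrite ge_max => /andP[r1 r2].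
have r0 : 0 < r by lra.
have s0 : 0 < (size (ball4 r))%:R :> R.
  by apply: lt_le_trans (hc _ r0); rewrite mulr_gt0 ?exprn_gt0.
rewrite subr0 /avg cabsM cabsV cabs_nat ler_pdivrMr//.
have b : cabs (\sum_(p <- ball4 r) achar w p.1 * achar w' p.2) <= D * (r + 1) ^+ 2 * (K * (r + 1)).
  rewrite big_filter big_mkcond big_allpairs_dep exchange_big /=.
  apply: le_trans (cabs_sum _ _ _) _.
  apply: (@le_trans _ _ (\sum_(h <- ball2 uL' r) (K * (r + 1)))); last first.
    rewrite big_const_seq count_predT iter_addr_0 -mulr_natl ler_wpM2r ?hD ?(ltW r0)//.
    by rewrite mulr_ge0// addr_ge0// ltW.
  rewrite big_seq [leRHS]big_seq; apply: ler_sum => h hh.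
  rewrite -big_mkcond -mulr_suml cabsM cabs_achar mulr1.
  have [rho /andP[rho0 rhor] ->] := slice_sum w r0 hh.
  by apply: le_trans (hK _ rho0) _; rewrite ler_wpM2l// lerD2r.
apply: le_trans b _.
apply: (@le_trans _ _ (e * (c * r ^+ 4))); last by rewrite ler_wpM2l ?hc ?(ltW e0).
move: r2; rewrite ler_pdivrMr ?mulr_gt0// => r2.
have h1 : (r + 1) ^+ 3 <= (2 * r) ^+ 3 by rewrite ler_pXn2r ?nnegrE//; lra.
have -> : D * (r + 1) ^+ 2 * (K * (r + 1)) = (D * K) * (r + 1) ^+ 3 by ring.
have h2 : (D * K) * (r + 1) ^+ 3 <= (D * K) * (2 * r) ^+ 3.
  by rewrite ler_wpM2l// mulr_ge0// ltW.
have h3 : 8 * K * D * r ^+ 3 <= r * (c * e) * r ^+ 3 by rewrite ler_wpM2r// exprn_ge0// ltW.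
have E1 : D * K * (2 * r) ^+ 3 = 8 * K * D * r ^+ 3 by ring.
have E2 : e * (c * r ^+ 4) = r * (c * e) * r ^+ 3 by ring.
by rewrite E2; apply: le_trans h2 _; rewrite E1.
Qed.

End FourBalls.

Lemma ball4_avg L L' (uL : L \in unitmx) (uL' : L' \in unitmx) w w' :
  ~ (trivial_char w /\ trivial_char w') ->
  tends (avg (ball4 uL uL') (fun p => achar w p.1 * achar w' p.2)) 0.
Proof.
move=> nt; have [tw|ntw] := pselect (trivial_char w); last exact: ball4_avg_l.
have ntw' : ~ trivial_char w' by move=> tw'; apply: nt.
move=> e e0; have := ball4_avg_l uL' uL w ntw' e0; apply: filterS => r.
suff -> : avg (ball4 uL uL') (fun p => achar w p.1 * achar w' p.2) r =
   avg (ball4 uL' uL) (fun p => achar w' p.1 * achar w p.2) r by [].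
have pe : perm_eq (ball4 uL uL' r) [seq (p.2, p.1) | p <- ball4 uL' uL r].
  apply: uniq_perm; rewrite ?ball4_uniq ?map_inj_uniq ?ball4_uniq//; first by move=> [? ?] [? ?] [-> ->].
  move=> [g h]; rewrite mem_ball4; apply/idP/mapP => [hp|[[h' g'] /= hq [-> ->]]].
    by exists (h, g) => //; rewrite mem_ball4; move: hp; rewrite /inball4 /= addrC.
  by move: hq; rewrite mem_ball4 /inball4 /= addrC.
rewrite /avg (perm_big _ pe) (perm_size pe) size_map big_map /=.
by congr (_ / _); apply: eq_bigr => p _; rewrite mulrC.
Qed.

End CharacterAverages.

(** * Fourier series and Poisson summation *)

Section FourierUniqueness.
Variable R : realType.
Local Notation C := (R[i]).

Lemma cis_eq1 (x : R) : cis (2 * pi * x) = 1 -> exists k : int, x = k%:~R.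
Proof.
move=> h; exists (Num.floor x); set k := Num.floor x.
have /andP[f1 f2] := floor_itv x; rewrite -/k in f1 f2.
have ck : cis (2 * pi * k%:~R) = 1 :> C.
  rewrite cis_int (_ : cis _ = 1 :> C) ?exp1rz//.
  by rewrite /cis mulrC mulr_natr cos2pi sin2pi.
have : cis (2 * pi * (x - k%:~R)) = 1 :> C.
  by rewrite mulrBr cisD h cisN ck conjc1 mul1r.
move=> /(congr1 (@complex.Re R)) /= c1.
have s0 : sin (pi * (x - k%:~R)) = 0.
  apply/eqP; rewrite -sqrf_eq0; apply/eqP.
  move: c1; have -> : 2 * pi * (x - k%:~R) = (pi * (x - k%:~R)) *+ 2 by rewrite -mulr_natr; ring.
  rewrite cos_mulr2n; have := cos2Dsin2 (pi * (x - k%:~R)); lra.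
apply/eqP; rewrite eq_le f1 andbT leNgt; apply/negP => kx.
have : 0 < sin (pi * (x - k%:~R)).
  have p0 := pi_gt0 R; have f3 : x - k%:~R < 1 by rewrite rmorphD /= in f2; lra.
  apply: sin_gt0_pi; rewrite mulr_gt0 ?subr_gt0//=.
  by rewrite -[ltRHS]mulr1 ltr_pM2l.
by rewrite s0 ltxx.
Qed.

Lemma cis_2pi_int (k : int) : cis (2 * pi * k%:~R) = 1 :> C.
Proof.
rewrite cis_int (_ : cis _ = 1 :> C) ?exp1rz//.
by rewrite /cis mulrC mulr_natr cos2pi sin2pi.
Qed.

Definition eint (j : int) (s : R) : C := cis (2 * pi * j%:~R * s).

Lemma cabs_eint j s : cabs (eint j s) = 1.
Proof. exact: cabs_cis. Qed.

Lemma eintD j k s : eint (j + k) s = eint j s * eint k s.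
Proof. by rewrite /eint rmorphD /= -cisD; congr cis; ring. Qed.

Lemma eintB j s u : eint j (s - u) = eint j s * eint (- j) u.
Proof. by rewrite /eint rmorphN /= -cisD; congr cis; ring. Qed.

Lemma eint_periodic j s (k : int) : eint j (s + k%:~R) = eint j s.
Proof.
rewrite /eint mulrDr cisD (_ : 2 * pi * j%:~R * k%:~R = 2 * pi * (j * k)%:~R) ?cis_2pi_int ?mulr1//.
by rewrite rmorphM /= mulrA.
Qed.

Lemma ccont_ReIm (f g : R -> R) : continuous f -> continuous g -> forall t, ccont_at (fun s => f s +i* g s) t.
Proof.
move=> cf cg t e e0; have e2 : 0 < e / 2 by rewrite divr_gt0.
have := cf t; have := cg t; move/cvgrPdist_lt => /(_ _ e2) [d1 /= d10 h1].
move/cvgrPdist_lt => /(_ _ e2) [d2 /= d20 h2].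
exists (Num.min d1 d2); first by rewrite lt_min d10.
move=> s; rewrite lt_min distrC => /andP[/h1 k1 /h2 k2].
apply: le_lt_trans (cabs_le_ReIm _) _; rewrite /= distrC [X in _ + X]distrC.
by move: k1 k2; rewrite /=; lra.
Qed.

Lemma cis_cont (t : R) : ccont_at (fun s => cis s) t.
Proof. apply: ccont_ReIm => x; [exact: continuous_cos|exact: continuous_sin]. Qed.

Lemma ccont_at_lin (g : R -> C) (a b t : R) : ccont_at g (a * t + b) -> ccont_at (fun s => g (a * s + b)) t.
Proof.
move=> cg e e0; have [d d0 hd] := cg e e0.
have a0 : 0 < `|a| + 1 by rewrite ltr_wpDl.
exists (d / (`|a| + 1)); first by rewrite divr_gt0.
move=> s; rewrite ltr_pdivlMr// => h; apply: hd.
have -> : a * s + b - (a * t + b) = (s - t) * a by ring.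
rewrite normrM; apply: le_lt_trans h; by rewrite ler_wpM2l// lerDl.
Qed.

Lemma ccont_eint j t : ccont_at (eint j) t.
Proof.
have := @ccont_at_lin (fun s => cis s) (2 * pi * j%:~R) 0 t (cis_cont _).
by rewrite (_ : (fun s => cis _) = eint j)//; apply/funext => s; rewrite addr0.
Qed.

Lemma ccont_atM (g h : R -> C) t : ccont_at g t -> ccont_at h t -> ccont_at (fun s => g s * h s) t.
Proof.
move=> cg ch e e0.
have g0 : 0 < cabs (g t) + 1 by rewrite ltr_wpDl ?cabs_ge0.
have h0 : 0 < cabs (h t) + 1 by rewrite ltr_wpDl ?cabs_ge0.
have [|d1 d10 k1] := cg (e / 2 / (cabs (h t) + 1)); first by rewrite !divr_gt0.
have [|d2 d20 k2] := ch (Num.min 1 (e / 2 / (cabs (g t) + 1))).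
  by rewrite lt_min ltr01 !divr_gt0.
have [|d3 d30 k3] := cg 1; first exact: ltr01.
exists (Num.min (Num.min d1 d2) d3); first by rewrite !lt_min d10 d20.
move=> s; rewrite !lt_min => /andP[/andP[/k1 a1 /k2 a2] /k3 a3].
move: a2; rewrite lt_min => /andP[a2 a4].
have -> : g s * h s - g t * h t = (g s - g t) * h s + g t * (h s - h t) by ring.
have hs : cabs (h s) <= cabs (h t) + 1.
  by have := cabs_lerB (h s) (h t); lra.
apply: le_lt_trans (cabsD _ _) _; rewrite !cabsM.
have b1 : cabs (g s - g t) * cabs (h s) < e / 2.
  apply: (@le_lt_trans _ _ (cabs (g s - g t) * (cabs (h t) + 1))).
    by rewrite ler_wpM2l ?cabs_ge0.
  by rewrite -ltr_pdivlMr.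
have b2 : cabs (g t) * cabs (h s - h t) <= e / 2.
  apply: (@le_trans _ _ ((cabs (g t) + 1) * cabs (h s - h t))).
    by rewrite ler_wpM2r ?cabs_ge0// lerDl.
  by rewrite mulrC -ler_pdivlMr// ltW.
clear -b1 b2; lra.
Qed.

Lemma crint_sum (I : Type) (s : seq I) (F : I -> R -> C) : (forall i, ccont (F i)) ->
  ccont (fun t => \sum_(i <- s) F i t) /\
  crint (fun t => \sum_(i <- s) F i t) = \sum_(i <- s) crint (F i).
Proof.
move=> hF; elim: s => [|i s [IH1 IH2]].
  rewrite (_ : (fun _ => _) = fun _ => 0); last by apply/funext => t; rewrite big_nil.
  by rewrite crint_cst big_nil; split => //; exact: ccont_cst.
rewrite (_ : (fun _ => _) = fun t => 1 * F i t + \sum_(j <- s) F j t); last first.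
  by apply/funext => t; rewrite big_cons mul1r.
by rewrite crint_lc// mul1r IH2 big_cons; split => //; apply: ccont_lc.
Qed.

Lemma crintZ a (g : R -> C) : ccont g -> ccont (fun t => a * g t) /\ crint (fun t => a * g t) = a * crint g.
Proof.
move=> cg; have c0 := ccont_cst (0 : C).
rewrite (_ : (fun t => a * g t) = fun t => a * g t + 0); last by apply/funext => t; rewrite addr0.
by rewrite crint_lc// crint_cst addr0; split => //; exact: ccont_lc.
Qed.

Lemma crint_mono (g h : R -> C) : ccont g -> ccont h ->
  (forall t, 0 <= t <= 1 -> cabs (g t) <= complex.Re (h t)) -> cabs (crint g) <= complex.Re (crint h).
Proof.
move=> cg ch gh; apply/ler_addgt0Pl => e e0; have e2 : 0 < e / 2 by rewrite divr_gt0.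
have [N1 N10 h1] := crint_lim cg e2; have [N2 N20 h2] := crint_lim ch e2.
pose N := maxn N1 N2; have {}h1 := h1 N (leq_maxl _ _); have {}h2 := h2 N (leq_maxr _ _).
have N0 : (0 < N)%N by apply: leq_trans N10 (leq_maxl _ _).
have n0 : 0 < N%:R :> R by rewrite ltr0n.
have b : cabs (rsum_unit N g) <= complex.Re (rsum_unit N h).
  rewrite /rsum_unit cabsM cabsV cabs_nat -realC_nat -realCV cReM /= mul0r subr0.
  rewrite ler_pM2l ?invr_gt0// Re_sum; apply: le_trans (cabs_sum _ _ _) _.
  apply: ler_sum => i _; apply: gh; rewrite divr_ge0//= ler_pdivrMr// mul1r ler_nat.
  exact/ltnW/ltn_ord.
have := cabs_lerB (crint g) (rsum_unit N g).
have := Re_le_cabs (crint h - rsum_unit N h); rewrite cReD cReN.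
have := ler_norm (- (complex.Re (crint h) - complex.Re (rsum_unit N h))); rewrite normrN.
clear -h1 h2 b; lra.
Qed.

Lemma crint_eint j : crint (eint j) = (j == 0)%:R.
Proof.
have [->|j0] := eqVneq j 0.
  rewrite -(crint_cst 1); apply: eq_crint => t _.
  by rewrite /eint mulr0 mul0r cis0.
apply: cabs_le_eps => e e0.
have cj : ccont (eint j) by move=> t _; exact: ccont_eint.
have [N1 N10 h1] := crint_lim cj e0.
pose N := maxn N1 `|j|.+1; have {}h1 := h1 N (leq_maxl _ _).
have N0 : (0 < N)%N by apply: leq_trans N10 (leq_maxl _ _).
have jN : (`|j| < N)%N by apply: leq_trans (leq_maxr _ _).
have n0 : N%:R != 0 :> R by rewrite pnatr_eq0 -lt0n.
suff E : rsum_unit N (eint j) = 0 by rewrite E subr0 in h1.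
rewrite /rsum_unit; set w : C := cis (2 * pi * (j%:~R / N%:R)).
have -> : \sum_(i < N) eint j (i%:R / N%:R) = \sum_(i < N) w ^+ i.
  apply: eq_bigr => i _; rewrite /w /eint -[_ ^+ i]/(_ ^ i%:Z) -cis_int; congr cis.
  by rewrite -pmulrn; field.
have w1 : w != 1.
  apply/eqP => /cis_eq1 [k]; move/(congr1 (fun x => x * N%:R)); rewrite divfK//.
  rewrite -[N%:R]/(N%:Z%:~R) -rmorphM => /intr_inj jk.
  move: jN; rewrite jk abszM /=.
  have k0 : (0 < `|k|)%N by rewrite absz_gt0; apply: contraNneq j0 => k0; rewrite jk k0 mul0r.
  by rewrite ltnNge leq_pmull.
have wN : w ^+ N = 1.
  rewrite /w -[_ ^+ N]/(_ ^ N%:Z) -cis_int -pmulrn.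
  have -> : 2 * pi * (j%:~R / N%:R) * N%:R = 2 * pi * j%:~R :> R by field.
  exact: cis_2pi_int.
have := subrX1 w N; rewrite wN subrr => /esym/eqP.
by rewrite mulf_eq0 subr_eq0 (negbTE w1) /= => /eqP ->; rewrite mulr0.
Qed.

(** After reduction of [x] to its fractional part, the continuous function [|1 - e^(2 pi i y)|] has
    a positive minimum on [[a, 1 - a]]. *)
Lemma far_from_int (eta : R) : 0 < eta -> exists2 c, 0 < c &
  forall x : R, c <= cabs (1 - cis (2 * pi * x)) \/ exists k : int, `|x - k%:~R| < eta.
Proof.
move=> eta0; pose a := Num.min (eta / 2) 4^-1.
have a0 : 0 < a by rewrite lt_min divr_gt0//= invr_gt0.
have a4 : a <= 4^-1 by rewrite ge_min lexx orbT.
have ae : a < eta by apply: (@le_lt_trans _ _ (eta / 2)); [rewrite ge_min lexx|lra].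
pose f (y : R) := cabs (1 - cis (2 * pi * y)).
have cf : {within `[a, 1 - a], continuous f}.
  apply: continuous_in_subspaceT => y _; apply/cvgrPdist_lt => e e0.
  have := @ccont_at_lin (fun s => cis s) (2 * pi) 0 y (cis_cont _); move=> /(_ e e0) [d d0 hd].
  near=> z.
  have zy : `|z - y| < d by near: z; exists d => // z /=; rewrite distrC.
  have := hd z zy; rewrite !addr0; apply: le_lt_trans; rewrite /f ler_norml.
  have := cabs_lerB (1 - cis (2 * pi * y)) (1 - cis (2 * pi * z)).
  have := cabs_lerB (1 - cis (2 * pi * z)) (1 - cis (2 * pi * y)).
  have -> : 1 - cis (2 * pi * y) - (1 - cis (2 * pi * z)) = cis (2 * pi * z) - cis (2 * pi * y) :> C by ring.
  have -> : 1 - cis (2 * pi * z) - (1 - cis (2 * pi * y)) = cis (2 * pi * y) - cis (2 * pi * z) :> C by ring.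
  by rewrite (cabsB (cis (2 * pi * y))); clear; lra.
have [|y0 hy0 hmin] := EVT_min _ cf; first lra.
exists (f y0).
  rewrite cabs_gt0 subr_eq0 eq_sym; apply/eqP => /cis_eq1 [k yk].
  move: hy0; rewrite in_itv /= yk => /andP[k1 k2].
  have k1' : (0 < k) by rewrite -(ltr0z R); lra.
  have k2' : (k < 1) by rewrite -(ltrz1 R); lra.
  by lia.
move=> x; have /andP[f1 f2] := floor_itv x; set k := Num.floor x in f1 f2 *.
rewrite rmorphD /= in f2.
have [h1|h1] := ltP (x - k%:~R) a.
  by right; exists k; rewrite ger0_norm; lra.
have [h2|h2] := ltP (1 - a) (x - k%:~R).
  by right; exists (k + 1); rewrite rmorphD /= ltr_norml; apply/andP; split; lra.
left; have <- : f (x - k%:~R) = cabs (1 - cis (2 * pi * x)).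
  by rewrite /f mulrBr cisD cisN cis_2pi_int conjc1 mulr1.
by apply: hmin; rewrite in_itv /= h1.
Unshelve. all: by end_near. Qed.

(** The Fejer kernel, as a double sum so that integration against it produces Fourier coefficients;
    [fejerE] gives the usual squared modulus. *)
Definition fejer (m : nat) (x : R) : C :=
  \sum_(p : 'I_m * 'I_m) (m%:R)^-1 * eint (p.1%:Z - p.2%:Z) x.

Lemma fejerE m x : fejer m x = (m%:R^-1 * cabs (\sum_(k < m) (cis (2 * pi * x)) ^+ k) ^+ 2)%:C.
Proof.
rewrite realCM -mul_conjc realCV realC_nat /fejer -mulr_sumr; congr (_ * _).
rewrite (big_morph _ (@conjcD R) (conjc0 R)) mulr_suml.
rewrite -(pair_bigA _ (fun k l : 'I_m => eint (k%:Z - l%:Z) x)) /=.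
apply: eq_bigr => k _; rewrite mulr_sumr; apply: eq_bigr => l _.
rewrite -[_ ^+ k]/(_ ^ k%:Z) -[_ ^+ l]/(_ ^ l%:Z) -!cis_int -cisN -cisD /eint; congr cis.
by rewrite rmorphB /=; ring.
Qed.

Lemma fejer_ge0 m x : 0 <= complex.Re (fejer m x).
Proof. by rewrite fejerE /= mulr_ge0 ?invr_ge0 ?sqr_ge0. Qed.

Lemma fejer_far m x c : (0 < m)%N -> 0 < c -> c <= cabs (1 - cis (2 * pi * x)) ->
  complex.Re (fejer m x) <= 4 / c ^+ 2 / m%:R.
Proof.
move=> m0 c0 hc; rewrite fejerE /= mulrC ler_wpM2r ?invr_ge0//.
set w : C := cis _ in hc *.
have w1 : w != 1 by rewrite -subr_eq0 -cabs_gt0 cabsB; apply: lt_le_trans hc.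
have := @interval_sum R w xpredT m w1 (cabs_cis _) (fun _ _ _ _ _ _ => isT).
have -> : 4 / c ^+ 2 = (2 / c) ^+ 2 by rewrite expr_div_n; congr (_ / _); ring.
move=> h; rewrite ler_pXn2r ?nnegrE ?cabs_ge0 ?divr_ge0 ?(ltW c0)//.
apply: le_trans h _; rewrite ler_wpM2l// lef_pV2 ?posrE//.
exact: lt_le_trans hc.
Qed.

Lemma fejer_int (g : R -> C) m s0 : ccont g ->
  ccont (fun s => g s * fejer m (s - s0)) /\
  crint (fun s => g s * fejer m (s - s0)) =
  \sum_(p : 'I_m * 'I_m) (m%:R^-1 * eint (- (p.1%:Z - p.2%:Z)) s0) *
     crint (fun s => g s * eint (p.1%:Z - p.2%:Z) s).
Proof.
move=> cg; have E : (fun s => g s * fejer m (s - s0)) = fun s =>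
   \sum_(p <- enum ({: 'I_m * 'I_m})) (m%:R^-1 * eint (- (p.1%:Z - p.2%:Z)) s0) * (g s * eint (p.1%:Z - p.2%:Z) s).
  apply/funext => s; rewrite /fejer mulr_sumr big_enum /=; apply: eq_bigr => p _; rewrite eintB; ring.
have hc (p : 'I_m * 'I_m) : ccont (fun s => g s * eint (p.1%:Z - p.2%:Z) s).
  by move=> t t01; apply: ccont_atM; [exact: cg|exact: ccont_eint].
rewrite E; have := @crint_sum _ (enum ({: 'I_m * 'I_m}))
  (fun p s => (m%:R^-1 * eint (- (p.1%:Z - p.2%:Z)) s0) * (g s * eint (p.1%:Z - p.2%:Z) s)).
case=> [p|h1 ->]; first exact: (crintZ _ (hc p)).1.
by split => //; rewrite big_enum /=; apply: eq_bigr => p _; rewrite (crintZ _ (hc p)).2.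
Qed.

Lemma fejer_mass m s0 : (0 < m)%N -> crint (fun s => fejer m (s - s0)) = 1.
Proof.
move=> m0; have := fejer_int m s0 (ccont_cst (1 : C)) => -[_].
rewrite (_ : (fun s => 1 * _) = fun s => fejer m (s - s0)); last by apply/funext => s; rewrite mul1r.
move=> ->.
rewrite (eq_bigr (fun p : 'I_m * 'I_m => if p.1 == p.2 then m%:R^-1 else 0)); last first.
  move=> [k l] _ /=; rewrite (_ : (fun s => 1 * _) = eint (k%:Z - l%:Z)); last by apply/funext => s; rewrite mul1r.
  rewrite crint_eint subr_eq0 eqz_nat -val_eqE /=; case: ifP => [/eqP ->|_]; last by rewrite mulr0.
  by rewrite subrr oppr0 /eint mulr0 mul0r cis0 !mulr1.
rewrite -(pair_bigA _ (fun k l : 'I_m => if k == l then m%:R^-1 else 0)) /=.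
rewrite (eq_bigr (fun=> (m%:R^-1 : C))); last first.
  by move=> k _; rewrite -big_mkcond (big_pred1 k)//= => l; rewrite eq_sym.
by rewrite sumr_const card_ord -[_ *+ m]mulr_natr mulVf// pnatr_eq0 -lt0n.
Qed.

(** All integrals of [g] against Fejer kernels vanish, while the kernel has mass one and
    concentrates at the integers. So [g s0] is a weighted mean of [g s0 - g s], which is small near
    [s0] and damped by [1 / m] elsewhere. *)
Lemma fourier_unique (g : R -> C) (M : R) : (forall t, ccont_at g t) -> (forall t, cabs (g t) <= M) ->
  (forall t (k : int), g (t + k%:~R) = g t) ->
  (forall j, crint (fun s => g s * eint j s) = 0) -> forall s0, g s0 = 0.
Proof.
move=> cg gM pg g0 s0; apply: cabs_le_eps => e e0.
have e2 : 0 < e / 2 by rewrite divr_gt0.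
have [eta eta0 heta] := cg s0 _ e2.
have [c c0 hc] := far_from_int eta0.
have M0 : 0 <= M by apply: le_trans (gM 0); exact: cabs_ge0.
pose b := 2 * M * (4 / c ^+ 2).
have b0 : 0 <= b by rewrite !mulr_ge0 ?invr_ge0 ?sqr_ge0.
pose m := (Num.truncn (b / (e / 2))).+1; have m0 : 0 < m%:R :> R by rewrite ltr0n.
have hm : b / m%:R <= e / 2.
  by rewrite ler_pdivrMr// mulrC -ler_pdivrMr// ltW// truncnS_gt.
have cg' : ccont g by move=> t _; exact: cg.
have [i1 i2] := fejer_int m s0 cg'.
have [j1 j2] := fejer_int m s0 (ccont_cst (g s0)).
have k2 : crint (fun s => g s * fejer m (s - s0)) = 0.
  by rewrite i2 big1// => p _; rewrite g0 mulr0.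
have [f1 _] := fejer_int m s0 (ccont_cst (1 : C)).
have {}f1 : ccont (fun s => fejer m (s - s0)).
  by move: f1; rewrite (_ : (fun s => 1 * _) = fun s => fejer m (s - s0))//; apply/funext => s; rewrite mul1r.
have k1 : crint (fun s => g s0 * fejer m (s - s0)) = g s0.
  by rewrite (crintZ _ f1).2 fejer_mass ?mulr1// -(ltr0n R).
(* A majorant of the integrand: the first term covers the points near an integer translate of [s0],
   the second the rest. *)
pose h s : C := (e / 2)%:C * fejer m (s - s0) + (b / m%:R)%:C.
have ch : ccont h by apply: ccont_lc => //; exact: ccont_cst.
have hh : crint h = (e / 2 + b / m%:R)%:C.
  by rewrite crint_lc ?crint_cst ?fejer_mass ?mulr1 ?realCD//; exact: ccont_cst.
have -> : g s0 = crint (fun s => (-1) * (g s * fejer m (s - s0)) + g s0 * fejer m (s - s0)).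
  by rewrite crint_lc// k1 k2 mulr0 add0r.
apply: (@le_trans _ _ (complex.Re (crint h))); last by rewrite hh /=; clear -hm; lra.
apply: crint_mono => //; first exact: ccont_lc.
move=> s _; rewrite /h cReD cReM /= mul0r subr0.
have -> : -1 * (g s * fejer m (s - s0)) + g s0 * fejer m (s - s0) = (g s0 - g s) * fejer m (s - s0) by ring.
rewrite cabsM.
have -> : cabs (fejer m (s - s0)) = complex.Re (fejer m (s - s0)).
  by rewrite fejerE cabs_real ger0_norm// mulr_ge0 ?invr_ge0 ?sqr_ge0.
have F0 := fejer_ge0 m (s - s0).
case: (hc (s - s0)) => [far|[k near_k]].
  have F1 := fejer_far (m := m) (ltn0Sn _) c0 far.
  have : cabs (g s0 - g s) <= 2 * M.
    by apply: le_trans (cabsD _ _) _; rewrite cabsN; have := gM s0; have := gM s; lra.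
  move=> h1; have h2 : cabs (g s0 - g s) * complex.Re (fejer m (s - s0)) <= 2 * M * (4 / c ^+ 2 / m%:R).
    by rewrite ler_pM ?cabs_ge0.
  have E : b / m%:R = 2 * M * (4 / c ^+ 2 / m%:R) by rewrite /b; ring.
  rewrite E; apply: le_trans h2 _; rewrite lerDr mulr_ge0// ltW//.
have gs : cabs (g s0 - g s) <= e / 2.
  rewrite cabsB -(subrK k%:~R s) pg ltW//; apply: heta.
  by have -> : s - k%:~R - s0 = s - s0 - k%:~R by ring.
apply: (@le_trans _ _ (e / 2 * complex.Re (fejer m (s - s0)))); first by rewrite ler_wpM2r.
by rewrite lerDl mulr_ge0 ?invr_ge0.
Qed.

End FourierUniqueness.

(** * Affine changes of variables in the plane *)

Section PlaneMeasure.
Variable R : realType.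
Local Notation C := (R[i]).
Local Notation P2 := (measurableTypeR R * measurableTypeR R)%type.
Local Notation leb := (@lebesgue_measure R).
Local Notation leb2 := (leb2 R).
Implicit Types (L : 'M[R]_2).

(** Changes of variables are recorded by the measure of preimages, a form closed under
    composition. *)
Definition scales (phi : P2 -> P2) (k : R) : Prop :=
  [/\ measurable_fun setT phi, 0 < k &
      forall X, measurable X -> leb2 (phi @^-1` X) = (k%:E * leb2 X)%E].

Lemma preim_measurable d d' (T : measurableType d) (T' : measurableType d') (f : T -> T') X :
  measurable_fun setT f -> measurable X -> measurable (f @^-1` X).
Proof. by move=> mf mX; rewrite -[X in measurable X]setTI; exact: mf. Qed.

Lemma scales_comp f g k l : scales f k -> scales g l -> scales (f \o g) (k * l).
Proof.
move=> [mf k0 hf] [mg l0 hg]; split; [exact: measurableT_comp|exact: mulr_gt0|].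
move=> X mX; rewrite comp_preimage hg ?hf//; last exact: preim_measurable.
by rewrite muleA -EFinM (mulrC l).
Qed.

(** Uniqueness of Lebesgue measure: the rescaled push-forward has the right value on half-open
    intervals. *)
Lemma lebesgue_affine (a b : R) (A : set (measurableTypeR R)) : a != 0 -> measurable A ->
  leb ((fun y => a * y + b) @^-1` A) = ((`|a|^-1)%:E * leb A)%E.
Proof.
move=> a0 mA; set phi : measurableTypeR R -> measurableTypeR R := fun y => a * y + b.
have mphi : measurable_fun setT phi.
  apply: continuous_measurable_fun => x.
  by apply: cvgD; [apply: cvgM; [exact: cvg_cst|exact: cvg_id]|exact: cvg_cst].
have na : 0 <= `|a| by [].
suff -> : leb A = mscale (NngNum na) (pushforward leb phi) A.
  rewrite /mscale /= muleA -EFinM mulVf ?normr_eq0// mul1e//.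
move=> m; apply: lebesgue_measure_unique mA => _ [[x y] _ <-].
transitivity (`|a|%:E * leb (phi @^-1` `]x, y]%classic))%E; last by [].
have aff z : phi z = a * z + b by [].
have [ap|an] := ltP 0 a.
  have -> : phi @^-1` `]x, y]%classic = `](x - b) / a, (y - b) / a]%classic.
    apply/seteqP; split => z; rewrite /= !in_itv /= aff ltr_pdivrMr// ler_pdivlMr// (mulrC z);
      by rewrite ltrBlDr lerBrDr.
  rewrite !lebesgue_measure_itv /= !lte_fin ltr_pM2r ?invr_gt0// ltrD2r.
  case: ifP => xy; rewrite -?EFinB -?EFinM ?mulr0// gtr0_norm//.
  by congr EFin; field.
have an' : a < 0 by rewrite lt_neqAle a0.
have -> : phi @^-1` `]x, y]%classic = `[(y - b) / a, (x - b) / a[%classic.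
  apply/seteqP; split => z; rewrite /= !in_itv /= aff ltr_ndivlMr// ler_ndivrMr// (mulrC z);
    rewrite ltrBlDr lerBrDr andbC//.
rewrite !lebesgue_measure_itv /= !lte_fin ltr_nM2r ?invr_lt0// ltrD2r.
case: ifP => xy; rewrite -?EFinB -?EFinM ?mulr0// ltr0_norm//.
by congr EFin; field.
Qed.

Lemma scales_swap : scales (fun x => (x.2, x.1)) 1.
Proof.
have mphi : measurable_fun setT (fun x : P2 => (x.2, x.1) : P2).
  by apply: measurable_fun_pair; [exact: measurable_snd|exact: measurable_fst].
split => // X mX; rewrite mul1e; symmetry.
apply: (product_measure_unique (m' := pushforward leb2 (fun x : P2 => (x.2, x.1) : P2))) => //.
move=> A B mA mB; rewrite /pushforward.
transitivity (leb2 (B `*` A)).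
  by congr (leb2 _); apply/seteqP; split => -[x y] [].
transitivity (leb B * leb A)%E; [exact: product_measure1E|exact: muleC].
Qed.

(** Uniqueness of the product measure reduces to rectangles, where every vertical section is empty
    or an affine preimage. *)
Lemma scales_shear (c a b : R) : a != 0 -> scales (fun x => (x.1, c * x.1 + a * x.2 + b)) `|a|^-1.
Proof.
move=> a0; set phi := (fun x : P2 => (x.1, c * x.1 + a * x.2 + b) : P2).
have mphi : measurable_fun setT phi.
  apply: measurable_fun_pair; first exact: measurable_fst.
  apply: measurable_funD; last exact: measurable_cst.
  apply: measurable_funD; apply: measurable_funM; try exact: measurable_cst.
    exact: measurable_fst.
  exact: measurable_snd.
have na : 0 <= `|a| by [].
split => //; first by rewrite invr_gt0 normr_gt0.
move=> X mX.
suff -> : leb2 X = mscale (NngNum na) (pushforward leb2 phi) X.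
  by rewrite /mscale /= muleA -EFinM mulVf ?normr_eq0// mul1e.
move=> m; apply: product_measure_unique mX => A B mA mB.
transitivity (`|a|%:E * \int[leb]_x leb (xsection (phi @^-1` (A `*` B)) x))%E; first by [].
have sec x : leb (xsection (phi @^-1` (A `*` B)) x) =
    ((\1_A x)%:E * ((`|a|^-1)%:E * leb B))%E.
  rewrite indicE; case: (boolP (x \in A)) => xA.
    rewrite mul1e -(@lebesgue_affine a (c * x + b))//; congr (leb _).
    apply/seteqP; split => y /=; rewrite /xsection /= inE /=.
      by move=> [_]; rewrite (_ : _ + b = a * y + (c * x + b))//; ring.
    move=> h; split; first by rewrite inE in xA.
    by rewrite (_ : _ + b = a * y + (c * x + b))//; ring.
  rewrite mul0e (_ : xsection _ _ = set0) ?measure0//.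
  apply/seteqP; split => y //=; rewrite /xsection /= inE /= => -[].
  by move/mem_set; rewrite (negbTE xA).
under eq_integral do rewrite sec.
rewrite ge0_integralZr//.
- by rewrite integral_indic// setIT muleCA (muleA `|a|%:E) -EFinM mulfV ?normr_eq0// mul1e.
- exact/measurable_EFinP/measurable_indic.
- by rewrite mule_ge0 ?lee_fin ?invr_ge0.
Qed.

Lemma det2E L : \det L = L 0 0 * L 1 1 - L 0 1 * L 1 0.
Proof.
rewrite (expand_det_row _ 0) big_ord_recl big_ord1 /cofactor !det_mx11 !mxE /=.
have -> : lift (0 : 'I_2) 0 = 1 by apply/val_inj.
have -> : lift (1 : 'I_2) 0 = 0 by apply/val_inj.
by rewrite addn0 add0n expr0 expr1 mul1r mulN1r mulrN.
Qed.

Definition amap L (t x : R * R) : R * R :=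
  (L 0 0 * x.1 + L 0 1 * x.2 + t.1, L 1 0 * x.1 + L 1 1 * x.2 + t.2).

Lemma vec2_amap L t x : vec2 (amap L t x) = L *m vec2 x + vec2 t.
Proof. by apply: cV2P; rewrite [in RHS]mxE mul2E !mxE. Qed.

Lemma scales_amap L t : \det L != 0 -> scales (amap L t) `|\det L|^-1.
Proof.
have main L' : L' 0 0 != 0 -> \det L' != 0 -> scales (amap L' t) `|\det L'|^-1.
  move=> a0 d0; pose sw := fun x : R * R => (x.2, x.1).
  pose p1 := fun x : R * R => (x.1, L' 0 1 * x.1 + L' 0 0 * x.2 + t.1).
  pose d := \det L' / L' 0 0.
  pose p2 := fun x : R * R => (x.1, L' 1 0 / L' 0 0 * x.1 + d * x.2 + (t.2 - L' 1 0 / L' 0 0 * t.1)).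
  have d'0 : d != 0 by rewrite mulf_neq0 ?invr_neq0.
  have -> : amap L' t = p2 \o (sw \o (p1 \o sw)).
    apply/funext => -[x y]; rewrite /p2 /p1 /sw /amap /d det2E /=.
    by congr (_, _); field.
  have -> : `|\det L'|^-1 = `|d|^-1 * (1 * (`|L' 0 0|^-1 * 1)).
    rewrite mulr1 mul1r /d normrM normrV ?unitfE// invfM invrK -mulrA mulfV ?mulr1//.
    by rewrite normr_eq0.
  apply: scales_comp; first exact: scales_shear.
  apply: scales_comp; first exact: scales_swap.
  apply: scales_comp; [exact: scales_shear|exact: scales_swap].
move=> d0; have [a0|a0] := eqVneq (L 0 0) 0; last exact: main.
pose L' : 'M[R]_2 := mx22 (L 0 1) (L 0 0) (L 1 1) (L 1 0).
have dL : \det L' = - \det L by rewrite !det2E !mxE /=; ring.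
have b0 : L' 0 0 != 0.
  by rewrite mxE /=; apply: contraNneq d0 => b0; rewrite det2E a0 b0 !mul0r subrr.
have -> : amap L t = amap L' t \o (fun x => (x.2, x.1)).
  by apply/funext => -[x y]; rewrite /amap /= !mxE /=; congr (_, _); ring.
rewrite -[_^-1]mulr1 -normrN -dL.
by apply: scales_comp; [apply: main; rewrite // dL oppr_eq0|exact: scales_swap].
Qed.

Lemma ge0_scales phi k (D : set P2) (F : P2 -> \bar R) : scales phi k -> measurable D ->
  measurable_fun D F -> (forall x, (0 <= F x)%E) ->
  (\int[leb2]_(x in D) F x = (k^-1)%:E * \int[leb2]_(x in phi @^-1` D) F (phi x))%E.
Proof.
move=> [mphi k0 hphi] mD mF F0.
rewrite -[X in (_ * X)%E](_ : (\int[pushforward leb2 phi]_(x in D) F x)%E = _); last first.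
  by rewrite ge0_integral_pushforward// => x _; exact: F0.
have kk : 0 <= k by exact: ltW.
have -> : (\int[pushforward leb2 phi]_(x in D) F x = \int[mscale (NngNum kk) leb2]_(x in D) F x)%E.
  apply: eq_measure_integral => //= A mA _; rewrite /mscale /= -hphi//.
rewrite ge0_integral_mscale//= muleA -EFinM mulVf ?gt_eqF// mul1e//.
Qed.

End PlaneMeasure.

(** * Unfolding of plane integrals over lattice cells *)

Section PlaneIntegrals.
Variable R : realType.
Local Notation C := (R[i]).
Local Notation P2 := (measurableTypeR R * measurableTypeR R)%type.
Local Notation leb := (@lebesgue_measure R).
Local Notation leb2 := (leb2 R).
Implicit Types (L : 'M[R]_2).

Definition cont2 (F : R -> R -> C) : Prop := forall s t e, 0 < e ->
  exists2 d : R, 0 < d & forall s' t', `|s' - s| < d -> `|t' - t| < d ->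
    cabs (F s' t' - F s t) < e.

(** The preimage of an open ray is open, hence a union of countably many squares with rational
    centres and half sides [1 / (n + 1)]. *)
Lemma cont2_measurable_gen (F : R -> R -> C) (h : C -> R) :
  (forall z w, `|h z - h w| <= cabs (z - w)) -> cont2 F ->
  measurable_fun setT (fun x : P2 => h (F x.1 x.2)).
Proof.
move=> hh cF; apply: (measurability _ (RGenOInfty.measurableE R)) => /= _ [_ [a ->] <-].
rewrite setTI; set X := (_ @^-1` _).
pose Sq (i : rat * rat * nat) : set P2 :=
  `]ratr i.1.1 - i.2.+1%:R^-1, ratr i.1.1 + i.2.+1%:R^-1[%classic `*`
  `]ratr i.1.2 - i.2.+1%:R^-1, ratr i.1.2 + i.2.+1%:R^-1[%classic.
have -> : X = \bigcup_i [set x | Sq i `<=` X /\ Sq i x].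
  apply/seteqP; split => [[x y] /= Xxy|[x y] [i _] [sub /sub]//].
  rewrite /X /= in_itv /= andbT in Xxy.
  have e0 : 0 < h (F x y) - a by rewrite subr_gt0.
  have [d d0 hd] := cF x y _ e0.
  have [n n0 hn] := small_inv (divr_gt0 d0 (ltr0n R 3)); have {}hn := hn n (leqnn _).
  case: n n0 hn => // n _ hn; have n0 : 0 < n.+1%:R^-1 :> R by rewrite invr_gt0.
  have a1 (z w u : R) : z - u < w -> w < z + u -> w - u < z < w + u.
    by move=> *; apply/andP; split; lra.
  have a2 (z w v u e : R) : u <= e / 3 -> z - u < w -> w < z + u -> w - u < v -> v < w + u -> 0 < u -> `|v - z| < e.
    by move=> *; rewrite ltr_norml; apply/andP; split; lra.
  have q (z : R) : exists p : rat, z - n.+1%:R^-1 < ratr p < z + n.+1%:R^-1.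
    have hz : z - n.+1%:R^-1 < z + n.+1%:R^-1 by rewrite ltrBlDr -addrA ltrDl addr_gt0.
    have [p] := rat_in_itvoo hz.
    by rewrite in_itv /= => hp; exists p.
  have [p /andP[p1 p2]] := q x; have [r /andP[r1 r2]] := q y.
  exists (p, r, n) => //; rewrite /Sq /=; split; last first.
    by split; rewrite in_itv /=; exact: a1.
  move=> [x' y'] [] /=; rewrite !in_itv /= => /andP[h1 h2] /andP[h3 h4].
  rewrite /X /= in_itv /= andbT.
  have : cabs (F x' y' - F x y) < h (F x y) - a.
    by apply: hd; [exact: (a2 _ _ _ _ _ hn p1 p2)|exact: (a2 _ _ _ _ _ hn r1 r2)].
  move=> /(le_lt_trans (hh _ _)); rewrite ltr_norml => /andP[h5 _].
  by clear -h5; lra.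
apply: countable_bigcupT_measurable => [|i].
  exact: countableP.
have [sub|nsub] := pselect (Sq i `<=` X).
  rewrite (_ : [set _ | _] = Sq i); first by apply: measurableX; exact: measurable_itv.
  by apply/seteqP; split => x [].
by rewrite (_ : [set _ | _] = set0)//; apply/seteqP; split => x [].
Qed.

Definition pr (v : 'cV[R]_2) : R * R := (v 0 0, v 1 0).

Lemma vec2_pr v : vec2 (pr v) = v.
Proof. by apply: cV2P; rewrite !mxE. Qed.

Lemma pr_vec2 x : pr (vec2 x) = x.
Proof. by case: x => x y; rewrite /pr !mxE. Qed.

Definition sq : set P2 := `[0, 1[%classic `*` `[0, 1[%classic.

Lemma measurable_sq : measurable sq.
Proof. by apply: measurableX; exact: measurable_itv. Qed.

Lemma leb2_sq : leb2 sq = 1%E.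
Proof.
transitivity (leb `[0%R, 1%R[%classic * leb `[0%R, 1%R[%classic)%E.
  by apply: product_measure1E; exact: measurable_itv.
by rewrite lebesgue_measure_itv /= lte_fin ltr01 oppr0 adde0 mule1.
Qed.

Definition cellmap L (n : coords) : P2 -> P2 := amap L (pr (lvec L n)).

Lemma vec2_cellmap L n x : vec2 (cellmap L n x) = L *m (vec2 x + ivec R n).
Proof. by rewrite vec2_amap vec2_pr mulmxDr. Qed.

Definition zsq (n : coords) : set P2 :=
  `[(n 0 0)%:~R, (n 0 0)%:~R + 1[%classic `*` `[(n 1 0)%:~R, (n 1 0)%:~R + 1[%classic.

Definition lcell L n : set P2 := amap (invmx L) (0, 0) @^-1` zsq n.

Lemma lcellP L n x : lcell L n x <->
  (n 0 0)%:~R <= (amap (invmx L) (0, 0) x).1 < (n 0 0)%:~R + 1 /\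
  (n 1 0)%:~R <= (amap (invmx L) (0, 0) x).2 < (n 1 0)%:~R + 1.
Proof. by rewrite /lcell /zsq /= !in_itv. Qed.

Lemma sqP x : sq x <-> 0 <= x.1 < 1 /\ 0 <= x.2 < 1.
Proof. by rewrite /sq /= !in_itv. Qed.

Lemma unit_det L : L \in unitmx -> \det L != 0.
Proof. by rewrite unitmxE unitfE. Qed.

Lemma measurable_lcell L n : L \in unitmx -> measurable (lcell L n).
Proof.
move=> uL; apply: preim_measurable; last by apply: measurableX; exact: measurable_itv.
by have [] := scales_amap (0, 0) (unit_det (etrans (unitmx_inv L) uL)).
Qed.

Lemma lcell_cellmap L n : L \in unitmx -> cellmap L n @^-1` lcell L n = sq.
Proof.
move=> uL; have E x : amap (invmx L) (0, 0) (cellmap L n x) = (x.1 + (n 0 0)%:~R, x.2 + (n 1 0)%:~R).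
  by rewrite -[LHS]pr_vec2 vec2_amap vec2_cellmap mulKmx// /pr !mxE /= !addr0.
apply/seteqP; split => x.
  by move=> /lcellP; rewrite E /= => -[/andP[h1 h2] /andP[h3 h4]]; apply/sqP; split; apply/andP; split; lra.
by move=> /sqP[/andP[h1 h2] /andP[h3 h4]]; apply/lcellP; rewrite E /=; split; apply/andP; split; lra.
Qed.

Lemma floor_uniq (i j : int) (z : R) :
  i%:~R <= z -> z < i%:~R + 1 -> j%:~R <= z -> z < j%:~R + 1 -> i = j.
Proof.
move=> h1 h2 h3 h4; have hi : (i < j + 1)%R by rewrite -(ltr_int R) rmorphD /=; lra.
have hj : (j < i + 1)%R by rewrite -(ltr_int R) rmorphD /=; lra.
by clear -hi hj; lia.
Qed.

(** The cells, indexed by [coords], are transported to [nat] by [pickle] so that countable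
    additivity applies; each is then pulled back to the unit square. *)
Lemma ge0_unfold L (F : P2 -> \bar R) : L \in unitmx -> measurable_fun setT F ->
  (forall x, (0 <= F x)%E) ->
  (\int[leb2]_x F x = \esum_(n in [set: coords]) (`|\det L|%:E * \int[leb2]_(x in sq) F (cellmap L n x)))%E.
Proof.
move=> uL mF F0.
pose E k : set P2 := if choice.pickle_inv k is Some n then lcell L n else set0.
have mE k : measurable (E k) by rewrite /E; case: (choice.pickle_inv k) => // n; exact: measurable_lcell.
have tE : trivIset setT E.
  apply/trivIsetP => k l _ _; rewrite /E; case kn : (choice.pickle_inv k) => [n|]; last by rewrite set0I.
  case lm : (choice.pickle_inv l) => [m|]; last by rewrite setI0.
  move=> kl; apply/seteqP; split => // x [/lcellP[/andP[a1 a2] /andP[a3 a4]] /lcellP[/andP[b1 b2] /andP[b3 b4]]].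
  have nm : n = m by rewrite -(cpair_eta n) -(cpair_eta m) (floor_uniq a1 a2 b1 b2) (floor_uniq a3 a4 b3 b4).
  have := @choice.pickle_invK coords k; have := @choice.pickle_invK coords l; rewrite kn lm /= nm => -> kE.
  by move: kl; rewrite -kE eqxx.
have UE : \bigcup_k E k = setT.
  apply/seteqP; split => // x _; set y := amap (invmx L) (0, 0) x.
  pose n := cpair (Num.floor y.1) (Num.floor y.2); exists (choice.pickle n) => //.
  rewrite /E choice.pickleK_inv; apply/lcellP; rewrite -/y !cpair0 !cpair1.
  have /andP[a1 a2] := floor_itv y.1; have /andP[a3 a4] := floor_itv y.2.
  by rewrite !rmorphD /= in a2 a4; rewrite a1 a2 a3 a4.
rewrite -UE ge0_integral_bigcup ?UE//.
rewrite nneseries_esumT; last by move=> k; apply: integral_ge0.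
transitivity (\esum_(k in range (choice.pickle : coords -> nat)) \int[leb2]_(x in E k) F x)%E.
  rewrite [RHS]esum_mkcond; apply: eq_esum => k _; case: ifPn => // kr.
  rewrite /E; case kn : (choice.pickle_inv k) => [n|]; last by rewrite integral_set0.
  case/negP: kr; rewrite inE; exists n => //.
  by have := @choice.pickle_invK coords k; rewrite kn.
rewrite (@reindex_esum R coords nat setT _ choice.pickle); last first.
  split; [by move=> n _; exists n| |by []].
  by move=> n m _ _ /(congr1 (@choice.pickle_inv coords)); rewrite !choice.pickleK_inv => -[].
apply: eq_esum => n _; rewrite /E choice.pickleK_inv.
rewrite (ge0_scales (scales_amap (pr (lvec L n)) (unit_det uL)))//.
- by rewrite invrK -/(cellmap L n) lcell_cellmap.
- exact: measurable_lcell.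
- exact: measurable_funTS.
Qed.

Lemma le_sq (F : P2 -> \bar R) (b : R) : measurable_fun sq F -> (forall x, (0 <= F x)%E) ->
  (forall x, sq x -> (F x <= b%:E)%E) -> (0 <= \int[leb2]_(x in sq) F x <= b%:E)%E.
Proof.
move=> mF F0 Fb; rewrite integral_ge0//=.
apply: (@le_trans _ _ (\int[leb2]_(x in sq) (cst b%:E x))%E).
  apply: ge0_le_integral => //; first exact: measurable_sq.
by rewrite integral_cst ?leb2_sq ?mule1//; exact: measurable_sq.
Qed.

Lemma real_unfold L (G : P2 -> R) (b : coords -> R) B : L \in unitmx ->
  measurable_fun setT G -> bsum b B -> (forall n, 0 <= b n) ->
  (forall n x, sq x -> `|G (cellmap L n x)| <= b n) ->
  asummable (fun n => (`|\det L| * Rintegral leb2 sq (G \o cellmap L n))%:C) /\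
  (Rintegral leb2 setT G)%:C = csum (fun n => (`|\det L| * Rintegral leb2 sq (G \o cellmap L n))%:C).
Proof.
move=> uL mG hB b0 hG; set D := `|\det L|.
have D0 : 0 <= D by exact: normr_ge0.
have mc n : measurable_fun setT (cellmap L n).
  by have [] := scales_amap (pr (lvec L n)) (unit_det uL).
have key (H : P2 -> \bar R) : measurable_fun setT H -> (forall x, (0 <= H x)%E) ->
    (forall n x, sq x -> (H (cellmap L n x) <= (b n)%:E)%E) ->
    exists j : coords -> R, [/\ forall n, 0 <= j n <= b n,
      forall n, (\int[leb2]_(x in sq) H (cellmap L n x) = (j n)%:E)%E &
      (\int[leb2]_x H x = (nsum (fun n => D * j n))%:E)%E].
  move=> mH H0 Hb; exists (fun n => fine (\int[leb2]_(x in sq) H (cellmap L n x))%E).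
  have b1 n : (0 <= \int[leb2]_(x in sq) H (cellmap L n x) <= (b n)%:E)%E.
    apply: le_sq => // [|x]; [|exact: Hb].
    by apply: measurable_funTS; apply: measurableT_comp.
  have fin n : (\int[leb2]_(x in sq) H (cellmap L n x))%E \is a fin_num.
    have /andP[h1 h2] := b1 n; rewrite ge0_fin_numE//; apply: le_lt_trans h2 _; exact: ltry.
  have jb n : 0 <= fine (\int[leb2]_(x in sq) H (cellmap L n x))%E <= b n.
    by have := b1 n; rewrite -(fineK (fin n)) !lee_fin.
  split => // [n|]; first by rewrite fineK.
  have sB : bsum (fun n => D * fine (\int[leb2]_(x in sq) H (cellmap L n x))%E) (D * B).
    move=> s us; rewrite -mulr_sumr ler_wpM2l//; apply: le_trans (hB s us).
    by apply: ler_sum => n _; case/andP: (jb n).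
  rewrite (ge0_unfold uL)// -(nsumE sB); apply: eq_esum => n _ /=.
  by rewrite EFinM fineK.
have mp : measurable_fun setT ((EFin \o G)^\+)%E by apply: measurable_funepos; exact/measurable_EFinP.
have mn : measurable_fun setT ((EFin \o G)^\-)%E by apply: measurable_funeneg; exact/measurable_EFinP.
have [|n x sx|p [p1 p2 p3]] := key _ mp; first by move=> x; exact: funepos_ge0.
  rewrite funeposE /= /maxe; case: ifP => _; rewrite lee_fin; first exact: b0.
  exact: le_trans (ler_norm _) (hG n x sx).
have [|n x sx|q [q1 q2 q3]] := key _ mn; first by move=> x; exact: funeneg_ge0.
  rewrite funenegE /= /maxe; case: ifP => _; rewrite lee_fin; first exact: b0.
  by apply: le_trans (ler_norm _) _; rewrite normrN; exact: hG.
have cell n : Rintegral leb2 sq (G \o cellmap L n) = p n - q n.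
  rewrite /Rintegral integralE.
  have -> : (\int[leb2]_(x in sq) (EFin \o (G \o cellmap L n))^\+ x = (p n)%:E)%E.
    by rewrite -p2; apply: eq_integral => x _; rewrite !funeposE.
  have -> : (\int[leb2]_(x in sq) (EFin \o (G \o cellmap L n))^\- x = (q n)%:E)%E.
    by rewrite -q2; apply: eq_integral => x _; rewrite !funenegE.
  by [].
have bs (j : coords -> R) : (forall n, 0 <= j n <= b n) ->
    (forall n, 0 <= D * j n) /\ bsum (fun n => D * j n) (D * B).
  move=> hj; split => [n|s us]; first by rewrite mulr_ge0//; case/andP: (hj n).
  rewrite -mulr_sumr ler_wpM2l//; apply: le_trans (hB s us).
  by apply: ler_sum => n _; case/andP: (hj n).
have [pp pB] := bs _ p1; have [qq qB] := bs _ q1.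
have E : (fun n => (D * Rintegral leb2 sq (G \o cellmap L n))%:C) =
    fun n => (-1) * (D * q n)%:C + (D * p n)%:C.
  by apply/funext => n; rewrite cell mulrBr realCB; ring.
have sp : asummable (fun n => (D * p n)%:C).
  by exists (D * B); apply: bsum_le pB => n; rewrite cabs_real ger0_norm.
have sn : asummable (fun n => (D * q n)%:C).
  by exists (D * B); apply: bsum_le qB => n; rewrite cabs_real ger0_norm.
rewrite E; split; first exact: asummableD.
rewrite csumD// (nsum_csum pp pB) (nsum_csum qq qB) /Rintegral integralE p3 q3 /=.
by rewrite realCB; ring.
Qed.

Lemma complex_unfold L (F : P2 -> C) (b : coords -> R) B : L \in unitmx ->
  measurable_fun setT (fun x => complex.Re (F x)) ->
  measurable_fun setT (fun x => complex.Im (F x)) -> bsum b B -> (forall n, 0 <= b n) ->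
  (forall n x, sq x -> cabs (F (cellmap L n x)) <= b n) ->
  cintegral leb2 setT F = csum (fun n => `|\det L|%:C * cintegral leb2 sq (F \o cellmap L n)).
Proof.
move=> uL mR mI hB b0 hF.
have [_ e1] := real_unfold uL mR hB b0 (fun n x sx => le_trans (Re_le_cabs _) (hF n x sx)).
have [_ e2] := real_unfold uL mI hB b0 (fun n x sx => le_trans (Im_le_cabs _) (hF n x sx)).
have := congr1 (@complex.Re R) e1; have := congr1 (@complex.Re R) e2; rewrite /csum /= => {}e2 {}e1.
rewrite /cintegral e1 e2 /csum; apply/eqP; rewrite eq_complex /=.
by apply/andP; split; apply/eqP; congr rsum; apply/funext => n /=; ring.
Qed.

(** The half-open square tiles the plane, while [crint] uses closed intervals; the difference is a
    null set. *)
Lemma fubini_sq (G : R -> R -> R) M : measurable_fun setT (fun x : P2 => G x.1 x.2) ->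
  (forall s t, `|G s t| <= M) ->
  Rintegral leb2 sq (fun x => G x.1 x.2) =
  Rintegral leb `[0, 1] (fun t => Rintegral leb `[0, 1] (fun s => G s t)).
Proof.
move=> mG GM; set g : P2 -> R := fun x => G x.1 x.2.
have mgs : measurable_fun setT (g \_ sq).
  by apply/(measurable_restrictT _ measurable_sq)/measurable_funTS.
have ig : leb2.-integrable setT (EFin \o (g \_ sq)).
  have : leb2.-integrable sq (EFin \o g).
    apply: measurable_bounded_integrable; [exact: measurable_sq|by rewrite /= leb2_sq ltry|exact: measurable_funTS|].
    exists M; split; first exact: num_real.
    by move=> N /ltW MN x _; apply: le_trans MN; exact: GM.
  by move/(integrable_mkcond _ measurable_sq); rewrite restrict_EFin.
have m1 t : measurable_fun (setT : set (measurableTypeR R)) (fun s : measurableTypeR R => (G s t)%:E).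
  by apply/measurable_EFinP; exact: (measurable_fun_pair1 (f := g) t mG).
have inner t : (\int[leb]_(s in `[0%R, 1%R]) (G s t)%:E = \int[leb]_(s in `[0%R, 1%R[) (G s t)%:E)%E.
  by symmetry; apply: integral_itv_bndo_bndc; apply: measurable_funTS; exact: m1.
have fin t : (\int[leb]_(s in `[0%R, 1%R[) (G s t)%:E)%E \is a fin_num.
  apply: integrable_fin_num => //.
  apply: (@measurable_bounded_integrable _ _ _ leb (fun s => G s t)) => //.
  - by rewrite /= lebesgue_measure_itv /= lte_fin ltr01 ltry.
  - by apply: measurable_funTS; apply/measurable_EFinP; exact: m1.
  - exists M; split; first exact: num_real.
    by move=> N /ltW MN x _; apply: le_trans MN; exact: GM.
have E t : (\int[leb]_s (EFin \o (g \_ sq)) (s, t) =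
    ((fun t => \int[leb]_(s in `[0%R, 1%R[) (G s t)%:E) \_ `[0%R, 1%R[) t)%E.
  rewrite /patch; case: ifPn => t01.
    rewrite [RHS]integral_mkcond; apply: eq_integral => s _; rewrite /patch /= /sq.
    rewrite in_setX /= t01 andbT; case: ifP => _ //.
  rewrite integral0_eq// => s _; rewrite /= /patch /sq in_setX /= (negbTE t01) andbF//.
rewrite Rintegral_mkcond [LHS]/Rintegral -(integral21_prod_meas1 ig) /Rintegral.
congr fine; transitivity (\int[leb]_(t in `[0%R, 1%R[) \int[leb]_(s in `[0%R, 1%R[) (G s t)%:E)%E.
  rewrite [RHS]integral_mkcond; apply: eq_integral => t _; exact: E.
rewrite integral_itv_bndo_bndc; last first.
  apply/(measurable_restrictT _ (measurable_itv _)).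
  have := measurable_fubini_G ig; congr measurable_fun; apply/funext => t; exact: E.
by apply: eq_integral => t _; rewrite inner fineK.
Qed.

Lemma complex_fubini (F : R -> R -> C) M : cont2 F -> (forall s t, cabs (F s t) <= M) ->
  cintegral leb2 sq (fun x => F x.1 x.2) = crint (fun t => crint (fun s => F s t)).
Proof.
move=> cF FM; rewrite /cintegral.
rewrite (@fubini_sq (fun s t => complex.Re (F s t)) M); last first.
- by move=> s t; apply: le_trans (Re_le_cabs _) _.
- exact: (cont2_measurable_gen (@Re_lip R)).
rewrite (@fubini_sq (fun s t => complex.Im (F s t)) M)//.
- exact: (cont2_measurable_gen (@Im_lip R)).
- by move=> s t; apply: le_trans (Im_le_cabs _) _.
Qed.

End PlaneIntegrals.

(** * Fourier series of doubly periodic functions *)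

Section FourierSeries.
Variable R : realType.
Local Notation C := (R[i]).

Lemma cont2_lc a (F G : R -> R -> C) : cont2 F -> cont2 G -> cont2 (fun s t => a * F s t + G s t).
Proof.
move=> cF cG s t e e0; have a0 : 0 < cabs a + 1 by rewrite ltr_wpDl ?cabs_ge0.
have [|d1 d10 h1] := cF s t (e / 2 / (cabs a + 1)); first by rewrite !divr_gt0.
have [|d2 d20 h2] := cG s t (e / 2); first by rewrite divr_gt0.
exists (Num.min d1 d2); first by rewrite lt_min d10.
move=> s' t'; rewrite !lt_min => /andP[s1 s2] /andP[t1 t2].
have -> : a * F s' t' + G s' t' - (a * F s t + G s t) = a * (F s' t' - F s t) + (G s' t' - G s t) by ring.
apply: le_lt_trans (cabsD _ _) _; rewrite cabsM.
have k1 := h1 _ _ s1 t1; have k2 := h2 _ _ s2 t2.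
have : cabs a * cabs (F s' t' - F s t) <= e / 2.
  apply: (@le_trans _ _ ((cabs a + 1) * cabs (F s' t' - F s t))).
    by rewrite ler_wpM2r ?cabs_ge0// lerDl.
  by rewrite mulrC -ler_pdivlMr// ltW.
clear -k2; lra.
Qed.

Lemma cont2M (F G : R -> R -> C) : cont2 F -> cont2 G -> cont2 (fun s t => F s t * G s t).
Proof.
move=> cF cG s t e e0.
have g0 : 0 < cabs (F s t) + 1 by rewrite ltr_wpDl ?cabs_ge0.
have h0 : 0 < cabs (G s t) + 1 by rewrite ltr_wpDl ?cabs_ge0.
have [|d1 d10 k1] := cF s t (e / 2 / (cabs (G s t) + 1)); first by rewrite !divr_gt0.
have [|d2 d20 k2] := cG s t (Num.min 1 (e / 2 / (cabs (F s t) + 1))).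
  by rewrite lt_min ltr01 !divr_gt0.
exists (Num.min d1 d2); first by rewrite !lt_min d10 d20.
move=> s' t'; rewrite !lt_min => /andP[s1 s2] /andP[t1 t2].
have a1 := k1 _ _ s1 t1; have := k2 _ _ s2 t2; rewrite lt_min => /andP[a2 a4].
have -> : F s' t' * G s' t' - F s t * G s t = (F s' t' - F s t) * G s' t' + F s t * (G s' t' - G s t) by ring.
have hs : cabs (G s' t') <= cabs (G s t) + 1.
  by have := cabs_lerB (G s' t') (G s t); lra.
apply: le_lt_trans (cabsD _ _) _; rewrite !cabsM.
have b1 : cabs (F s' t' - F s t) * cabs (G s' t') < e / 2.
  apply: (@le_lt_trans _ _ (cabs (F s' t' - F s t) * (cabs (G s t) + 1))).
    by rewrite ler_wpM2l ?cabs_ge0.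
  by rewrite -ltr_pdivlMr.
have b2 : cabs (F s t) * cabs (G s' t' - G s t) <= e / 2.
  apply: (@le_trans _ _ ((cabs (F s t) + 1) * cabs (G s' t' - G s t))).
    by rewrite ler_wpM2r ?cabs_ge0// lerDl.
  by rewrite mulrC -ler_pdivlMr// ltW.
clear -b1 b2; lra.
Qed.

Lemma cont2_cst c : cont2 (fun _ _ : R => c : C).
Proof. by move=> s t e e0; exists 1 => // *; rewrite subrr cabs0. Qed.

Lemma cont2_sum (T : Type) (r : seq T) (u : T -> R -> R -> C) : (forall n, cont2 (u n)) ->
  cont2 (fun s t => \sum_(n <- r) u n s t).
Proof.
move=> cu; elim: r => [|n r IH].
  have -> : (fun s t => \sum_(n <- [::]) u n s t) = fun _ _ => 0.
    by apply/funext => s; apply/funext => t; rewrite big_nil.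
  exact: cont2_cst.
have -> : (fun s t => \sum_(m <- n :: r) u m s t) = fun s t => 1 * u n s t + \sum_(m <- r) u m s t.
  by apply/funext => s; apply/funext => t; rewrite big_cons mul1r.
exact: cont2_lc.
Qed.

Lemma cont2_1 (g : R -> C) : (forall s, ccont_at g s) -> cont2 (fun s _ => g s).
Proof. by move=> cg s t e e0; have [d d0 h] := cg s e e0; exists d => // s' t' /h. Qed.

Lemma cont2_2 (g : R -> C) : (forall s, ccont_at g s) -> cont2 (fun _ t => g t).
Proof. by move=> cg s t e e0; have [d d0 h] := cg t e e0; exists d => // s' t' _ /h. Qed.

Lemma cont2_l (F : R -> R -> C) t s : cont2 F -> ccont_at (fun s => F s t) s.
Proof.
move=> cF e e0; have [d d0 h] := cF s t e e0; exists d => // s' hs.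
by apply: h; rewrite ?subrr ?normr0.
Qed.

(** Domination on bounded sets of parameters, suited to periodised functions, whose terms have no
    common summable majorant on the whole plane. *)
Definition loc_summable (T : choiceType) (u : T -> R -> R -> C) : Prop := forall rho : R, exists b B,
  [/\ bsum b B, forall n, 0 <= b n &
      forall n s t, `|s| <= rho -> `|t| <= rho -> cabs (u n s t) <= b n].

Lemma cont2_csum (T : choiceType) (u : T -> R -> R -> C) : (forall n, cont2 (u n)) ->
  loc_summable u -> cont2 (fun s t => csum (fun n => u n s t)).
Proof.
move=> cu hu s t e e0; have e4 : 0 < e / 4 by rewrite divr_gt0.
have [b [B [hB b0 hb]]] := hu (`|s| + `|t| + 1).
have [s0 [us0 h0]] := csum_tail b0 hB e4.
have [d d0 hd] := cont2_sum s0 cu s t e4.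
exists (Num.min d 1); first by rewrite lt_min d0 ltr01.
move=> s' t'; rewrite !lt_min => /andP[s1 s2] /andP[t1 t2].
have k1 := h0 (fun n => u n s t) (fun n => hb n s t _ _).
have {}k1 : cabs (csum (fun n => u n s t) - \sum_(n <- s0) u n s t) <= e / 4.
  by apply: k1; have := normr_ge0 s; have := normr_ge0 t; lra.
have k2 : cabs (csum (fun n => u n s' t') - \sum_(n <- s0) u n s' t') <= e / 4.
  apply: (h0 (fun n => u n s' t')) => n; apply: hb.
    by have := ler_normD (s' - s) s; rewrite subrK; have := normr_ge0 t; lra.
  by have := ler_normD (t' - t) t; rewrite subrK; have := normr_ge0 s; lra.
have k3 := hd _ _ s1 t1.
apply: le_lt_trans (cabs_dist _ (\sum_(n <- s0) u n s' t') _) _.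
have k4 := cabs_dist (\sum_(n <- s0) u n s' t') (\sum_(n <- s0) u n s t) (csum (fun n => u n s t)).
rewrite (cabsB (csum _)) in k1; clear -k1 k2 k3 k4 e0; lra.
Qed.

Lemma ccont_crint (F : R -> R -> C) t : cont2 F -> ccont_at (fun t => crint (fun s => F s t)) t.
Proof.
move=> cF e e0; have e2 : 0 < e / 2 by rewrite divr_gt0.
have [|d d0 hd] := @lebesgue_number R `[0, 1]
    (fun d s => forall t', `|t' - t| <= d -> cabs (F s t' - F s t) <= e / 2) (@segment_compact _ _ _).
  move=> s _; have e4 : 0 < e / 4 by rewrite divr_gt0.
  have [d d0 h] := cF s t _ e4; exists d => // s' r hs /andP[r0 rd] t' ht.
  have k1 : cabs (F s' t' - F s t) < e / 4 by apply: h => //; apply: le_lt_trans rd.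
  have k2 : cabs (F s' t - F s t) < e / 4 by apply: h; rewrite ?subrr ?normr0.
  apply: le_trans (cabs_dist _ (F s t) _) _; rewrite (cabsB (F s t)); clear -k1 k2; lra.
exists d => // t' ht.
have c1 t1 : ccont (fun s => F s t1) by move=> s _; exact: cont2_l.
have -> : crint (fun s => F s t') - crint (fun s => F s t) = crint (fun s => (-1) * F s t + F s t').
  by rewrite crint_lc//; ring.
apply: (@le_lt_trans _ _ (e / 2)); last by clear -e0; lra.
apply: crint_bound; first exact: ccont_lc.
move=> s s01; rewrite mulN1r addrC; apply: hd; last exact: ltW.
by rewrite /= in_itv.
Qed.

Lemma crint_csum (T : choiceType) (v : T -> R -> C) (b : T -> R) B : bsum b B -> (forall n, 0 <= b n) ->
  (forall n, ccont (v n)) -> (forall n t, 0 <= t <= 1 -> cabs (v n t) <= b n) ->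
  ccont (fun t => csum (fun n => v n t)) ->
  asummable (fun n => crint (v n)) /\
  crint (fun t => csum (fun n => v n t)) = csum (fun n => crint (v n)).
Proof.
move=> hB b0 cv hv cS.
have hc n : cabs (crint (v n)) <= b n by apply: crint_bound => // t; exact: hv.
split; first exact: asummable_le hc hB.
apply/eqP; rewrite -subr_eq0; apply/eqP; apply: cabs_le_eps => e e0.
have e2 : 0 < e / 2 by rewrite divr_gt0.
have [s0 [us0 h0]] := csum_tail b0 hB e2.
have k1 := h0 _ hc; have [c1 E1] := crint_sum s0 cv.
have k2 : cabs (crint (fun t => csum (fun n => v n t)) - \sum_(n <- s0) crint (v n)) <= e / 2.
  rewrite -E1.
  have -> : crint (fun t => csum (fun n => v n t)) - crint (fun t => \sum_(n <- s0) v n t) =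
      crint (fun t => (-1) * (\sum_(n <- s0) v n t) + csum (fun n => v n t)).
    by rewrite crint_lc//; ring.
  apply: crint_bound => [|t t01]; first exact: ccont_lc.
  rewrite mulN1r addrC; apply: h0 => n; exact: hv.
apply: le_trans (cabs_dist _ (\sum_(n <- s0) crint (v n)) _) _.
rewrite (cabsB (\sum_(n <- s0) _)); clear -k1 k2; lra.
Qed.

Definition mean2 (F : R -> R -> C) : C := crint (fun t => crint (fun s => F s t)).

Lemma mean2_lc a (F G : R -> R -> C) : cont2 F -> cont2 G ->
  mean2 (fun s t => a * F s t + G s t) = a * mean2 F + mean2 G.
Proof.
move=> cF cG; rewrite /mean2 -crint_lc; try by move=> t _; exact: ccont_crint.
by congr crint; apply/funext => t; rewrite crint_lc// => s _; exact: cont2_l.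
Qed.

Lemma mean2_csum (T : choiceType) (u : T -> R -> R -> C) : (forall n, cont2 (u n)) ->
  loc_summable u -> mean2 (fun s t => csum (fun n => u n s t)) = csum (fun n => mean2 (u n)).
Proof.
move=> cu hu; have cS := cont2_csum cu hu.
have E t : crint (fun s => csum (fun n => u n s t)) = csum (fun n => crint (fun s => u n s t)).
  have [b [B [hB b0 hb]]] := hu (`|t| + 1).
  apply: (crint_csum hB b0 _ _ _).2.
  - by move=> n s _; exact: cont2_l.
  - move=> n s /andP[s0 s1]; apply: hb; last by rewrite lerDl.
    by rewrite ger0_norm//; have := normr_ge0 t; lra.
  - by move=> s _; exact: (@cont2_l _ t s cS).
have [b [B [hB b0 hb]]] := hu 1.
have := @crint_csum T (fun n t => crint (fun s => u n s t)) b B hB b0.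
rewrite /mean2 (_ : (fun t => csum _) = fun t => crint (fun s => csum (fun n => u n s t))); last first.
  by apply/funext => t; rewrite E.
case=> //; first by move=> n t _; exact: ccont_crint.
  move=> n t /andP[t0 t1]; apply: crint_bound => [s _|s /andP[s0 s1]]; first exact: cont2_l.
  by apply: hb; rewrite ger0_norm.
by move=> t _; exact: ccont_crint.
Qed.

Lemma mean2_eint (j k : int) : mean2 (fun s t => eint j s * eint k t) = ((j == 0) && (k == 0))%:R.
Proof.
have ce l : ccont (@eint R l) by move=> t _; exact: ccont_eint.
rewrite /mean2 (_ : (fun t => _) = fun t => (j == 0)%:R * eint k t); last first.
  apply/funext => t; rewrite -(crint_eint R j) -(mulrC (eint k t)) -(crintZ _ (ce j)).2.
  by congr crint; apply/funext => s; rewrite mulrC.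
by rewrite (crintZ _ (ce k)).2 crint_eint -natrM mulnb.
Qed.

(** One variable at a time: the coefficients in [s] are continuous periodic functions of [t] whose
    own coefficients vanish. *)
Lemma fourier_unique2 (Q : R -> R -> C) M : cont2 Q -> (forall s t, cabs (Q s t) <= M) ->
  (forall s t (k : int), Q (s + k%:~R) t = Q s t) -> (forall s t (k : int), Q s (t + k%:~R) = Q s t) ->
  (forall j k, mean2 (fun s t => Q s t * (eint j s * eint k t)) = 0) -> forall s t, Q s t = 0.
Proof.
move=> cQ QM p1 p2 h s t.
have cj j : cont2 (fun s t => Q s t * eint j s).
  by apply: cont2M => //; apply: cont2_1 => x; exact: ccont_eint.
have G0 j t' : crint (fun s => Q s t' * eint j s) = 0.
  apply: (@fourier_unique R (fun t => crint (fun s => Q s t * eint j s)) M).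
  - by move=> x; exact: ccont_crint.
  - move=> x; apply: crint_bound => [y _|y _]; first exact: (@cont2_l _ x y (cj j)).
    by rewrite cabsM cabs_eint mulr1.
  - by move=> x k; congr crint; apply/funext => y; rewrite p2.
  - move=> k; rewrite -[RHS](h j k) /mean2; congr crint; apply/funext => x.
    rewrite mulrC -(crintZ _ _).2; last by move=> y _; exact: (@cont2_l _ x y (cj j)).
    by congr crint; apply/funext => y; ring.
apply: (@fourier_unique R (fun s => Q s t) M) => //.
by move=> x; exact: cont2_l.
Qed.

(** The series may be integrated term by term, so its difference with [P] has vanishing Fourier
    coefficients. *)
Lemma fourier_series2 (P : R -> R -> C) M (c : coords -> C) (b : coords -> R) B : cont2 P ->
  (forall s t, cabs (P s t) <= M) ->
  (forall s t (k : int), P (s + k%:~R) t = P s t) -> (forall s t (k : int), P s (t + k%:~R) = P s t) ->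
  bsum b B -> (forall j, cabs (c j) <= b j) ->
  (forall j : coords, mean2 (fun s t => P s t * (eint (- j 0 0) s * eint (- j 1 0) t)) = c j) ->
  forall s t, P s t = csum (fun j : coords => c j * (eint (j 0 0) s * eint (j 1 0) t)).
Proof.
move=> cP PM p1 p2 hB cb coef s t.
pose T s t := csum (fun j : coords => c j * (eint (j 0 0) s * eint (j 1 0) t)).
have b0 j : 0 <= b j by apply: le_trans (cb j); exact: cabs_ge0.
have ce k l : cont2 (fun s t : R => eint k s * eint l t).
  by apply: cont2M; [apply: cont2_1 => x|apply: cont2_2 => x]; exact: ccont_eint.
have tb (j : coords) s' t' : cabs (c j * (eint (j 0 0) s' * eint (j 1 0) t')) <= b j.
  by rewrite !cabsM !cabs_eint !mulr1.
have cu (j : coords) : cont2 (fun s t => c j * (eint (j 0 0) s * eint (j 1 0) t)).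
  by apply: cont2M => //; exact: cont2_cst.
have ls : loc_summable (fun (j : coords) s t => c j * (eint (j 0 0) s * eint (j 1 0) t)).
  by move=> rho; exists b, B; split.
have cT : cont2 T by exact: cont2_csum.
have TB s' t' : cabs (T s' t') <= B.
  by apply: cabs_csum; apply: bsum_le hB => j.
have TC (k l : int) : mean2 (fun s t : R => T s t * (eint k s * eint l t)) = c (cpair (- k) (- l)).
  have su (x y : R) : asummable (fun j : coords => c j * (eint (j 0 0) x * eint (j 1 0) y)).
    by apply: asummable_le hB => j.
  have -> : (fun s t => T s t * (eint k s * eint l t)) = fun s t =>
      csum (fun j : coords => c j * (eint (j 0 0 + k) s * eint (j 1 0 + l) t)).
    apply/funext => x; apply/funext => y; rewrite mulrC -csumZ//.
    by apply: eq_csum => j; rewrite !eintD; ring.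
  rewrite mean2_csum.
  - rewrite (csum1 (x0 := cpair (- k) (- l))).
      have -> : (fun s t => c (cpair (- k) (- l)) * (eint (cpair (- k) (- l) 0 0 + k) s * eint (cpair (- k) (- l) 1 0 + l) t)) =
        fun s t => c (cpair (- k) (- l)) * (eint 0 s * eint 0 t) + 0.
        by apply/funext => x; apply/funext => y; rewrite cpair0 cpair1 !addNr addr0.
      rewrite mean2_lc//; last exact: cont2_cst.
      by rewrite mean2_eint /mean2 !crint_cst addr0 mulr1.
    move=> j jk.
    have -> : (fun s t => c j * (eint (j 0 0 + k) s * eint (j 1 0 + l) t)) =
      fun s t => c j * (eint (j 0 0 + k) s * eint (j 1 0 + l) t) + 0.
      by apply/funext => x; apply/funext => y; rewrite addr0.
    rewrite mean2_lc//; last exact: cont2_cst.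
    rewrite mean2_eint /mean2 !crint_cst addr0; case: andP => [[/eqP e1 /eqP e2]|]; last by rewrite mulr0.
    case/eqP: jk; rewrite -(cpair_eta j); congr cpair; apply/eqP; rewrite -subr_eq0 opprK.
      exact/eqP.
    exact/eqP.
  - by move=> j; apply: cont2M => //; exact: cont2_cst.
  - by move=> rho; exists b, B; split => // j x y _ _; rewrite !cabsM !cabs_eint !mulr1.
suff Z x y : -1 * T x y + P x y = 0 by apply/eqP; rewrite -subr_eq0 addrC -mulN1r -/(T s t) Z.
move: x y; apply: (@fourier_unique2 (fun s t => (-1) * T s t + P s t) (B + M)).
- exact: cont2_lc.
- by move=> x y; apply: le_trans (cabsD _ _) _; rewrite mulN1r cabsN lerD.
- move=> x y k; rewrite p1 /T; congr (-1 * _ + _); apply: eq_csum => j; by rewrite eint_periodic.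
- move=> x y k; rewrite p2 /T; congr (-1 * _ + _); apply: eq_csum => j; by rewrite eint_periodic.
move=> k l; have := coef (cpair (- k) (- l)); rewrite cpair0 cpair1 !opprK => co.
have -> : (fun s t => (-1 * T s t + P s t) * (eint k s * eint l t)) =
  fun s t => (-1) * (T s t * (eint k s * eint l t)) + P s t * (eint k s * eint l t).
  by apply/funext => x; apply/funext => y; ring.
by rewrite mean2_lc ?TC ?co ?mulN1r ?addNr//; exact: cont2M.
Qed.

End FourierSeries.

(** * Poisson summation *)

Section Poisson.
Variable R : realType.
Local Notation C := (R[i]).
Implicit Types (L : 'M[R]_2) (v w x y xi : 'cV[R]_2).

Definition plane_cont (h : 'cV[R]_2 -> C) : Prop := forall x e, 0 < e ->
  exists2 d : R, 0 < d & forall y, n1 (y - x) < d -> cabs (h y - h x) < e.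

Lemma continuous_plane (h : 'cV[R]_2 -> C) : continuous (h : 'cV[R]_2 -> C^o) -> plane_cont h.
Proof.
move=> ch x e e0; have /cvgCP/(_ e e0) := ch x.
move/nbhs_ballP => [d /= d0 hd]; exists d => // y hy; apply: hd; split => // i j.
rewrite /ball /= (ord1 j); have : `|(y - x) i 0| <= n1 (y - x).
  case: (unliftP ord0 i) => [k ->|->]; rewrite /n1; last by rewrite lerDl.
  by rewrite (ord1 k) (_ : lift ord0 0 = 1) ?lerDr//; apply/val_inj.
by move=> /le_lt_trans /(_ hy); rewrite !mxE distrC.
Qed.

Lemma plane_cont_cell (h : 'cV[R]_2 -> C) L n : plane_cont h ->
  cont2 (fun s t => h (L *m (vec2 (s, t) + ivec R n))).
Proof.
move=> ch s t e e0; have [d d0 hd] := ch (L *m (vec2 (s, t) + ivec R n)) e e0.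
have [c c0 hc] := n1_upper L.
exists (d / (2 * c)); first by rewrite divr_gt0// mulr_gt0.
move=> s' t' hs ht; apply: hd; rewrite -mulmxBr.
have -> : vec2 (s', t') + ivec R n - (vec2 (s, t) + ivec R n) = vec2 (s' - s, t' - t).
  by apply: cV2P; rewrite !mxE /=; ring.
apply: le_lt_trans (hc _) _; rewrite /n1 !mxE /=.
rewrite mulrC -ltr_pdivlMr//.
have -> : d / c = d / (2 * c) + d / (2 * c) by field; rewrite gt_eqF.
exact: ltrD.
Qed.

Lemma plane_cont_cis xi : plane_cont (fun x => cis (dot xi x)).
Proof.
move=> x e e0; have [d d0 hd] := cis_cont (dot xi x) e0.
exists (d / (n1 xi + 1)); first by rewrite divr_gt0// ltr_wpDl ?n1_ge0.
move=> y; rewrite ltr_pdivlMr ?ltr_wpDl ?n1_ge0// => hy; apply: hd; apply: le_lt_trans hy.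
rewrite -dotNr -dotDr dotE; apply: le_trans (ler_normD _ _) _; rewrite !normrM.
set u := y - x; have := normr_ge0 (u 0 0); have := normr_ge0 (u 1 0).
have := normr_ge0 (xi 0 0); have := normr_ge0 (xi 1 0); rewrite /n1.
move: `|xi 0 0| `|xi 1 0| `|u 0 0| `|u 1 0| => a b p q; clear; nra.
Qed.

Section Summation.
Variables (L M : 'M[R]_2) (h : 'cV[R]_2 -> C) (K c K' c' : R).
Hypotheses (uL : L \in unitmx) (uM : M \in unitmx) (hLM : M^T *m L = (2 * pi)%:M).
Hypotheses (ch : plane_cont h) (c0 : 0 < c) (c'0 : 0 < c').
Hypotheses (hK : forall x, cabs (h x) <= K * expR (- c * n1 x))
  (hK' : forall x, cabs (fourier h x) <= K' * expR (- c' * n1 x)).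

Let K0 : 0 <= K.
Proof. by have := le_trans (cabs_ge0 _) (hK 0); rewrite pmulr_lge0 ?expR_gt0. Qed.

Let K'0 : 0 <= K'.
Proof. by have := le_trans (cabs_ge0 _) (hK' 0); rewrite pmulr_lge0 ?expR_gt0. Qed.

Lemma dual_dot (g : coords) v : dot (lvec M g) (L *m v) = 2 * pi * dot (ivec R g) v.
Proof.
have -> : dot (lvec M g) (L *m v) = dot (ivec R g) ((M^T *m L) *m v).
  by rewrite lvecE -mulmxA [RHS]dot_mul trmxK.
by rewrite hLM mul_scalar_mx !dotE !mxE; ring.
Qed.

Variable xi : 'cV[R]_2.

(** The terms of the function to be periodised, in cell coordinates: [h] times the plane wave of
    momentum [- xi]. *)
Let phi (n : coords) (s t : R) : C :=
  h (L *m (vec2 (s, t) + ivec R n)) * cis (dot (- xi) (L *m (vec2 (s, t) + ivec R n))).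

Let phi_cont n : cont2 (phi n).
Proof.
apply: cont2M; first exact: plane_cont_cell.
exact: (@plane_cont_cell (fun x => cis (dot (- xi) x)) L n (@plane_cont_cis (- xi))).
Qed.

Let phi_sum : loc_summable phi.
Proof.
have [cl cl0 hcl] := n1_lower uL; have [B B0 hB] := @lat_sum1 R (c * cl) (mulr_gt0 c0 cl0).
move=> rho; pose k := K * expR (c * cl * (2 * rho)).
have k0 : 0 <= k by rewrite mulr_ge0 ?expR_ge0.
exists (fun n => k * expR (- (c * cl) * n1 (0 + ivec R n))), (k * B); split.
- by move=> s us; rewrite -mulr_sumr ler_wpM2l ?hB.
- by move=> n; rewrite mulr_ge0 ?expR_ge0.
move=> n s t hs ht; rewrite cabsM cabs_cis mulr1; apply: le_trans (hK _) _.
rewrite /k -mulrA ler_wpM2l// -expRD ler_expR add0r.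
have := hcl (vec2 (s, t) + ivec R n).
have : n1 (ivec R n) <= n1 (vec2 (s, t) + ivec R n) + n1 (vec2 (s, t)).
  have := n1D (vec2 (s, t) + ivec R n) (- vec2 (s, t)); rewrite n1N.
  by rewrite addrAC subrr add0r.
have : n1 (vec2 (s, t)) <= 2 * rho by rewrite /n1 !mxE /=; lra.
set p := n1 (vec2 _); set q := n1 (ivec R n); set r := n1 (vec2 _ + _); set z := n1 (L *m _).
move=> h1 h2 h3; have h4 : cl * (q - 2 * rho) <= z.
  by apply: le_trans h3; rewrite ler_wpM2l ?(ltW cl0)//; lra.
have := ler_wpM2l (ltW c0) h4; lra.
Qed.

Let P (s t : R) : C := csum (fun n => phi n s t).

Let P_shift s t (m : coords) : P (s + (m 0 0)%:~R) (t + (m 1 0)%:~R) = P s t.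
Proof.
have [b [B [hB b0 hb]]] := phi_sum (`|s| + `|t|).
have sm : asummable (fun n => phi n s t).
  by apply: (asummable_le _ hB) => n; apply: hb; rewrite ?lerDl ?lerDr.
have inj : injective (fun n : coords => n - m) by exact: addIr.
rewrite /P; transitivity (csum ((fun n => phi n (s + (m 0 0)%:~R) (t + (m 1 0)%:~R)) \o (fun n => n - m))).
  apply: reindex_csum => // [n hn|].
    by have := hn (n + m); rewrite addrK eqxx.
  rewrite (_ : _ \o _ = fun n => phi n s t)//; apply/funext => n /=; rewrite /phi.
  have -> : vec2 (s + (m 0 0)%:~R, t + (m 1 0)%:~R) + ivec R (n - m) = vec2 (s, t) + ivec R n.
    by apply: cV2P; rewrite !mxE /= ?rmorphB /= ?rmorphD ?rmorphN /=; ring.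
  by [].
apply: eq_csum => n /=; rewrite /phi.
have -> // : vec2 (s + (m 0 0)%:~R, t + (m 1 0)%:~R) + ivec R (n - m) = vec2 (s, t) + ivec R n.
by apply: cV2P; rewrite !mxE /= ?rmorphB /= ?rmorphD ?rmorphN /=; ring.
Qed.

Let P_bound : exists B, forall s t, cabs (P s t) <= B.
Proof.
have [b [B [hB b0 hb]]] := phi_sum 1; exists B => s t.
have fr (x : R) : `|x - (Num.floor x)%:~R| <= 1.
  have /andP[f1 f2] := floor_itv x; rewrite rmorphD /= in f2.
  by rewrite ger0_norm; lra.
have := P_shift (s - (Num.floor s)%:~R) (t - (Num.floor t)%:~R) (cpair (Num.floor s) (Num.floor t)).
rewrite cpair0 cpair1 !subrK => ->.
by apply: cabs_csum; apply: bsum_le hB => n; apply: hb; exact: fr.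
Qed.

(** The Fourier coefficient of the periodised function: [4 * pi ^+ 2] undoes the normalisation of
    [fourier], and the modulus of the determinant is the area of the cell. *)
Let coef (g : coords) : C := ((`|\det L|)^-1 * (4 * pi ^+ 2))%:C * fourier h (xi + lvec M g).

(** Characters of the dual lattice are trivial on the lattice, so the mean of the periodised
    function against one of them over a cell unfolds to an integral over the plane. *)
Let coef_mean (g : coords) :
  mean2 (fun s t => P s t * (eint (- g 0 0) s * eint (- g 1 0) t)) = coef g.
Proof.
have d0 : `|\det L| != 0 by rewrite normr_eq0 unit_det.
have sm s t : asummable (fun n => phi n s t).
  have [b [B [hB b0 hb]]] := phi_sum (`|s| + `|t|).
  by apply: (asummable_le _ hB) => n; apply: hb; rewrite ?lerDl ?lerDr.
pose F x := h x * cis (- dot (xi + lvec M g) x).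
have E n s t : phi n s t * (eint (- g 0 0) s * eint (- g 1 0) t) = F (vec2 (cellmap L n (s, t))).
  rewrite /F vec2_cellmap /phi -mulrA; congr (_ * _); rewrite dotDl dual_dot opprD cisD -dotNl; congr (_ * _).
  rewrite dotDr mulrDr opprD cisD.
  have -> : 2 * pi * dot (ivec R g) (ivec R n) = 2 * pi * (g 0 0 * n 0 0 + g 1 0 * n 1 0)%:~R.
    by rewrite dotE !mxE rmorphD !rmorphM.
  rewrite (cisN (2 * pi * _%:~R)) cis_2pi_int conjc1 mulr1 -cisD; congr cis.
  by rewrite dotE !mxE /= !rmorphN /=; ring.
have e1 : mean2 (fun s t => P s t * (eint (- g 0 0) s * eint (- g 1 0) t)) =
    csum (fun n => mean2 (fun s t => F (vec2 (cellmap L n (s, t))))).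
  rewrite -mean2_csum.
  - congr mean2; apply/funext => s; apply/funext => t; rewrite /P mulrC -csumZ//.
    by apply: eq_csum => n; rewrite -E mulrC.
  - move=> n; rewrite (_ : (fun s t => _) = fun s t => phi n s t * (eint (- g 0 0) s * eint (- g 1 0) t)).
      by do 2?apply: cont2M => //; [apply: cont2_1 => x|apply: cont2_2 => x]; exact: ccont_eint.
    by apply/funext => s; apply/funext => t; rewrite E.
  - move=> rho; have [b [B [hB b0 hb]]] := phi_sum rho; exists b, B; split => // n s t hs ht.
    by rewrite -E (cabsM (phi n s t)) (cabsM (eint _ _)) !cabs_eint !mulr1 hb.
have cF : plane_cont F.
  move=> x e e0.
  have := @cont2M R (fun s t => h (1%:M *m (vec2 (s, t) + ivec R 0)))
     (fun s t => cis (dot (- (xi + lvec M g)) (1%:M *m (vec2 (s, t) + ivec R 0))))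
     (plane_cont_cell 1%:M 0 ch) (@plane_cont_cell _ 1%:M 0 (@plane_cont_cis _)).
  have ee v : 1%:M *m (vec2 (v 0 0, v 1 0) + ivec R 0) = v.
    by rewrite mul1mx; apply: cV2P; rewrite !mxE addr0.
  move=> /(_ (x 0 0) (x 1 0) e e0) [d dd0 hd]; exists d => // y.
  rewrite /n1 !mxE => hy; have := hd (y 0 0) (y 1 0).
  rewrite !ee /F -!dotNl; apply.
    by apply: le_lt_trans hy; rewrite lerDl.
  by apply: le_lt_trans hy; rewrite lerDr.
have cF2 : cont2 (fun s t => F (vec2 (s, t))).
  have := plane_cont_cell 1%:M 0 cF; congr cont2; apply/funext => s; apply/funext => t.
  by rewrite mul1mx; congr F; apply: cV2P; rewrite !mxE addr0.
have [b [B [hB b0 hb]]] := phi_sum 1.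
have Fb n (x : R * R) : sq x -> cabs (F (vec2 (cellmap L n x))) <= b n.
  move=> /sqP[/andP[s0 s1] /andP[t0 t1]]; case: x s0 s1 t0 t1 => s t /= s0 s1 t0 t1.
  by rewrite -E (cabsM (phi _ _ _)) (cabsM (eint _ _)) !cabs_eint !mulr1; apply: hb; rewrite ger0_norm// ltW.
have := @complex_unfold R L (fun x : R * R => F (vec2 x)) b B uL _ _ hB b0 Fb.
rewrite -[cintegral _ _ _]/(plane_integral setT F) => U.
have {}U : plane_integral setT F = csum (fun n => `|\det L|%:C * mean2 (fun s t => F (vec2 (cellmap L n (s, t))))).
  rewrite U.
  - apply: eq_csum => n; congr (_ * _).
    transitivity (cintegral (leb2 R) (@sq R) (fun x : R * R => F (vec2 (cellmap L n (x.1, x.2))))); last first.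
      apply: (@complex_fubini R (fun s t => F (vec2 (cellmap L n (s, t)))) K).
      + have := plane_cont_cell L n cF; congr cont2; apply/funext => s; apply/funext => t.
      by rewrite vec2_cellmap.
      + move=> s t; rewrite /F cabsM cabs_cis mulr1; apply: le_trans (hK _) _.
      rewrite -[leRHS]mulr1 ler_wpM2l// expR_le1 mulNr oppr_le0 mulr_ge0 ?n1_ge0 ?(ltW c0)//.
    by rewrite /cintegral; congr (_ +i* _); apply: eq_Rintegral => -[s t].
  - rewrite (_ : (fun _ => _) = fun x : R * R => complex.Re (F (vec2 (x.1, x.2)))).
      exact: (cont2_measurable_gen (@Re_lip R) cF2).
    by apply/funext => -[].
  - rewrite (_ : (fun _ => _) = fun x : R * R => complex.Im (F (vec2 (x.1, x.2)))).
      exact: (cont2_measurable_gen (@Im_lip R) cF2).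
    by apply/funext => -[].
have sF : asummable (fun n => mean2 (fun s t => F (vec2 (cellmap L n (s, t))))).
  apply: (asummable_le _ hB) => n; apply: crint_bound.
    move=> t _; apply: ccont_crint; have := plane_cont_cell L n cF; congr cont2.
    by apply/funext => s; apply/funext => u; rewrite vec2_cellmap.
  move=> t /andP[t0 t1]; apply: crint_bound.
    move=> s _; apply: (@cont2_l R (fun s t => F (vec2 (cellmap L n (s, t))))).
    have := plane_cont_cell L n cF; congr cont2.
    by apply/funext => s'; apply/funext => u; rewrite vec2_cellmap.
  move=> s /andP[s0 s1]; rewrite -E (cabsM (phi _ _ _)) (cabsM (eint _ _)) !cabs_eint !mulr1; apply: hb; rewrite ger0_norm//.
rewrite csumZ// in U; rewrite e1 /coef /fourier -/F U; set S := csum _.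
transitivity ((`|\det L|^-1 * (4 * pi ^+ 2) * (4 * pi ^+ 2)^-1 * `|\det L|)%:C * S).
  have -> : `|\det L|^-1 * (4 * pi ^+ 2) * (4 * pi ^+ 2)^-1 * `|\det L| = 1.
    by rewrite mulfK ?mulVf// mulf_neq0 ?expf_neq0 ?gt_eqF ?pi_gt0// pnatr_eq0.
  by rewrite mul1r.
by rewrite (realCM (_ * _^-1)) (realCM (_ * _) (_^-1)) -!mulrA.
Qed.

Lemma fourier_lattice_bound : exists2 B, 0 <= B & bsum (fun g => cabs (coef g)) B.
Proof.
have [B B0 hB] := lat_sum uM c'0.
pose k := `|(`|\det L|)^-1 * (4 * pi ^+ 2)| * K'; have k0 : 0 <= k by rewrite mulr_ge0.
exists (k * B); first exact: mulr_ge0.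
move=> s us; apply: le_trans (ler_wpM2l k0 (hB xi s us)); rewrite mulr_sumr; apply: ler_sum => g _.
by rewrite cabsM cabs_real /k -mulrA ler_wpM2l.
Qed.

(** The decay of the transform makes the Fourier series of the periodised function absolutely
    convergent; the phase [cis (dot xi y)] then restores the wave of momentum [xi] on the
    lattice. *)
Lemma poisson y :
  asummable (fun n => h (y - lvec L n) * cis (dot xi (lvec L n))) /\
  csum (fun n => h (y - lvec L n) * cis (dot xi (lvec L n))) =
  csum (fun g => coef g * cis (dot (xi + lvec M g) y)).
Proof.
pose v := invmx L *m y; have Lv : L *m v = y by rewrite mulKVmx.
have vv : vec2 (v 0 0, v 1 0) = v by apply: cV2P; rewrite !mxE.
have [b [B [hB b0 hb]]] := phi_sum (n1 v).
have sm : asummable (fun n => phi n (v 0 0) (v 1 0)).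
  by apply: (asummable_le _ hB) => n; apply: hb; rewrite /n1 ?lerDl ?lerDr.
have E n : h (y - lvec L n) * cis (dot xi (lvec L n)) = cis (dot xi y) * phi (- n) (v 0 0) (v 1 0).
  rewrite /phi vv mulmxDr Lv -[L *m ivec R (- n)]/(lvec L (- n)) lvecN mulrCA -cisD; congr (_ * cis _).
  by rewrite dotNl dotDr dotNr; ring.
have inj : injective (fun n : coords => - n) by exact: oppr_inj.
have [r1 r2] : asummable (fun n => phi (- n) (v 0 0) (v 1 0)) /\
    csum (fun n => phi (- n) (v 0 0) (v 1 0)) = P (v 0 0) (v 1 0).
  have := @reindex_sums R _ _ _ (fun n => phi (- n) (v 0 0) (v 1 0)) inj.
  have -> : (fun n => phi (- n) (v 0 0) (v 1 0)) \o (fun n : coords => - n) = fun n => phi n (v 0 0) (v 1 0).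
    by apply/funext => n /=; rewrite opprK.
  by apply => // n hn; have := hn (- n); rewrite opprK eqxx.
have -> : (fun n => h (y - lvec L n) * cis (dot xi (lvec L n))) =
  fun n => cis (dot xi y) * phi (- n) (v 0 0) (v 1 0) by apply/funext.
split; first exact: asummableZ.
rewrite csumZ// r2; have [PB hPB] := P_bound; have [D D0 hD] := fourier_lattice_bound.
have P1 s t (k : int) : P (s + k%:~R) t = P s t.
  by have := P_shift s t (cpair k 0); rewrite cpair0 cpair1 addr0.
have P2 s t (k : int) : P s (t + k%:~R) = P s t.
  by have := P_shift s t (cpair 0 k); rewrite cpair0 cpair1 addr0.
have cP : cont2 P by exact: cont2_csum.
rewrite (fourier_series2 cP hPB P1 P2 hD (fun j => lexx _) coef_mean) -csumZ; last first.
  by apply: (asummable_le _ hD) => g; rewrite !cabsM !cabs_eint !mulr1.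
apply: eq_csum => g; rewrite mulrCA; congr (_ * _); rewrite dotDl cisD; congr (_ * _).
rewrite -{1}Lv dual_dot -cisD; congr cis; rewrite dotE !mxE; ring.
Qed.

End Summation.
End Poisson.

(** * The trilayer operators *)

Section MorePowers.
Variable R : realType.
Local Notation C := (R[i]).

(** The index set is split into finitely many classes, each mapped injectively into a summable
    family; it serves for sums over sites labelled by an orbital. *)
Lemma bsum_cover (F : finType) (T T' : choiceType) (v : T' -> R) (key : T' -> F)
    (h : F -> T' -> T) (g : F -> T -> R) (B : F -> R) :
  (forall f x, 0 <= g f x) -> (forall f, bsum (g f) (B f)) ->
  (forall y, v y != 0 -> v y <= g (key y) (h (key y) y)) ->
  (forall y y', v y != 0 -> v y' != 0 -> key y = key y' -> h (key y) y = h (key y) y' -> y = y') ->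
  bsum v (\sum_f B f).
Proof.
move=> g0 gB vg inj s us; rewrite (bigID (fun y => v y != 0)) /= [X in _ + X]big1 ?addr0; last first.
  by move=> y; rewrite negbK => /eqP.
rewrite (partition_big key xpredT) //=; apply: ler_sum => f _.
rewrite -big_filter; set s' := [seq i <- s | _].
apply: (@le_trans _ _ (\sum_(y <- s') g f (h f y))).
  rewrite big_seq [leRHS]big_seq; apply: ler_sum => y; rewrite mem_filter => /andP[/andP[v0 /eqP <-] _].
  exact: vg.
rewrite -(big_map (h f) xpredT (g f)); apply: gB.
rewrite map_inj_in_uniq ?filter_uniq// => y y'.
rewrite !mem_filter => /andP[/andP[v0 /eqP k1] _] /andP[/andP[v0' /eqP k2] _] E.
by apply: inj; rewrite ?k1.
Qed.

Lemma bsum_term (T : choiceType) (v : T -> R) B x : bsum v B -> v x <= B.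
Proof. by move=> /(_ [:: x] isT); rewrite big_seq1. Qed.

Lemma mpow_row (T : choiceType) (M : T -> T -> C) K : schur M K ->
  forall n x, bsum (fun y => cabs (mpow M n x y)) (K ^+ n).
Proof.
move=> [K0 rM cM]; elim=> [|n IH] x.
  move=> s us; rewrite expr0 (eq_bigr (fun y => (y == x)%:R)); last first.
    by move=> y _; rewrite mpow0 cabs_nat eq_sym.
  have [xs|xs] := boolP (x \in s).
    rewrite (bigD1_seq x)//= eqxx big1 ?addr0// => y /negbTE ->//.
  by rewrite big1_seq ?ler01// => y /andP[_ ys]; case: eqP => // yx; rewrite -yx ys in xs.
apply: (@asummable2_l _ _ _ (fun y z => M x z * mpow M n z y) _ _).2.
move=> s1 s2 u1 u2; rewrite exchange_big /=.
apply: (@le_trans _ _ (\sum_(z <- s2) cabs (M x z) * K ^+ n)).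
  apply: ler_sum => z _; under eq_bigr do rewrite cabsM.
  by rewrite -mulr_sumr ler_wpM2l ?cabs_ge0 ?IH.
by rewrite -mulr_suml exprS ler_wpM2r ?exprn_ge0 ?rM.
Qed.

Lemma csum_mul_exchange (T1 T2 : choiceType) (u : T1 -> C) (v : T1 -> T2 -> C) (w : T2 -> C) B :
  bsum2 (fun x y => cabs (u x * v x y * w y)) B ->
  (forall x, asummable (fun y => v x y * w y)) -> (forall y, asummable (fun x => u x * v x y)) ->
  csum (fun x => u x * csum (fun y => v x y * w y)) = csum (fun y => csum (fun x => u x * v x y) * w y).
Proof.
move=> hB s1 s2.
have -> : (fun x => u x * csum (fun y => v x y * w y)) = fun x => csum (fun y => u x * v x y * w y).
  by apply/funext => x; rewrite -csumZ//; apply: eq_csum => y; rewrite mulrA.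
rewrite csum_exchange; last by exists B.
by apply: eq_csum => y; rewrite [RHS]mulrC -csumZ//; apply: eq_csum => x; rewrite mulrC.
Qed.

(** Induction on the power by exchange of sums. As [W] is merely bounded, absolute summability has
    to come from the Schur bounds of [M] and [N]. *)
Lemma mpow_intertwine (T T' : choiceType) (M : T -> T -> C) (N : T' -> T' -> C) (W : T -> T' -> C) K K' :
  schur M K -> schur N K' -> (forall x y, cabs (W x y) <= 1) ->
  (forall x y, csum (fun z => M x z * W z y) = csum (fun z => W x z * N z y)) ->
  forall n x y, csum (fun z => mpow M n x z * W z y) = csum (fun z => W x z * mpow N n z y).
Proof.
move=> hM hN W1 MW; elim=> [|n IH] x y.
  rewrite (csum1 (x0 := x)); last by move=> z zx; rewrite mpow0 eq_sym (negbTE zx) mul0r.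
  rewrite (csum1 (x0 := y)); last by move=> z zy; rewrite mpow0 (negbTE zy) mulr0.
  by rewrite !mpow0 !eqxx mul1r mulr1.
have [K0 rM _] := hM; have [K'0 rN cN] := hN.
have rMn := mpow_row hM; have cNn := mpow_col hN.
have bM k z : asummable (fun z' => mpow M k z z' * W z' y).
  by apply: (asummable_le _ (rMn k z)) => z'; rewrite cabsM ler_piMr ?cabs_ge0.
have bMW z z' : asummable (fun p => M z p * W p z').
  by apply: (asummable_le _ (rM z)) => p; rewrite cabsM ler_piMr ?cabs_ge0.
have bWN z z' : asummable (fun p => W z p * N p z').
  by apply: (asummable_le _ (cN z')) => p; rewrite cabsM ler_piMl ?cabs_ge0.
have bWNn z : asummable (fun p => W z p * mpow N n p y).
  by apply: (asummable_le _ (cNn n y)) => p; rewrite cabsM ler_piMl ?cabs_ge0.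
have bNN z : asummable (fun p => N z p * mpow N n p y).
  exists (K' ^+ n * K' ); move=> s us; apply: (@le_trans _ _ (\sum_(p <- s) K' ^+ n * cabs (N z p))).
    apply: ler_sum => p _; rewrite cabsM mulrC ler_wpM2r ?cabs_ge0//.
    exact: (bsum_term p (cNn n y)).
  by rewrite -mulr_sumr ler_wpM2l ?exprn_ge0 ?rN.
have bMM z : asummable (fun p => M x p * mpow M n p z).
  exists (K * K ^+ n); move=> s us; apply: (@le_trans _ _ (\sum_(p <- s) cabs (M x p) * K ^+ n)).
    apply: ler_sum => p _; rewrite cabsM ler_wpM2l ?cabs_ge0//.
    exact: (bsum_term z (rMn n p)).
  by rewrite -mulr_suml ler_wpM2r ?exprn_ge0 ?rM.
transitivity (csum (fun p => M x p * csum (fun z => W p z * mpow N n z y))).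
  rewrite -(eq_csum (fun p => congr1 (fun t => M x p * t) (IH p y))).
  rewrite (@csum_mul_exchange _ _ _ _ _ (K * K ^+ n)) => [|s1 s2 u1 u2|p|//].
  - by apply: eq_csum => z; rewrite mpowS.
  - apply: (@le_trans _ _ (\sum_(p <- s1) cabs (M x p) * K ^+ n)).
      apply: ler_sum => p _; apply: le_trans (ler_wpM2l (cabs_ge0 _) (rMn n p s2 u2)).
      rewrite mulr_sumr; apply: ler_sum => z _; rewrite !cabsM -mulrA ler_wpM2l ?cabs_ge0//.
      by rewrite ler_piMr ?cabs_ge0.
    by rewrite -mulr_suml ler_wpM2r ?exprn_ge0 ?rM.
  - exact: bM.
rewrite (@csum_mul_exchange _ _ _ _ _ (K * K' ^+ n)) => [|s1 s2 u1 u2|p|z].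
- transitivity (csum (fun z => csum (fun p => W x p * N p z) * mpow N n z y)).
    by apply: eq_csum => z; rewrite MW.
  rewrite -(@csum_mul_exchange _ _ _ _ _ (K' * K' ^+ n)) => [|s1 s2 u1 u2|p|z].
  + by apply: eq_csum => z; rewrite mpowS.
  + rewrite exchange_big /=; apply: (@le_trans _ _ (\sum_(z <- s2) K' * cabs (mpow N n z y))).
      apply: ler_sum => z _; apply: le_trans (ler_wpM2r (cabs_ge0 _) (cN z s1 u1)).
      rewrite mulr_suml; apply: ler_sum => p _; rewrite !cabsM ler_wpM2r ?cabs_ge0//.
      by rewrite ler_piMl ?cabs_ge0.
    by rewrite -mulr_sumr ler_wpM2l ?cNn.
  + exact: bNN.
  + exact: bWN.
- rewrite exchange_big /=; apply: (@le_trans _ _ (\sum_(z <- s2) K * cabs (mpow N n z y))).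
    apply: ler_sum => z _; apply: le_trans (ler_wpM2r (cabs_ge0 _) (rM x s1 u1)).
    rewrite mulr_suml; apply: ler_sum => p _; rewrite !cabsM ler_wpM2r ?cabs_ge0//.
    by rewrite ler_piMr ?cabs_ge0.
  by rewrite -mulr_sumr ler_wpM2l ?cNn.
- exact: bWNn.
- exact: bMW.
Qed.

Lemma tends_cauchy (F : R -> C) :
  (forall e, 0 < e -> exists z, \forall r \near +oo, cabs (F r - z) <= e) -> exists l, tends F l.
Proof.
move=> h; have h1 n : exists z, \forall r \near +oo, cabs (F r - z) <= n.+1%:R^-1.
  by apply: h; rewrite invr_gt0.
have [z hz] := boolp.choice h1.
have [n k|l hl] := @cauchy_complex R z (fun n => 2 * n.+1%:R^-1).
  have [r [r1 r2]] := @filter_ex _ _ _ _ (filterI (hz n) (hz (n + k)%N)).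
  apply: le_trans (cabs_dist _ (F r) _) _; rewrite cabsB.
  have : (n + k).+1%:R^-1 <= n.+1%:R^-1 :> R by rewrite lef_pV2 ?posrE// ler_nat ltnS leq_addr.
  move=> h3; apply: le_trans (lerD r2 r1) _.
  by rewrite -[2]/(1 + 1) mulrDl mul1r lerD2r.
exists l => e e0.
pose n := Num.truncn (5 / e); have n0 : 0 < n.+1%:R :> R by [].
have ne : 5 / n.+1%:R < e.
  by rewrite ltr_pdivrMr// mulrC -ltr_pdivrMr// truncnS_gt.
apply: filterS (hz n) => r hr; have := hl n; rewrite /= in hr *.
move=> hln; apply: le_lt_trans (cabs_dist _ (z n) _) _; apply: le_lt_trans (lerD hr hln) _.
by move: ne; move: (n.+1%:R^-1) => d; clear; lra.
Qed.

End MorePowers.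

Section Layers.
Implicit Types (i j k t : 'I_3).

Lemma layer_cases i j : [|| i == j, i == j + 1 | i == j + 2].
Proof. by case: i => [[|[|[|i]]] hi] //; case: j => [[|[|[|j]]] hj] //; rewrite -!val_eqE. Qed.

Lemma layer_neq j : [&& j + 1 != j, j + 2 != j, j + 1 != j + 2 & j != j + 1].
Proof. by case: j => [[|[|[|j]]] hj] //; rewrite -!val_eqE. Qed.

Lemma sum_others (V : nmodType) (F : 'I_3 -> V) j : \sum_(t | t != j) F t = F (j + 1) + F (j + 2).
Proof.
have /and4P[h1 h2 h3 h4] := layer_neq j.
rewrite (bigD1 (j + 1))//= (big_pred1 (j + 2))// => t.
have := layer_cases t j; case: (eqVneq t j) => [->|_] /=.
  by rewrite eq_sym (negbTE h2).
by case: (eqVneq t (j + 1)) => [->|_] /=; rewrite ?(negbTE h3).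
Qed.

Lemma sum_layers (V : nmodType) (F : 'I_3 -> V) j : \sum_t F t = F j + (F (j + 1) + F (j + 2)).
Proof. by rewrite (bigD1 j)//= sum_others. Qed.

Lemma sum_third (V : nmodType) (F : 'I_3 -> V) j k : j != k ->
  \sum_t F t = F j + F k + \sum_(t | (t != j) && (t != k)) F t.
Proof. by move=> jk; rewrite (bigD1 j)//= (bigD1 k) 1?eq_sym//= addrA. Qed.

End Layers.

(** * The lattices of the layers, their duals and incommensurability *)

Section Lattices.
Variables (R : realType) (theta : 'I_3 -> R).
Local Notation C := (R[i]).
Implicit Types (L : 'M[R]_2) (v w x y xi : 'cV[R]_2) (j k : 'I_3).
Local Notation A := (lattA theta).
Local Notation B := (lattB theta).

Lemma rotation_orth t : (rotation t)^T *m rotation t = 1%:M :> 'M[R]_2.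
Proof.
have h := cos2Dsin2 t; rewrite !expr2 in h.
apply/matrixP => i k; rewrite mxE big_ord_recl big_ord1 !mxE /=.
case: (unliftP ord0 i) => [i' ->|->]; case: (unliftP ord0 k) => [k' ->|->];
  rewrite ?(ord1 i') ?(ord1 k') /=; lra.
Qed.

Lemma rotation_enorm t v : enorm (rotation t *m v) = enorm v.
Proof.
congr Num.sqrt; rewrite !dotE !mul2E !mxE /=; have := cos2Dsin2 t.
set c := cos t; set s := sin t => h.
have -> : v 0 0 * v 0 0 + v 1 0 * v 1 0 = (c ^+ 2 + s ^+ 2) * (v 0 0 * v 0 0 + v 1 0 * v 1 0) by rewrite h mul1r.
ring.
Qed.

Lemma rotation_det t : \det (rotation t) = 1 :> R.
Proof. by rewrite det2E !mxE /=; have := cos2Dsin2 t; rewrite !expr2; lra. Qed.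

Lemma baseA_unit : baseA R \in unitmx.
Proof.
rewrite unitmxE unitfE det2E !mxE /=.
have lc0 : 0 < lattice_const R by rewrite mulr_gt0 ?divr_gt0 ?sqrtr_gt0.
have s0 : 0 < Num.sqrt 3 :> R by rewrite sqrtr_gt0.
by rewrite !mulr0 subr0 !mulf_neq0 ?gt_eqF ?invr_gt0.
Qed.

Lemma pi2_neq0 : 2 * pi != 0 :> R.
Proof. by rewrite mulf_neq0 ?gt_eqF ?pi_gt0. Qed.

Lemma baseB_unit : baseB R \in unitmx.
Proof.
rewrite unitmxE detZ det_tr unitrM -(unitmxE (invmx _)) unitmx_inv baseA_unit andbT.
by rewrite unitrX// unitfE pi2_neq0.
Qed.

Lemma lattA_unit j : A j \in unitmx.
Proof. by rewrite unitmx_mul baseA_unit andbT unitmxE rotation_det unitr1. Qed.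

Lemma lattB_unit j : B j \in unitmx.
Proof. by rewrite unitmx_mul baseB_unit andbT unitmxE rotation_det unitr1. Qed.

Lemma lattBA j : (B j)^T *m A j = (2 * pi)%:M.
Proof.
rewrite trmx_mul -mulmxA (mulmxA (rotation _)^T) rotation_orth mul1mx /baseB.
have -> : ((2 * pi) *: (invmx (baseA R))^T)^T = (2 * pi) *: invmx (baseA R).
  by apply/matrixP => i k; rewrite !mxE.
by rewrite -scalemxAl mulVmx ?baseA_unit// scalemx1.
Qed.

Lemma lattAB j : (A j)^T *m B j = (2 * pi)%:M.
Proof. by rewrite -[LHS]trmxK trmx_mul trmxK lattBA tr_scalar_mx. Qed.

Lemma enorm_lattA j n : enorm (lvec (A j) n) = enorm (lvec (baseA R) n).
Proof. by rewrite !lvecE -mulmxA rotation_enorm. Qed.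

Lemma enorm_lattB j n : enorm (lvec (B j) n) = enorm (lvec (baseB R) n).
Proof. by rewrite !lvecE -mulmxA rotation_enorm. Qed.

Definition area : R := `|\det (baseB R)|.

Lemma area_gt0 : 0 < area.
Proof. by rewrite normr_gt0 unit_det ?baseB_unit. Qed.

Lemma det_lattB j : `|\det (B j)| = area.
Proof. by rewrite det_mulmx rotation_det mul1r. Qed.

(** The constant of Poisson summation over a layer; by [cstarM] it is the factor [cstar j * cstar k]
    of the reciprocal Hamiltonian. *)
Lemma area_lattA j : (`|\det (A j)|)^-1 * (4 * pi ^+ 2) = area.
Proof.
have := congr1 (fun M => `|\det M|) (lattBA j).
rewrite det_mulmx det_tr det_scalar normrM det_lattB (ger0_norm (x := (2 * pi) ^+ 2)) ?exprn_ge0 ?mulr_ge0 ?pi_ge0// => h.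
have d0 : `|\det (A j)| != 0 by rewrite normr_eq0 unit_det ?lattA_unit.
have -> : 4 * pi ^+ 2 = (2 * pi) ^+ 2 :> R by rewrite exprMn -natrX.
by rewrite -h mulrCA mulVf ?mulr1.
Qed.

Lemma dual_cellE j : dual_cell theta j = lcell (B j) 0.
Proof.
have uB := lattB_unit j; apply/seteqP; split => x.
  move=> [s [t [/andP[s0 s1] /andP[t0 t1] xE]]]; apply/lcellP.
  have -> : amap (invmx (B j)) (0, 0) x = (s, t).
    by rewrite -[LHS]pr_vec2 vec2_amap xE mulKmx// /pr !mxE /= !addr0.
  by rewrite !mxE /= !add0r s0 s1 t0.
move=> /lcellP; rewrite !mxE /= !add0r => -[h1 h2].
exists (amap (invmx (B j)) (0, 0) x).1, (amap (invmx (B j)) (0, 0) x).2; split => //.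
rewrite -surjective_pairing vec2_amap mulmxDr mulKVmx//.
by rewrite (_ : vec2 (0, 0) = 0) ?mulmx0 ?addr0//; apply: cV2P; rewrite !mxE.
Qed.

Lemma leb2_lcell L : L \in unitmx -> leb2 R (lcell L 0) = (`|\det L|)%:E.
Proof.
move=> uL; have [_ _ h] := scales_amap (pr (lvec L 0)) (unit_det uL).
have := h _ (measurable_lcell 0 uL); rewrite -/(cellmap L 0) lcell_cellmap// leb2_sq.
have d0 : `|\det L| != 0 by rewrite normr_eq0 unit_det.
move: d0; move: (`|\det L|) (leb2 R _) => d u d0 e.
transitivity (d%:E * ((d^-1)%:E * u))%E; last by rewrite -e mule1.
by rewrite muleA -EFinM mulfV// mul1e.
Qed.

Lemma dual_areaE j : dual_area theta j = area.
Proof. by rewrite /dual_area dual_cellE leb2_lcell ?lattB_unit//= det_lattB. Qed.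

Lemma cstarM j k : cstar theta j * cstar theta k = area.
Proof. by rewrite /cstar !dual_areaE -expr2 sqr_sqrtr ?ltW ?area_gt0. Qed.

Lemma nustarE : nustar theta = (6 * area)^-1.
Proof.
rewrite /nustar; congr (_^-1).
rewrite (eq_bigr (fun _ => 2 * area)) => [|j _].
  by rewrite sumr_const card_ord -[_ *+ 3]mulr_natl; ring.
rewrite dual_areaE; congr (_%:R * _).
have -> : [set o : 'I_3 * bool | o.1 == j]%SET = [set (j, b) | b : bool]%SET.
  apply/setP => -[i b]; rewrite inE /=; apply/eqP/imsetP => [->|[b' _ [-> _]]//].
  by exists b.
by rewrite card_imset ?card_bool// => b b' [].
Qed.

Lemma achar_lattice L xi n : achar (L^T *m xi) n = cis (dot xi (lvec L n)).
Proof. by rewrite /achar -dot_mul. Qed.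

Lemma trivial_int w : trivial_char w -> exists m : coords, w = (2 * pi) *: ivec R m.
Proof.
have aux (z : R) : cis z = 1 -> exists m : int, z = 2 * pi * m%:~R.
  move=> h; have [|m hm] := @cis_eq1 R (z / (2 * pi)).
    by rewrite mulrC divfK ?pi2_neq0.
  by exists m; rewrite -hm mulrC divfK ?pi2_neq0.
move=> [/aux[a ha] /aux[b hb]]; exists (cpair a b).
by apply: cV2P; rewrite !mxE /=.
Qed.

Lemma trivial_lattA j xi : trivial_char ((A j)^T *m xi) -> exists m, xi = lvec (B j) m.
Proof.
move=> /trivial_int[m hm]; exists m.
have uA : (A j)^T \in unitmx by rewrite unitmx_tr lattA_unit.
rewrite -[xi](mulKmx uA) hm -[RHS](mulKmx uA) lvecE; congr (_ *m _).
by rewrite mulmxA lattAB mul_scalar_mx.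
Qed.

Lemma trivial_lattB j x : trivial_char ((B j)^T *m x) -> exists m, x = lvec (A j) m.
Proof.
move=> /trivial_int[m hm]; exists m.
have uB : (B j)^T \in unitmx by rewrite unitmx_tr lattB_unit.
rewrite -[x](mulKmx uB) hm -[RHS](mulKmx uB) lvecE; congr (_ *m _).
by rewrite mulmxA lattBA mul_scalar_mx.
Qed.

(** Triviality of the character puts the sum of the other layers' dual vectors in the dual lattice
    of layer [j], which is a vanishing sum of dual vectors from all layers. *)
Lemma incomm_dual j (D : {ffun 'I_3 -> coords}) : incommensurate B -> D j = 0 ->
  trivial_char ((A j)^T *m \sum_t dvec theta D t) -> D = [ffun=> 0].
Proof.
move=> hB Dj /trivial_lattA[m hm].
pose v t := if t == j then - m else D t.
have v0 : \sum_(t in [set: 'I_3]%SET) lvec (B t) (v t) = 0.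
  rewrite (bigD1 j) ?inE//= /v eqxx lvecN.
  rewrite -hm (bigD1 j)//= /dvec Dj lvec0 add0r.
  rewrite [X in _ + X](_ : _ = \sum_(t | t != j) lvec (B t) (D t)) ?addNr//.
  by apply: eq_big => t; rewrite inE // => tj; rewrite (negbTE tj).
apply/ffunP => t; rewrite ffunE; have [->//|tj] := eqVneq t j.
have := (hB _ _).1 v0 t; rewrite inE => /(_ isT); rewrite /v (negbTE tj) -(lvec0 (B t)).
exact: (lvec_inj (lattB_unit t)).
Qed.

Lemma incomm_real j k (S : coords) : incommensurate A -> j != k ->
  trivial_char ((B k)^T *m lvec (A j) S) -> S = 0.
Proof.
move=> hA jk /trivial_lattB[m hm].
pose v t := if t == j then S else - m.
have kj : k != j by rewrite eq_sym.
have v0 : \sum_(t in [set j; k]%SET) lvec (A t) (v t) = 0.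
  by rewrite big_setU1 ?inE//= big_set1 /v eqxx (negbTE kj) hm lvecN subrr.
have := (hA _ _).1 v0 j; rewrite !inE eqxx => /(_ isT); rewrite /v eqxx -(lvec0 (A j)).
exact: (lvec_inj (lattA_unit j)).
Qed.

End Lattices.

Lemma fin_bound (R : realType) (F : finType) (P : F -> R -> Prop) :
  (forall x K K', P x K -> K <= K' -> P x K') -> (forall x, exists2 K, 0 <= K & P x K) ->
  exists2 K, 0 <= K & forall x, P x K.
Proof.
move=> mono ex; have [K hK] := boolp.choice (fun x => let: ex_intro2 K h1 h2 := ex x in ex_intro _ K (conj h1 h2)).
exists (\sum_x K x) => [|x]; first by apply: sumr_ge0 => x _; case: (hK x).
apply: mono (hK x).2 _; rewrite (bigD1 x)//= lerDl; apply: sumr_ge0 => y _; by case: (hK y).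
Qed.

(** The rate is halved because [n1] is at most twice [enorm]. *)
Lemma decay_bound (R : realType) (T : Type) (u : T -> R) (p : T -> 'cV[R]_2) (g c : R) :
  has_ubound (range (fun x => u x * expR (g * enorm (p x)))) -> 0 < c -> 2 * c <= g -> (forall x, 0 <= u x) ->
  exists2 K, 0 <= K & forall x, u x <= K * expR (- c * n1 (p x)).
Proof.
move=> [U hU] c0 cg u0; exists `|U| => // x.
have h : u x * expR (g * enorm (p x)) <= `|U|.
  by apply: le_trans (ler_norm U); apply: hU; exists x.
have := ler_wpM2r (expR_ge0 (- (g * enorm (p x)))) h; rewrite -mulrA -expRD subrr expR0 mulr1.
move=> /le_trans; apply; rewrite ler_wpM2l// ler_expR mulNr lerN2.
have h1 := n1_le_enorm (p x); have h2 := enorm_ge0 (p x).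
apply: (@le_trans _ _ (c * (2 * enorm (p x)))); first by rewrite ler_wpM2l// ltW.
by rewrite mulrA ler_wpM2r// mulrC.
Qed.

(** * Fourier transforms of adjoint hoppings *)

Section FourierConj.
Variable R : realType.
Local Notation C := (R[i]).
Local Notation P2 := (measurableTypeR R * measurableTypeR R)%type.

Lemma Rintegral_opp (G : P2 -> R) : measurable_fun setT G ->
  Rintegral (leb2 R) setT (fun x => G (- x.1, - x.2)) = Rintegral (leb2 R) setT G.
Proof.
move=> mG; have d1 : \det (- 1%:M : 'M[R]_2) = 1 by rewrite det2E !mxE /=; ring.
have sc : scales (fun x : P2 => (- x.1, - x.2)) 1.
  have := @scales_amap R (- 1%:M) (0, 0); rewrite d1 oner_neq0 normr1 invr1.
  move=> /(_ isT); congr scales; apply/funext => -[x y].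
  by rewrite /amap !mxE /=; congr (_, _); ring.
have key (H : P2 -> \bar R) : measurable_fun setT H -> (forall x, (0 <= H x)%E) ->
    (\int[leb2 R]_x H x = \int[leb2 R]_x H ((- x.1)%R, (- x.2)%R))%E.
  by move=> mH H0; rewrite (ge0_scales sc)// invr1 mul1e preimage_setT.
rewrite /Rintegral; congr fine; rewrite integralE [RHS]integralE; congr (_ - _)%E.
  rewrite [RHS]key; last by move=> x; exact: funepos_ge0.
    by apply: eq_integral => x _; rewrite !funeposE.
  by apply: measurable_funepos; exact/measurable_EFinP.
rewrite [RHS]key; last by move=> x; exact: funeneg_ge0.
  by apply: eq_integral => x _; rewrite !funenegE.
by apply: measurable_funeneg; exact/measurable_EFinP.
Qed.

(** Exchanging the positive and negative parts changes the sign of [fine (a - b)], infinite values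
    included. *)
Lemma RintegralN_all (G : P2 -> R) :
  Rintegral (leb2 R) setT (fun x => - G x) = - Rintegral (leb2 R) setT G.
Proof.
have sub (a b : \bar R) : fine (b - a)%E = - fine (a - b)%E.
  by case: a => [a||]; case: b => [b||]; rewrite /= ?oppr0 ?opprB.
rewrite /Rintegral integralE [X in _ = - fine X]integralE -sub; congr (fine (_ - _)%E).
  by apply: eq_integral => x _; rewrite funeposE funenegE.
by apply: eq_integral => x _; rewrite funeposE funenegE /= opprK.
Qed.

Lemma plane_cont_measurable (F : 'cV[R]_2 -> C) (h : C -> R) :
  (forall z w, `|h z - h w| <= cabs (z - w)) -> plane_cont F ->
  measurable_fun setT (fun x : P2 => h (F (vec2 x))).
Proof.
move=> hh cF; have := plane_cont_cell 1%:M 0 cF.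
have -> : (fun s t => F (1%:M *m (vec2 (s, t) + ivec R 0))) = fun s t => F (vec2 (s, t)).
  by apply/funext => s; apply/funext => t; rewrite mul1mx; congr F; apply: cV2P; rewrite !mxE addr0.
move=> /(cont2_measurable_gen hh); rewrite (_ : (fun x : P2 => h (F (vec2 (x.1, x.2)))) = fun x => h (F (vec2 x)))//.
Qed.

Lemma plane_contM (F G : 'cV[R]_2 -> C) : plane_cont F -> plane_cont G -> plane_cont (fun x => F x * G x).
Proof.
move=> cF cG x e e0.
have := cont2M (plane_cont_cell 1%:M 0 cF) (plane_cont_cell 1%:M 0 cG).
have ee (v : 'cV[R]_2) : 1%:M *m (vec2 (v 0 0, v 1 0) + ivec R 0) = v.
  by rewrite mul1mx; apply: cV2P; rewrite !mxE addr0.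
move=> /(_ (x 0 0) (x 1 0) e e0) [d dd0 hd]; exists d => // y.
rewrite /n1 !mxE => hy; have := hd (y 0 0) (y 1 0); rewrite !ee; apply.
  by apply: le_lt_trans hy; rewrite lerDl.
by apply: le_lt_trans hy; rewrite lerDr.
Qed.

(** Substitution of [- x] for [x]; it makes the interlayer entries of the reciprocal Hamiltonian
    hermitian. *)
Lemma fourier_conj (h h' : 'cV[R]_2 -> C) xi : plane_cont h ->
  (forall x, h' x = conjc (h (- x))) -> fourier h' xi = conjc (fourier h xi).
Proof.
move=> ch hh; rewrite /fourier conjcM conjc_real; congr (_ * _).
have cF : plane_cont (fun x => h x * cis (- dot xi x)).
  have := plane_contM ch (@plane_cont_cis R (- xi)); congr plane_cont.
  by apply/funext => x; rewrite dotNl.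
have E (x : P2) : h' (vec2 x) * cis (- dot xi (vec2 x)) =
    conjc (h (vec2 (- x.1, - x.2)) * cis (- dot xi (vec2 (- x.1, - x.2)))).
  have -> : vec2 (- x.1, - x.2) = - vec2 x by apply: cV2P; rewrite !mxE.
  by rewrite hh conjcM -cisN dotNr opprK.
rewrite /plane_integral /cintegral.
under eq_Rintegral do rewrite E.
under [X in _ +i* X]eq_Rintegral do rewrite E.
apply/eqP; rewrite eq_complex /=; apply/andP; split; apply/eqP.
  transitivity (Rintegral (leb2 R) setT (fun x : P2 => complex.Re (h (vec2 (- x.1, - x.2)) * cis (- dot xi (vec2 (- x.1, - x.2)))))).
    by apply: eq_Rintegral => x _; case: (h _ * _).
  exact: (Rintegral_opp (plane_cont_measurable (@Re_lip R) cF)).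
rewrite -RintegralN_all.
have cF' : plane_cont (fun x => conjc (h x * cis (- dot xi x))).
  move=> x e e0; have [d d0 hd] := cF x e e0; exists d => // y /hd.
  have -> : conjc (h y * cis (- dot xi y)) - conjc (h x * cis (- dot xi x)) =
     conjc (h y * cis (- dot xi y) - h x * cis (- dot xi x)) by rewrite rmorphB.
  by rewrite cabs_conj.
rewrite (Rintegral_opp (plane_cont_measurable (@Im_lip R) cF')).
by apply: eq_Rintegral => x _; case: (h _ * _).
Qed.

End FourierConj.

(** * The two Hamiltonians and the plane waves *)

Section Trilayer.
Variables (R : realType) (theta : 'I_3 -> R).
Local Notation C := (R[i]).
Local Notation A := (lattA theta).
Local Notation B := (lattB theta).
Local Notation tau := (tau theta).
Local Notation dvec := (dvec theta).
Variable intra : 'I_3 -> bool -> bool -> coords -> C.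
Variable inter : orbital -> orbital -> 'cV[R]_2 -> C.
Local Notation H := (H_mat theta intra inter).
Local Notation Hhat := (Hhat_mat theta intra inter).
Implicit Types (o : orbital) (p : site) (x y z : dual_site) (q xi v w : 'cV[R]_2).

Definition site_position p : 'cV[R]_2 := lvec (A p.1.1) p.2 + tau p.1.

Definition dual_momentum q (G : {ffun 'I_3 -> coords}) : 'cV[R]_2 := q + \sum_t dvec G t.

Variables (K c : R).
Hypotheses (K0 : 0 <= K) (c0 : 0 < c).
Hypothesis cont_inter : forall o o', o.1 != o'.1 -> plane_cont (inter o o').
Hypothesis bnd_inter : forall o o', o.1 != o'.1 -> forall v, cabs (inter o o' v) <= K * expR (- c * n1 v).
Hypothesis bnd_fourier : forall o o', o.1 != o'.1 ->
  forall v, cabs (fourier (inter o o') v) <= K * expR (- c * n1 v).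
Hypothesis bnd_intra : forall j a b n, cabs (intra j a b n) <= K * expR (- c * n1 (lvec (A j) n)).
Hypothesis herm : hermitian_hopping intra inter.

Lemma site_sum (d : R) : 0 < d -> exists2 D, 0 <= D &
  forall v, bsum (fun p => expR (- d * n1 (site_position p - v))) D.
Proof.
move=> d0; have [D D0 hD] : exists2 D, 0 <= D & forall j w, bsum (fun n => expR (- d * n1 (w + lvec (A j) n))) D.
  apply: fin_bound => [j D D' h DD w|j]; first by move=> s us; apply: le_trans (h w s us) DD.
  exact: lat_sum (lattA_unit theta j) d0.
exists (\sum_(o : orbital) D); first by apply: sumr_ge0.
move=> v; apply: (@bsum_cover R orbital coords site _ fst (fun _ p => p.2)
    (fun o n => expR (- d * n1 (tau o - v + lvec (A o.1) n)))).
- by move=> o n; exact: expR_ge0.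
- by move=> o; exact: hD.
- by move=> [ o n] _ /=; rewrite /site_position /= [lvec _ _ + _]addrC addrAC.
- by move=> [ o n] [ o' n'] _ _ /= -> ->.
Qed.

(** Both kinds of hopping are measured by the distance of actual positions; within a layer the
    shifts [tau] are absorbed in the constant. *)
Lemma H_bound : exists2 K1, 0 <= K1 & forall p p', cabs (H p p') <= K1 * expR (- c * n1 (site_position p - site_position p')).
Proof.
pose T := \sum_(o : orbital) n1 (tau o).
have T1 o : n1 (tau o) <= T by rewrite /T (bigD1 o)//= lerDl; apply: sumr_ge0 => ? _; exact: n1_ge0.
have T0 : 0 <= T by apply: sumr_ge0 => ? _; exact: n1_ge0.
have KK : K <= K * expR (c * (2 * T)).
  by rewrite ler_peMr// -expR0 ler_expR !mulr_ge0// ltW.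
exists (K * expR (c * (2 * T))); first by rewrite mulr_ge0 ?expR_ge0.
move=> [ o n] [ o' n']; rewrite /H_mat; case: eqP => [eo|/eqP eo].
  apply: le_trans (bnd_intra _ _ _ _) _; rewrite -mulrA ler_wpM2l// -expRD ler_expR.
  have h : n1 (site_position (o, n) - site_position (o', n')) <= n1 (lvec (A o.1) (n - n')) + 2 * T.
    rewrite /site_position /= -eo lvecB.
    have -> : lvec (A o.1) n + tau o - (lvec (A o.1) n' + tau o') =
       (lvec (A o.1) n - lvec (A o.1) n') + (tau o + - tau o') by apply/matrixP => i k; rewrite !mxE; ring.
    apply: le_trans (n1D _ _) _; rewrite lerD2l; apply: le_trans (n1D _ _) _; rewrite n1N.
    have := T1 o; have := T1 o'; lra.
  have := ler_wpM2l (ltW c0) h; lra.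
apply: le_trans (bnd_inter eo _) _; apply: (@le_trans _ _ (K * expR (- c * n1 (site_position (o, n) - site_position (o', n'))))).
  by rewrite /site_position /= opprD !addrA.
by rewrite ler_wpM2r ?expR_ge0.
Qed.

Lemma H_hermitian : hermitian_mat H.
Proof.
have [h1 h2] := herm; move=> [ o n] [ o' n']; rewrite /H_mat eq_sym; case: eqP => [eo|/eqP eo].
  by rewrite h1 eo opprB.
rewrite h2 1?eq_sym//; congr (conjc (inter _ _ _)).
by apply/matrixP => i k; rewrite !mxE; ring.
Qed.

(** Half of the decay rate goes into a submultiplicative exponential weight, the other half keeps
    the weighted column sums finite; [mpow_col_weight] then gives decay of all powers at rate
    [c / 2]. *)
Lemma H_weighted : exists2 KH, 0 <= KH & schur H KH /\
  forall N p p', cabs (mpow H N p p') <= KH ^+ N * expR (- (c / 2) * n1 (site_position p - site_position p')).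
Proof.
have [K1 K10 hK1] := H_bound; have c2 : 0 < c / 2 by rewrite divr_gt0.
have [D D0 hD] := site_sum c2.
pose w p p' := expR (c / 2 * n1 (site_position p - site_position p')).
have w1 p p' : 1 <= w p p' by rewrite -expR0 ler_expR mulr_ge0 ?n1_ge0// ltW.
have w0 p p' : 0 <= w p p' by exact: expR_ge0.
have wcol p' : bsum (fun p => cabs (H p p') * w p p') (K1 * D).
  move=> s us; apply: le_trans (ler_wpM2l K10 (hD (site_position p') s us)); rewrite mulr_sumr.
  apply: ler_sum => p _; apply: le_trans (ler_wpM2r (w0 _ _) (hK1 p p')) _.
  by rewrite -mulrA ler_wpM2l// -expRD ler_expR; lra.
have col p' : bsum (fun p => cabs (H p p')) (K1 * D).
  by apply: bsum_le (wcol p') => p; rewrite ler_peMr ?cabs_ge0.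
exists (K1 * D); first exact: mulr_ge0.
split.
  split; [exact: mulr_ge0| |exact: col].
  by move=> p; apply: bsum_le (col p) => p'; rewrite (H_hermitian p' p) cabs_conj.
move=> N p p'; have := @mpow_col_weight R _ H (K1 * D) w (mulr_ge0 K10 D0) w0.
move=> /(_ _ _ wcol w1 N p').
have h1 : forall p, w p p <= 1 by move=> p0; rewrite /w subrr n10 mulr0 expR0.
have h2 p1 p2 p3 : w p1 p3 <= w p1 p2 * w p2 p3.
  rewrite /w -expRD ler_expR -mulrDr ler_wpM2l ?(ltW c2)//.
  by apply: le_trans (n1D _ _); rewrite addrA subrK.
move=> /(_ h1 h2) /(bsum_term p).
rewrite -ler_pdivlMr ?expR_gt0// => /le_trans; apply.
by rewrite -expRN mulNr.
Qed.

Lemma layer_zero x : (val x).2 (val x).1.1 = 0.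
Proof. by case: x => [[ o G] /= /eqP]. Qed.

Lemma intra_symbol_bound : exists2 KS, 0 <= KS & forall j a b q, cabs (intra_symbol theta intra j a b q) <= KS.
Proof.
have [KS KS0 hKS] : exists2 KS, 0 <= KS & forall j, bsum (fun n => K * expR (- c * n1 (0 + lvec (A j) n))) KS.
  apply: fin_bound => [j D D' h DD|j]; first by move=> s us; apply: le_trans (h s us) DD.
  have [D D0 hD] := lat_sum (lattA_unit theta j) c0; exists (K * D); first exact: mulr_ge0.
  by move=> s us; rewrite -mulr_sumr ler_wpM2l ?hD.
exists KS => // j a b q; apply: cabs_csum; apply: bsum_le (hKS j) => n.
by rewrite cabsM cabs_cis mul1r add0r.
Qed.

Lemma Hhat_support q x y : Hhat q x y != 0 -> forall t, t != (val x).1.1 -> t != (val y).1.1 ->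
  (val y).2 t = (val x).2 t.
Proof.
case: x => [[ o G] Go]; case: y => [[ o' G'] Go'] /=; rewrite /Hhat_mat /=; have [eo|eo] := eqVneq o.1 o'.1.
  by have [->//|_] := eqVneq G G'; rewrite mul0r eqxx.
have [/forallP h _ t to to'|_] := boolP [forall l, (l != o.1) && (l != o'.1) ==> (G l == G' l)]; last by rewrite !mul0r eqxx.
by have := h t; rewrite to to' /= => /eqP.
Qed.

Lemma Hhat_hermitian q : hermitian_mat (Hhat q).
Proof.
have [h1 h2] := herm; move=> [[ o G] Go] [[ o' G'] Go']; rewrite /Hhat_mat /= eq_sym; case: eqP => [eo|/eqP eo].
  rewrite -eo eq_sym; have [->|_] := eqVneq G G'; last by rewrite !mul0r conjc0.
  rewrite !mul1r /intra_symbol -csum_conj; last first.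
    have [D D0 hD] := lat_sum (lattA_unit theta o.1) c0.
    exists (K * D); move=> s us; apply: le_trans (ler_wpM2l K0 (hD 0 s us)).
    by rewrite mulr_sumr; apply: ler_sum => n _; rewrite cabsM cabs_cis mul1r add0r.
  have inj : injective (fun n : coords => - n) by exact: oppr_inj.
  rewrite [RHS](reindex_csum inj).
  - apply: eq_csum => n /=; rewrite conjcM h1 -cisN; congr (cis _ * _).
    by rewrite lvecN !dotDr !dotNr; ring.
  - by move=> n hn; have := hn (- n); rewrite opprK eqxx.
  - have [D D0 hD] := lat_sum (lattA_unit theta o.1) c0.
    exists (K * D); move=> s us; apply: le_trans (ler_wpM2l K0 (hD 0 (map -%R s) _)); last by rewrite map_inj_uniq.
    rewrite big_map mulr_sumr; apply: ler_sum => n _ /=.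
    by rewrite cabs_conj cabsM cabs_cis mul1r add0r.
have E : [forall l, (l != o'.1) && (l != o.1) ==> (G' l == G l)] = [forall l, (l != o.1) && (l != o'.1) ==> (G l == G' l)].
  by apply: eq_forallb => l; rewrite andbC [G' l == _]eq_sym.
have z (u v w : C) : false%:R * u * v * w = 0 by rewrite !mul0r.
rewrite E; case: (boolP [forall l, _ ==> _]) => [/forallP h|_]; last by rewrite !z conjc0.
have z1 (u v w : C) : true%:R * u * v * w = u * v * w by rewrite mul1r.
rewrite !z1.
have gen (r r' t t' : R) (w w' : C) : r = r' -> t = - t' -> w = conjc w' ->
    r%:C * cis t * w = conjc (r'%:C * cis t' * w').
  by move=> -> -> ->; rewrite !conjcM conjc_real -cisN.
apply: gen; [exact: mulrC|by rewrite opprB|].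
rewrite (@fourier_conj R (inter o o') (inter o' o)).
- congr (conjc (fourier _ _)).
  have -> : \sum_(l | (l != o'.1) && (l != o.1)) dvec G' l = \sum_(l | (l != o.1) && (l != o'.1)) dvec G l.
    apply: eq_big => [l|l]; first by rewrite andbC.
    rewrite andbC => ll; have := h l; rewrite ll => /eqP; by rewrite /Defs.dvec => ->.
  by congr (_ + _); rewrite addrAC.
- exact: cont_inter.
- by move=> v; rewrite h2 1?eq_sym.
Qed.

(** A site joined to [(o, G)] is determined by its orbital and its component in layer [o.1]: its own
    component vanishes and any further one is shared with [G]. The lattice sum over the free
    component is bounded uniformly in [q]. *)
Lemma Hhat_schur : exists2 KG, 0 <= KG & forall q, schur (Hhat q) KG.
Proof.
have [KS KS0 hKS] := intra_symbol_bound.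
have [D D0 hD] : exists2 D, 0 <= D & forall j w, bsum (fun n => expR (- c * n1 (w + lvec (B j) n))) D.
  apply: fin_bound => [j D D' h DD w|j]; first by move=> s us; apply: le_trans (h w s us) DD.
  exact: lat_sum (lattB_unit theta j) c0.
have ar0 := ltW (area_gt0 R).
pose K3 := area R * K; have K30 : 0 <= K3 by rewrite mulr_ge0.
pose KG := \sum_(o : orbital) (KS + K3 * D).
have KG0 : 0 <= KG by apply: sumr_ge0 => o _; rewrite addr_ge0// mulr_ge0.
have row q x : bsum (fun y => cabs (Hhat q x y)) KG.
  case: x => [[ o G] Go].
  pose w (o' : orbital) := q + dvec G o'.1 + \sum_(l | (l != o.1) && (l != o'.1)) dvec G l.
  apply: (@bsum_cover R orbital coords dual_site _ (fun y => (val y).1) (fun _ y => (val y).2 o.1)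
    (fun o' n => if o.1 == o'.1 then KS * (n == 0)%:R else K3 * expR (- c * n1 (w o' + lvec (B o.1) n)))).
  - by move=> o' n; case: ifP => _; rewrite mulr_ge0 ?expR_ge0 ?ler0n.
  - move=> o'; case: (o.1 == o'.1) => /= s us; last first.
      rewrite -mulr_sumr; apply: le_trans (ler_wpM2l K30 (hD o.1 (w o') s us)) _.
      by rewrite lerDr.
    rewrite -mulr_sumr; apply: (@le_trans _ _ (KS * 1)); last by rewrite mulr1 lerDl mulr_ge0.
    rewrite ler_wpM2l//; have [s0|s0] := boolP (0 \in s).
      by rewrite (bigD1_seq 0)//= eqxx big1 ?addr0// => n /negbTE ->.
    by rewrite big1_seq// => n /andP[_ ns]; case: eqP => // n0; rewrite -n0 ns in s0.
  - move=> [[ o' G'] Go'] /=; rewrite /Hhat_mat /= cabs_eq0; have [eo|eo] := eqVneq o.1 o'.1.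
      have [EG _|_] := eqVneq G G'; last by rewrite mul0r eqxx.
      rewrite mul1r -EG; move: (Go) => /= /eqP ->; rewrite eqxx mulr1; exact: hKS.
    have [hl _|_] := boolP [forall l, (l != o.1) && (l != o'.1) ==> (G l == G' l)]; last by rewrite !mul0r eqxx.
    rewrite mul1r cabsM cabsM cabs_cis mulr1 cstarM cabs_real ger0_norm// /K3 -mulrA ler_wpM2l//.
    apply: le_trans (bnd_fourier eo _) _; rewrite /w.
    have -> : q + dvec G' o.1 + dvec G o'.1 + \sum_(l | (l != o.1) && (l != o'.1)) dvec G l =
      q + dvec G o'.1 + \sum_(l | (l != o.1) && (l != o'.1)) dvec G l + lvec (B o.1) (G' o.1).
      by rewrite /Defs.dvec -!addrA; congr (_ + _); rewrite addrC -!addrA.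
    by [].
  - move=> y y'; rewrite !cabs_eq0 => hy hy' k1 k2.
    apply: val_inj; rewrite [LHS]surjective_pairing [RHS]surjective_pairing k1; congr (_, _).
    apply/ffunP => t; have [->//|t1] := eqVneq t o.1.
    have [->|t2] := eqVneq t (val y).1.1; first by rewrite layer_zero k1 layer_zero.
    by rewrite (Hhat_support hy)// (Hhat_support hy')// -k1.
exists KG => // q; split => // y.
by apply: bsum_le (row q y) => x; rewrite (Hhat_hermitian q y x) cabs_conj.
Qed.

Lemma cis_dual j (g n : coords) : cis (dot (lvec (B j) g) (lvec (A j) n)) = 1.
Proof.
rewrite [lvec (A j) n]lvecE (dual_dot (lattBA theta j)).
have -> : dot (ivec R g) (ivec R n) = (g 0 0 * n 0 0 + g 1 0 * n 1 0)%:~R.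
  by rewrite dotE !mxE rmorphD !rmorphM.
exact: cis_2pi_int.
Qed.

Definition plane_wave q p x : C := (p.1 == (val x).1)%:R * cis (dot (dual_momentum q (val x).2) (site_position p)).

Lemma cabs_plane_wave q p x : cabs (plane_wave q p x) <= 1.
Proof. by rewrite cabsM cabs_cis mulr1 cabs_nat; case: (_ == _). Qed.

Lemma W_right q x (F : site -> C) :
  asummable (fun n => F ((val x).1, n) * cis (dot (dual_momentum q (val x).2) (site_position ((val x).1, n)))) ->
  csum (fun p' => F p' * plane_wave q p' x) =
  csum (fun n => F ((val x).1, n) * cis (dot (dual_momentum q (val x).2) (site_position ((val x).1, n)))).
Proof.
move=> hF; have inj : injective (fun n : coords => ((val x).1, n)) by move=> n n' [].
have E : (fun p' => F p' * plane_wave q p' x) \o (fun n : coords => ((val x).1, n)) =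
  fun n => F ((val x).1, n) * cis (dot (dual_momentum q (val x).2) (site_position ((val x).1, n))).
  by apply/funext => n; rewrite /= /plane_wave eqxx mul1r.
rewrite (reindex_csum inj) ?E// => -[ o n] hn; rewrite /plane_wave /=.
case: eqP => [eo|_]; last by rewrite mul0r mulr0.
by have := hn n; rewrite -eo eqxx.
Qed.

Lemma W_intra q (o o' : orbital) n (G' : {ffun 'I_3 -> coords}) (Go' : G' o'.1 == 0) : o.1 = o'.1 ->
  csum (fun n' => intra o.1 o.2 o'.2 (n - n') * cis (dot (dual_momentum q G') (site_position (o', n')))) =
  cis (dot (dual_momentum q G') (site_position (o, n))) * intra_symbol theta intra o.1 o.2 o'.2 (dual_momentum q G').
Proof.
move=> eo; set xi := dual_momentum q G'.
have [D D0 hD] := lat_sum (lattA_unit theta o.1) c0.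
have sm : asummable (fun m => cis (- dot xi (lvec (A o.1) m + tau (o.1, o.2) - tau (o.1, o'.2))) * intra o.1 o.2 o'.2 m).
  exists (K * D); move=> s us; apply: le_trans (ler_wpM2l K0 (hD 0 s us)).
  by rewrite mulr_sumr; apply: ler_sum => m _; rewrite cabsM cabs_cis mul1r add0r.
have inj : injective (fun m : coords => n - m) by move=> m m' /addrI /oppr_inj.
have E : (fun n' => intra o.1 o.2 o'.2 (n - n') * cis (dot xi (site_position (o', n')))) \o (fun m : coords => n - m) =
  fun m => cis (dot xi (site_position (o, n))) * (cis (- dot xi (lvec (A o.1) m + tau (o.1, o.2) - tau (o.1, o'.2))) * intra o.1 o.2 o'.2 m).
  apply/funext => m /=; rewrite opprB addrC subrK mulrC mulrA -cisD; congr (cis _ * _).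
  have -> : (o.1, o'.2) = o' by rewrite eo -surjective_pairing.
  rewrite /site_position /= -eo -(surjective_pairing o).
  by rewrite lvecB !dotDr !dotNr; ring.
rewrite (reindex_csum inj) ?E ?csumZ//.
- by move=> y hy; have := hy (n - y); rewrite opprB addrC subrK eqxx.
- exact: asummableZ.
Qed.

Lemma pair_val_inj x y : (val x).1 = (val y).1 -> (val x).2 =1 (val y).2 -> x = y.
Proof.
move=> e1 e2; apply: val_inj; rewrite [LHS]surjective_pairing [RHS]surjective_pairing e1.
by congr (_, _); apply/ffunP.
Qed.

(** With [g] free, this describes all dual sites of orbital [o] that interact with the site
    [(o', G')] of another layer. *)
Definition change_layer (o o' : orbital) (G : {ffun 'I_3 -> coords}) (g : coords) : {ffun 'I_3 -> coords} :=
  [ffun t => if t == o.1 then 0 else if t == o'.1 then g else G t].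

Fact change_layerP o o' G g : (o, change_layer o o' G g).2 (o, change_layer o o' G g).1.1 == 0.
Proof. by rewrite ffunE eqxx. Qed.

Definition change_site o o' G g : dual_site := exist _ (o, change_layer o o' G g) (change_layerP o o' G g).

(** Poisson summation over the lattice of [o']. The change of site removes from the momentum a dual
    vector of the layer of [o]; on that lattice it is invisible, and it leaves only a phase in
    [tau o], the one built into the reciprocal Hamiltonian. *)
Lemma W_inter q (o o' : orbital) n (G' : {ffun 'I_3 -> coords}) (Go' : G' o'.1 = 0) : o.1 != o'.1 ->
  let xi := dual_momentum q G' in
  let y := lvec (A o.1) n + tau o - tau o' in
  asummable (fun n' => inter o o' (y - lvec (A o'.1) n') * cis (dot xi (lvec (A o'.1) n'))) /\
  csum (fun n' => inter o o' (y - lvec (A o'.1) n') * cis (dot xi (site_position (o', n')))) =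
  csum (fun g => cis (dot (dual_momentum q (change_layer o o' G' g)) (site_position (o, n))) *
     (area R)%:C * cis (dot (dvec G' o.1) (tau o) - dot (lvec (B o'.1) g) (tau o')) *
     fourier (inter o o') (xi + lvec (B o'.1) g)) /\
  asummable (fun g => cis (dot (dual_momentum q (change_layer o o' G' g)) (site_position (o, n))) *
     (area R)%:C * cis (dot (dvec G' o.1) (tau o) - dot (lvec (B o'.1) g) (tau o')) *
     fourier (inter o o') (xi + lvec (B o'.1) g)).
Proof.
move=> eo xi y.
have [s1 s2] := @poisson R (A o'.1) (B o'.1) (inter o o') K c K c (lattA_unit theta o'.1)
  (lattB_unit theta o'.1) (lattBA theta o'.1) (cont_inter eo) c0 c0 (bnd_inter eo) (bnd_fourier eo) xi y.
have [D D0 hD] := @fourier_lattice_bound R (A o'.1) (B o'.1) (inter o o') K c (lattB_unit theta o'.1) c0 (bnd_fourier eo) xi.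
rewrite area_lattA in s2.
have xiE g : dual_momentum q (change_layer o o' G' g) = xi - dvec G' o.1 + lvec (B o'.1) g.
  rewrite /xi /dual_momentum !(sum_third _ eo) /Defs.dvec !ffunE eqxx (negbTE (_ : o'.1 != o.1)) 1?eq_sym// eqxx Go' !lvec0.
  rewrite (eq_bigr (fun t => lvec (B t) (G' t))) => [|t /andP[t1 t2]]; last by rewrite ffunE (negbTE t1) (negbTE t2).
  by apply/matrixP => i k; rewrite !mxE; ring.
have E g : cis (dot (dual_momentum q (change_layer o o' G' g)) (site_position (o, n))) *
     (area R)%:C * cis (dot (dvec G' o.1) (tau o) - dot (lvec (B o'.1) g) (tau o')) *
     fourier (inter o o') (xi + lvec (B o'.1) g) =
   cis (dot xi (tau o')) * ((area R)%:C * fourier (inter o o') (xi + lvec (B o'.1) g) * cis (dot (xi + lvec (B o'.1) g) y)).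
  have -> : dot (dual_momentum q (change_layer o o' G' g)) (site_position (o, n)) =
     - dot (dvec G' o.1) (lvec (A o.1) n) + (- dot (dvec G' o.1) (tau o) + dot (xi + lvec (B o'.1) g) (site_position (o, n))).
    by rewrite xiE /site_position /= !dotDl !dotDr !dotNl; ring.
  have ed : cis (dot (dvec G' o.1) (lvec (A o.1) n)) = 1 by exact: cis_dual.
  rewrite (cisD (- dot _ (lvec _ n))) (cisN (dot _ (lvec _ n))) ed conjc1 mul1r.
  set f := fourier _ _; set r : C := (area R)%:C.
  transitivity (r * f * (cis (- dot (dvec G' o.1) (tau o) + dot (xi + lvec (B o'.1) g) (site_position (o, n))) *
     cis (dot (dvec G' o.1) (tau o) - dot (lvec (B o'.1) g) (tau o')))); first by ring.
  transitivity (r * f * (cis (dot xi (tau o')) * cis (dot (xi + lvec (B o'.1) g) y))); last by ring.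
  congr (_ * _); rewrite -!cisD; congr cis.
  by rewrite /y /site_position /= !dotDl !dotDr !dotNr; ring.
have sg : asummable (fun g => (area R)%:C * fourier (inter o o') (xi + lvec (B o'.1) g) * cis (dot (xi + lvec (B o'.1) g) y)).
  apply: (asummable_le _ hD) => g; by rewrite area_lattA cabsM cabs_cis mulr1.
split => //; split; last first.
  by rewrite (_ : (fun _ => _) = fun g => cis (dot xi (tau o')) * ((area R)%:C * fourier (inter o o') (xi + lvec (B o'.1) g) * cis (dot (xi + lvec (B o'.1) g) y))); [exact: asummableZ|exact/funext].
transitivity (cis (dot xi (tau o')) * csum (fun n' => inter o o' (y - lvec (A o'.1) n') * cis (dot xi (lvec (A o'.1) n')))).
  rewrite -csumZ//; apply: eq_csum => n'; rewrite /site_position /= dotDr cisD; ring.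
by rewrite s2 -csumZ//; apply: eq_csum => g; rewrite -E.
Qed.

(* Poisson summation over the layer of the neighbouring site. *)
Lemma intertwine q p y : csum (fun p' => H p p' * plane_wave q p' y) = csum (fun x => plane_wave q p x * Hhat q x y).
Proof.
have [KH KH0 [hH _]] := H_weighted.
have sH : asummable (fun n' => H p ((val y).1, n') * cis (dot (dual_momentum q (val y).2) (site_position ((val y).1, n')))).
  have [_ rH _] := hH; have inj : injective (fun n : coords => ((val y).1, n)) by move=> n n' [].
  by apply: (asummable_le _ (bsum_inj inj (rH p))) => n'; rewrite cabsM cabs_cis mulr1.
rewrite (W_right sH) {sH}; case: p => o n; case: y => [[ o' G'] Go']; have Go'2 := eqP Go'; rewrite /= in Go' Go'2 *.
have [eo|eo] := eqVneq o.1 o'.1.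
  have Go : (o, G').2 (o, G').1.1 == 0 by rewrite /= eo Go'2.
  rewrite (csum1 (x0 := exist _ (o, G') Go)).
    have eb : o.1 == o'.1 by apply/eqP.
    by rewrite /plane_wave /Hhat_mat /= eb !eqxx !mul1r -(W_intra q n Go' eo).
  move=> [[ o1 G] Go1] ne; rewrite /plane_wave /=.
  case: eqP => [oE|_]; last by rewrite !mul0r.
  rewrite /Hhat_mat /= -oE eo eqxx; case: eqP => [GE|_]; last by rewrite mul0r mulr0.
  by case/eqP: ne; apply: pair_val_inj; rewrite /= ?oE// GE.
have [_ [e2 e3]] := W_inter q n Go'2 eo.
transitivity (csum (fun n' => inter o o' (lvec (A o.1) n + tau o - tau o' - lvec (A o'.1) n') *
    cis (dot (dual_momentum q G') (site_position (o', n'))))).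
  apply: eq_csum => n'; congr (inter _ _ _ * _).
  by apply/matrixP => i k; rewrite !mxE; ring.
rewrite e2.
have inj : injective (change_site o o' G').
  move=> g g' /(congr1 (fun z : dual_site => (val z).2 o'.1)) /=.
  by rewrite !ffunE eqxx (negbTE (_ : o'.1 != o.1)) 1?eq_sym.
have E : (fun x => plane_wave q (o, n) x * Hhat q x (exist _ (o', G') Go')) \o change_site o o' G' =
  fun g => cis (dot (dual_momentum q (change_layer o o' G' g)) (site_position (o, n))) *
     (area R)%:C * cis (dot (dvec G' o.1) (tau o) - dot (lvec (B o'.1) g) (tau o')) *
     fourier (inter o o') (dual_momentum q G' + lvec (B o'.1) g).
  apply/funext => g; rewrite /= /plane_wave /Hhat_mat /= eqxx mul1r (negbTE eo) cstarM.
  have -> : [forall l, (l != o.1) && (l != o'.1) ==> (change_layer o o' G' g l == G' l)].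
    by apply/forallP => l; apply/implyP => /andP[l1 l2]; rewrite ffunE (negbTE l1) (negbTE l2).
  have e4 : dvec (change_layer o o' G' g) o'.1 = lvec (B o'.1) g.
    by rewrite /Defs.dvec ffunE (negbTE (_ : o'.1 != o.1)) 1?eq_sym// eqxx.
  have -> : q + dvec G' o.1 + dvec (change_layer o o' G' g) o'.1 +
      \sum_(l | (l != o.1) && (l != o'.1)) dvec (change_layer o o' G' g) l = dual_momentum q G' + lvec (B o'.1) g.
    have e5 : dvec G' o'.1 = 0 by rewrite /Defs.dvec Go'2 lvec0.
    rewrite e4 /dual_momentum (sum_third _ eo) e5 addr0.
    rewrite (eq_bigr (fun t => dvec G' t)) => [|t /andP[t1 t2]]; last by rewrite /Defs.dvec ffunE (negbTE t1) (negbTE t2).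
    by rewrite -!addrA; congr (_ + (_ + _)); rewrite addrC.
  by rewrite e4 mul1r !mulrA.
rewrite (reindex_csum inj) ?E// => -[[ o1 G] Go1] hn; rewrite /plane_wave /=.
case: eqP => [oE|_]; last by rewrite !mul0r.
have [->|nz] := eqVneq (Hhat q (exist _ (o1, G) Go1) (exist _ (o', G') Go')) 0; first by rewrite mulr0.
have := hn (G o'.1); case/eqP; apply: pair_val_inj => //= t; rewrite ffunE.
have [->|t1] := eqVneq t o.1; first by rewrite oE; apply/eqP.
have [->//|t2] := eqVneq t o'.1.
by have := Hhat_support nz (t := t); rewrite /= -oE => ->.
Qed.

Lemma intertwine_pow q N p y :
  csum (fun p' => mpow H N p p' * plane_wave q p' y) = csum (fun x => plane_wave q p x * mpow (Hhat q) N x y).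
Proof.
have [KH KH0 [hH _]] := H_weighted; have [KG KG0 hG] := Hhat_schur.
exact: (mpow_intertwine hH (hG q) (cabs_plane_wave q) (intertwine q)).
Qed.

End Trilayer.

(** * Limits of the averages *)

Section AverageLimits.
Variable R : realType.
Local Notation C := (R[i]).

Lemma avg_csum_swap (S : choiceType) (T : Type) (bs : R -> seq T) (u : T -> S -> C) r :
  (forall x, asummable (u x)) ->
  avg bs (fun x => csum (u x)) r = csum (fun k => avg bs (fun x => u x k) r).
Proof.
move=> hu; have [h1 h2] := csum_sumr (bs r) hu.
by rewrite /avg -h2 mulrC -csumZ//; apply: eq_csum => k; rewrite mulrC.
Qed.

Lemma eq_avg (T : Type) (bs : R -> seq T) (u v : T -> C) : u =1 v -> avg bs u = avg bs v.
Proof. by move=> uv; apply/funext => r; rewrite /avg; congr (_ / _); apply: eq_bigr => x _. Qed.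

Lemma tends_eq (F G : R -> C) l : F =1 G -> tends F l -> tends G l.
Proof. by move=> /funext ->. Qed.

Lemma avgZ (T : Type) (bs : R -> seq T) (u : T -> C) a r :
  avg bs (fun x => a * u x) r = a * avg bs u r.
Proof. by rewrite /avg -mulr_sumr mulrA. Qed.

Lemma tendsZ (F : R -> C) a l : tends F l -> tends (fun r => a * F r) (a * l).
Proof.
move=> hF; have := tends_lc a hF (@tends_const R 0); rewrite addr0.
by apply: tends_eq => r; rewrite addr0.
Qed.

Lemma tends_sum (T : Type) (s : seq T) (F : R -> T -> C) (D : T -> C) :
  (forall x, tends (fun r => F r x) (D x)) ->
  tends (fun r => \sum_(x <- s) F r x) (\sum_(x <- s) D x).
Proof.
move=> hF; elim: s => [|x l IH].
  rewrite big_nil; apply: tends_eq (@tends_const R 0) => r; by rewrite big_nil.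
rewrite big_cons; have := tends_lc 1 (hF x) IH; rewrite mul1r.
by apply: tends_eq => r; rewrite big_cons mul1r.
Qed.

Lemma tends_avg (T : Type) (bs : R -> seq T) (F : R -> T -> C) (D : T -> C) s :
  (forall x, tends (fun r => F r x) (D x)) -> tends (fun r => avg bs (F r) s) (avg bs D s).
Proof.
move=> /tends_sum sums; rewrite /avg; set k : C := (size (bs s))%:R.
have := tendsZ (k^-1) (sums (bs s)); rewrite mulrC; apply: tends_eq => r; exact: mulrC.
Qed.

End AverageLimits.

(** * Mean coefficients of the powers *)

Section Coefficients.
Variables (R : realType) (theta : 'I_3 -> R).
Local Notation C := (R[i]).
Local Notation A := (lattA theta).
Local Notation B := (lattB theta).
Local Notation dvec := (dvec theta).
Variable intra : 'I_3 -> bool -> bool -> coords -> C.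
Variable inter : orbital -> orbital -> 'cV[R]_2 -> C.
Local Notation H := (H_mat theta intra inter).
Local Notation Hhat := (Hhat_mat theta intra inter).
Local Notation posit := (site_position theta).
Local Notation momentum := (dual_momentum theta).
Local Notation Wmat := (plane_wave theta).
Implicit Types (o : orbital) (x y : dual_site) (q xi : 'cV[R]_2) (S n : coords).

Variables (c KH KG : R).
Hypotheses (c0 : 0 < c) (KH0 : 0 <= KH).
Hypothesis incomm : double_incommensurate theta.
Hypothesis H_pow : forall N p p',
  cabs (mpow H N p p') <= KH ^+ N * expR (- c * n1 (posit p - posit p')).
Hypothesis Hhat_schur : forall q, schur (Hhat q) KG.
Hypothesis Hpow_intertwine : forall q N p y,
  csum (fun p' => mpow H N p p' * Wmat q p' y) = csum (fun x => Wmat q p x * mpow (Hhat q) N x y).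

Local Notation ballA := (ball2 (baseA_unit R)).
Local Notation ballB := (ball2 (baseB_unit R)).

Section OnePower.
Variables (o : orbital) (N : nat).

(** Summable majorant, uniform in [n], of the entries of [H^N] between [n] and [n + S]. *)
Let u S : R := KH ^+ N * expR (- c * n1 (0 + lvec (A o.1) S)).

Let u0 S : 0 <= u S.
Proof. by rewrite mulr_ge0 ?exprn_ge0 ?expR_ge0. Qed.

Let uB : exists D, bsum u D.
Proof.
have [D D0 hD] := lat_sum (lattA_unit theta o.1) c0; exists (KH ^+ N * D) => s us.
by rewrite -mulr_sumr ler_wpM2l ?exprn_ge0 ?hD.
Qed.

Let posit_shift n S : posit (o, n + S) = posit (o, n) + lvec (A o.1) S.
Proof. by rewrite /site_position /= lvecD addrAC. Qed.

Let hop n S : C := mpow H N (o, n) (o, n + S).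

Let hop_le n S : cabs (hop n S) <= u S.
Proof.
apply: le_trans (H_pow _ _ _) _; rewrite /u posit_shift.
by rewrite opprD addrA subrr !add0r n1N.
Qed.

Let chi q y x n : C := (o == (val x).1)%:R * cis (dot (momentum q (val x).2 - momentum q (val y).2) (posit (o, n))).

(** The intertwining of powers at row [(o, n)] and column [y], divided by the value of the wave at
    [(o, n)]. *)
Let shift_sum q y n : (val y).1 = o ->
  csum (fun S => hop n S * cis (dot (momentum q (val y).2) (lvec (A o.1) S))) =
  csum (fun x => mpow (Hhat q) N x y * chi q y x n).
Proof.
move=> yo; set xi := momentum q (val y).2; have [D hD] := uB.
have sm (w : C) : cabs w = 1 -> asummable (fun S => hop n S * (w * cis (dot xi (lvec (A o.1) S)))).
  move=> w1; apply: (asummable_le _ hD) => S; by rewrite !cabsM cabs_cis w1 !mulr1.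
pose e := cis (dot xi (posit (o, n))).
have ee : conjc e * e = 1 by rewrite mulrC mul_conjc cabs_cis expr1n.
have inj : injective (fun S : coords => n + S) by exact: addrI.
have E : (fun n' => mpow H N (o, n) (o, n') * cis (dot xi (posit (o, n')))) \o (fun S : coords => n + S) =
    fun S => hop n S * (e * cis (dot xi (lvec (A o.1) S))).
  by apply/funext => S /=; rewrite posit_shift dotDr cisD.
have [r1 r2] : asummable (fun n' => mpow H N (o, n) (o, n') * cis (dot xi (posit (o, n')))) /\
   csum (fun n' => mpow H N (o, n) (o, n') * cis (dot xi (posit (o, n')))) =
   csum (fun S => hop n S * (e * cis (dot xi (lvec (A o.1) S)))).
  rewrite -E; apply: reindex_sums => //.
    by move=> n' hn; have := hn (n' - n); rewrite addrC subrK eqxx.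
  by rewrite E; apply: sm; exact: cabs_cis.
have h : csum (fun S => hop n S * (e * cis (dot xi (lvec (A o.1) S)))) =
    csum (fun x => Wmat q (o, n) x * mpow (Hhat q) N x y).
  have := @W_right _ theta q y (fun p' => mpow H N (o, n) p').
  by rewrite /xi in r1 r2 *; rewrite yo -r2 -Hpow_intertwine => ->.
transitivity (conjc e * csum (fun S => hop n S * (e * cis (dot xi (lvec (A o.1) S))))).
  rewrite -csumZ; last by apply: sm; exact: cabs_cis.
  by apply: eq_csum => S; rewrite mulrCA !mulrA -(mulrA _ (conjc e)) ee mulr1.
rewrite h -csumZ; last first.
  have := mpow_col (Hhat_schur q) N y; apply: asummable_le => x.
  by rewrite cabsM ler_piMl ?cabs_ge0 ?cabs_plane_wave.
apply: eq_csum => x; rewrite /plane_wave /chi /= dotDl dotNl cisD cisN -/xi -/e.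
have comb (u' b' v' M' : C) : u' * (b' * v' * M') = M' * (b' * (v' * u')) by ring.
exact: comb.
Qed.

(** Distinct sites of one orbital differ in momentum by a combination of dual vectors of the two
    other layers, a nontrivial character of the lattice of layer [o.1]. The balls are those of the
    unrotated lattice, the rotation being moved onto the momentum. *)
Let chi_avg q y x : (val y).1 = o -> tends (avg ballA (chi q y x)) ((x == y)%:R).
Proof.
move=> yo; have [xy|xy] := eqVneq x y.
  apply: tends_eq (tends_avg1 (ball2_size_gt0 (baseA_unit R))) => r; congr avg; apply/funext => n.
  by rewrite /chi xy yo eqxx subrr dotE !mxE !mul0r addr0 cis0 mulr1.
have [xo|xo] := eqVneq o (val x).1; last first.
  apply: tends_eq (@tends_const R 0) => r; rewrite /avg big1 ?mul0r// => n _.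
  by rewrite /chi (negbTE xo) mul0r.
pose D := [ffun t => (val x).2 t - (val y).2 t]; pose delta := \sum_t dvec D t.
have mD : momentum q (val x).2 - momentum q (val y).2 = delta.
  rewrite /dual_momentum opprD addrACA subrr add0r -sumrB; apply: eq_bigr => t _.
  by rewrite /Defs.dvec ffunE lvecB.
pose w := (A o.1)^T *m delta.
have nt : ~ trivial_char ((baseA R)^T *m ((rotation (theta o.1))^T *m delta)).
  rewrite mulmxA -trmx_mul => tr.
  have D0 : D o.1 = 0.
    by rewrite ffunE xo layer_zero -xo -yo layer_zero subrr.
  have := incomm_dual incomm.2 D0 tr => /ffunP DE.
  case/eqP: xy; apply: pair_val_inj; first by rewrite -xo yo.
  by move=> t; have := DE t; rewrite !ffunE => /eqP; rewrite subr_eq0 => /eqP.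
have := tendsZ (cis (dot delta (tau theta o))) (achar_avg (baseA_unit R) nt).
rewrite mulr0; apply: tends_eq => r; rewrite -avgZ; congr avg; apply/funext => n.
rewrite /chi xo eqxx mul1r mD mulmxA -trmx_mul achar_lattice -cisD; congr cis.
by rewrite /site_position dotDr -xo addrC.
Qed.

Let a r S : C := avg ballA (fun n => hop n S) r.

Let a_le r S : cabs (a r S) <= u S.
Proof. by apply: cabs_avg => // n; exact: hop_le. Qed.

Let L q y r : C := csum (fun S => a r S * cis (dot (momentum q (val y).2) (lvec (A o.1) S))).

(** Averaging [shift_sum] over [n] turns its left side into [L], while on the right only the
    diagonal term survives. *)
Let L_tends q y : (val y).1 = o -> tends (L q y) (mpow (Hhat q) N y y).
Proof.
move=> yo; have [D hD] := uB.
have col := mpow_col (Hhat_schur q) N y.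
have chi1 x n : cabs (chi q y x n) <= 1.
  by rewrite cabsM cabs_cis mulr1 cabs_nat; case: (_ == _).
have := @avg_csum R _ _ ballA (chi q y) (fun x => mpow (Hhat q) N x y) (fun x => (x == y)%:R) _ _
  (fun x => cabs_ge0 _) col (fun x => lexx _) chi1.
have z1 x : cabs ((x == y)%:R : C) <= 1 by rewrite cabs_nat; case: (_ == _).
move=> /(_ z1 (fun x => chi_avg q x yo)).
rewrite (csum1 (x0 := y)) ?eqxx ?mulr1; last by move=> x /negbTE ->; rewrite mulr0.
apply: tends_eq => r.
rewrite -(@eq_avg R _ ballA _ _ (fun n => shift_sum q n yo)) avg_csum_swap; last first.
  by move=> n; apply: (asummable_le _ hD) => S; rewrite cabsM cabs_cis mulr1.
apply: eq_csum => S; rewrite /a mulrC -avgZ; congr avg; apply/funext => n; exact: mulrC.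
Qed.

(** Another layer, whose dual lattice provides the momenta of the second average. *)
Let k := o.1 + 1.

Let ok : o.1 != k.
Proof. by have /and4P[] := layer_neq o.1. Qed.

Let site g : dual_site := change_site o (k, o.2) [ffun=> 0] g.

Let site_momentum g : momentum 0 (val (site g)).2 = lvec (B k) g.
Proof.
rewrite /dual_momentum add0r /= (bigD1 k)//= big1 ?addr0 => [|t tk].
  by rewrite /Defs.dvec ffunE eq_sym (negbTE ok) eqxx.
by rewrite /Defs.dvec !ffunE (negbTE tk); case: ifP => _; rewrite lvec0.
Qed.

Let w S : 'cV[R]_2 := (B k)^T *m lvec (A o.1) S.

Let achar_w S g : achar (w S) g = cis (dot (lvec (B k) g) (lvec (A o.1) S)).
Proof. by rewrite achar_lattice dotC. Qed.

Let w_avg S : tends (avg ballB (achar (w S))) ((S == 0)%:R).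
Proof.
have [->|S0] := eqVneq S 0.
  apply: tends_eq (tends_avg1 (ball2_size_gt0 (baseB_unit R))) => r; congr avg; apply/funext => g.
  by rewrite /achar /w lvec0 mulmx0 dotE !mxE !mul0r addr0 cis0.
have nt : ~ trivial_char ((baseB R)^T *m ((rotation (theta k))^T *m lvec (A o.1) S)).
  rewrite mulmxA -trmx_mul => tr; case/eqP: S0.
  exact: (incomm_real incomm.1 ok tr).
have := achar_avg (baseB_unit R) nt; apply: tends_eq => r; congr avg; apply/funext => g.
by rewrite mulmxA -trmx_mul.
Qed.

(* The coefficient of index [S0] is extracted by averaging over the dual lattice of another layer,
   along which the series [L] only changes by characters. *)
Let a_cauchy S0 : exists l, tends (fun r => a r S0) l.
Proof.
have [D hD] := uB; apply: tends_cauchy => e e0; have e2 : 0 < e / 2 by rewrite divr_gt0.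
(* The deviation of an averaged character from the Kronecker symbol. It is at most 2 and tends to
   zero, so one radius [s] makes its sum against [u] small; this [s] does not depend on [r]. *)
pose dev s S : R := cabs (avg ballB (achar (w (S - S0))) s - (S == S0)%:R).
have dev2 s S : dev s S <= 2.
  apply: le_trans (cabsD _ _) _; rewrite cabsN cabs_nat.
  have : cabs (avg ballB (achar (w (S - S0))) s) <= 1 by apply: cabs_avg => // g; rewrite cabs_achar.
  by case: (S == S0) => /=; lra.
have uB2 : bsum (fun S => u S * 2) (D * 2).
  by move=> s us; rewrite -mulr_suml ler_wpM2r ?hD.
have dev_le s S : u S * dev s S <= u S * 2 by rewrite ler_wpM2l.
have uB2' s : bsum (fun S => u S * dev s S) (D * 2) by exact: (bsum_le (dev_le s) uB2).
have dev0 s S : 0 <= u S * dev s S by rewrite mulr_ge0 ?cabs_ge0.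
have [s hs] : exists s, nsum (fun S => u S * dev s S) < e / 2.
  have near_small : \forall s \near +oo,
      cabs (csum (fun S => (u S * dev s S)%:C) - csum (fun _ : coords => 0 : C)) < e / 2.
    have u2 S : 0 <= u S * 2 by rewrite mulr_ge0.
    apply: (tannery u2 uB2) => // [s S|S|S e' e'0].
    - by rewrite cabs_real ger0_norm.
    - by rewrite cabs0.
    have uS : 0 < u S + 1 by rewrite ltr_wpDl.
    have := w_avg (S - S0) (divr_gt0 e'0 uS); rewrite subr_eq0; apply: filterS => s hs.
    rewrite subr0 cabs_real ger0_norm//; apply: (@le_lt_trans _ _ ((u S + 1) * dev s S)).
      by rewrite ler_wpM2r ?cabs_ge0// lerDl.
    by rewrite mulrC -ltr_pdivlMr.
  have [s] := filter_ex near_small; rewrite csum0 subr0 => hs; exists s.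
  apply: le_lt_trans hs; rewrite (nsum_csum (dev0 s) (uB2' s)) cabs_real.
  exact: ler_norm.
(* With [s] fixed, this finite average converges in [r] to [z], and it stays within [e / 2] of
   [a r S0] for every [r]. *)
pose X r := avg ballB (fun g => cis (- dot (lvec (B k) g) (lvec (A o.1) S0)) * L 0 (site g) r) s.
pose z := avg ballB (fun g => cis (- dot (lvec (B k) g) (lvec (A o.1) S0)) * mpow (Hhat 0) N (site g) (site g)) s.
have Xz : tends X z by apply: tends_avg => g; apply: tendsZ; exact: L_tends.
exists z; apply: filterS (Xz _ e2) => r hr.
have Xa : cabs (X r - a r S0) <= e / 2.
  have asm (v : coords -> C) : (forall S, cabs (v S) <= 1) -> asummable (fun S => a r S * v S).
    by move=> v1; apply: (asummable_le _ hD) => S; rewrite cabsM; apply: le_trans (a_le r S); rewrite ler_piMr ?cabs_ge0.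
  have XE : X r = csum (fun S => a r S * avg ballB (achar (w (S - S0))) s).
    rewrite /X (@eq_avg R _ ballB _ (fun g => csum (fun S => a r S * achar (w (S - S0)) g))); last first.
      move=> g; rewrite /L site_momentum -csumZ; last by apply: asm => S; rewrite cabs_cis.
      apply: eq_csum => S; rewrite achar_w lvecB dotDr dotNr cisD; ring.
    rewrite avg_csum_swap; last by move=> g; apply: asm => S; rewrite cabs_achar.
    by apply: eq_csum => S; rewrite avgZ.
  have aE : a r S0 = csum (fun S => a r S * (S == S0)%:R).
    by rewrite (csum1 (x0 := S0)) ?eqxx ?mulr1// => S /negbTE ->; rewrite mulr0.
  have -> : X r - a r S0 = csum (fun S => (-1) * (a r S * (S == S0)%:R) + a r S * avg ballB (achar (w (S - S0))) s).
    rewrite csumD -?XE -?aE; [by rewrite mulN1r addrC| |].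
      by apply: asm => S; rewrite cabs_nat; case: (_ == _).
    by apply: asm => S; apply: cabs_avg => // g; rewrite cabs_achar.
  apply: le_trans (ltW hs); apply: cabs_csum.
  apply: bsum_le (nsum_bsum (uB2' s)) => S.
  have -> : -1 * (a r S * (S == S0)%:R) + a r S * avg ballB (achar (w (S - S0))) s =
     a r S * (avg ballB (achar (w (S - S0))) s - (S == S0)%:R) by ring.
  by rewrite cabsM ler_wpM2r ?cabs_ge0.
apply: le_trans (cabs_dist _ (X r) _) _; rewrite cabsB [leRHS]splitr; apply: (lerD Xa (ltW hr)).
Qed.

(** The diagonal entry and the series of the limits [m] are both limits of [L], the second by
    dominated convergence. *)
Lemma power_coefficients : exists m : coords -> C, exists v D,
  [/\ bsum v D, (forall S, cabs (m S) <= v S),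
      forall q y, (val y).1 = o -> mpow (Hhat q) N y y =
        csum (fun S => m S * cis (dot (momentum q (val y).2) (lvec (A o.1) S))) &
      tends (avg ballA (fun n => mpow H N (o, n) (o, n))) (m 0)].
Proof.
have [D hD] := uB; have [m hm] := boolp.choice a_cauchy.
have mu S : cabs (m S) <= u S.
  apply/ler_addgt0Pl => e e0; have [r hr] := @filter_ex _ _ _ _ (hm S e e0).
  have := le_trans (cabs_lerB (m S) (a r S)) _; rewrite cabsB => /(_ _ (ltW hr)).
  by rewrite lerBlDr => h; apply: le_trans h _; rewrite lerD2l a_le.
exists m, u, D; split => // [q y yo|].
  apply: tends_uniq (L_tends q yo) _ => e e0.
  apply: (tannery u0 hD) => // [r S|S|S e' e'0]; try by rewrite cabsM cabs_cis mulr1.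
  have := hm S _ e'0; apply: filterS => r hr.
  by rewrite -mulrBl cabsM cabs_cis mulr1.
apply: tends_eq (hm 0) => r; congr avg; apply/funext => n.
by rewrite /hop addr0.
Qed.

End OnePower.

Lemma poly_coefficients o (p : {poly C}) : exists m : coords -> C, exists v D,
  [/\ bsum v D, (forall S, cabs (m S) <= v S),
      forall q y, (val y).1 = o -> act (Hhat_op theta intra inter q) p (basis_vec R y) y =
        csum (fun S => m S * cis (dot (momentum q (val y).2) (lvec (A o.1) S))) &
      tends (avg ballA (fun n => act (H_op theta intra inter) p (basis_vec R (o, n)) (o, n))) (m 0)].
Proof.
have [m [v [D [hD mv h1 h2]]]] : exists m : coords -> C, exists v D,
  [/\ bsum v D, (forall S, cabs (m S) <= v S),
      forall q y, (val y).1 = o -> \sum_(i < size p) p`_i * mpow (Hhat q) i y y =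
        csum (fun S => m S * cis (dot (momentum q (val y).2) (lvec (A o.1) S))) &
      tends (avg ballA (fun n => \sum_(i < size p) p`_i * mpow H i (o, n) (o, n))) (m 0)].
  elim: (size p) => [|d [m [v [D [hD mv h1 h2]]]]].
    exists (fun=> 0), (fun=> 0), 0; split => //.
    - by move=> s us; rewrite big1.
    - by move=> S; rewrite cabs0.
    - move=> q y _; rewrite big_ord0 -[LHS](csum0 R coords); apply: eq_csum => S; by rewrite mul0r.
    - apply: tends_eq (@tends_const R 0) => r; rewrite /avg big1 ?mul0r// => n _; by rewrite big_ord0.
  have [m' [v' [D' [hD' mv' h1' h2']]]] := power_coefficients o d.
  exists (fun S => p`_d * m' S + m S), (fun S => cabs p`_d * v' S + v S), (cabs p`_d * D' + D); split.
  - move=> s us; rewrite big_split /= -mulr_sumr lerD ?hD// ler_wpM2l ?cabs_ge0 ?hD'//.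
  - move=> S; apply: le_trans (cabsD _ _) _; rewrite cabsM lerD// ler_wpM2l ?cabs_ge0//.
  - move=> q y yo; rewrite big_ord_recr /= h1// h1'// addrC -csumD.
    + by apply: eq_csum => S; ring.
    + by apply: (asummable_le _ hD') => S; rewrite cabsM cabs_cis mulr1.
    + by apply: (asummable_le _ hD) => S; rewrite cabsM cabs_cis mulr1.
  - have := tends_lc p`_d h2' h2; apply: tends_eq => r; rewrite -avg_lc; congr avg; apply/funext => n.
    by rewrite big_ord_recr /= addrC.
exists m, v, D; split; [exact: hD|exact: mv|by move=> q y yo; rewrite -h1// act_mpow|].
by apply: tends_eq h2 => r; congr avg; apply/funext => n; rewrite act_mpow.
Qed.

End Coefficients.

(** * Means over the dual cells *)

Section CellMeans.
Variable R : realType.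
Local Notation C := (R[i]).
Local Notation P2 := (measurableTypeR R * measurableTypeR R)%type.

Lemma cont2_uniform (F : R -> R -> C) : (forall e, 0 < e -> exists G, cont2 G /\
  forall s t, cabs (F s t - G s t) <= e) -> cont2 F.
Proof.
move=> h s t e e0; have [|G [cG hG]] := h (e / 4); first by rewrite divr_gt0.
have [|d d0 hd] := cG s t (e / 4); first by rewrite divr_gt0.
exists d => // s' t' hs ht; have h3 := hd _ _ hs ht.
have -> : F s' t' - F s t = (F s' t' - G s' t') + ((G s' t' - G s t) - (F s t - G s t)) by ring.
apply: le_lt_trans (cabsD _ _) _.
have h4 := cabsD (G s' t' - G s t) (- (F s t - G s t)); rewrite cabsN in h4.
have h1 := hG s' t'; have h2 := hG s t; move: h1 h2 h3 h4 e0; clear; lra.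
Qed.

Lemma mean2_bound (F : R -> R -> C) M : cont2 F -> (forall s t, cabs (F s t) <= M) -> cabs (mean2 F) <= M.
Proof.
move=> cF hM; apply: crint_bound => [t _|t _]; first exact: ccont_crint.
by apply: crint_bound => // s _; exact: cont2_l.
Qed.

Lemma mean2_dist (F G : R -> R -> C) e : cont2 F -> cont2 G -> (forall s t, cabs (F s t - G s t) <= e) ->
  cabs (mean2 F - mean2 G) <= e.
Proof.
move=> cF cG h; have := mean2_lc (-1) cG cF; rewrite mulN1r addrC => <-.
apply: mean2_bound; first exact: cont2_lc.
by move=> s t; rewrite mulN1r addrC.
Qed.

Lemma cont2_linear L (u : coords -> 'cV[R]_2) (m : coords -> C) v D :
  bsum v D -> (forall S, cabs (m S) <= v S) ->
  cont2 (fun s t => csum (fun S => m S * cis (dot (L *m vec2 (s, t)) (u S)))).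
Proof.
move=> hD mv; apply: cont2_csum => [S|rho].
  apply: cont2M; first exact: cont2_cst.
  have := plane_cont_cell L 0 (plane_cont_cis (u S)).
  congr cont2; apply/funext => s; apply/funext => t.
  by rewrite [ivec R 0]map_mx0 addr0 dotC.
exists v, D; split => // [S|S s t _ _]; first by apply: le_trans (mv S); exact: cabs_ge0.
by rewrite cabsM cabs_cis mulr1.
Qed.

Lemma cont2_id (E : 'cV[R]_2 -> C) : (forall L, cont2 (fun s t => E (L *m vec2 (s, t)))) ->
  cont2 (fun s t => E (vec2 (s, t))).
Proof.
move=> /(_ 1%:M); congr cont2; apply/funext => s; apply/funext => t; by rewrite mul1mx.
Qed.

(** The function cut off outside the cell is unfolded over the lattice, and only the translate of
    index zero meets the cell. *)
Lemma cell_integral (E : 'cV[R]_2 -> C) L M : L \in unitmx -> cont2 (fun s t => E (vec2 (s, t))) ->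
  cont2 (fun s t => E (L *m vec2 (s, t))) -> (forall q, cabs (E q) <= M) ->
  plane_integral (lcell L 0) E = `|\det L|%:C * mean2 (fun s t => E (L *m vec2 (s, t))).
Proof.
move=> uL cE cEL hM; set D := lcell L 0.
have M0 : 0 <= M by apply: le_trans (hM 0); exact: cabs_ge0.
pose F (x : P2) : C := if x \in D then E (vec2 x) else 0.
have mD : measurable D := measurable_lcell 0 uL.
have mF (h : C -> R) : h 0 = 0 -> (forall z w, `|h z - h w| <= cabs (z - w)) ->
    measurable_fun setT (fun x => h (F x)).
  move=> h0 hh.
  have -> : (fun x => h (F x)) = (fun x => h (E (vec2 x))) \_ D.
    by apply/funext => x; rewrite /F patchE; case: ifP.
  apply/(measurable_restrict _ mD measurableT); rewrite setTI.
  apply: (@measurable_funS _ _ _ _ setT) => //.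
  have := cont2_measurable_gen hh cE.
  by congr measurable_fun; apply/funext => -[].
have FE : cintegral (leb2 R) setT F = plane_integral D E.
  rewrite /plane_integral /cintegral; congr (_ +i* _); rewrite [RHS]Rintegral_mkcond;
    apply: eq_Rintegral => x _; rewrite /F patchE; by case: ifP.
pose b (n : coords) := M * (n == 0)%:R.
have bB : bsum b M.
  move=> s us; rewrite -mulr_sumr -[leRHS]mulr1 ler_wpM2l//.
  have [s0|s0] := boolP (0 \in s).
    by rewrite (bigD1_seq 0)//= eqxx big1 ?addr0// => n /negbTE ->.
  by rewrite big1_seq// => n /andP[_ ns]; case: eqP => // n0; rewrite -n0 ns in s0.
have cell n x : sq x -> lcell L n (cellmap L n x) by rewrite -(lcell_cellmap n uL).
have Fn n x : sq x -> n != 0 -> F (cellmap L n x) = 0.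
  move=> sx n0; rewrite /F; case: ifP => // /set_mem dx; case/eqP: n0.
  have [a1 a2] := (lcellP L n _).1 (cell n x sx); have [b1 b2] := (lcellP L 0 _).1 dx.
  have [[a11 a12] [a21 a22]] : ((n 0 0)%:~R <= (amap (invmx L) (0, 0) (cellmap L n x)).1 /\ (amap (invmx L) (0, 0) (cellmap L n x)).1 < (n 0 0)%:~R + 1) /\
    ((n 1 0)%:~R <= (amap (invmx L) (0, 0) (cellmap L n x)).2 /\ (amap (invmx L) (0, 0) (cellmap L n x)).2 < (n 1 0)%:~R + 1).
    by split; apply/andP.
  case/andP: b1 => b11 b12; case/andP: b2 => b21 b22.
  have e1 := floor_uniq a11 a12 b11 b12; have e2 := floor_uniq a21 a22 b21 b22.
  by rewrite -(cpair_eta n) e1 e2 cpair_eta.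
have F0 x : sq x -> F (cellmap L 0 x) = E (L *m vec2 x).
  move=> sx; rewrite /F; case: ifP => [_|/negP []].
    by rewrite vec2_cellmap [ivec R 0]map_mx0 addr0.
  by apply/mem_set; exact: cell.
have int0 (G : P2 -> C) : (forall x, sq x -> G x = 0) -> cintegral (leb2 R) (@sq R) G = 0.
  move=> G0; have z0 : Rintegral (leb2 R) (@sq R) (fun=> 0) = 0 by rewrite /Rintegral integral0.
  by rewrite /cintegral -[RHS]/(0 +i* 0) -z0; congr (_ +i* _);
    apply: eq_Rintegral => x /set_mem sx /=; rewrite G0.
rewrite -FE (complex_unfold uL (mF _ erefl (@Re_lip R)) (mF _ erefl (@Im_lip R)) bB)//; last 2 first.
- by move=> n; rewrite /b mulr_ge0.
- move=> n x sx; rewrite /b; have [->|n0] := eqVneq n 0; first by rewrite mulr1 F0.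
  by rewrite Fn// cabs0 mulr0.
rewrite (csum1 (x0 := 0)) => [|n n0].
  congr (_ * _); rewrite /mean2 -(complex_fubini cEL (M := M))//.
  rewrite /cintegral; congr (_ +i* _); apply: eq_Rintegral => x /set_mem sx /=;
    by rewrite F0//; case: (x).
by rewrite int0 ?mulr0// => x sx /=; rewrite Fn.
Qed.

(** In cell coordinates the terms are multiples of [eint (S 0 0) s * eint (S 1 0) t], of mean zero
    unless [S = 0]. *)
Lemma mean2_lattice (theta : 'I_3 -> R) j (m : coords -> C) v D :
  bsum v D -> (forall S, cabs (m S) <= v S) ->
  mean2 (fun s t => csum (fun S => m S * cis (dot (lattB theta j *m vec2 (s, t)) (lvec (lattA theta j) S)))) = m 0.
Proof.
move=> hD mv.
have E S s t : dot (lattB theta j *m vec2 (s, t)) (lvec (lattA theta j) S) = 2 * pi * (S 0 0)%:~R * s + 2 * pi * (S 1 0)%:~R * t.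
  by rewrite dotC (dual_dot (lattAB theta j)) dotE !mxE /=; ring.
have cu S : cont2 (fun s t => m S * cis (dot (lattB theta j *m vec2 (s, t)) (lvec (lattA theta j) S))).
  apply: cont2M; first exact: cont2_cst.
  have := plane_cont_cell (lattB theta j) 0 (plane_cont_cis (lvec (lattA theta j) S)).
  congr cont2; apply/funext => s; apply/funext => t.
  by rewrite [ivec R 0]map_mx0 addr0 dotC.
rewrite mean2_csum => //; last first.
  move=> rho; exists v, D; split => // [S|S s t _ _]; first by apply: le_trans (mv S); exact: cabs_ge0.
  by rewrite cabsM cabs_cis mulr1.
have ES S : mean2 (fun s t => m S * cis (dot (lattB theta j *m vec2 (s, t)) (lvec (lattA theta j) S))) =
    m S * ((S 0 0 == 0) && (S 1 0 == 0))%:R.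
  have ce : cont2 (fun s t => eint (S 0 0) s * eint (S 1 0) t : C).
    by apply: cont2M; [apply: cont2_1|apply: cont2_2] => s; exact: ccont_eint.
  have := mean2_lc (m S) ce (cont2_cst 0); rewrite mean2_eint.
  have -> : mean2 (fun _ _ : R => 0 : C) = 0 by rewrite /mean2 !crint_cst.
  rewrite addr0 => <-; congr mean2; apply/funext => s; apply/funext => t.
  by rewrite addr0 E cisD.
rewrite (csum1 (x0 := 0)) => [|S S0]; rewrite ES ?mxE ?eqxx ?mulr1//.
have -> : (S 0 0 == 0) && (S 1 0 == 0) = false; last by rewrite mulr0.
apply/negbTE; apply: contra S0 => /andP[/eqP h0 /eqP h1].
by rewrite -(cpair_eta S) h0 h1; apply/eqP/colP => i; rewrite !mxE; case: ifP.
Qed.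

Lemma mean2_series_dist (theta : 'I_3 -> R) j (E : 'cV[R]_2 -> C) (m : coords -> C) v D e :
  bsum v D -> (forall S, cabs (m S) <= v S) -> cont2 (fun s t => E (lattB theta j *m vec2 (s, t))) ->
  (forall q, cabs (E q - csum (fun S => m S * cis (dot q (lvec (lattA theta j) S)))) <= e) ->
  cabs (m 0 - mean2 (fun s t => E (lattB theta j *m vec2 (s, t)))) <= e.
Proof.
move=> hD mv cE h; rewrite -(mean2_lattice theta j hD mv) cabsB.
by apply: mean2_dist => //; exact: cont2_linear hD mv.
Qed.

End CellMeans.

(** * Traces per site and real spectra *)

Section Traces.
Variable R : realType.
Local Notation C := (R[i]).

Lemma tends_approx (F : R -> C) l : (forall e, 0 < e -> exists G m, [/\ forall r, cabs (F r - G r) <= e,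
  tends G m & cabs (m - l) <= e]) -> tends F l.
Proof.
move=> h e e0; have [|G [m [h1 h2 h3]]] := h (e / 4); first by rewrite divr_gt0.
have e4 : 0 < e / 4 by rewrite divr_gt0.
have := h2 _ e4; apply: filterS => r hr.
have -> : F r - l = (F r - G r) + ((G r - m) + (m - l)) by ring.
apply: le_lt_trans (cabsD _ _) _; have h5 := cabsD (G r - m) (m - l).
have h4 := h1 r; move: hr h4 h3 h5 e0; clear; lra.
Qed.

Lemma trace_avg_seq (T : choiceType) (s : seq T) (A : op R T) : uniq s ->
  trace_avg [set` s] A = (\sum_(x <- s) entry A x x) / (size s)%:R.
Proof.
move=> us; have fs : finite_set [set` s] by exact: finite_seq.
have ps : perm_eq (fset_set [set` s]) s.
  apply: uniq_perm => // x; rewrite in_fset_set//.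
  by apply/idP/idP => [/set_mem|xs]; [|apply/mem_set].
rewrite /trace_avg fsbig_finite// (perm_big _ ps) /=; congr (_ / _%:R).
exact: (perm_size ps).
Qed.

(** All six orbitals contribute equally many sites to the ball, so the average over sites is the
    mean of six averages over the common list [bs]. *)
Lemma trace_avg_orbitals (T T' : choiceType) (site : orbital -> T -> T') (bs : seq T) (D : set T')
    (A : op R T') : uniq bs ->
  (forall o o' n n', site o n = site o' n' -> o = o' /\ n = n') ->
  (forall x, D x <-> exists o n, n \in bs /\ x = site o n) ->
  trace_avg D A = 6^-1 * \sum_o (\sum_(n <- bs) entry A (site o n) (site o n)) / (size bs)%:R.
Proof.
move=> ub inj hD; pose s := [seq site o n | o <- enum (predT : pred orbital), n <- bs].
have us : uniq s.
  apply: allpairs_uniq => //; first exact: enum_uniq.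
  by move=> [ o n] [ o' n'] _ _ /= /inj[-> ->].
have -> : D = [set` s].
  apply/seteqP; split => x.
    by move=> /hD [ o [n [nb ->]]]; apply/allpairsP; exists (o, n); rewrite mem_enum.
  by move=> /allpairsP [[ o n] [_ nb ->]]; apply/hD; exists o, n.
rewrite trace_avg_seq// size_allpairs -cardE card_prod card_ord card_bool natrM invfM.
rewrite big_allpairs_dep /= big_enum /= mulrC -mulr_suml mulrAC -mulrA mulrC; congr (_ * _).
Qed.

Lemma open_cabs (U : set C^o) z : open U -> U z -> exists2 d : R, 0 < d & forall w, cabs (w - z) < d -> U w.
Proof.
move=> oU Uz; have : nbhs (z : C^o) U by exact: open_nbhs_nbhs.
move=> /nbhs_ballP [e /=]; rewrite ltcE /= => /andP[/eqP ime ree] he.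
exists (complex.Re e) => // w hw; apply: he; rewrite -ball_normE /= normcabs cabsB.
by case: e ime ree hw => a b /= -> _; rewrite ltcR.
Qed.

Lemma nbhs_cabs (z : C) d : 0 < d -> nbhs (z : C^o) [set w : C^o | cabs ((w : C) - z) < d].
Proof.
move=> d0; apply/nbhs_ballP; exists d%:C; first by rewrite /= ltcR.
by move=> w; rewrite -ball_normE /= normcabs cabsB ltcR.
Qed.

Lemma closed_real (S : set C^o) : closed S -> closed [set t : R | S t%:C].
Proof.
move=> cS; rewrite -[X in closed X]setCK; apply: open_closedC; rewrite openE => t nt.
have [d d0 hd] := open_cabs (closed_openC cS) nt.
exists d; first exact: d0.
move=> s /=; rewrite /ball_ /= distrC => ts.
by apply: hd; rewrite -realCB cabs_real.
Qed.

End Traces.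

Section Conclusion.
Variables (R : realType) (theta : 'I_3 -> R).
Local Notation C := (R[i]).
Local Notation A := (lattA theta).
Local Notation B := (lattB theta).
Variable intra : 'I_3 -> bool -> bool -> coords -> C.
Variable inter : orbital -> orbital -> 'cV[R]_2 -> C.
Local Notation H := (H_op theta intra inter).
Local Notation Hhat := (Hhat_op theta intra inter).

Lemma decay_constants : exp_decay theta intra inter -> exists K c, [/\ 0 <= K, 0 < c,
  forall o o', o.1 != o'.1 -> forall v, cabs (inter o o' v) <= K * expR (- c * n1 v),
  forall o o', o.1 != o'.1 -> forall v, cabs (fourier (inter o o') v) <= K * expR (- c * n1 v) &
  forall j a b n, cabs (intra j a b n) <= K * expR (- c * n1 (lvec (A j) n))].
Proof.
move=> [g1 [g2 [g10 g20 hinter hintra]]]; pose c := Num.min g1 g2 / 2.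
have c0 : 0 < c by rewrite divr_gt0// lt_min g10.
have cg1 : 2 * c <= g1 by rewrite /c mulrC divfK// ge_min lexx.
have cg2 : 2 * c <= g2 by rewrite /c mulrC divfK// ge_min lexx orbT.
have mono (x K K' y : R) : x <= K * expR y -> K <= K' -> x <= K' * expR y.
  by move=> h KK; apply: le_trans h _; rewrite ler_wpM2r ?expR_ge0.
have [K1 K10 hK1] : exists2 K, 0 <= K & forall oo : orbital * orbital, oo.1.1 != oo.2.1 ->
    forall v, cabs (inter oo.1 oo.2 v) <= K * expR (- c * n1 v).
  apply: (@fin_bound R _ (fun oo K => oo.1.1 != oo.2.1 ->
    forall v, cabs (inter oo.1 oo.2 v) <= K * expR (- c * n1 v))).
    by move=> oo K K' h KK hoo v; apply: mono (h hoo v) KK.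
  move=> oo; have [e|ne] := eqVneq oo.1.1 oo.2.1; first by exists 0.
  have [K K0 hK] := decay_bound (hinter _ _ ne).1 c0 cg1 (fun _ => cabs_ge0 _).
  by exists K.
have [K2 K20 hK2] : exists2 K, 0 <= K & forall oo : orbital * orbital, oo.1.1 != oo.2.1 ->
    forall v, cabs (fourier (inter oo.1 oo.2) v) <= K * expR (- c * n1 v).
  apply: (@fin_bound R _ (fun oo K => oo.1.1 != oo.2.1 ->
    forall v, cabs (fourier (inter oo.1 oo.2) v) <= K * expR (- c * n1 v))).
    by move=> oo K K' h KK hoo v; apply: mono (h hoo v) KK.
  move=> oo; have [e|ne] := eqVneq oo.1.1 oo.2.1; first by exists 0.
  have [K K0 hK] := decay_bound (hinter _ _ ne).2 c0 cg2 (fun _ => cabs_ge0 _).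
  by exists K.
have [K3 K30 hK3] : exists2 K, 0 <= K & forall jab : 'I_3 * bool * bool, forall n,
    cabs (intra jab.1.1 jab.1.2 jab.2 n) <= K * expR (- c * n1 (lvec (A jab.1.1) n)).
  apply: (@fin_bound R _ (fun jab K => forall n,
    cabs (intra jab.1.1 jab.1.2 jab.2 n) <= K * expR (- c * n1 (lvec (A jab.1.1) n)))).
    by move=> jab K K' h KK n; apply: mono (h n) KK.
  move=> [[j a] b]; have [K K0 hK] := decay_bound (hintra j a b) c0 cg1 (fun _ => cabs_ge0 _).
  by exists K.
exists (K1 + K2 + K3), c; split => //.
- by rewrite !addr_ge0.
- by move=> o o' ne v; apply: mono (hK1 (o, o') ne v) _; rewrite -addrA lerDl addr_ge0.
- by move=> o o' ne v; apply: mono (hK2 (o, o') ne v) _; rewrite addrAC lerDr addr_ge0.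
- by move=> j a b n; apply: mono (hK3 (j, a, b) n) _; rewrite lerDr addr_ge0.
Qed.

(** The reciprocal operators share the bound [KG], which survives the closure of the union of their
    spectra. *)
Lemma spectra_compact K KG : sa_op H K -> (forall q, sa_op (Hhat q) KG) ->
  compact [set t : R | (spectrum_hat theta intra inter `|` spectrum H) t%:C].
Proof.
move=> saH saG; have KG0 : 0 <= KG by have [] := saG 0.
have -> : [set t : R | (spectrum_hat theta intra inter `|` spectrum H) t%:C] =
  [set t : R | spectrum_hat theta intra inter t%:C] `|` rspec H by [].
apply: compactU; last exact: (rspec_compact saH).
apply: (@real_compact _ _ KG).
  by apply: closed_real; exact: closed_closure.
move=> t ht; rewrite leNgt; apply/negP => tK.
have d0 : 0 < `|t| - KG by rewrite subr_gt0.
have [z [[q _ hz]]] := ht _ (nbhs_cabs t%:C d0); rewrite /= => zt.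
have [_ lA bA _] := saG q; have := spectrum_bounded lA bA KG0 hz.
have := cabs_lerB t%:C z; rewrite cabsB cabs_real; move: zt; clear; lra.
Qed.

(* Runge's theorem on one compact set containing all the spectra reduces [f] to polynomials,
   uniformly in [q]. *)
Lemma entries_poly K KG f : sa_op H K -> (forall q, sa_op (Hhat q) KG) -> O_hat theta intra inter f ->
  forall e : R, 0 < e -> exists p : {poly C},
  (forall q y, cabs (entry (holo_calc f (Hhat q)) y y - act (Hhat q) p (basis_vec R y) y) <= e) /\
  (forall x, cabs (entry (holo_calc f H) x x - act H p (basis_vec R x) x) <= e).
Proof.
move=> saH saG [U [oU sU aU]] e e0.
have near t : (spectrum_hat theta intra inter `|` spectrum H) t%:C ->
    exists2 d : R, 0 < d & forall z, cabs (z - t%:C) < d -> analytic_at f z.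
  by move=> /sU /(open_cabs oU) [d d0 hd]; exists d => // z /hd /aU.
have e2 : 0 < e / 2 by rewrite divr_gt0.
have [p hp] := runge (spectra_compact saH saG) near e2.
have sub q t : spectrum (Hhat q) t%:C -> (spectrum_hat theta intra inter `|` spectrum H) t%:C.
  by move=> h; left; apply: subset_closure; exists q.
exists p; split => [q y|x]; rewrite -[e](mulrVK (x := 2)) ?unitfE// mulrC.
  apply: (holo_calc_poly y (saG q) (ltW e2)) => t /sub ht; [exact: near|rewrite cabsB; exact: hp].
apply: (holo_calc_poly x saH (ltW e2)) => t ht; [|rewrite cabsB]; [apply: near|apply: hp]; by right.
Qed.

End Conclusion.

(** * The cell mean and the two averages for one orbital *)

Section OrbitalLimits.
Variables (R : realType) (theta : 'I_3 -> R).
Local Notation C := (R[i]).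
Local Notation A := (lattA theta).
Local Notation B := (lattB theta).
Local Notation momentum := (dual_momentum theta).
Local Notation ballA := (ball2 (baseA_unit R)).
Local Notation ball4 := (ball4 (baseB_unit R) (baseB_unit R)).

Fact dual_pair_subproof (o : orbital) (p : coords * coords) :
  (o, [ffun t : 'I_3 => if t == o.1 + 1 then p.1 else if t == o.1 + 2 then p.2 else 0]).2 o.1 == 0.
Proof.
have /and4P[n1 n2 _ _] := layer_neq o.1.
by rewrite /= ffunE !(eq_sym o.1) (negbTE n1) (negbTE n2).
Qed.

(** Coordinates on the dual sites of an orbital: the vectors of the two other layers, [o.1 + 1] and
    [o.1 + 2] modulo 3. *)
Definition dual_pair o p : dual_site := exist _ (o, _) (dual_pair_subproof o p).

Lemma dual_pair1 o p : (val (dual_pair o p)).2 (o.1 + 1) = p.1.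
Proof. by rewrite ffunE eqxx. Qed.

Lemma dual_pair2 o p : (val (dual_pair o p)).2 (o.1 + 2) = p.2.
Proof. by have /and4P[_ _ n3 _] := layer_neq o.1; rewrite ffunE eq_sym (negbTE n3) eqxx. Qed.

Lemma dual_pair_inj o o' p p' : dual_pair o p = dual_pair o' p' -> o = o' /\ p = p'.
Proof.
move=> E; have eo : o = o' by exact: (congr1 (fun y : dual_site => (val y).1) E).
rewrite -eo in E *; split => //.
by rewrite [p]surjective_pairing [p']surjective_pairing -(dual_pair1 o p) -(dual_pair2 o p) E dual_pair1 dual_pair2.
Qed.

Lemma dual_pairP (y : dual_site) :
  y = dual_pair (val y).1 ((val y).2 ((val y).1.1 + 1), (val y).2 ((val y).1.1 + 2)).
Proof.
apply: pair_val_inj => // t /=; rewrite ffunE /=.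
by case/or3P: (layer_cases t (val y).1.1) => /eqP ->; have /and4P[n1 n2 n3 n4] := layer_neq (val y).1.1;
  rewrite ?eqxx// eq_sym ?(negbTE n1) ?(negbTE n3)// eq_sym ?(negbTE n2) ?layer_zero.
Qed.

Lemma momentum_pair o p : momentum 0 (val (dual_pair o p)).2 =
  lvec (B (o.1 + 1)) p.1 + lvec (B (o.1 + 2)) p.2.
Proof.
rewrite /dual_momentum add0r (sum_layers _ o.1) /Defs.dvec dual_pair1 dual_pair2.
by rewrite (eqP (dual_pair_subproof o p)) lvec0 add0r.
Qed.

Lemma Omega_ballP r x : Omega_ball theta r x <-> exists o n, n \in ballA r /\ x = (o, n).
Proof.
rewrite /Omega_ball /=; split.
  by case: x => o n /=; rewrite enorm_lattA => h; exists o, n; rewrite mem_ball2.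
by move=> [ o [n [h ->]]] /=; rewrite enorm_lattA; rewrite mem_ball2 in h.
Qed.

Lemma dual_Omega_ballP r y : dual_Omega_ball theta r y <-> exists o p, p \in ball4 r /\ y = dual_pair o p.
Proof.
have E o p : dual_Omega_ball theta r (dual_pair o p) <-> p \in ball4 r.
  rewrite mem_ball4 /inball4 /dual_Omega_ball /= sum_others /Defs.dvec.
  by rewrite -/(val (dual_pair o p)) ?dual_pair1 ?dual_pair2 !enorm_lattB.
split; last by move=> [ o [p [h ->]]]; apply/E.
by rewrite [y]dual_pairP => /E h; exists (val y).1, ((val y).2 ((val y).1.1 + 1), (val y).2 ((val y).1.1 + 2)).
Qed.

(** For [S != 0] incommensurability makes the character nontrivial already on the first of the two
    dual lattices. *)
Lemma dual_series_avg o (m : coords -> C) v D : double_incommensurate theta -> bsum v D ->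
  (forall S, cabs (m S) <= v S) ->
  tends (avg ball4 (fun p => csum (fun S => m S *
    cis (dot (momentum 0 (val (dual_pair o p)).2) (lvec (A o.1) S))))) (m 0).
Proof.
move=> incomm hD mv; have v0 S : 0 <= v S by apply: le_trans (mv S); exact: cabs_ge0.
pose w j S := (B j)^T *m lvec (A o.1) S.
pose chi S (p : coords * coords) := achar (w (o.1 + 1) S) p.1 * achar (w (o.1 + 2) S) p.2.
have E p S : cis (dot (momentum 0 (val (dual_pair o p)).2) (lvec (A o.1) S)) = chi S p.
  by rewrite momentum_pair dotDl cisD /chi !achar_lattice ![dot (lvec (A _) _) _]dotC.
have chi1 S p : cabs (chi S p) <= 1 by rewrite cabsM !cabs_achar mulr1.
have z1 (S : coords) : cabs ((S == 0)%:R : C) <= 1 by rewrite cabs_nat; case: (_ == _).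
have := avg_csum v0 hD mv chi1 z1 (bs := ball4).
rewrite (csum1 (x0 := 0)) ?eqxx ?mulr1; last by move=> S /negbTE ->; rewrite mulr0.
move=> h; apply: tends_eq (h _) => [r|S].
  by congr avg; apply/funext => p; apply: eq_csum => S; rewrite E.
have [->|S0] := eqVneq S 0.
  apply: tends_eq (tends_avg1 (ball4_size_gt0 (baseB_unit R) (baseB_unit R))) => r; congr avg; apply/funext => p.
  by rewrite /chi /w lvec0 !mulmx0 /achar !dotE !mxE !mul0r addr0 cis0 mulr1.
apply: ball4_avg => -[tr _]; case/eqP: S0.
by apply: (incomm_real incomm.1 _ tr); have /and4P[] := layer_neq o.1.
Qed.

Variable intra : 'I_3 -> bool -> bool -> coords -> C.
Variable inter : orbital -> orbital -> 'cV[R]_2 -> C.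
Local Notation H := (H_op theta intra inter).
Local Notation Hhat := (Hhat_op theta intra inter).
Variable f : C -> C.
Hypothesis incomm : double_incommensurate theta.
Hypothesis approx : forall e : R, 0 < e -> exists p : {poly C},
  (forall q y, cabs (entry (holo_calc f (Hhat q)) y y - act (Hhat q) p (basis_vec R y) y) <= e) /\
  (forall x, cabs (entry (holo_calc f H) x x - act H p (basis_vec R x) x) <= e).
Hypothesis coefficients : forall o (p : {poly C}), exists m : coords -> C, exists v D,
  [/\ bsum v D, (forall S, cabs (m S) <= v S),
      forall q y, (val y).1 = o -> act (Hhat q) p (basis_vec R y) y =
        csum (fun S => m S * cis (dot (momentum q (val y).2) (lvec (A o.1) S))) &
      tends (avg ballA (fun n => act H p (basis_vec R (o, n)) (o, n))) (m 0)].

(** The common value is taken to be the mean of the diagonal entry over the cell. For each tolerance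
    a polynomial approximation yields a coefficient [m 0] within [e] of it, to which both averages
    of the approximations converge. *)
Lemma orbital_limits o : exists z, [/\
  plane_integral (dual_cell theta o.1) (fun q => entry (holo_calc f (Hhat q)) (origin o) (origin o)) =
    (area R)%:C * z,
  tends (avg ballA (fun n => entry (holo_calc f H) (o, n) (o, n))) z &
  tends (avg ball4 (fun p => entry (holo_calc f (Hhat 0)) (dual_pair o p) (dual_pair o p))) z].
Proof.
pose E q := entry (holo_calc f (Hhat q)) (origin o) (origin o).
have origin_momentum q : momentum q (val (origin o)).2 = q.
  by rewrite /dual_momentum big1 ?addr0// => t _; rewrite /Defs.dvec ffunE lvec0.
have series e : 0 < e -> exists m : coords -> C, exists v D, [/\ bsum v D, (forall S, cabs (m S) <= v S),
    forall q, cabs (E q - csum (fun S => m S * cis (dot q (lvec (A o.1) S)))) <= e,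
    exists G, (forall n, cabs (entry (holo_calc f H) (o, n) (o, n) - G n) <= e) /\ tends (avg ballA G) (m 0) &
    forall p, cabs (entry (holo_calc f (Hhat 0)) (dual_pair o p) (dual_pair o p) -
      csum (fun S => m S * cis (dot (momentum 0 (val (dual_pair o p)).2) (lvec (A o.1) S)))) <= e].
  move=> e0; have [p [p1 p2]] := approx e0; have [m [v [D [hD mv h1 h2]]]] := coefficients o p.
  exists m, v, D; split => //.
  - move=> q; have := p1 q (origin o); rewrite h1//.
    by under eq_csum do rewrite origin_momentum.
  - by exists (fun n => act H p (basis_vec R (o, n)) (o, n)).
  - by move=> pp; have := p1 0 (dual_pair o pp); rewrite h1.
(* The diagonal entry is continuous in [q] as a uniform limit of absolutely convergent series of
   characters; this is what gives access to its integral over the cell. *)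
have cEL (L : 'M[R]_2) : cont2 (fun s t => E (L *m vec2 (s, t))).
  apply: cont2_uniform => e e0; have [m [v [D [hD mv h _ _]]]] := series e e0.
  by have := cont2_linear L (lvec (A o.1)) hD mv; eexists; split; [eassumption|move=> s t; exact: h].
have cE : cont2 (fun s t => E (vec2 (s, t))) := cont2_id cEL.
have [M hM] : exists M, forall q, cabs (E q) <= M.
  have [m [v [D [hD mv h _ _]]]] := series 1 ltr01; exists (D + 1) => q.
  have b1 : cabs (csum (fun S => m S * cis (dot q (lvec (A o.1) S)))) <= D.
    by apply: cabs_csum; apply: bsum_le hD => S; rewrite cabsM cabs_cis mulr1.
  have := cabs_lerB (E q) (csum (fun S => m S * cis (dot q (lvec (A o.1) S)))).
  by rewrite lerBlDr => /le_trans; apply; rewrite addrC lerD.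
pose z := mean2 (fun s t => E (B o.1 *m vec2 (s, t))).
have zm e m v D : bsum v D -> (forall S, cabs (m S) <= v S) ->
    (forall q, cabs (E q - csum (fun S => m S * cis (dot q (lvec (A o.1) S)))) <= e) -> cabs (m 0 - z) <= e.
  move=> hD mv h; exact: mean2_series_dist hD mv (cEL _) h.
have avg_dist (T : Type) (bs : R -> seq T) (u v : T -> C) e r : 0 < e -> (forall x, cabs (u x - v x) <= e) ->
    cabs (avg bs u r - avg bs v r) <= e.
  move=> e0 h; have <- : avg bs (fun x => -1 * v x + u x) r = avg bs u r - avg bs v r.
    by rewrite avg_lc mulN1r addrC.
  by apply: cabs_avg => [|x]; [exact: ltW|rewrite mulN1r addrC].
exists z; split.
- by rewrite dual_cellE -(det_lattB theta o.1); exact: cell_integral (lattB_unit theta o.1) cE (cEL _) hM.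
- apply: tends_approx => e e0; have [m [v [D [hD mv h [G [hG tG]] _]]]] := series e e0.
  exists (avg ballA G), (m 0); split => //; last exact: zm hD mv h.
  by move=> r; exact: avg_dist.
- apply: tends_approx => e e0; have [m [v [D [hD mv h _ hp]]]] := series e e0.
  exists (avg ball4 (fun p => csum (fun S => m S *
    cis (dot (momentum 0 (val (dual_pair o p)).2) (lvec (A o.1) S))))), (m 0); split.
  + by move=> r; exact: avg_dist.
  + exact: dual_series_avg incomm hD mv.
  + exact: zm hD mv h.
Qed.

End OrbitalLimits.

Theorem theorem3p5 (R : realType) (theta : 'I_3 -> R)
    (intra : 'I_3 -> bool -> bool -> coords -> R[i])
    (inter : orbital -> orbital -> 'cV[R]_2 -> R[i])
    (h_incomm : double_incommensurate theta)
    (h_cont : inter_continuous inter)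
    (h_decay : exp_decay theta intra inter)
    (h_herm : hermitian_hopping intra inter)
    (h_near : nearest_layer_coupling inter)
    (f : R[i] -> R[i]) (hf : O_hat theta intra inter f) :
  trace_limit (dual_Omega_ball theta)
    (holo_calc f (Hhat_op theta intra inter 0%R))
    (cell_trace theta intra inter f) /\
  trace_limit (Omega_ball theta)
    (holo_calc f (H_op theta intra inter))
    (cell_trace theta intra inter f).
Proof.
have [K [c [K0 c0 b_inter b_fourier b_intra]]] := decay_constants h_decay.
have c_inter o o' : o.1 != o'.1 -> plane_cont (inter o o') by move=> /h_cont /continuous_plane.
have [KH KH0 [schurH powH]] := H_weighted K0 c0 b_inter b_intra h_herm.
have [KG KG0 schurG] := Hhat_schur K0 c0 c_inter b_fourier b_intra h_herm.
have saH := matrix_sa schurH (H_hermitian theta h_herm).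
have saG q := matrix_sa (schurG q) (Hhat_hermitian K0 c0 c_inter b_intra h_herm q).
have coef := poly_coefficients (divr_gt0 c0 (ltr0Sn R 1)) KH0 h_incomm powH schurG
  (intertwine_pow K0 c0 c_inter b_inter b_fourier b_intra h_herm).
have lim o := orbital_limits h_incomm (entries_poly saH saG hf) coef o.
have [z hz] := boolp.choice lim.
(* Each cell integral is the area times [z o], and [nustar] is the inverse of six times the area. *)
have cellE : cell_trace theta intra inter f = 6^-1 * \sum_o z o.
  rewrite /cell_trace nustarE (eq_bigr (fun o => (area R)%:C * z o)); last by move=> o _; have [] := hz o.
  rewrite -mulr_sumr mulrA; congr (_ * _); rewrite -realCM invfM mulfVK ?gt_eqF ?area_gt0//.
  by rewrite fmorphV rmorph_nat.
have sum_tends (F : orbital -> R -> R[i]) : (forall o, tends (F o) (z o)) ->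
    tends (fun r => 6^-1 * \sum_o F o r) (cell_trace theta intra inter f).
  move=> hF; rewrite cellE; apply: tendsZ.
  exact: (tends_sum _ (F := fun r o => F o r)).
split; apply/cvgCP.
  have h : tends (fun r => 6^-1 * \sum_o avg (ball4 (baseB_unit R) (baseB_unit R)) (fun p =>
      entry (holo_calc f (Hhat_op theta intra inter 0)) (dual_pair o p) (dual_pair o p)) r)
      (cell_trace theta intra inter f).
    by apply: sum_tends => o; have [] := hz o.
  apply: tends_eq h => r; apply/esym; apply: trace_avg_orbitals.
  - exact: ball4_uniq.
  - exact: dual_pair_inj.
  - exact: dual_Omega_ballP.
have h : tends (fun r => 6^-1 * \sum_o avg (ball2 (baseA_unit R)) (fun n =>
    entry (holo_calc f (H_op theta intra inter)) (o, n) (o, n)) r) (cell_trace theta intra inter f).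
  by apply: sum_tends => o; have [] := hz o.
apply: tends_eq h => r; apply/esym; apply: (@trace_avg_orbitals _ _ _ (fun o n => (o, n))).
- exact: ball2_uniq.
- by move=> o o' n n' [-> ->].
- exact: Omega_ballP.
Qed.
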